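(* Let $M$ be a manifold. There is a one-to-one correspondence between gauge equivalence classes of (self-crossing) stable generalized complex structures on $M$ and isomorphism classes of co-oriented elliptic divisors $(I_{|D|},\mathfrak{o})$ on $M$ endowed with an elliptic symplectic form $\omega\in\Omega^2_{\operatorname{Im}}(\mathcal{A}_{|D|})$. Explicitly, it is induced by the map $$\{(\mathbb{J},H):\ \mathbb{J}\text{ is a stable generalized complex structure}\}\to\{(I_{|D|},\mathfrak{o},\omega):\ (I_{|D|},\mathfrak{o})\text{ is a co-oriented elliptic divisor and }\omega\in\Omega^2_{\operatorname{Im}}(\mathcal{A}_{|D|})\text{ is symplectic}\}$$ which assigns to each stable generalized complex structure on $M$ the co-oriented elliptic divisor determined by its anticanonical section and the imaginary part $\omega=\operatorname{Im}^*\sigma$ of its corresponding complex log symplectic form $\sigma=\rho_2/\rho_0$, where $\rho$ is any local non-vanishing section of the canonical line bundle of $\mathbb{J}$ and $\rho_k$ its degree-$k$ part.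
   Context: Generalized complex structures. A generalized complex structure is a pair $(\mathbb{J},H)$ with $H\in\Omega^3(M)$ closed and $\mathbb{J}$ an endomorphism of $\mathbb{T}M=TM\oplus T^*M$, orthogonal for the natural pairing, with $\mathbb{J}^2=-\mathrm{Id}$, whose $+i$-eigenbundle $L\subset\mathbb{T}M\otimes\mathbb{C}$ is involutive for $[\![X+\xi,Y+\eta]\!]_H=[X,Y]+\mathcal{L}_X\eta-\iota_Yd\xi+\iota_X\iota_YH$. $(\mathbb{J},H)$ and $(\mathbb{J}',H')$ are gauge equivalent if there is $B\in\Omega^2(M)$ with $H'=H+dB$ and $\mathbb{J}'=\left(\begin{smallmatrix} 1 & 0 \\ B^\flat & 1 \end{smallmatrix}\right)\mathbb{J}\left(\begin{smallmatrix} 1 & 0 \\ -B^\flat & 1 \end{smallmatrix}\right)$. The canonical line bundle is the complex line bundle $K\subset\wedge^\bullet T^*_{\mathbb{C}}M$ annihilated by $L$ under $(X+\xi)\cdot\rho=\iota_X\rho+\xi\wedge\rho$; the anticanonical section is $s\in\Gamma(K^* )$, $s(\rho)=\rho_0$. The structure is (self-crossing) stable if $(K^*,s)$ is a complex log divisor. Divisors. A complex divisor is a complex line bundle $L'\to M$ with a section $\sigma$ with nowhere dense zero set; its ideal is $I_\sigma=\sigma(\Gamma((L')^* ))\subset C^\infty(M;\mathbb{C})$; divisors are isomorphic iff their ideals agree. It is a smooth complex log divisor if $\sigma$ vanishes transversely, and a (self-crossing) complex log divisor if locally $I_\sigma=I_1\cdots I_j$ ($j\ge0$) with $I_i$ smooth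 complex log divisors having local generators $f_i$ such that $df_{i_1}\wedge d\bar f_{i_1}\wedge\cdots\wedge df_{i_k}\wedge d\bar f_{i_k}\ne0$ at the common zeros of $f_{i_1},\dots,f_{i_k}$ for every subset of indices. A smooth elliptic divisor is a real line bundle $R$ with a section $q$ whose zero set is a codimension-two submanifold along which the normal Hessian of $q$ is positive definite, with ideal $q(\Gamma(R^* ))$. A (self-crossing) elliptic divisor is a real divisor whose ideal $I_{|D|}\subset C^\infty(M;\mathbb{R})$ is locally a product of smooth elliptic divisors with transversely intersecting zero loci. The intersection number of a point is the minimal number of factors; $D(i)$ is the set of points of intersection number at least $i$; $C(1)=D(1)\setminus D(2)$. A co-orientation $\mathfrak{o}$ is an orientation of the normal bundle $NC(1)$. A complex log divisor $(L',\sigma)$ with ideal $I_D$ induces the co-oriented elliptic divisor $(I_{|D|},\mathfrak{o})$ with $I_{|D|}\otimes\mathbb{C}=I_D\cdot\bar I_D$ and $\mathfrak{o}$ the orientation making the normal derivative $d^\nu\sigma:NC(1)\to L'|_{C(1)}$ orientation preserving; this gives a bijection between isomorphism classes of complex log divisors and of co-oriented elliptic divisors. Algebroids. $\mathcal{A}_D$ is the complex Lie algebroid whose sections are the complex vector fields preserving $I_D$; $\mathcal{A}_{|D|}$ is the real Lie algebroid whose sections are the vector fields preserving $I_{|D|}$; $\Omega^\bullet(\mathcal{A})=\Gamma(\wedge^\bullet\mathcal{A}^* )$ with the Lie algebroid differential. $\operatorname{Im}^*:\Omega^\bullet(\mathcal{A}_D)\to\Omega^\bullet(\mathcal{A}_{|D|})$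 is pullback along the natural map $\mathcal{A}_{|D|}\otimes\mathbb{C}\to\mathcal{A}_D$ followed by the imaginary part. For a co-oriented elliptic divisor with corresponding complex log divisor $I_D$, $\Omega^\bullet_{\operatorname{Im}}(\mathcal{A}_{|D|})$ denotes the image of $\operatorname{Im}^*$. An elliptic symplectic form is a closed non-degenerate element of $\Omega^2(\mathcal{A}_{|D|})$. A complex log symplectic form is $\sigma\in\Omega^2(\mathcal{A}_D)$ with $d\sigma$ a smooth real three-form on $M$ and $\operatorname{Im}^*\sigma$ non-degenerate. *)

(* Defs.v *)
From HB Require Import structures.
From mathcomp Require Import all_boot all_order all_algebra.
From mathcomp Require Import all_classical all_reals all_analysis.
From mathcomp Require Import complex ring.
Import numFieldNormedType.Exports.

Set Implicit Arguments.
Unset Strict Implicit.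
Unset Printing Implicit Defensive.

Import Order.TTheory GRing.Theory Num.Theory.
Local Open Scope classical_set_scope.
Local Open Scope ring_scope.
Local Open Scope complex_scope.

(* A vector bundle is represented by the C^oo(M)-module of its global         *)
(* sections: vector fields are the derivations of C^oo(M), and forms on a Lie *)
(* algebroid are the alternating C^oo(M)-multilinear maps on its module of    *)
(* sections. Every germ of a smooth function is the germ of a global one, so  *)
(* stalks are described with global functions. Manifolds are Hausdorff,       *)
(* second countable and of constant dimension n; they may be empty and need   *)
(* not be connected.                                                          *)

Section SmoothEuclidean.
Variables (R : realType) (n : nat).
Implicit Types (O : set 'rV[R]_n) (f g : 'rV[R]_n -> R).

Definition partial (i : 'I_n) f : 'rV[R]_n -> R :=
  fun x => 'D_(delta_mx ord0 i) f x.

Fixpoint Ck (k : nat) O f : Prop :=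
  (forall x, O x -> {for x, continuous f}) /\
  if k is k'.+1 then
    forall i : 'I_n, (forall x, O x -> derivable f x (delta_mx ord0 i)) /\
                     Ck k' O (partial i f)
  else True.

Definition smooth_on O f := forall k, Ck k O f.

Lemma Ck_continuous k O f x : Ck k O f -> O x -> {for x, continuous f}.
Proof. by case: k => [|k] [+ _]; apply. Qed.

Lemma CkS k O f : Ck k.+1 O f -> Ck k O f.
Proof.
elim: k f => [|k IHk] f [cf df]; split=> // i.
by have [dfi Ckf] := df i; split=> //; apply: IHk.
Qed.

Lemma Ck_ext k O f g : open O -> (forall x, O x -> f x = g x) ->
  Ck k O f -> Ck k O g.
Proof.
move=> oO; elim: k f g => [|k IHk] f g fg [cf df].
all: have fgx x (Ox : O x) : {near x, f =1 g}
  by apply: filterS (open_nbhs_nbhs (conj oO Ox)) => y; apply: fg.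
all: have cg x : O x -> {for x, continuous g}.
1,3: move=> Ox; have := cf _ Ox; rewrite /prop_for /continuous_at (fg _ Ox).
1,2: move=> fc; apply: cvg_trans fc; exact: near_eq_cvg (fgx _ Ox).
- by split.
- split=> // i; have [di Ci] := df i; split=> [x Ox|].
    exact: near_eq_derivable (fgx _ Ox) (di _ Ox).
  apply: IHk Ci => x Ox; rewrite /partial.
  exact: near_eq_derive (fgx _ Ox).
Qed.

Lemma Ck_cst k O a : Ck k O (cst a).
Proof.
elim: k a => [|k IHk] a; (split; first by move=> x _; exact: cst_continuous) => //.
move=> i; split=> [x _|]; first exact: derivable_cst.
have -> : partial i (cst a) = cst 0 by apply/funext => x; exact: derive_cst.
exact: IHk.
Qed.

Lemma CkD k O f g : open O -> Ck k O f -> Ck k O g -> Ck k O (f + g).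
Proof.
move=> oO; elim: k f g => [|k IHk] f g [cf df] [cg dg].
all: split=> [x Ox|//]; first exact: continuousD (cf _ Ox) (cg _ Ox).
move=> i; have [fi Cf] := df i; have [gi Cg] := dg i; split=> [x Ox|].
  exact: derivableD (fi _ Ox) (gi _ Ox).
apply: Ck_ext (IHk _ _ Cf Cg) => // x Ox.
by rewrite /partial deriveD //; [exact: fi | exact: gi].
Qed.

Lemma CkM k O f g : open O -> Ck k O f -> Ck k O g -> Ck k O (f * g).
Proof.
move=> oO; elim: k f g => [|k IHk] f g Cf Cg.
all: have [cf df] := Cf; have [cg dg] := Cg.
all: split=> [x Ox|//]; first exact: continuousM (cf _ Ox) (cg _ Ox).
move=> i; have [fi Cfi] := df i; have [gi Cgi] := dg i; split=> [x Ox|].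
  exact: derivableM (fi _ Ox) (gi _ Ox).
have := CkD oO (IHk _ _ (CkS Cf) Cgi) (IHk _ _ (CkS Cg) Cfi).
apply: Ck_ext => // x Ox.
by rewrite /partial deriveM //; [exact: fi | exact: gi].
Qed.

Lemma smooth_on_cst O a : smooth_on O (cst a).
Proof. by move=> k; apply: Ck_cst. Qed.

Lemma smooth_onD O f g : open O ->
  smooth_on O f -> smooth_on O g -> smooth_on O (f + g).
Proof. by move=> oO sf sg k; apply: CkD. Qed.

Lemma smooth_onM O f g : open O ->
  smooth_on O f -> smooth_on O g -> smooth_on O (f * g).
Proof. by move=> oO sf sg k; apply: CkM. Qed.

End SmoothEuclidean.

Record chart (R : realType) (n : nat) (M : topologicalType) := Chart {
  dom : set M;
  cmap : M -> 'rV[R]_n;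
  cinv : 'rV[R]_n -> M;
  dom_open : open dom;
  cmap_open : open (cmap @` dom);
  cmapK : forall x, dom x -> cinv (cmap x) = x;
  cmap_cont : forall x, dom x -> {for x, continuous cmap};
  cinv_cont : forall y, (cmap @` dom) y -> {for y, continuous cinv} }.

Record manifold (R : realType) (n : nat) := Manifold {
  points :> topologicalType;
  manifold_hausdorff : hausdorff_space points;
  manifold_countable : @second_countable points;
  atlas : set (chart R n points);
  atlas_cover : forall x, exists2 c, atlas c & dom c x;
  atlas_compatible : forall c c', atlas c -> atlas c' -> forall i : 'I_n,
    smooth_on (cmap c @` (dom c `&` dom c'))
              (fun y => cmap c' (cinv c y) ord0 i) }.

Arguments atlas {R n} m _.

Section SmoothFunctions.
Variables (R : realType) (n : nat) (M : manifold R n).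

Definition smoothR (U : set M) (f : M -> R) :=
  forall c, atlas M c -> smooth_on (cmap c @` (dom c `&` U)) (f \o cinv c).

Definition smoothC (U : set M) (f : M -> R[i]) :=
  smoothR U (fun x => complex.Re (f x)) /\ smoothR U (fun x => complex.Im (f x)).

Lemma smoothR_ext U f g : f =1 g -> smoothR U f -> smoothR U g.
Proof. by move=> /funext ->. Qed.

Lemma smoothR_cst a : smoothR setT (cst a).
Proof. by move=> c _; apply: smooth_on_cst. Qed.

Lemma smoothRD f g : smoothR setT f -> smoothR setT g -> smoothR setT (f + g).
Proof.
move=> sf sg c Mc; have := sf c Mc; have := sg c Mc; rewrite setIT => sg' sf'.
exact: smooth_onD (@cmap_open _ _ _ c) sf' sg'.
Qed.

Lemma smoothRM f g : smoothR setT f -> smoothR setT g -> smoothR setT (f * g).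
Proof.
move=> sf sg c Mc; have := sf c Mc; have := sg c Mc; rewrite setIT => sg' sf'.
exact: smooth_onM (@cmap_open _ _ _ c) sf' sg'.
Qed.

Lemma smoothRB f g : smoothR setT f -> smoothR setT g -> smoothR setT (f - g).
Proof.
move=> sf sg; have -> : f - g = f + cst (-1) * g.
  by apply/funext => x /=; rewrite !fctE mulN1r.
exact: smoothRD sf (smoothRM (smoothR_cst _) sg).
Qed.

Definition smoothRb : {pred M -> R} := fun f => `[< smoothR setT f >].
Definition smoothCb : {pred M -> R[i]} := fun f => `[< smoothC setT f >].

Fact smoothRb_subring : subring_closed smoothRb.
Proof.
split=> [|f g /asboolP sf /asboolP sg|f g /asboolP sf /asboolP sg]; apply/asboolP.
- exact: smoothR_cst.
- exact: smoothRB.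
- exact: smoothRM.
Qed.

Fact smoothCb_subring : subring_closed smoothCb.
Proof.
split=> [|f g /asboolP[sf sf'] /asboolP[sg sg']|
          f g /asboolP[sf sf'] /asboolP[sg sg']]; apply/asboolP.
- by split; exact: smoothR_cst.
- split; [apply: smoothR_ext (smoothRB sf sg) |
          apply: smoothR_ext (smoothRB sf' sg')] => x; rewrite !fctE.
  1,2: by move: (f x) (g x) => [? ?] [? ?].
- split; [apply: smoothR_ext (smoothRB (smoothRM sf sg) (smoothRM sf' sg')) |
          apply: smoothR_ext (smoothRD (smoothRM sf sg') (smoothRM sf' sg))] => x.
  1,2: by rewrite !fctE; move: (f x) (g x) => [? ?] [? ?].
Qed.

Record smooth_real := SmoothReal { rval : M -> R; _ : rval \in smoothRb }.
Record smooth_complex := SmoothComplex { cval : M -> R[i]; _ : cval \in smoothCb }.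

HB.instance Definition _ := [isSub for rval].
HB.instance Definition _ := [Choice of smooth_real by <:].
HB.instance Definition _ := GRing.SubChoice_isSubComPzRing.Build
  _ smoothRb smooth_real smoothRb_subring.
HB.instance Definition _ := [isSub for cval].
HB.instance Definition _ := [Choice of smooth_complex by <:].
HB.instance Definition _ := GRing.SubChoice_isSubComPzRing.Build
  _ smoothCb smooth_complex smoothCb_subring.

Implicit Types (f g : smooth_real) (h k : smooth_complex).

Lemma smooth_realP f : smoothR setT (rval f).
Proof. by case: f => f /= /asboolP. Qed.

Lemma smooth_complexP h : smoothC setT (cval h).
Proof. by case: h => h /= /asboolP. Qed.

Definition mk_real (f : M -> R) (sf : smoothR setT f) : smooth_real :=
  SmoothReal (asboolT sf : f \in smoothRb).

Definition mk_complex (h : M -> R[i]) (sh : smoothC setT h) : smooth_complex :=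
  SmoothComplex (asboolT sh : h \in smoothCb).

Definition real_cst (a : R) : smooth_real := mk_real (smoothR_cst a).

Definition to_complex f : smooth_complex :=
  @mk_complex (fun x => (rval f x)%:C) (conj (smooth_realP f) (smoothR_cst 0)).

Definition complex_cst (a : R[i]) : smooth_complex :=
  @mk_complex (cst a) (conj (smoothR_cst (complex.Re a))
                            (smoothR_cst (complex.Im a))).

Definition re h : smooth_real := mk_real (proj1 (smooth_complexP h)).
Definition im h : smooth_real := mk_real (proj2 (smooth_complexP h)).
Definition conjA h : smooth_complex :=
  to_complex (re h) - complex_cst 'i * to_complex (im h).

Let rvalD f g x : rval (f + g) x = rval f x + rval g x. Proof. by []. Qed.
Let rvalM f g x : rval (f * g) x = rval f x * rval g x. Proof. by []. Qed.
Let cvalD h k x : cval (h + k) x = cval h x + cval k x. Proof. by []. Qed.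
Let cvalM h k x : cval (h * k) x = cval h x * cval k x. Proof. by []. Qed.
Let reE h x : rval (re h) x = complex.Re (cval h x). Proof. by []. Qed.
Let imE h x : rval (im h) x = complex.Im (cval h x). Proof. by []. Qed.
Let tcE f x : cval (to_complex f) x = (rval f x)%:C. Proof. by []. Qed.
Let rvalB f g x : rval (f - g) x = rval f x - rval g x. Proof. by []. Qed.

Lemma rval_inj f g : (forall x, rval f x = rval g x) -> f = g.
Proof. by move=> fg; apply/val_inj/funext. Qed.

Lemma cval_inj h k : (forall x, cval h x = cval k x) -> h = k.
Proof. by move=> hk; apply/val_inj/funext. Qed.

Lemma smooth_complexE h : h = to_complex (re h) + complex_cst 'i * to_complex (im h).
Proof.
apply: cval_inj => x; rewrite cvalD cvalM /=; exact: complexE.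
Qed.

Lemma reD h k : re (h + k) = re h + re k.
Proof.
apply: rval_inj => x; rewrite rvalD ?reE ?imE cvalD.
by move: (cval h x) (cval k x) => [? ?] [? ?].
Qed.

Lemma imD h k : im (h + k) = im h + im k.
Proof.
apply: rval_inj => x; rewrite rvalD ?reE ?imE cvalD.
by move: (cval h x) (cval k x) => [? ?] [? ?].
Qed.

Lemma re_to_complexM f h : re (to_complex f * h) = f * re h.
Proof.
apply: rval_inj => x; rewrite rvalM ?reE ?imE cvalM tcE.
by move: (cval h x) => [? ?] /=; rewrite mul0r subr0.
Qed.

Lemma im_to_complexM f h : im (to_complex f * h) = f * im h.
Proof.
apply: rval_inj => x; rewrite rvalM ?reE ?imE cvalM tcE.
by move: (cval h x) => [? ?] /=; rewrite mul0r addr0.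
Qed.

Lemma reM h k : re (h * k) = re h * re k - im h * im k.
Proof.
apply: rval_inj => x.
rewrite rvalB !rvalM !reE !imE cvalM.
by move: (cval h x) (cval k x) => [? ?] [? ?].
Qed.

Lemma imM h k : im (h * k) = re h * im k + im h * re k.
Proof.
apply: rval_inj => x.
rewrite rvalD !rvalM !reE !imE cvalM.
by move: (cval h x) (cval k x) => [? ?] [? ?].
Qed.

Lemma to_complexD f g : to_complex (f + g) = to_complex f + to_complex g.
Proof.
apply: cval_inj => x; rewrite tcE cvalD rvalD.
exact: rmorphD.
Qed.

Lemma to_complexM f g : to_complex (f * g) = to_complex f * to_complex g.
Proof.
apply: cval_inj => x; rewrite tcE cvalM rvalM.
exact: rmorphM.
Qed.

Lemma to_complex0 : to_complex 0 = 0.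
Proof. exact: cval_inj. Qed.

Lemma to_complexN f : to_complex (- f) = - to_complex f.
Proof.
by apply: (addrI (to_complex f)); rewrite -to_complexD !subrr to_complex0.
Qed.

Lemma to_complex_cst (a : R) : to_complex (real_cst a) = complex_cst a%:C.
Proof. exact: val_inj. Qed.

Lemma re_cst (a : R[i]) : re (complex_cst a) = real_cst (complex.Re a).
Proof. exact: val_inj. Qed.

Lemma im_cst (a : R[i]) : im (complex_cst a) = real_cst (complex.Im a).
Proof. exact: val_inj. Qed.

Lemma complex_cstE (a : R[i]) : complex_cst a =
  to_complex (real_cst (complex.Re a)) +
  complex_cst 'i * to_complex (real_cst (complex.Im a)).
Proof. by rewrite {1}[complex_cst a]smooth_complexE re_cst im_cst. Qed.

Lemma complex_iM : complex_cst 'i * complex_cst 'i = -1.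
Proof.
apply: cval_inj => x; rewrite cvalM /=.
by rewrite -expr2 sqr_i.
Qed.

End SmoothFunctions.

Record fun_algebra (K : fieldType) (X : Type) := FunAlgebra {
  carrier :> comPzRingType;
  ev : carrier -> X -> K;
  scalar : K -> carrier;
  locally_smooth : set X -> (X -> K) -> Prop }.

Definition CR (R : realType) n (M : manifold R n) : fun_algebra R M :=
  FunAlgebra (@rval R n M) (@real_cst R n M) (@smoothR R n M).

Definition CC (R : realType) n (M : manifold R n) : fun_algebra R[i] M :=
  FunAlgebra (@cval R n M) (@complex_cst R n M) (@smoothC R n M).

Section Algebroids.
Variables (K : fieldType) (X : Type) (A : fun_algebra K X).

Record ideal := Ideal {
  ideal_set :> A -> Prop;
  ideal0 : ideal_set 0;
  idealD : forall f g, ideal_set f -> ideal_set g -> ideal_set (f + g);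
  idealM : forall f g, ideal_set g -> ideal_set (f * g) }.

Definition idealT : ideal :=
  @Ideal (fun=> True) Logic.I (fun _ _ _ _ => Logic.I) (fun _ _ _ => Logic.I).

(* The sections of the Lie algebroid of vector fields preserving I.           *)
Record vect (I : ideal) := Vect {
  vect_fun :> A -> A;
  vectD : forall f g, vect_fun (f + g) = vect_fun f + vect_fun g;
  vectM : forall f g, vect_fun (f * g) = vect_fun f * g + f * vect_fun g;
  vectZ : forall a f, vect_fun (scalar A a * f) = scalar A a * vect_fun f;
  vect_ideal : forall f, I f -> I (vect_fun f) }.

HB.instance Definition _ (I : ideal) := gen_eqMixin (vect I).
HB.instance Definition _ (I : ideal) := gen_choiceMixin (vect I).

Section VectorFields.
Variable I : ideal.
Implicit Types (Y Z : vect I) (f : A).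

Lemma vect_inj Y Z : (forall f, Y f = Z f) -> Y = Z.
Proof.
case: Y Z => [Y YD YM YZ YI] [Z ZD ZM ZZ ZI] /= /funext YZe; subst Z.
by congr Vect; apply: Prop_irrelevance.
Qed.

Lemma vect0 Y : Y 0 = 0.
Proof. by apply: (addrI (Y 0)); rewrite -vectD !addr0. Qed.

Lemma vect_scalar Y a : Y (scalar A a) = 0.
Proof.
have Y1 : Y 1 = 0 by apply: (addrI (Y 1)); rewrite -{3}[1]mulr1 vectM mulr1 mul1r addr0.
by rewrite -[scalar A a]mulr1 vectZ Y1 mulr0.
Qed.

Lemma vectN Y f : Y (- f) = - Y f.
Proof. by apply: (addrI (Y f)); rewrite -vectD !subrr vect0. Qed.

Lemma idealN f : I f -> I (- f).
Proof. by move=> If; rewrite -mulN1r; apply: idealM. Qed.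

Definition vzero : vect I.
Proof.
refine (@Vect I (fun=> 0) _ _ _ _) => [f g|f g|a' f|f If].
- by rewrite addr0.
- by rewrite mul0r mulr0 addr0.
- by rewrite mulr0.
- exact: ideal0.
Defined.

Definition vadd Y Z : vect I.
Proof.
refine (@Vect I (fun f => Y f + Z f) _ _ _ _) => [f g|f g|a' f|f If].
- by rewrite !vectD addrACA.
- by rewrite !vectM; ring.
- by rewrite !vectZ mulrDr.
- by apply: idealD; apply: vect_ideal.
Defined.

Definition vscale (a : A) Y : vect I.
Proof.
refine (@Vect I (fun f => a * Y f) _ _ _ _) => [f g|f g|a' f|f If].
- by rewrite !vectD mulrDr.
- by rewrite !vectM; ring.
- by rewrite !vectZ mulrCA.
- by apply/idealM/vect_ideal.
Defined.

Definition vopp Y : vect I.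
Proof.
refine (@Vect I (fun f => - Y f) _ _ _ _) => [f g|f g|a' f|f If].
- by rewrite !vectD opprD.
- by rewrite !vectM; ring.
- by rewrite !vectZ mulrN.
- by apply/idealN/vect_ideal.
Defined.

Definition bracket Y Z : vect I.
Proof.
refine (@Vect I (fun f => Y (Z f) - Z (Y f)) _ _ _ _) => [f g|f g|a' f|f If].
- by rewrite !vectD; ring.
- by rewrite !vectM !vectD !vectM; ring.
- by rewrite !vectZ mulrBr.
- by apply/idealD; [|apply: idealN]; do 2 apply: vect_ideal.
Defined.

Fact vaddA : associative vadd.
Proof. by move=> Y Z W; apply: vect_inj => f /=; rewrite addrA. Qed.
Fact vaddC : commutative vadd.
Proof. by move=> Y Z; apply: vect_inj => f /=; rewrite addrC. Qed.
Fact vadd0 : left_id vzero vadd.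
Proof. by move=> Y; apply: vect_inj => f /=; rewrite add0r. Qed.
Fact vaddN : left_inverse vzero vopp vadd.
Proof. by move=> Y; apply: vect_inj => f /=; rewrite addNr. Qed.

HB.instance Definition _ :=
  GRing.isZmodule.Build (vect I) vaddA vaddC vadd0 vaddN.

Definition anchor Y : vect idealT :=
  @Vect idealT Y (vectD Y) (vectM Y) (vectZ Y) (fun _ _ => Logic.I).

Definition kform (k : nat) := ('I_k -> vect I) -> A.
HB.instance Definition _ k := GRing.Zmodule.copy (kform k) (('I_k -> vect I) -> A).

Definition upd k (V : 'I_k -> vect I) i Y : 'I_k -> vect I :=
  fun j => if j == i then Y else V j.

Definition vcons k Y (V : 'I_k -> vect I) : 'I_k.+1 -> vect I :=
  fun i => if unlift ord0 i is Some j then V j else Y.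

Definition is_form k (a : kform k) :=
  [/\ forall V i Y Z, a (upd V i (Y + Z)) = a (upd V i Y) + a (upd V i Z),
      forall V i f Y, a (upd V i (vscale f Y)) = f * a (upd V i Y) &
      forall V i j, i != j -> V i = V j -> a V = 0].

Definition fscale k f (a : kform k) : kform k := fun V => f * a V.

(* i_Y a = a(Y, -) and (xi /\ eta)(Y, Z) = xi(Y) eta(Z) - xi(Z) eta(Y).        *)
Definition contract k Y (a : kform k.+1) : kform k := fun V => a (vcons Y V).

Definition wedge1 k (xi : kform 1) (a : kform k) : kform k.+1 := fun V =>
  \sum_(i < k.+1) (-1) ^+ i * (xi (fun=> V i) * a (V \o lift i)).

(* Koszul's formula; in the term of (l, j) with l < j, the bracket stands in  *)
(* position l, which accounts for the usual sign (-1)^(l + j).                *)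
Definition differential k (a : kform k) : kform k.+1 := fun V =>
  \sum_(j < k.+1) (-1) ^+ j *
    (V j (a (V \o lift j)) +
     \sum_(l < k | (l < j)%N)
        a (upd (V \o lift j) l (bracket (V (lift j l)) (V j)))).

Definition is_closed k (a : kform k) := differential a = 0.

Definition scalar_of (a : kform 0) : A := a (fun=> 0).

Definition lie_derivative k Y (a : kform k) : kform k :=
  match k return kform k -> kform k with
  | 0 => fun a => contract Y (differential a)
  | k'.+1 => fun a => contract Y (differential a) + differential (contract Y a)
  end a.

Definition nondegenerate (w : kform 2) := forall xi : kform 1, is_form xi ->
  exists! Y, contract Y w = xi.

End VectorFields.
End Algebroids.

Arguments kform {K X A} I k.

Section Divisors.
Variables (K : fieldType) (X : topologicalType) (A : fun_algebra K X).

(* A line bundle given by its transition functions g i j, with sections       *)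
(* s_i = g i j * s_j; only A-smoothness and nowhere vanishing are required,   *)
(* so this is a real line bundle for A = CR M and a complex one for CC M.     *)
Record line_bundle := LineBundle {
  lb_index : Type;
  lb_open : lb_index -> set X;
  lb_trans : lb_index -> lb_index -> X -> K;
  lb_openP : forall i, open (lb_open i);
  lb_cover : forall x, exists i, lb_open i x;
  lb_smooth : forall i j,
    locally_smooth A (lb_open i `&` lb_open j) (lb_trans i j);
  lb_neq0 : forall i j x, lb_open i x -> lb_open j x -> lb_trans i j x != 0;
  lb_cocycle : forall i j k x, lb_open i x -> lb_open j x -> lb_open k x ->
    lb_trans i j x * lb_trans j k x = lb_trans i k x }.

Definition is_section (L : line_bundle) (s : lb_index L -> X -> K) :=
  (forall i, locally_smooth A (lb_open i) (s i)) /\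
  forall i j x, lb_open i x -> lb_open j x -> s i x = lb_trans i j x * s j x.

Definition is_dual_section (L : line_bundle) (t : lb_index L -> X -> K) :=
  (forall i, locally_smooth A (lb_open i) (t i)) /\
  forall i j x, lb_open i x -> lb_open j x -> t i x * lb_trans i j x = t j x.

Definition section_zeros (L : line_bundle) (s : lb_index L -> X -> K) : set X :=
  [set x | exists2 i, lb_open i x & s i x = 0].

Definition nowhere_dense (Z : set X) := interior (closure Z) = set0.

Definition divisor_ideal (I : A -> Prop) :=
  exists (L : line_bundle) (s : lb_index L -> X -> K),
    [/\ is_section s, nowhere_dense (section_zeros s) &
        forall f, I f <-> exists2 t, is_dual_section t &
          forall i x, lb_open i x -> ev f x = t i x * s i x].

(* On U, the sheaf of ideals spanned by I is the principal one spanned by g.  *)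
Definition generated_by (U : set X) (I : A -> Prop) (g : A) :=
  forall x, U x -> forall f : A,
    (exists2 h, I h & \forall y \near x, ev f y = ev h y) <->
    (exists h : A, \forall y \near x, ev f y = ev h y * ev g y).

Definition vzeros (f : A) : set X := [set x | ev f x = 0].

(* dh_1 /\ ... /\ dh_m does not vanish at x, for s = [:: h_1; ...; h_m].      *)
Definition wedge_neq0 (x : X) (s : seq A) :=
  exists V : 'I_(size s) -> vect (idealT A),
    \det (\matrix_(i, j) ev (V j (nth 0 s i)) x) != 0.

End Divisors.

Section StableGeneralizedComplex.
Variables (R : realType) (n : nat) (M : manifold R n).
Local Notation CR := (CR M).
Local Notation CC := (CC M).
Local Notation TR := (vect (idealT CR)).
Local Notation TC := (vect (idealT CC)).

Lemma complex_vectM (Y : TR) (D := fun h : CC =>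
    to_complex (Y (re h)) + complex_cst M 'i * to_complex (Y (im h)) : CC) f g :
  D (f * g) = D f * g + f * D g.
Proof.
pose i := complex_cst M 'i; have iM : i * i = -1 := complex_iM M.
transitivity (D f * (to_complex (re g) + i * to_complex (im g)) +
              (to_complex (re f) + i * to_complex (im f)) * D g); last first.
  by rewrite -!smooth_complexE.
rewrite /D reM imM !vectD vectN !vectM -/i.
rewrite !(to_complexD, to_complexN, to_complexM); by ring: iM.
Qed.

Definition complex_vect (Y : TR) : TC.
Proof.
refine (@Vect _ _ CC (idealT CC)
  (fun h => to_complex (Y (re h)) + complex_cst M 'i * to_complex (Y (im h)))
  _ _ _ _) => [f g|f g|a f|//].
- by rewrite reD imD !vectD !to_complexD; ring.
- exact: complex_vectM.
- rewrite complex_vectM re_cst im_cst.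
  by rewrite !(vect_scalar Y) to_complex0 mulr0 addr0 mul0r add0r.
Defined.

Definition re_vect (Y : TC) : TR.
Proof.
refine (@Vect _ _ CR (idealT CR) (fun f => re (Y (to_complex f))) _ _ _ _)
  => [f g|f g|a f|//].
- by rewrite to_complexD vectD reD.
- rewrite to_complexM vectM reD re_to_complexM [Y _ * _]mulrC re_to_complexM.
  by rewrite [g * _]mulrC.
- have e : to_complex (scalar CR a) = scalar CC a%:C := to_complex_cst M a.
  by rewrite to_complexM e vectZ -e re_to_complexM.
Defined.

Definition im_vect (Y : TC) : TR.
Proof.
refine (@Vect _ _ CR (idealT CR) (fun f => im (Y (to_complex f))) _ _ _ _)
  => [f g|f g|a f|//].
- by rewrite to_complexD vectD imD.
- rewrite to_complexM vectM imD im_to_complexM [Y _ * _]mulrC im_to_complexM.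
  by rewrite [g * _]mulrC.
- have e : to_complex (scalar CR a) = scalar CC a%:C := to_complex_cst M a.
  by rewrite to_complexM e vectZ -e im_to_complexM.
Defined.

(* The C-multilinear extension of a real form.                                *)
Definition complex_form k (h : kform (idealT CR) k) : kform (idealT CC) k :=
  fun V => \sum_(S : {set 'I_k}) complex_cst M ('i ^+ #|S|) *
    to_complex (h (fun j => if j \in S then im_vect (V j) else re_vect (V j))).

(* The second clause is the transverse vanishing of each f i.                 *)
Definition log_product (U : set M) (I : CC -> Prop) j (f : 'I_j -> CC) :=
  [/\ generated_by U I (\prod_(i < j) f i),
      forall i x, U x -> ev (f i) x = 0 ->
        forall z : R[i], exists Y : TR, ev (complex_vect Y (f i)) x = z &
      forall (S : {set 'I_j}) x, U x -> (forall i, i \in S -> ev (f i) x = 0) ->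
        wedge_neq0 x (flatten [seq [:: f i; conjA (f i) : CC] | i <- enum S])].

Definition locally_log (I : CC -> Prop) := forall p : M, exists U : set M,
  [/\ open U, U p & exists j (f : 'I_j -> CC), log_product U I f].

Definition log_divisor (I : CC -> Prop) := divisor_ideal I /\ locally_log I.

(* Near p, Z is a codimension two submanifold with defining functions u, v.   *)
Definition cut_out (p : M) (Z : set M) (u v : CR) :=
  (\forall y \near p, Z y <-> ev u y = 0 /\ ev v y = 0) /\
  wedge_neq0 p [:: u; v].

(* Hess q (Y, Y) = Y (Y q), for Y_x not tangent to the zero locus of q.       *)
Definition smooth_elliptic (U : set M) (q : CR) :=
  forall x, U x -> ev q x = 0 -> exists u v : CR, cut_out x (vzeros q) u v /\
    forall Y : TR, ev (Y u) x != 0 \/ ev (Y v) x != 0 -> 0 < ev (Y (Y q)) x.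

Definition elliptic_product (U : set M) (I : CR -> Prop) j (q : 'I_j -> CR) :=
  [/\ generated_by U I (\prod_(i < j) q i),
      forall i, smooth_elliptic U (q i) &
      forall (S : {set 'I_j}) x, U x -> (forall i, i \in S -> ev (q i) x = 0) ->
        exists u v : 'I_j -> CR,
          (forall i, i \in S -> cut_out x (vzeros (q i)) (u i) (v i)) /\
          wedge_neq0 x (flatten [seq [:: u i; v i] | i <- enum S])].

Definition factors_at (I : CR -> Prop) (p : M) (j : nat) := exists U : set M,
  [/\ open U, U p & exists q : 'I_j -> CR, elliptic_product U I q].

Definition elliptic_divisor (I : CR -> Prop) :=
  divisor_ideal I /\ forall p, exists j, factors_at I p j.

Definition intersection_number (I : CR -> Prop) (p : M) (j : nat) :=
  factors_at I p j /\ forall j', factors_at I p j' -> (j <= j')%N.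

Definition stratum (I : CR -> Prop) (i : nat) : set M :=
  [set p | exists2 j, intersection_number I p j & (i <= j)%N].

Definition C1 (I : CR -> Prop) : set M := stratum I 1 `\` stratum I 2.

Definition ndet (u v : CR) (x : M) (Y Z : TR) : R :=
  ev (Y u) x * ev (Z v) x - ev (Y v) x * ev (Z u) x.

(* An orientation of the normal bundle NC(1) is given by its oriented frames: *)
(* o p Y Z means that p lies in C(1) and that the classes of Y_p and Z_p form *)
(* an oriented basis of the normal space at p.                                *)
Definition co_orientation (I : CR -> Prop) (o : M -> TR -> TR -> Prop) :=
  [/\ forall p Y Z, o p Y Z -> C1 I p,
      forall p u v, C1 I p -> cut_out p (C1 I) u v ->
        (forall Y Z, o p Y Z -> ndet u v p Y Z != 0) /\
        (forall Y Z Y' Z',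
           (0 < ndet u v p Y Z * ndet u v p Y' Z' -> o p Y Z <-> o p Y' Z') /\
           (ndet u v p Y Z * ndet u v p Y' Z' < 0 -> o p Y Z <-> ~ o p Y' Z')) &
      forall p Y Z, o p Y Z -> \forall y \near p, C1 I y -> o y Y Z].

(* The co-oriented elliptic divisor (I, o) induced by a complex log divisor   *)
(* with ideal ID: a local generator f of ID is the section in a local frame.  *)
Definition induces (ID : CC -> Prop) (I : CR -> Prop)
    (o : M -> TR -> TR -> Prop) :=
  (forall f : CC, I (re f) /\ I (im f) <->
     exists m (a b : 'I_m -> CC),
       (forall i, ID (a i) /\ ID (b i)) /\ f = \sum_(i < m) a i * conjA (b i)) /\
  (forall p Y Z, o p Y Z <-> C1 I p /\
     exists (U : set M) (f : CC), [/\ open U, U p, generated_by U ID f &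
       0 < complex.Im ((ev (complex_vect Y f) p)^*%C * ev (complex_vect Z f) p)]).

(* V' is the image of V under the natural map from the complexified elliptic  *)
(* algebroid to the log one; it is determined by V.                           *)
Definition Im_pullback (ID : ideal CC) (I : ideal CR) k
    (s : kform ID k) (w : kform I k) :=
  forall V : 'I_k -> vect I, exists V' : 'I_k -> vect ID,
    (forall i, anchor (V' i) = complex_vect (anchor (V i))) /\ w V = im (s V').

Definition log_symplectic (ID : ideal CC) (I : ideal CR) (s : kform ID 2) :=
  [/\ is_form s,
      exists2 h : kform (idealT CR) 3, is_form h &
        differential s = (fun V => complex_form h (fun i => anchor (V i))) &
      exists2 w : kform I 2, Im_pullback s w & nondegenerate w].

Record elliptic_triple := EllipticTriple {
  et_ideal : ideal CR;
  et_coor : M -> TR -> TR -> Prop;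
  et_form : kform et_ideal 2 }.
Arguments et_form : clear implicits.

Definition symplectic_triple (t : elliptic_triple) :=
  [/\ elliptic_divisor (et_ideal t), co_orientation (et_ideal t) (et_coor t),
      [/\ is_form (et_form t), is_closed (et_form t) & nondegenerate (et_form t)] &
      exists ID : ideal CC, [/\ log_divisor ID,
        induces ID (et_ideal t) (et_coor t) &
        exists2 s : kform ID 2, is_form s & Im_pullback s (et_form t)]].

(* Divisors are isomorphic iff their ideals agree.                            *)
Definition isomorphic_triples (t t' : elliptic_triple) :=
  [/\ forall f, et_ideal t f <-> et_ideal t' f,
      forall p Y Z, et_coor t p Y Z <-> et_coor t' p Y Z &
      forall V V', (forall i, anchor (V i) = anchor (V' i)) ->
        et_form t V = et_form t' V'].

(* Sections X + xi of the generalized tangent bundle; only the pairs with xi  *)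
(* a one-form, i.e. those satisfying is_gsec, are meaningful.                 *)
Definition gsec (K : fieldType) (A : fun_algebra K M) : zmodType :=
  (vect (idealT A) * kform (idealT A) 1)%type.

Section GeneralizedTangent.
Variables (K : fieldType) (A : fun_algebra K M).
Implicit Types (u v : gsec A).

Definition is_gsec u := is_form u.2.

Definition gscale (f : A) u : gsec A := (vscale f u.1, fscale f u.2).

Definition pairing u v : A :=
  scalar_of (contract u.1 v.2) + scalar_of (contract v.1 u.2).

Definition courant (H : kform (idealT A) 3) u v : gsec A :=
  (bracket u.1 v.1,
   lie_derivative u.1 v.2 - contract v.1 (differential u.2) +
   contract u.1 (contract v.1 H)).

Definition shear (B : kform (idealT A) 2) u : gsec A :=
  (u.1, u.2 + contract u.1 B).

Definition clifford u (rho : forall k, kform (idealT A) k) k : kform (idealT A) k :=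
  contract u.1 (rho k.+1) +
  match k return kform (idealT A) k with
  | 0 => 0
  | k'.+1 => wedge1 u.2 (rho k')
  end.

End GeneralizedTangent.
Arguments clifford {K A} u rho k _.

Definition re_gsec (u : gsec CC) : gsec CR :=
  (re_vect u.1, fun V => re (u.2 (fun i => complex_vect (V i)))).

Definition im_gsec (u : gsec CC) : gsec CR :=
  (im_vect u.1, fun V => im (u.2 (fun i => complex_vect (V i)))).

(* Only the values of gs_J on the pairs satisfying is_gsec matter.            *)
Record gstructure := GStructure {
  gs_J : gsec CR -> gsec CR;
  gs_H : kform (idealT CR) 3 }.

(* J (a + i b) = i (a + i b).                                                 *)
Definition eigen_section (g : gstructure) (u : gsec CC) :=
  [/\ is_gsec u, gs_J g (re_gsec u) = - im_gsec u &
      gs_J g (im_gsec u) = re_gsec u].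

Definition generalized_complex (g : gstructure) :=
  let J := gs_J g in let H := gs_H g in
  [/\ is_form H /\ is_closed H,
      [/\ forall u, is_gsec u -> is_gsec (J u),
          forall u v, is_gsec u -> is_gsec v -> J (u + v) = J u + J v &
          forall f u, is_gsec u -> J (gscale f u) = gscale f (J u)],
      forall u v, is_gsec u -> is_gsec v -> pairing (J u) (J v) = pairing u v,
      forall u, is_gsec u -> J (J u) = - u &
      forall u v, eigen_section g u -> eigen_section g v ->
        eigen_section g (courant (complex_form H) u v)].

Definition gauge_equivalent (g g' : gstructure) :=
  exists B : kform (idealT CR) 2,
    [/\ is_form B, gs_H g' = gs_H g + differential B &
        forall u, is_gsec u -> gs_J g' u = shear B (gs_J g (shear (- B) u))].

Definition canonical_section (g : gstructure)
    (rho : forall k, kform (idealT CC) k) :=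
  (forall k, is_form (rho k)) /\
  forall u, eigen_section g u -> forall k, clifford u rho k = 0.

Definition anticanonical_ideal (g : gstructure) : CC -> Prop :=
  fun f => exists2 rho, canonical_section g rho & f = scalar_of (rho 0%N).

Definition anticanonical_zeros (g : gstructure) : set M :=
  [set x | forall rho, canonical_section g rho ->
             ev (scalar_of (rho 0%N) : CC) x = 0].

Definition stable (g : gstructure) :=
  [/\ generalized_complex g, nowhere_dense (anticanonical_zeros g) &
      locally_log (anticanonical_ideal g)].

Definition nonvanishing_on (U : set M) (rho : forall k, kform (idealT CC) k) :=
  forall x, U x -> exists k V, ev (rho k V) x != 0.

(* s = rho_2 / rho_0 for the local non-vanishing sections rho of K.           *)
Definition is_ratio (g : gstructure) (ID : ideal CC) (s : kform ID 2) :=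
  forall (U : set M) rho, open U -> canonical_section g rho ->
    nonvanishing_on U rho -> forall V x, U x ->
    ev (s V * scalar_of (rho 0%N)) x = ev (rho 2%N (fun i => anchor (V i))) x.

Definition assigned (g : gstructure) (t : elliptic_triple) :=
  exists ID : ideal CC,
    [/\ forall f, ID f <-> anticanonical_ideal g f,
        induces ID (et_ideal t) (et_coor t) &
        exists s : kform ID 2, [/\ is_ratio g s,
          log_symplectic (et_ideal t) s & Im_pullback s (et_form t)]].

End StableGeneralizedComplex.

(* Main.v *)
(* For a stable structure the canonical ratio s = rho_2 / rho_0 extends, by      *)
(* division along the smooth points of the divisor and a Hartogs-type argument at *)
(* the crossings, to a form on the log algebroid, and the +i-eigenbundle is the   *)
(* graph of s; conversely the graph of a log form s with ds the pullback of a     *)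
(* real three-form is a generalized complex structure as soon as Im^* s is        *)
(* nondegenerate. A log form that is real on the elliptic algebroid has no        *)
(* residues, hence is a smooth real form on M: this yields ds from dw = 0, and the *)
(* B-field relating two structures with the same imaginary part. The elliptic     *)
(* ideal consists of finite sums a_i conj b_i; it is local because the log ideal   *)
(* has n + 1 global generators.                                                   *)

Require Import Defs.
From HB Require Import structures.
From mathcomp Require Import all_boot all_order all_algebra.
From mathcomp Require Import all_classical all_reals all_analysis.
From mathcomp Require Import complex ring lra zify.
Import numFieldNormedType.Exports.

Set Implicit Arguments.
Unset Strict Implicit.
Unset Printing Implicit Defensive.

Import Order.TTheory GRing.Theory Num.Theory.
Local Open Scope classical_set_scope.
Local Open Scope ring_scope.
Local Open Scope complex_scope.

(** Where the anticanonical section does not vanish, a stable structure amounts to a complex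
    two-form: the canonical line is spanned by exp(s) with s = rho_2 / rho_0, the +i-eigenbundle
    consists of the X - i_X s, integrability reads ds = -H, and the splitting of the complexified
    generalized tangent bundle into this bundle and its conjugate is nondegeneracy of Im s. The
    proof carries this dictionary across the divisor, where s has poles, by testing s on the log
    algebroid and Im s on the elliptic one.

    The analytic engine is division. If z vanishes transversely, z divides h near a point as soon as
    all iterated dbar-derivatives of h vanish on z = 0 ([flat_along_divide], [nf_flat]). This is a
    closed condition, so it suffices to check it on a dense set of zeros ([divide_generic]). Points
    where a single factor of the log ideal vanishes are dense in the divisor, so crossings need no
    separate study ([divide_simple]): a system a_i h = b_i is solved near simple points and the
    solution exists globally ([log_extend]). Functions, fields and forms on the log algebroid are
    all produced in this way.

    From a structure to a form: if f = rho_0, the sections f V - i_V rho_2 are eigensections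
    ([spinor_eigen]), and their brackets give f d rho_2 + f^2 H = df /\ rho_2 ([star]). Near a
    smooth point of the divisor this shows that rho_2(V, W) / rho_0 is smooth for log fields V and W
    ([ratio_exists]), with ds = -H ([log_form_dif]). The inverse of Im s is the Poisson structure
    contained in J; the delicate point in [real_form_ndeg] is that the field q |-> xi(P q) dual to
    an elliptic one-form xi preserves the log ideal ([dual_preserves]).

    From a form to a structure: a form on the log algebroid that is real on the elliptic one has no
    residue, hence is a smooth real form on the manifold ([real_residue_free], [extend_form],
    [real_ext]). Applied to ds, whose imaginary part is dw = 0, this gives H; applied to i (i_Y s +
    xi), it shows that every real generalized section is the real part of a section of the graph
    ([graph_exists]), which defines J; applied to the difference of two log forms with the same
    imaginary part, it gives the B-field ([assigned_gauge]). The spinors f exp(s), with f in the log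
    ideal, identify that ideal with the anticanonical one ([antican_sup], [antican_sub]).

    On the side of divisors, the induced elliptic ideal consists of finite sums of a conj(b). It is
    a divisor ideal because it is local, which rests on the existence of n + 1 global generators of
    the log ideal ([finite_gens], [hsum_local]). Finally the elliptic ideal and the co-orientation
    determine the log ideal ([div_determined]). *)

Local Notation pd := partial.
Local Notation anc := anchor.
Local Notation falg := fun_algebra.
Local Notation toCx := to_complex.
Local Notation scal_of := scalar_of.
Local Notation cvec := complex_vect.
Local Notation cform := complex_form.
Local Notation dif := differential.
Local Notation nbhs1 := nbhs_singleton.
Local Notation eigsec := eigen_section.
Local Notation ccst := complex_cst.
Local Notation anti_ideal := anticanonical_ideal.
Local Notation cont_subT := continuous_in_subspaceT.
Local Notation gen_by := generated_by.
Ltac fext := apply/funext.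
Ltac ceq := apply/eqP; rewrite eq_complex /=; apply/andP; split; apply/eqP.

(** * Smooth functions on Euclidean space *)

Section Euclidean.
Variables (R : realType) (n : nat).
Local Notation V := 'rV[R]_n.
Local Notation e_ i := (delta_mx ord0 i : V).
Implicit Types (O : set V) (f g : V -> R) (x y v : V).

Lemma drv_line f x v s : derivable f (x + s *: v) v ->
 is_derive s 1 (fun t => f (x + t *: v)) ('D_v f (x + s *: v)).
Proof.
have E : (fun h => h^-1 *: (((fun t => f (x + t *: v)) \o shift s) (h *: 1) -
  f (x + s *: v))) =
 (fun h => h^-1 *: ((f \o shift (x + s *: v)) (h *: v) - f (x + s *: v))).
 fext => h /=; congr (_ *: (f _ - _)).
 by rewrite /shift /= [h%:A]mulr1 scalerDl addrCA.
move=> df; split; first by rewrite /derivable E.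
by rewrite /derive E.
Qed.

Lemma line_MVT f x v (h : R) :
 (forall t : R, `|t| <= `|h| -> derivable f (x + t *: v) v) ->
 exists2 t : R, `|t| <= `|h| & f (x + h *: v) - f x = h * 'D_v f (x + t *: v).
Proof.
move=> df; pose phi t := f (x + t *: v).
have dphi (t : R) : `|t| <= `|h| -> is_derive t 1 phi ('D_v f (x + t *: v)).
 by move=> /df; exact: drv_line.
have cphi (t : R) : `|t| <= `|h| -> {for t, continuous phi}.
 move=> /dphi [dt _]; apply: differentiable_continuous.
 exact/derivable1_diffP.
have x0 : x + 0 *: v = x by rewrite scale0r addr0.
case: (ltrgt0P h) => [h0|h0|->]; last first.
- exists 0; first by rewrite normr0.
 by rewrite scale0r addr0 mul0r subrr.
- have [t th e] : exists2 t, t \in `]h, 0[ & phi 0 - phi h = 'D_v f (x + t *: v) * (0 - h).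
  apply: MVT => // [t|]; first rewrite in_itv /= => /andP[ht t0].
   by apply: dphi; rewrite !ltr0_norm // lerN2 ltW.
  apply: cont_subT => t; rewrite inE /= in_itv /= => /andP[ht t0].
  by apply: cphi; rewrite (ltr0_norm h0) ler0_norm // lerN2.
 exists t; first by move: th; rewrite in_itv /= => /andP[ht t0]; rewrite ltr0_norm // lerN2 ltW.
 by move: e; rewrite /phi x0 sub0r mulrN mulrC => /eqP; rewrite -[_ - _]opprB eqr_opp => /eqP.
- have [t th e] : exists2 t, t \in `]0, h[ & phi h - phi 0 = 'D_v f (x + t *: v) * (h - 0).
  apply: MVT => // [t|]; first rewrite in_itv /= => /andP[ht t0].
   by apply: dphi; rewrite !gtr0_norm // ltW.
  apply: cont_subT => t; rewrite inE /= in_itv /= => /andP[ht t0].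
  by apply: cphi; rewrite (gtr0_norm h0) ger0_norm.
 exists t; first by move: th; rewrite in_itv /= => /andP[ht t0]; rewrite gtr0_norm // ltW.
 by move: e; rewrite /phi x0 subr0 mulrC.
Qed.

(** Passing through the truncations from 0 to h changes one coordinate at a time, which turns
    increments of a function into telescoping sums of one-variable increments. *)
Definition trunc (k : nat) (h : V) : V := \row_i (if (i < k)%N then h ord0 i else 0).
Lemma trunc0 h : trunc 0 h = 0.
Proof. by apply/rowP => i; rewrite !mxE. Qed.
Lemma trunc_full h : trunc n h = h.
Proof. by apply/rowP => i; rewrite !mxE ltn_ord. Qed.
Lemma truncS (i : 'I_n) h : trunc i.+1 h = trunc i h + h ord0 i *: e_ i.
Proof.
apply/rowP => j; rewrite !mxE eqxx /= ltnS leq_eqVlt.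
by case: (eqVneq j i) => [->|ji]; rewrite ?eqxx ?ltnn ?mulr1 ?add0r //=
 ?(negbTE ji) ?mulr0 ?addr0 // (_ : (_ == _ :> nat) = false) //; apply/negbTE.
Qed.
Lemma normrV_le (v : V) c : 0 <= c -> (forall i, `|v ord0 i| <= c) -> `|v| <= c.
Proof.
move=> c0 vc; rewrite [leLHS]mx_normrE; apply/bigmax_leP; split => // -[i j] _ /=.
by rewrite (ord1 i).
Qed.
Lemma normrV_ge (v : V) i : `|v ord0 i| <= `|v|.
Proof.
rewrite [leRHS]mx_normrE.
exact: (@le_bigmax _ _ _ _ (fun ij : 'I_1 * 'I_n => `|v ij.1 ij.2|) (ord0, i)).
Qed.
Lemma normrV_mono (h v : V) : (forall i, `|v ord0 i| <= `|h ord0 i|) -> `|v| <= `|h|.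
Proof. by move=> vh; apply: normrV_le => // i; apply: le_trans (normrV_ge _ i). Qed.
Definition lin_form (c : 'I_n -> R) (v : V) : R := \sum_i v ord0 i * c i.

Fact lin_form_linear c : linear (lin_form c).
Proof.
move=> a u v; rewrite /lin_form scaler_sumr -big_split /=; apply: eq_bigr => i _.
by rewrite !mxE mulrDl -mulrA.
Qed.

HB.instance Definition _ c :=
 GRing.isLinear.Build R V R _ (lin_form c) (lin_form_linear c).

Lemma lin_form_cont c : continuous (lin_form c).
Proof.
move=> x; apply: differentiable_continuous.
have -> : lin_form c = \sum_i (fun v : V => v ord0 i * c i).
 by fext => v; rewrite /lin_form fct_sumE.
apply: differentiable_sum => i; apply: differentiableM => //.
exact: differentiable_coord.
Qed.
(** The increment telescopes along the truncations; each one-coordinate increment is a partial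
    derivative at a nearby point, close to the one at x by continuity. *)
Lemma C1_diff f x : (forall i, \forall y \near x, derivable f y (e_ i)) ->
 (forall i, {for x, continuous (pd i f)}) ->
 differentiable f x /\ forall v, 'd f x v = lin_form (fun i => pd i f x) v.
Proof.
move=> df cf; pose L := lin_form (fun i => pd i f x).
have H : f \o shift x = cst (f x) + L +o_ (0 : V) id.
 apply/eqaddoP => _/posnumP[eps].
 (* The n errors must add up to at most eps; dividing by n.+1 also covers dimension zero. *)
 have /filter_forall /nbhs_ballP[d /= d0 Hd] : forall i : 'I_n, \forall y \near x,
   derivable f y (e_ i) /\ `|pd i f y - pd i f x| <= eps%:num / n.+1%:R.
  move=> i; near=> y; split; first by near: y; exact: df.
  rewrite distrC; near: y; move/cvgrPdist_le : (cf i); apply.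
  by rewrite divr_gt0.
 near=> h => /=.
 have hd : `|h| < d by near: h; apply/nbhs_ballP; exists d => // y; rewrite -ball_normE /= sub0r normrN.
 rewrite [X in `|X|](_ : _ = f (x + h) - (f x + L h)); last by rewrite [x + h]addrC.
 have -> : f (x + h) - (f x + L h) =
  \sum_(i < n) (f (x + trunc i.+1 h) - f (x + trunc i h) - h ord0 i * pd i f x).
  rewrite big_split /= sumrN opprD addrA; congr (_ - _).
  rewrite -[X in _ = X](big_mkord xpredT (fun i => f (x + trunc i.+1 h) - f (x + trunc i h))).
  by rewrite telescope_sumr // trunc0 addr0 trunc_full.
 apply: le_trans (ler_norm_sum _ _ _) _.
 apply: (@le_trans _ _ (\sum_(i < n) (eps%:num / n.+1%:R * `|h|))); last first.
  rewrite sumr_const card_ord -[leLHS]mulr_natr [leLHS]mulrAC; apply: ler_wpM2r => //.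
  rewrite -mulrA ler_piMr //.
  by rewrite mulrC ler_pdivrMr // mul1r ler_nat.
 apply: ler_sum => i _.
 have bi (t : R) : `|t| <= `|h ord0 i| -> ball x d (x + trunc i h + t *: e_ i).
  move=> th; rewrite -ball_normE /ball_ /= opprD addrA opprD addrA subrr add0r -opprD normrN.
  apply: le_lt_trans hd; apply: normrV_mono => j; rewrite !mxE eqxx /=.
  case: (eqVneq j i) => [->|ji]; rewrite ?ltnn ?add0r ?mulr1 // mulr0 addr0.
  by case: ifP => //; rewrite normr0.
 rewrite truncS addrA.
 have [t /bi tb ->] : exists2 t : R, `|t| <= `|h ord0 i| &
   f (x + trunc i h + h ord0 i *: e_ i) - f (x + trunc i h) =
    h ord0 i * 'D_(e_ i) f (x + trunc i h + t *: e_ i).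
  apply: line_MVT => t th; exact: (Hd _ (bi _ th) i).1.
 rewrite -mulrBr normrM mulrC ler_pM //; last exact: normrV_ge.
 exact: (Hd _ tb i).2.
have E := @diff_unique _ V R f (lin_form (fun i => pd i f x)) x (@lin_form_cont _) H.
split=> [|v]; last by rewrite E.
apply/diff_locallyP; rewrite E; split=> //; exact: lin_form_cont.
Unshelve. all: end_near. Qed.

Lemma cont_coords (T : topologicalType) (Phi : T -> V) (x : T) :
 (forall j, {for x, continuous (fun t => Phi t ord0 j)}) -> {for x, continuous Phi}.
Proof.
move=> cP; apply/cvgrPdist_le => e e0.
have /filter_forall : forall j, \forall t \near x, `|Phi x ord0 j - Phi t ord0 j| <= e.
 by move=> j; move/cvgrPdist_le : (cP j); apply.
apply: filterS => t H; apply: normrV_le => [|i]; first exact: ltW.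
by rewrite !mxE.
Qed.
Lemma coord_cont j : continuous (fun v : V => v ord0 j).
Proof. by move=> v; apply: differentiable_continuous; exact: differentiable_coord. Qed.
Lemma diff_coords (Phi : V -> V) x :
 (forall j, differentiable (fun t => Phi t ord0 j) x) -> differentiable Phi x.
Proof.
move=> dP; have -> : Phi = \sum_j (fun t => Phi t ord0 j *: e_ j).
 by fext => t; rewrite fct_sumE [LHS]row_sum_delta.
by apply: differentiable_sum => j; apply: differentiableZl.
Qed.
Lemma Ck_le k l O f : (l <= k)%N -> Ck k O f -> Ck l O f.
Proof.
move=> lk; rewrite -(subnK lk); elim: (k - l)%N => // m IH.
by rewrite addSn => /CkS.
Qed.
Lemma Ck_sub k O W f : W `<=` O -> Ck k O f -> Ck k W f.
Proof.
move=> OW; elim: k f => [|k IH] f [cf df]; split=> //; first by move=> x /OW; exact: cf.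
 by move=> x /OW; exact: cf.
move=> i.
have [di Ci] := df i; split; last exact: IH.
by move=> x /OW; exact: di.
Qed.
Lemma Ck_local k O f :
 (forall x, O x -> exists W, [/\ open W, W x & Ck k W f]) -> Ck k O f.
Proof.
have cont k' g x : (forall x, O x -> exists W, [/\ open W, W x & Ck k' W g]) ->
  O x -> {for x, continuous g}.
 by move=> H /H [W [_ Wx Cg]]; exact: Ck_continuous Cg Wx.
elim: k f => [|k IH] f H.
 by split=> // x; exact: cont H.
split=> [x|i]; first exact: cont H.
split=> [x /H [W [ oW Wx [_ /(_ i)[+ _]]]]|]; first exact.
by apply: IH => x /H [W [ oW Wx [_ /(_ i)[_ C]]]]; exists W.
Qed.

Lemma sm_sub O W f : W `<=` O -> smooth_on O f -> smooth_on W f.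
Proof. by move=> OW sf k; apply: Ck_sub (sf k). Qed.
Lemma sm_local O f :
 (forall x, O x -> exists W, [/\ open W, W x & smooth_on W f]) -> smooth_on O f.
Proof. by move=> H k; apply: Ck_local => x /H [W [? ? /(_ k)]]; exists W. Qed.
Lemma sm_ext O f g : open O -> (forall x, O x -> f x = g x) ->
 smooth_on O f -> smooth_on O g.
Proof. by move=> oO fg sf k; apply: Ck_ext (sf k). Qed.
Lemma smooth_partial O f i : smooth_on O f -> smooth_on O (pd i f).
Proof. by move=> sf k; have [_ /(_ i)[]] := sf k.+1. Qed.
Lemma smooth_cont O f x : smooth_on O f -> O x -> {for x, continuous f}.
Proof. by move=> sf; apply: Ck_continuous (sf 0%N). Qed.
Lemma smooth_on_derivable O f x i : smooth_on O f -> O x -> derivable f x (e_ i).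
Proof. by move=> sf; have [_ /(_ i)[]] := sf 1%N => + _; apply. Qed.
Lemma Ck1_diff O f x : open O -> Ck 1 O f -> O x ->
 differentiable f x /\ forall v, 'd f x v = lin_form (fun i => pd i f x) v.
Proof.
move=> oO [cf df] Ox; apply: C1_diff => i; have [di [ci _]] := df i; last exact: ci.
by apply: filterS (open_nbhs_nbhs (conj oO Ox)) => y; exact: di.
Qed.
Lemma CkN k O f : open O -> Ck k O f -> Ck k O (- f).
Proof.
move=> oO Cf; have := CkM oO (Ck_cst k O (-1)) Cf.
by apply: Ck_ext => // x _; rewrite !fctE mulN1r.
Qed.
Lemma Ck_sum k O (I : Type) (r : seq I) (P : pred I) (F : I -> V -> R) : open O ->
 (forall i, P i -> Ck k O (F i)) -> Ck k O (\sum_(i <- r | P i) F i).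
Proof.
move=> oO CF; elim/big_ind: _ => // [|f g]; first exact: Ck_cst.
exact: CkD.
Qed.
Lemma Ck_prod k O (I : Type) (r : seq I) (P : pred I) (F : I -> V -> R) : open O ->
 (forall i, P i -> Ck k O (F i)) -> Ck k O (\prod_(i <- r | P i) F i).
Proof.
move=> oO CF; elim/big_ind: _ => // [|f g]; first exact: Ck_cst.
exact: CkM.
Qed.
Lemma pd_coord i j : pd i (fun v : V => v ord0 j) = cst (i == j)%:R.
Proof.
fext => x; have := derive_mx (@derivable_id _ V x (e_ i)).
rewrite derive_id => /matrixP/(_ ord0 j); rewrite !mxE eqxx /= => E.
by rewrite /pd [LHS](_ : _ = 'D_(e_ i) (fun t : V => id t ord0 j) x) // -E eq_sym.
Qed.
Lemma Ck_coord k O j : Ck k O (fun v : V => v ord0 j).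
Proof.
case: k => [|k]; (split; first by move=> x _; exact: coord_cont) => // i.
split=> [x _|]; last by rewrite pd_coord; apply: Ck_cst.
exact/diff_derivable/differentiable_coord.
Qed.
Lemma pd_comp O W f (Phi : V -> V) x i : open O -> open W ->
 (forall x, O x -> W (Phi x)) -> Ck 1 W f ->
 (forall j, Ck 1 O (fun x => Phi x ord0 j)) -> O x ->
 differentiable (f \o Phi) x /\ pd i (f \o Phi) x =
  \sum_j pd i (fun x => Phi x ord0 j) x * pd j f (Phi x).
Proof.
move=> oO oW OW Cf CP Ox.
have dP : differentiable Phi x by apply: diff_coords => j; case: (Ck1_diff oO (CP j) Ox).
have [df Ef] := Ck1_diff oW Cf (OW _ Ox).
have dfP : differentiable (f \o Phi) x by apply: differentiable_comp.
have E1 : pd i (f \o Phi) x = 'd (f \o Phi) x (e_ i) := deriveE _ dfP.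
split=> //; rewrite E1 (diff_comp dP df) [LHS]Ef -(deriveE (e_ i) dP).
have dv : derivable Phi x (e_ i) by exact: diff_derivable.
rewrite (derive_mx dv).
by rewrite /lin_form; apply: eq_bigr => j _; rewrite mxE.
Qed.

Lemma Ck_comp k O W f (Phi : V -> V) : open O -> open W ->
 (forall x, O x -> W (Phi x)) -> Ck k W f ->
 (forall j, Ck k O (fun x => Phi x ord0 j)) -> Ck k O (f \o Phi).
Proof.
move=> oO oW OW; elim: k f => [|k IH] f Cf CP.
all: have cc x : O x -> {for x, continuous (f \o Phi)}.
1,3: move=> Ox; apply: continuous_comp;
  [apply: cont_coords => j; exact: Ck_continuous (CP j) Ox
  |exact: Ck_continuous Cf (OW _ Ox)].
 by split.
have C1 := @Ck_le k.+1 1 _ _ isT.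
split=> // i; split=> [x Ox|].
 by apply: diff_derivable; case: (@pd_comp O W f Phi x i oO oW OW (C1 _ _ Cf) (fun j => C1 _ _ (CP j)) Ox).
apply: (@Ck_ext _ _ _ _ (\sum_j (pd i (fun x => Phi x ord0 j) * (pd j f \o Phi)))) => //.
 move=> x Ox; rewrite fct_sumE.
 by case: (@pd_comp O W f Phi x i oO oW OW (C1 _ _ Cf) (fun j => C1 _ _ (CP j)) Ox).
apply: Ck_sum => // j _; apply: CkM => //; first by have [_ /(_ i)[]] := CP j.
by apply: IH => [|l]; [have [_ /(_ j)[]] := Cf | exact/CkS].
Qed.

Lemma sm_comp O W f (Phi : V -> V) : open O -> open W ->
 (forall x, O x -> W (Phi x)) -> smooth_on W f ->
 (forall j, smooth_on O (fun x => Phi x ord0 j)) -> smooth_on O (f \o Phi).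
Proof. by move=> oO oW OW sf sP k; apply: Ck_comp oO oW OW (sf k) (fun j => sP j k). Qed.
(** A whole family is treated at once: when the derivative of each member is a combination of
    members, the induction on k closes up. It is used for inverse powers and for the flat
    functions. *)
Lemma Ck_comp1 k O (T : set R) f (e : nat -> R -> R) (c : nat -> nat -> R)
  (N : nat -> nat) :
 (forall m (t : R), T t -> is_derive t 1 (e m) (\sum_(l < N m) c m l * e l t)) ->
 open O -> (forall x, O x -> T (f x)) -> Ck k O f -> forall m, Ck k O (e m \o f).
Proof.
move=> de oO OT; elim: k => [|k IH] Cf m.
all: have [cf df] := Cf.
all: have cc x : O x -> {for x, continuous (e m \o f)}.
1,3: move=> Ox; apply: continuous_comp; [exact: cf|];
  apply: differentiable_continuous; apply/derivable1_diffP; by case: (de m _ (OT _ Ox)).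
 by split.
split=> // i; have [di Ci] := df i.
have Df x : O x -> differentiable f x.
 by move=> Ox; case: (Ck1_diff oO (@Ck_le k.+1 1 _ _ isT Cf) Ox).
have De x : O x -> differentiable (e m) (f x).
 by move=> Ox; apply/derivable1_diffP; case: (de m _ (OT _ Ox)).
have dd x : O x -> differentiable (e m \o f) x.
 by move=> Ox; apply: differentiable_comp; [exact: Df | exact: De].
split=> [x /dd|]; first exact: diff_derivable.
apply: (@Ck_ext _ _ _ _ (\sum_(l < N m) ((cst (c m l) * (e l \o f)) * pd i f))) => //.
 move=> x Ox.
 have -> : pd i (e m \o f) x = 'd (e m \o f) x (e_ i) := deriveE _ (dd _ Ox).
 rewrite (diff_comp (Df _ Ox) (De _ Ox)).
 rewrite [RHS](_ : _ = 'd (e m) (f x) ('d f x (e_ i))) // -(deriveE _ (Df _ Ox)).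
 rewrite diff1E; last exact: De.
 rewrite derive1E; have [_ ->] := de m _ (OT _ Ox).
 rewrite fct_sumE /GRing.scale /= mulr_sumr; apply: eq_bigr => l _.
 by rewrite !fctE mulrC.
apply: Ck_sum => // l _; apply: CkM => //; apply: CkM => //; first exact: Ck_cst.
by apply: IH; exact/CkS.
Qed.

Lemma is_der_exprV m (t : R) : t != 0 ->
 is_derive t 1 (fun t : R => t ^- m) (- m%:R * t ^- m.+1).
Proof.
move=> t0; have D : is_derive t 1 (fun t : R => t ^+ m) (m%:R * t ^+ m.-1).
 by split; [exact: exprn_derivable | rewrite exp_derive /GRing.scale /= mulr1].
have tm : t ^+ m != 0 by rewrite expf_neq0.
have dm : derivable (fun t : R => t ^+ m) t 1 by case: D.
split; first exact: derivableV.
rewrite deriveV // (@derive_val _ _ _ _ _ _ _ D).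
rewrite /GRing.scale /= !mulNr; congr (- _).
case: m tm {D dm} => [|m] tm; first by rewrite !mul0r mulr0.
rewrite /= mulrCA; congr (_ * _); rewrite -exprM.
have -> : (m.+1 * 2 = m.+2 + m)%N by lia.
by rewrite exprD invfM -mulrA mulVf ?mulr1 // expf_neq0.
Qed.

Lemma CkV k O f : open O -> (forall x, O x -> f x != 0) -> Ck k O f ->
 Ck k O (fun x => (f x)^-1).
Proof.
move=> oO f0 Cf; pose e m (t : R) := t ^- m.
pose c m l : R := if l == m.+1 then - m%:R else 0.
apply: (@Ck_ext _ _ _ _ (e 1%N \o f)) => //.
apply: (@Ck_comp1 k O [set t | t != 0] f e c (fun m => m.+2)) => // m t t0.
rewrite (bigD1 (Ordinal (ltnSn m.+1))) //= big1 ?addr0; last first.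
 move=> l /negP lm; rewrite /c ifF ?mul0r //; apply/negP => /eqP lm'.
 by apply: lm; apply/eqP/val_inj.
rewrite /c eqxx /e.
exact: is_der_exprV.
Qed.

Lemma sm_onV O f : open O -> (forall x, O x -> f x != 0) -> smooth_on O f ->
 smooth_on O (fun x => (f x)^-1).
Proof. by move=> oO f0 sf k; apply: CkV. Qed.
End Euclidean.

(** * Symmetry of second derivatives *)

Section Schwarz.
Variables (R : realType) (n : nat).
Local Notation V := 'rV[R]_n.
Local Notation e_ i := (delta_mx ord0 i : V).
Implicit Types (O : set V) (f : V -> R) (x y v : V).

Lemma delta_norm i : `|e_ i| <= 1.
Proof.
apply: normrV_le => // j; rewrite mxE eqxx /=.
by case: (j == i); rewrite ?normr1 ?normr0.
Qed.
Lemma near_close (T : topologicalType) (f : T -> R) (x : T) (e : R) :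
 {for x, continuous f} -> 0 < e -> \forall y \near x, `|f x - f y| <= e.
Proof. by move=> cf e0; move/cvgrPdist_le : cf; apply. Qed.
Lemma close_cont (T : topologicalType) (f : T -> R) (x : T) :
 (forall e : R, 0 < e -> \forall y \near x, `|f x - f y| <= e) -> {for x, continuous f}.
Proof. by move=> H; apply/cvgrPdist_le. Qed.
Lemma dist_half (a b c e : R) : `|a - b| <= e / 2 -> `|c - b| <= e / 2 -> `|a - c| <= e.
Proof.
move=> ab; rewrite distrC => cb; rewrite -(subrKA b) [e]splitr.
by apply: le_trans (ler_normD _ _) _; apply: lerD.
Qed.
Lemma der_translate f y v w : derivable f (y + v) w ->
 is_derive y w (fun y => f (y + v)) ('D_w f (y + v)).
Proof.
have E : (fun t => t^-1 *: (((fun y => f (y + v)) \o shift y) (t *: w) - f (y + v))) =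
  (fun t => t^-1 *: ((f \o shift (y + v)) (t *: w) - f (y + v))).
 by fext => t /=; rewrite /shift addrA.
by move=> D; split; [rewrite /derivable E | rewrite /derive E].
Qed.
(** Two applications of the mean value theorem. Since the second difference is symmetric in i and j,
    Schwarz's theorem follows by continuity of the mixed derivatives. *)
Lemma double_difference O f x d i j (h : R) : open O -> Ck 2 O f ->
 ball x d `<=` O -> `|h| *+ 2 < d ->
 exists y, ball x d y /\
  f (x + h *: e_ i + h *: e_ j) - f (x + h *: e_ i) - f (x + h *: e_ j) + f x =
  h * (h * pd j (pd i f) y).
Proof.
move=> oO C2 bO hd; have [cf df] := C2.
have inb (s t : R) : `|s| <= `|h| -> `|t| <= `|h| -> ball x d (x + s *: e_ i + t *: e_ j).
 move=> sh th; rewrite -ball_normE /ball_ /= -addrA opprD addrA subrr sub0r normrN.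
 apply: le_lt_trans hd; apply: le_trans (ler_normD _ _) _; rewrite mulr2n lerD // normrZ.
  by apply: le_trans sh; rewrite ler_piMr // delta_norm.
 by apply: le_trans th; rewrite ler_piMr // delta_norm.
pose phi y := f (y + h *: e_ j) - f y.
have di y : O y -> derivable f y (e_ i) by have [+ _] := df i; apply.
have dphi s : `|s| <= `|h| -> is_derive (x + s *: e_ i) (e_ i) phi
  (pd i f (x + s *: e_ i + h *: e_ j) - pd i f (x + s *: e_ i)).
 move=> sh.
 have D1 := di _ (bO _ (inb _ _ sh (lexx _))).
 have D0 : derivable f (x + s *: e_ i) (e_ i).
  by apply: di; apply: bO; have := inb s 0 sh; rewrite normr0 scale0r addr0; apply.
 have D2 := der_translate D1.
 exact: is_deriveB D2 (derivableP D0).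
have [s sh Es] : exists2 s : R, `|s| <= `|h| &
  phi (x + h *: e_ i) - phi x = h * 'D_(e_ i) phi (x + s *: e_ i).
 by apply: line_MVT => t /dphi [].
have [_ /(_ j)[dij _]] := (df i).2.
have [t th Et] : exists2 t : R, `|t| <= `|h| &
  pd i f (x + s *: e_ i + h *: e_ j) - pd i f (x + s *: e_ i) =
  h * 'D_(e_ j) (pd i f) (x + s *: e_ i + t *: e_ j).
 apply: line_MVT => t th; apply: dij; apply: bO; exact: inb.
exists (x + s *: e_ i + t *: e_ j); split; first exact: inb.
move: Es; rewrite (@derive_val _ _ _ _ _ _ _ (dphi _ sh)) Et => <-.
by rewrite /phi; ring.
Qed.

Lemma Schwarz O f x i j : open O -> Ck 2 O f -> O x ->
 pd i (pd j f) x = pd j (pd i f) x.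
Proof.
move=> oO C2 Ox; apply/eqP; rewrite -subr_eq0 -normr_le0; apply/ler_addgt0Pl => e e0.
rewrite addr0.
have cont a b : {for x, continuous (pd a (pd b f))}.
 by have [_ /(_ b)[_ [_ /(_ a)[_ [+ _]]]]] := C2; apply.
have /nbhs_ballP[d /= d0 Hd] : \forall y \near x, [/\ O y,
  `|pd i (pd j f) x - pd i (pd j f) y| <= e / 2 &
  `|pd j (pd i f) x - pd j (pd i f) y| <= e / 2].
 have e2 : 0 < e / 2 by rewrite divr_gt0.
 have H1 := near_close (cont i j) e2; have H2 := near_close (cont j i) e2.
 have H0 := open_nbhs_nbhs (conj oO Ox).
 by apply: filterS3 H0 H1 H2 => y.
have h0 : 0 < d / 4 by rewrite divr_gt0.
have hd : `|d / 4| *+ 2 < d by rewrite gtr0_norm // mulr2n; lra.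
have bO : ball x d `<=` O by move=> y /Hd[].
have [y [/Hd[_ _ y2] Ey]] := double_difference i j oO C2 bO hd.
have [z [/Hd[_ z1 _] Ez]] := double_difference j i oO C2 bO hd.
move: y2 Ey; move: (pd j (pd i f) y) => Y y2 Ey.
move: z1 Ez; move: (pd i (pd j f) z) => Z z1 Ez.
suff YZ : Y = Z by rewrite YZ in y2; exact: dist_half z1 y2.
apply: (mulfI (lt0r_neq0 h0)); apply: (mulfI (lt0r_neq0 h0)); rewrite -Ey -Ez.
rewrite [x + _ *: e_ i + _]addrAC; congr (_ + _); exact: addrAC.
Qed.
End Schwarz.

(** * Flat functions and bump functions *)

Section Bump.
Variable R : realType.

(** [flat 0] is the usual exp(-1/t); the powers t^-m make the family closed under differentiation,
    as [Ck_comp1] requires. *)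
Definition flat (m : nat) (t : R) : R := if 0 < t then t ^- m * expR (- t^-1) else 0.
Lemma flat_ge0 m t : 0 <= flat m t.
Proof.
rewrite /flat; case: ifP => // t0.
by rewrite mulr_ge0 ?expR_ge0 // invr_ge0 exprn_ge0 // ltW.
Qed.
Lemma flat_gt0 m t : 0 < t -> 0 < flat m t.
Proof. by move=> t0; rewrite /flat t0 mulr_gt0 ?expR_gt0 // invr_gt0 exprn_gt0. Qed.
Lemma flat_le0 m t : t <= 0 -> flat m t = 0.
Proof. by rewrite /flat leNgt => /negbTE ->. Qed.
(** This is y <= exp(y) at y = 1 / ((m + 1) t), raised to the power m + 1. *)
Lemma flat_small m t : 0 <= t -> flat m t <= m.+1%:R ^+ m.+1 * t.
Proof.
rewrite le_eqVlt => /predU1P[<-|t0]; first by rewrite flat_le0 // mulr0.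
rewrite /flat t0 expRN -lter_pdivlMl; last by rewrite invr_gt0 exprn_gt0.
rewrite invrK -[X in _ <= X]invrK lef_pV2; last 2 first.
- by rewrite posrE expR_gt0.
- by rewrite posrE invr_gt0 !mulr_gt0 ?exprn_gt0.
rewrite mulrCA -exprSr -exprMn -exprVn.
have -> : t^-1 = m.+1%:R * (m.+1%:R * t)^-1.
 by rewrite invfM mulrA divff ?mul1r // pnatr_eq0.
rewrite expRM_natl lerXn2r ?nnegrE ?expR_ge0 ?invr_ge0 ?mulr_ge0 ?(ltW t0) //.
by apply: le_trans (expR_ge1Dx _); rewrite lerDr.
Qed.

Lemma flat_der m (t : R) : is_derive t 1 (flat m) (- m%:R * flat m.+1 t + flat m.+2 t).
Proof.
case: (ltrgt0P t) => [t0|t0|->].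
- apply: (@near_eq_is_derive R R R (fun s : R => s ^- m * expR (- s^-1))).
  by near=> s; rewrite /flat ifT //; near: s; exact: lt_nbhsr.
 have t1 := lt0r_neq0 t0.
 have D1 := is_der_exprV m t1.
 have D2 : is_derive t 1 (fun s : R => - s^-1) (t ^- 2).
  have := is_deriveN (@is_deriveV _ (@id R) t 1 1 t1 (is_derive_id _ _)).
  by rewrite scaleNr opprK /GRing.scale /= mulr1.
 have D3 := @is_derive1_comp _ expR (fun s : R => - s^-1) t _ _ (is_derive_expR _) D2.
 apply: (@is_derive_eq _ _ _ _ _ _ _ _ (is_deriveM D1 D3)).
 rewrite /flat t0 /GRing.scale /= addrC; congr (_ + _).
  by rewrite mulrC mulrA.
 by rewrite mulrA mulrAC -invfM -exprD addn2.
- apply: (@near_eq_is_derive R R R (cst 0)).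
  by near=> s; rewrite flat_le0 // ltW //; near: s; exact: lt_nbhsl.
 by rewrite !flat_le0 ?ltW // mulr0 addr0; exact: is_derive_cst.
rewrite !flat_le0 // mulr0 addr0.
suff H : (fun h => h^-1 *: ((flat m \o shift 0) (h *: 1) - flat m 0)) @ 0^' --> (0 : R).
 by split; [apply/cvg_ex; exists 0 | apply/cvg_lim].
apply/cvgr0Pnorm_le => e e0; pose C : R := m.+2%:R ^+ m.+2.
have C0 : 0 < C by rewrite exprn_gt0.
near=> h => /=; rewrite (@flat_le0 m 0) // subr0 addr0 [h%:A]mulr1.
have -> : `|h^-1 *: flat m h| = flat m.+1 h.
 rewrite /flat; case: ifPn => h0; last by rewrite scaler0 normr0.
 rewrite /GRing.scale /= ger0_norm; last first.
  by rewrite !mulr_ge0 ?expR_ge0 ?invr_ge0 ?exprn_ge0 // ltW.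
 by rewrite mulrA -invfM -exprS.
have [h0|h0] := lerP h 0; first by rewrite flat_le0 // ltW.
apply: le_trans (flat_small _ (ltW h0)) _.
rewrite mulrC -ler_pdivlMr //; apply: le_trans (ler_norm _) _.
near: h; apply: dnbhs0_le; exact: divr_gt0.
Unshelve. all: end_near. Qed.

Lemma Ck_flat n k (O : set 'rV[R]_n) f m : open O -> Ck k O f -> Ck k O (flat m \o f).
Proof.
move=> oO; pose c m l : R := if l == m.+1 then - m%:R else if l == m.+2 then 1 else 0.
move=> Cf; apply: (@Ck_comp1 R n k O setT f flat c (fun m => m.+3)) => // {}m t _.
apply: (@is_derive_eq _ _ _ _ _ _ _ _ (flat_der m t)).
rewrite !big_ord_recr /= big1 ?add0r => [|l _]; last first.
 by rewrite /c ifF ?ifF ?mul0r //; apply/negbTE; rewrite neq_ltn ltnS ltnW ?ltn_ord //;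
   rewrite ltnS ltnW.
have [E1 [E2 E3]] : (m == m.+1) = false /\ (m == m.+2) = false /\ (m.+2 == m.+1) = false by lia.
by rewrite /c !eqxx E1 E2 E3 mul0r add0r mul1r.
Qed.

Definition step (t : R) : R := flat 0 t / (flat 0 t + flat 0 (1 - t)).
Lemma step_den t : 0 < flat 0 t + flat 0 (1 - t).
Proof.
have [t0|t0] := lerP t 0; last by rewrite ltr_pwDl ?flat_gt0 ?flat_ge0.
by rewrite ltr_wpDl ?flat_ge0 // flat_gt0 // subr_gt0; lra.
Qed.
Lemma step0 t : t <= 0 -> step t = 0.
Proof. by move=> t0; rewrite /step flat_le0 // mul0r. Qed.
Lemma step1 t : 1 <= t -> step t = 1.
Proof.
move=> t1; rewrite /step (@flat_le0 _ (1 - t)) ?subr_le0 // addr0 divff //.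
by rewrite lt0r_neq0 // flat_gt0 // (lt_le_trans _ t1).
Qed.
Lemma Ck_step n k (O : set 'rV[R]_n) f : open O -> Ck k O f -> Ck k O (step \o f).
Proof.
move=> oO Cf; apply: CkM => //; first exact: Ck_flat.
apply: (@CkV R n k O (fun x => flat 0 (f x) + flat 0 (1 - f x))) => //.
 by move=> x _; rewrite lt0r_neq0 ?step_den.
apply: CkD => //; first exact: Ck_flat.
apply: (@Ck_flat n k O (fun x => 1 - f x)) => //.
by apply: CkD => //; [exact: Ck_cst | exact: CkN].
Qed.
Lemma bump n (p : 'rV[R]_n) (r : R) : 0 < r -> exists chi : 'rV[R]_n -> R,
 [/\ smooth_on setT chi, forall x, `|x - p| <= r -> chi x = 1 &
   forall x, r *+ 2 <= `|x - p| -> chi x = 0].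
Proof.
(* [q i] is at least 1 where |x_i - p_i| <= r and at most -2 where |x_i - p_i| >= 2 r. *)
move=> r0; pose q i (x : 'rV[R]_n) : R := 2 - ((x ord0 i - p ord0 i) / r) ^+ 2.
exists (\prod_i (step \o q i)); split=> [k|x xp|x xp].
- apply: Ck_prod => [|i _]; first exact: openT.
 apply: Ck_step; first exact: openT.
 have C1 : Ck k setT (fun x : 'rV[R]_n => (x ord0 i - p ord0 i) / r).
  apply: CkM (Ck_cst _ _ _) => //; first exact: openT.
  by apply: CkD (Ck_cst _ _ _) => //; [exact: openT | exact: Ck_coord].
 apply: CkD; [exact: openT | exact: Ck_cst|].
 by apply: CkN; [exact: openT | apply: CkM => //; exact: openT].
- rewrite fct_prodE big1 // => i _ /=; apply: step1; rewrite /q.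
 have : `|(x ord0 i - p ord0 i) / r| <= 1.
  rewrite normrM normfV (gtr0_norm r0) ler_pdivrMr // mul1r.
  by apply: le_trans xp; have := normrV_ge (x - p) i; rewrite !mxE.
 move=> H; have : ((x ord0 i - p ord0 i) / r) ^+ 2 <= 1.
  by rewrite -real_normK ?num_real // expr_le1.
 by lra.
have [i xi] : exists i, r *+ 2 <= `|x ord0 i - p ord0 i|.
 apply: contrapT => /forallNP H.
 suff : `|x - p| < r *+ 2 by rewrite ltNge xp.
 rewrite [ltLHS]mx_normrE; apply/bigmax_ltP; split; first by rewrite mulr2n addr_gt0.
 by move=> [a j] _ /=; rewrite (ord1 a) !mxE ltNge; apply/negP/H.
rewrite fct_prodE (bigD1 i) //= step0 ?mul0r // /q.
have : 2 <= `|(x ord0 i - p ord0 i) / r|.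
 by rewrite normrM normfV (gtr0_norm r0) ler_pdivlMr // mulr_natl.
rewrite -real_normK ?num_real //; move: `|_| => y y2.
have : 2 * 2 <= y * y by apply: ler_pM.
by rewrite -expr2; lra.
Qed.

Lemma Ck_cutoff n (k : nat) (O : set 'rV[R]_n) (chi f : 'rV[R]_n -> R) (K : set 'rV[R]_n) :
 open O -> closed K -> K `<=` O -> (forall x, ~ K x -> chi x = 0) ->
 Ck k setT chi -> Ck k O f -> Ck k setT (chi * f).
Proof.
move=> oO cK KO chi0 Cchi Cf; apply: Ck_local => x _.
case: (pselect (K x)) => Kx.
 exists O; split=> //; first exact: KO.
 by apply: CkM => //; apply: Ck_sub Cchi.
exists (~` K); split=> //; first exact: closed_openC.
apply: (@Ck_ext _ _ _ _ (cst 0)); [exact: closed_openC | | exact: Ck_cst].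
by move=> y /chi0 E; rewrite !fctE E mul0r.
Qed.
End Bump.

(** * Quotients by coordinates *)

Section Division.
Variables (R : realType) (n : nat).
Local Notation V := 'rV[R]_n.
Local Notation e_ i := (delta_mx ord0 i : V).
Implicit Types (O : set V) (f g N M : V -> R) (x y v : V).

Lemma line_MVT0 f x v (h : R) : h != 0 -> {for x, continuous f} ->
 (forall t : R, t != 0 -> `|t| <= `|h| -> derivable f (x + t *: v) v) ->
 exists t : R, [/\ t != 0, `|t| <= `|h| &
  f (x + h *: v) - f x = h * 'D_v f (x + t *: v)].
Proof.
move=> h0 cf df; pose phi (t : R) := f (x + t *: v).
have dphi (t : R) : t != 0 -> `|t| <= `|h| -> is_derive t 1 phi ('D_v f (x + t *: v)).
 by move=> t0 /(df _ t0); exact: drv_line.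
have x0 : x + 0 *: v = x by rewrite scale0r addr0.
have cphi (t : R) : `|t| <= `|h| -> {for t, continuous phi}.
 have [-> _|t0 th] := eqVneq t 0.
  apply: continuous_comp; last by rewrite /= x0.
  apply: continuousD; first exact: cst_continuous.
  exact: scalel_continuous.
 apply: differentiable_continuous; apply/derivable1_diffP.
 by have [] := dphi _ t0 th.
case: (ltrgt0P h) h0 => [h0 _|h0 _|//].
- have [t th e] : exists2 t, t \in `]0, h[ & phi h - phi 0 = 'D_v f (x + t *: v) * (h - 0).
  apply: MVT => // [t|]; first rewrite in_itv /= => /andP[t0 ht].
   by apply: dphi; rewrite ?(lt0r_neq0 t0) // !gtr0_norm // ltW.
  apply: cont_subT => t; rewrite inE /= in_itv /= => /andP[ht t0].
  by apply: cphi; rewrite (gtr0_norm h0) ger0_norm.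
 move: th; rewrite in_itv /= => /andP[t0 ht].
 exists t; split; [by rewrite lt0r_neq0 | by rewrite gtr0_norm // ltW|].
 by move: e; rewrite /phi x0 subr0 mulrC.
have [t th e] : exists2 t, t \in `]h, 0[ & phi 0 - phi h = 'D_v f (x + t *: v) * (0 - h).
 apply: MVT => // [t|]; first rewrite in_itv /= => /andP[ht t0].
  by apply: dphi; rewrite ?ltr0_neq0 // !ltr0_norm // lerN2 ltW.
 apply: cont_subT => t; rewrite inE /= in_itv /= => /andP[ht t0].
 by apply: cphi; rewrite (ltr0_norm h0) ler0_norm // lerN2.
move: th; rewrite in_itv /= => /andP[ht t0].
exists t; split; [by rewrite ltr0_neq0 | by rewrite ltr0_norm // lerN2 ltW|].
by move: e; rewrite /phi x0 sub0r mulrN mulrC => /eqP; rewrite -[_ - _]opprB eqr_opp => /eqP.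
Qed.

Lemma is_der_val f x v (a b : R) : is_derive x v f a -> a = b -> is_derive x v f b.
Proof. by move=> D <-. Qed.
Lemma cont_shrink f x v : {for x, continuous f} -> forall e : R, 0 < e ->
 exists2 d : R, 0 < d & forall t : R, `|t| <= d -> `|f x - f (x + t *: v)| <= e.
Proof.
move=> cf e e0; have : {for 0, continuous (fun t : R => f (x + t *: v))}.
 apply: continuous_comp; last by rewrite /= scale0r addr0.
 by apply: continuousD; [exact: cst_continuous | exact: scalel_continuous].
move=> /near_close/(_ e0)/nbhs_ballP[d /= d0 H]; exists (d / 2); first by rewrite divr_gt0.
move=> t td; have := H t; rewrite /= scale0r addr0; apply.
by rewrite -ball_normE /= sub0r normrN (le_lt_trans td) // ltr_pdivrMr // ltr_pMr // ltr1n.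
Qed.
(** By the mean value theorem the difference quotient at x is a value of g close to x. This extends
    derivative formulas across the zeros of a denominator. *)
Lemma der_limit f g x v : {for x, continuous f} -> {for x, continuous g} ->
 (forall t : R, t != 0 -> is_derive (x + t *: v) v f (g (x + t *: v))) ->
 is_derive x v f (g x).
Proof.
move=> cf cg df.
suff H : (fun h => h^-1 *: ((f \o shift x) (h *: v) - f x)) @ 0^' --> (g x : R).
 by split; [apply/cvg_ex; exists (g x) | apply/cvg_lim].
apply/cvgrPdist_le => e /(cont_shrink v cg) [d d0 H].
near=> h => /=.
have h0 : h != 0 by near: h; exact: nbhs_dnbhs_neq.
have hd : `|h| <= d by near: h; exact: dnbhs0_le.
have [t t0 th] : exists2 t : R, `|t| <= `|h| & f (x + h *: v) - f x = h * g (x + t *: v).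
 have df' (t : R) : t != 0 -> `|t| <= `|h| -> derivable f (x + t *: v) v.
  by move=> t0 _; case: (df t t0).
 have [t [t0 th E]] := line_MVT0 h0 cf df'.
 by exists t => //; rewrite E; congr (_ * _); case: (df t t0).
rewrite /shift /= [h *: v + x]addrC th /GRing.scale /= mulKf //; apply: H.
exact: le_trans t0 hd.
Unshelve. all: end_near. Qed.

(* [N / x_i ^ m.+1] where [partial i N = x_i ^ m * M] and [N = 0] on [x_i = 0]. *)
Definition quot i m N M : V -> R := fun x =>
 if x ord0 i == 0 then M x / m.+1%:R else N x / x ord0 i ^+ m.+1.
Lemma coordD x j (t : R) i : (x + t *: e_ j) ord0 i = x ord0 i + t * (i == j)%:R.
Proof. by rewrite !mxE eqxx. Qed.
Lemma near_coord_neq0 x i : x ord0 i != 0 -> \forall y \near x, (y : V) ord0 i != 0.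
Proof.
move=> x0; have := @coord_cont R n i x.
move/(_ [set t | t != 0]); apply; apply: open_nbhs_nbhs; split=> //.
Qed.
Lemma is_der_coordX x i j m : is_derive x (e_ j) (fun y : V => y ord0 i ^+ m)
  (m%:R * x ord0 i ^+ m.-1 * (i == j)%:R).
Proof.
have D : is_derive x (e_ j) (fun y : V => y ord0 i) (i == j)%:R.
 have [d _] : derivable (fun y : V => y ord0 i) x (e_ j) /\ True.
  by split=> //; apply/diff_derivable/differentiable_coord.
 by split=> //; have := congr1 (@^~ x) (@pd_coord R n j i); rewrite /pd eq_sym.
have -> : (fun y : V => y ord0 i ^+ m) = (fun y : V => y ord0 i) ^+ m.
 by fext => y; elim: m => [|m IH]; rewrite ?expr0 // !exprS IH.
apply: (@is_derive_eq _ _ _ _ _ _ _ _ (is_deriveX m D)).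
by rewrite /GRing.scale /=.
Qed.

Lemma quot_der_neq0 i m N M x j : x ord0 i != 0 -> derivable N x (e_ j) ->
 is_derive x (e_ j) (quot i m N M)
  (pd j N x / x ord0 i ^+ m.+1 - (i == j)%:R * (m.+1%:R * N x / x ord0 i ^+ m.+2)).
Proof.
move=> x0 dN; apply: (@near_eq_is_derive R V R (fun y : V => N y * (y ord0 i ^+ m.+1)^-1)).
 by apply: filterS (near_coord_neq0 x0) => y y0; rewrite /quot (negbTE y0).
have xm k : x ord0 i ^+ k != 0 by rewrite expf_neq0.
have [dX eX] := is_der_coordX x i j m.+1.
pose X (y : V) := y ord0 i ^+ m.+1.
have dV := @derivableV _ _ X x (e_ j) (xm m.+1) dX.
pose W (y : V) := (X y)^-1.
split; first exact: (@derivableM _ _ N W x (e_ j) dN dV).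
rewrite [LHS](@deriveM _ _ N W x (e_ j) dN dV) (@deriveV _ _ X x (e_ j) (xm _) dX) eX.
rewrite /GRing.scale /= /pd addrC; congr (_ + _); first by rewrite mulrC.
rewrite mulNr mulrN; congr (- _).
have -> : X x ^- 2 = (x ord0 i ^+ m)^-1 * x ord0 i ^- m.+2.
 by rewrite -invfM -exprM -exprD; congr (_ ^- _); lia.
by move: (N x) (i == j)%:R => a c; field; rewrite !xm.
Qed.

Lemma quot_der_eq0 i m N M x j : x ord0 i = 0 -> j != i -> derivable M x (e_ j) ->
 is_derive x (e_ j) (quot i m N M) (pd j M x / m.+1%:R).
Proof.
move=> x0 ji dM; have E : (fun h => h^-1 *: ((quot i m N M \o shift x) (h *: e_ j) - quot i m N M x))
  = (fun h => h^-1 *: (((m.+1%:R^-1 \*: M) \o shift x) (h *: e_ j) - (m.+1%:R^-1 \*: M) x)).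
 fext => h /=; congr (_ *: (_ - _)); rewrite /quot.
  by rewrite /shift /= addrC coordD x0 add0r (negbTE (_ : i != j)) ?mulr0 1?eq_sym // eqxx mulrC.
 by rewrite x0 eqxx mulrC.
have [dZ eZ] : is_derive x (e_ j) (m.+1%:R^-1 \*: M) (pd j M x / m.+1%:R).
 apply: (@is_derive_eq _ _ _ _ _ _ _ _ (is_deriveZ m.+1%:R^-1 (derivableP dM))).
 by rewrite /GRing.scale /= mulrC.
by split; [rewrite /derivable E | rewrite /derive E].
Qed.

Lemma sderive f : smooth_on setT f ->
 forall y i, is_derive y (e_ i) f (pd i f y).
Proof. by move=> sf y i; apply: derivableP; exact: smooth_on_derivable sf Logic.I. Qed.
Lemma smooth_derivable f : smooth_on setT f -> forall y i, derivable f y (e_ i).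
Proof. by move=> sf y i; case: (sderive sf y i). Qed.
Lemma open_coord_neq0 i : open [set y : V | y ord0 i != 0].
Proof.
rewrite openE => x /= x0; exact: near_coord_neq0.
Qed.
Lemma Ck_coordX k O i m : open O -> Ck k O (fun y : V => y ord0 i ^+ m).
Proof.
move=> oO; elim: m => [|m IH].
 by apply: (@Ck_ext _ _ _ _ (cst 1)) (Ck_cst _ _ _) => // x _; rewrite expr0.
apply: (@Ck_ext _ _ _ _ ((fun y : V => y ord0 i) * (fun y : V => y ord0 i ^+ m))) => //.
 by move=> x _; rewrite exprS.
by apply: CkM => //; exact: Ck_coord.
Qed.
Lemma quot_sm_off i m N M : smooth_on setT N ->
 smooth_on [set y : V | y ord0 i != 0] (quot i m N M).
Proof.
move=> sN k; have oO := @open_coord_neq0 i.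
apply: (@Ck_ext _ _ _ _ (N * (fun y : V => (y ord0 i ^+ m.+1)^-1))) => //.
 by move=> x x0; rewrite /quot (negbTE x0).
apply: CkM => //; first exact: Ck_sub (sN k).
by apply: CkV => // [x x0|]; [rewrite expf_neq0 | exact: Ck_coordX].
Qed.
Lemma quot_mean i m N M x : smooth_on setT N ->
 (forall x, x ord0 i = 0 -> N x = 0) ->
 (forall x, pd i N x = x ord0 i ^+ m * M x) ->
 exists t : R, `|t| <= `|x ord0 i| /\
  quot i m N M x = M (x - x ord0 i *: e_ i + t *: e_ i) / m.+1%:R.
Proof.
move=> sN N0 dN; set h := x ord0 i; set z := x - h *: e_ i.
have zi : z ord0 i = 0 by rewrite !mxE eqxx eqxx mulr1 subrr.
have [h0|h0] := eqVneq h 0.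
 exists 0; split; first by rewrite normr0.
 by rewrite /quot -/h h0 eqxx /z h0 !scale0r subr0 addr0.
pose psi y : R := N y * h ^+ m.+1 - N x * y ord0 i ^+ m.+1.
have dpsi y : is_derive y (e_ i) psi
  (h ^+ m.+1 * pd i N y - N x * (m.+1%:R * y ord0 i ^+ m)).
 have D0 := sderive sN y i.
 have D1 := is_deriveM D0 (is_derive_cst (h ^+ m.+1) y (e_ i)).
 have D2 := is_deriveM (is_derive_cst (N x) y (e_ i)) (is_der_coordX y i i m.+1).
 apply: (@is_derive_eq _ _ _ _ _ _ _ _ (is_deriveB D1 D2)).
 by rewrite !scaler0 add0r addr0 eqxx mulr1.
have cpsi : {for z, continuous psi}.
 have C : Ck 0 setT psi.
  apply: (@CkD _ _ _ _ (N * cst (h ^+ m.+1)) (- (cst (N x) * (fun y : V => y ord0 i ^+ m.+1))));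
   [exact: openT| |].
   apply: CkM; [exact: openT | exact: sN | exact: Ck_cst].
  apply: CkN; first exact: openT.
  by apply: CkM; [exact: openT | exact: Ck_cst | apply: Ck_coordX; exact: openT].
 exact: Ck_continuous C Logic.I.
have dd (t : R) : t != 0 -> `|t| <= `|h| -> derivable psi (z + t *: e_ i) (e_ i).
 by move=> _ _; case: (dpsi (z + t *: e_ i)).
have [t [t0 th E]] := line_MVT0 h0 cpsi dd.
exists t; split=> //.
move: E; rewrite (@derive_val _ _ _ _ _ _ _ (dpsi _)) /z subrK -/z /psi -/h.
rewrite (N0 _ zi) zi subrr expr0n mulr0 mul0r subr0 coordD zi eqxx mulr1 add0r dN coordD zi eqxx mulr1 add0r.
move/esym/eqP; rewrite oppr0 mulf_eq0 (negbTE h0) /= => /eqP E.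
rewrite /quot -/h (negbTE h0).
have tm : t ^+ m != 0 by rewrite expf_neq0.
have hm : h ^+ m.+1 != 0 by rewrite expf_neq0.
have mn : m.+1%:R != 0 :> R by rewrite pnatr_eq0.
apply: (mulfI tm); apply: (mulfI hm); apply: (mulfI mn).
move/eqP: E; rewrite subr_eq0 => /eqP E.
transitivity (N x * (m.+1%:R * t ^+ m)); first by field; rewrite hm.
by rewrite -E; field.
Qed.

Lemma quot_cont i m N M : smooth_on setT N -> smooth_on setT M ->
 (forall x, x ord0 i = 0 -> N x = 0) ->
 (forall x, pd i N x = x ord0 i ^+ m * M x) -> continuous (quot i m N M).
Proof.
move=> sN sM N0 dN; suff H (x : V) : {for x, continuous (quot i m N M)} by move=> x; exact: H.
have [x0|x0] := eqVneq (x ord0 i) 0; last first.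
 exact: smooth_cont (quot_sm_off i m M sN) x0.
apply: close_cont => e e0.
have cM := smooth_cont sM (Logic.I : setT x).
have /nbhs_ballP[d /= d0 H] := near_close cM e0.
near=> y.
have [t [ty ->]] := quot_mean y sN N0 dN.
rewrite /quot x0 eqxx -mulrBl normrM normfV.
have -> : `|m.+1%:R : R| = m.+1%:R by rewrite normr_nat.
rewrite ler_pdivrMr //; apply: (@le_trans _ _ e); last by rewrite ler_peMr ?ler1n // ltW.
apply: H; have : `|x - y| < d by near: y; apply/nbhs_ballP; exists d => // y; rewrite -ball_normE.
rewrite -ball_normE /ball_ /=; apply: le_lt_trans.
apply: normrV_mono => j; rewrite !mxE eqxx /=.
case: (eqVneq j i) => [->|ji]; last by rewrite !mulr0 subr0 addr0.
by rewrite !mulr1 subrr add0r x0 !sub0r !normrN.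
Unshelve. all: end_near. Qed.

(** Every partial derivative of such a quotient is again one: in direction i the exponent becomes m
    + 1 and N becomes x_i^(m+1) M - (m+1) N, with the i-th derivative of M; in another direction N
    and M are both differentiated. So continuity of all such quotients gives C^k by induction. *)
Lemma quot_Ck k i m N M : smooth_on setT N -> smooth_on setT M ->
 (forall x, x ord0 i = 0 -> N x = 0) ->
 (forall x, pd i N x = x ord0 i ^+ m * M x) -> Ck k setT (quot i m N M).
Proof.
elim: k m N M => [|k IH] m N M sN sM N0 dN.
 by split=> // x _; exact: quot_cont.
have cq := quot_cont sN sM N0 dN.
split=> [x _|j]; first exact: cq.
have [->|ji] := eqVneq j i.
 pose N' x := x ord0 i ^+ m.+1 * M x - m.+1%:R * N x.
 have sN' : smooth_on setT N'.
  move=> l; apply: (@CkD _ _ _ _ ((fun y : V => y ord0 i ^+ m.+1) * M) (- (cst m.+1%:R * N)));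
   [exact: openT| |].
   by apply: CkM; [exact: openT | apply: Ck_coordX; exact: openT | exact: sM].
  by apply: CkN; [exact: openT | apply: CkM; [exact: openT | exact: Ck_cst | exact: sN]].
 have N'0 x : x ord0 i = 0 -> N' x = 0.
  by move=> x0; rewrite /N' x0 N0 // expr0n mul0r mulr0 subr0.
 have dN' x : pd i N' x = x ord0 i ^+ m.+1 * pd i M x.
  have D0 := sderive sN x i.
  have D1 := sderive sM x i.
  have D2 := is_deriveM (is_der_coordX x i i m.+1) D1.
  have D3 := is_deriveM (is_derive_cst (m.+1%:R : R) x (e_ i)) D0.
  rewrite /pd (@derive_val _ _ _ _ _ _ _ (is_deriveB D2 D3)).
  rewrite scaler0 addr0 eqxx mulr1.
  move: (dN x); rewrite /pd => ->.
  by rewrite /GRing.scale /=; ring.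
 have sM' := smooth_partial i sM.
 have D x : is_derive x (e_ i) (quot i m N M) (quot i m.+1 N' (pd i M) x).
  have off y : y ord0 i != 0 ->
   is_derive y (e_ i) (quot i m N M) (quot i m.+1 N' (pd i M) y).
   move=> y0; apply: (is_der_val (@quot_der_neq0 i m N M y i y0 (@smooth_derivable _ sN _ _)));
    rewrite /quot (negbTE y0) eqxx mul1r dN /N'.
   by rewrite !exprS; field; rewrite y0 expf_neq0.
  have [x0|] := eqVneq (x ord0 i) 0; last exact: off.
  apply: der_limit; first exact: cq.
   exact: quot_cont.
  by move=> t t0; apply: off; rewrite coordD x0 eqxx mulr1 add0r.
 split=> [x _|]; first by case: (D x).
 have -> : pd i (quot i m N M) = quot i m.+1 N' (pd i M).
  by fext => x; case: (D x).
 exact: IH.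
have sNj := smooth_partial j sN; have sMj := smooth_partial j sM.
have Nj0 x : x ord0 i = 0 -> pd j N x = 0.
 move=> x0; have [_ <-] := is_derive_cst (0 : R) x (e_ j).
 have E : (fun h : R => h^-1 *: ((N \o shift x) (h *: e_ j) - N x)) =
  (fun h : R => h^-1 *: ((cst (0 : R) \o shift x) (h *: e_ j) - cst (0 : R) x)).
  fext => h /=; rewrite !N0 //.
  by rewrite /shift /= addrC coordD x0 (negbTE (_ : i != j)) ?mulr0 ?addr0 // eq_sym.
 by rewrite /pd /derive E.
have dNj x : pd i (pd j N) x = x ord0 i ^+ m * pd j M x.
 rewrite (@Schwarz _ _ setT N x i j openT (sN 2) Logic.I).
 have -> : pd i N = (fun y : V => y ord0 i ^+ m) * M by fext => y; exact: dN.
 have D1 := sderive sM x j.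
 rewrite {1}/pd (@derive_val _ _ _ _ _ _ _ (is_deriveM (is_der_coordX x i j m) D1)).
 by rewrite (negbTE (_ : i != j)) ?mulr0 ?scaler0 ?addr0 // eq_sym.
have D x : is_derive x (e_ j) (quot i m N M) (quot i m (pd j N) (pd j M) x).
 have [x0|x0] := eqVneq (x ord0 i) 0.
  apply: (is_der_val (@quot_der_eq0 i m N M x j x0 ji (@smooth_derivable _ sM _ _)));
   rewrite /quot x0 eqxx //.
 apply: (is_der_val (@quot_der_neq0 i m N M x j x0 (@smooth_derivable _ sN _ _)));
  rewrite /quot (negbTE x0) (negbTE (_ : i != j)) ?mul0r ?subr0 //.
 by rewrite eq_sym.
split=> [x _|]; first by case: (D x).
have -> : pd j (quot i m N M) = quot i m (pd j N) (pd j M).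
 by fext => x; case: (D x).
exact: IH.
Qed.

Lemma Hadamard_coord i (h : V -> R) : smooth_on setT h ->
 (forall x, x ord0 i = 0 -> h x = 0) ->
 exists2 k, smooth_on setT k & forall x, h x = x ord0 i * k x.
Proof.
move=> sh h0; exists (quot i 0 h (pd i h)).
 move=> k; apply: quot_Ck => //; first exact: smooth_partial.
 by move=> x; rewrite expr0 mul1r.
move=> x; rewrite /quot; have [x0|x0] := eqVneq (x ord0 i) 0.
 by rewrite x0 mul0r h0.
by rewrite expr1 mulrC divfK.
Qed.
End Division.

(** * Quotients by powers of a squared radius *)

Section RadialQuotient.
Variables (R : realType) (n : nat) (i j : 'I_n).
Hypothesis ij : i != j.
Local Notation V := 'rV[R]_n.
Local Notation e_ i := (delta_mx ord0 i : V).
Implicit Types (O : set V) (b : V -> R) (x y : V).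

Definition rad2 x : R := x ord0 i ^+ 2 + x ord0 j ^+ 2.
(** Partial derivatives of these quotients are combinations of quotients of the same kind, and each
    derivative lowers a + c - 2 m by at most one; this number measures the order of
    differentiability along the axis. *)
Definition radial a c b m : V -> R :=
 fun x => x ord0 i ^+ a * x ord0 j ^+ c * b x / rad2 x ^+ m.
Lemma rad2_eq0 x : (rad2 x == 0) = (x ord0 i == 0) && (x ord0 j == 0).
Proof. by rewrite /rad2 paddr_eq0 ?sqr_ge0 // !sqrf_eq0. Qed.
Lemma rad2_Ck k O : open O -> Ck k O rad2.
Proof.
move=> oO; apply: (@CkD _ _ _ _ (fun y : V => y ord0 i ^+ 2) (fun y : V => y ord0 j ^+ 2)) => //.
all: exact: Ck_coordX.
Qed.
Lemma rad2X_Ck k O m : open O -> Ck k O (fun x => rad2 x ^+ m).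
Proof.
move=> oO; elim: m => [|m IH].
 by apply: (@Ck_ext _ _ _ _ (cst 1)) (Ck_cst _ _ _) => // x _; rewrite expr0.
apply: (@Ck_ext _ _ _ _ (rad2 * (fun y : V => rad2 y ^+ m))) => //.
 by move=> x _; rewrite exprS.
by apply: CkM => //; exact: rad2_Ck.
Qed.
Lemma open_rad2_neq0 : open [set x | rad2 x != 0].
Proof.
rewrite openE => x /= x0.
have c : {for x, continuous rad2} := Ck_continuous (@rad2_Ck 0 setT openT) Logic.I.
move: c => /(_ [set t | t != 0]); apply; apply: open_nbhs_nbhs; split=> //.
Qed.
Lemma radial_sm_off a c b m : smooth_on setT b ->
 smooth_on [set x | rad2 x != 0] (radial a c b m).
Proof.
move=> sb k; have oO := open_rad2_neq0.
apply: (@CkM _ _ _ _ ((fun x : V => x ord0 i ^+ a * x ord0 j ^+ c) * b)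
 (fun x => (rad2 x ^+ m)^-1)) => //.
 apply: CkM => //; last exact: Ck_sub (sb k).
 apply: (@CkM _ _ _ _ (fun x : V => x ord0 i ^+ a) (fun x : V => x ord0 j ^+ c)) => //; exact: Ck_coordX.
by apply: CkV => // [x x0|]; [rewrite expf_neq0 | exact: rad2X_Ck].
Qed.
Lemma radial_eq0 a c b m x : (0 < a + c)%N -> rad2 x = 0 -> radial a c b m x = 0.
Proof.
move=> ac /eqP; rewrite rad2_eq0 => /andP[/eqP xi /eqP xj].
rewrite /radial xi xj -exprD expr0n.
by case: (a + c)%N ac => // d _; rewrite !mul0r.
Qed.
(** The numerator is at most rho^(a+c) times |b|, the denominator at least rho^(2m), so one factor
    rho survives. *)
Lemma radial_bound a c b m x (rho : R) : (m.*2 < a + c)%N ->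
 `|x ord0 i| <= rho -> `|x ord0 j| <= rho -> rho <= 1 -> rho ^+ 2 <= rad2 x ->
 `|radial a c b m x| <= rho * `|b x|.
Proof.
move=> mac xi xj r1 r2; have r0 : 0 <= rho by apply: le_trans xi.
rewrite /radial !normrM normfV !normrX mulrAC; apply: ler_wpM2r => //.
have [z|z] := eqVneq (rad2 x) 0.
 move/eqP: (z); rewrite rad2_eq0 => /andP[/eqP -> /eqP ->].
 rewrite normr0 -exprD expr0n; case: (a + c)%N mac => // d _.
 by rewrite mul0r.
have x2 : 0 < rad2 x by rewrite lt_neqAle eq_sym z /rad2 addr_ge0 ?sqr_ge0.
rewrite (gtr0_norm x2) ler_pdivrMr ?exprn_gt0 //.
apply: (@le_trans _ _ (rho ^+ (a + c))).
 by rewrite exprD ler_pM ?exprn_ge0 // lerXn2r ?nnegrE.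
apply: (@le_trans _ _ (rho ^+ (m.*2).+1)); first by rewrite ler_wiXn2l.
rewrite exprS ler_wpM2l // -mul2n exprM lerXn2r ?nnegrE ?exprn_ge0 //.
exact: ltW.
Qed.

Lemma radial_cont a c b m : (m.*2 < a + c)%N -> smooth_on setT b ->
 forall x, {for x, continuous (radial a c b m)}.
Proof.
move=> mac sb x; have [x0|x0] := eqVneq (rad2 x) 0; last first.
 exact: smooth_cont (radial_sm_off a c m sb) x0.
apply: close_cont => e e0.
have ac : (0 < a + c)%N by apply: leq_ltn_trans mac.
have cb := smooth_cont sb (Logic.I : setT x).
have C0 : 0 < `|b x| + 1 by rewrite ltr_wpDl.
pose d := Num.min 1 (e / (`|b x| + 1)).
have d0 : 0 < d by rewrite lt_min ltr01 divr_gt0.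
have Hball : \forall y \near x, `|x - y| < d.
 by apply/nbhs_ballP; exists d => // y; rewrite -ball_normE.
apply: filterS2 (near_close cb ltr01) Hball => y yb yd.
rewrite (radial_eq0 b m ac x0) sub0r normrN.
move/eqP: x0; rewrite rad2_eq0 => /andP[/eqP xi /eqP xj].
pose rho := Num.max `|y ord0 i| `|y ord0 j|.
have rd : rho < d.
 have H l : x ord0 l = 0 -> `|y ord0 l| < d.
  by move=> xl; apply: le_lt_trans yd; have := normrV_ge (x - y) l; rewrite !mxE xl sub0r normrN.
 by rewrite /rho maxEle; case: ifP => _; exact: H.
apply: le_trans (radial_bound b mac (_ : _ <= rho) (_ : _ <= rho) _ _) _.
- by rewrite /rho le_max lexx.
- by rewrite /rho le_max lexx orbT.
- by apply: ltW; apply: lt_le_trans rd _; rewrite ge_min lexx.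
- rewrite /rho /rad2; rewrite maxEle; case: ifP => _; rewrite real_normK ?num_real //.
  by rewrite lerDr sqr_ge0.
 by rewrite lerDl sqr_ge0.
apply: (@le_trans _ _ (d * (`|b x| + 1))).
 apply: ler_pM => //; [by rewrite /rho le_max normr_ge0 | exact: ltW |].
 by rewrite -lerBlDl; apply: le_trans yb; rewrite distrC lerB_dist.
by rewrite -ler_pdivlMr // ge_min lexx orbT.
Qed.

Lemma is_der_rad2X x l m : is_derive x (e_ l) (fun y => rad2 y ^+ m)
 (m%:R * rad2 x ^+ m.-1 * (2 * x ord0 i * (i == l)%:R + 2 * x ord0 j * (j == l)%:R)).
Proof.
have D : is_derive x (e_ l) rad2 (2 * x ord0 i * (i == l)%:R + 2 * x ord0 j * (j == l)%:R).
 have D := is_deriveD (is_der_coordX x i l 2) (is_der_coordX x j l 2).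
 by apply: is_der_val D _; rewrite !expr1.
have -> : (fun y => rad2 y ^+ m) = rad2 ^+ m.
 by fext => y; elim: m => [|m IH]; rewrite ?expr0 // !exprS IH.
by apply: is_der_val (is_deriveX m D) _; rewrite /GRing.scale.
Qed.
Definition radial_pd l a c b m : V -> R := fun x =>
 a%:R * (i == l)%:R * radial a.-1 c b m x + c%:R * (j == l)%:R * radial a c.-1 b m x
 + radial a c (pd l b) m x
 - m%:R * 2 * (i == l)%:R * radial a.+1 c b m.+1 x
 - m%:R * 2 * (j == l)%:R * radial a c.+1 b m.+1 x.
Lemma radial_der_off l a c b m x : smooth_on setT b -> rad2 x != 0 ->
 is_derive x (e_ l) (radial a c b m) (radial_pd l a c b m x).
Proof.
move=> sb x0; have xm k : rad2 x ^+ k != 0 by rewrite expf_neq0.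
pose X (y : V) := rad2 y ^+ m; pose W (y : V) := (X y)^-1.
have [dX eX] := is_der_rad2X x l m.
have dW : is_derive x (e_ l) W (- X x ^- 2 * (m%:R * rad2 x ^+ m.-1 *
  (2 * x ord0 i * (i == l)%:R + 2 * x ord0 j * (j == l)%:R))).
 split; first exact: (@derivableV _ _ X x (e_ l) (xm m) dX).
 by rewrite (@deriveV _ _ X x (e_ l) (xm _) dX) eX.
have D1 := is_deriveM (is_deriveM (is_deriveM (is_der_coordX x i l a) (is_der_coordX x j l c))
 (sderive sb x l)) dW.
apply: is_der_val D1 _; rewrite /GRing.scale /= !fctE /radial_pd /radial /W /X.
move: (b x) (pd l b x) (i == l)%:R (j == l)%:R => B B' di dj.
have -> : - rad2 x ^+ m ^- 2 * (m%:R * rad2 x ^+ m.-1 * (2 * x ord0 i * di + 2 * x ord0 j * dj)) =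
 - (m%:R * 2 * (x ord0 i * di + x ord0 j * dj) / rad2 x ^+ m.+1).
 case: m xm {X W dX eX dW} => [|m] xm; first by rewrite mulr0n !(mul0r, mulr0) oppr0.
 have -> : rad2 x ^+ m.+1 ^- 2 = (rad2 x ^+ m)^-1 * rad2 x ^- m.+2.
  by rewrite -invfM -exprM -exprD; congr (_ ^- _); lia.
 by rewrite /=; field; rewrite !xm.
have xm1 := xm m; have x1 : rad2 x ^+ m.+1 = rad2 x * rad2 x ^+ m by rewrite exprS.
rewrite x1 !exprS; move: (rad2 x ^+ m) xm1 => rm rm0.
move: (x ord0 i ^+ a) (x ord0 i ^+ a.-1) (x ord0 j ^+ c) (x ord0 j ^+ c.-1) => p p' q q'.
by move: (a%:R) (c%:R) (m%:R) => A C Mm; field; rewrite x0 rm0.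
Qed.

Lemma radial_pd_cont l a c b m : (m.*2.+1 < a + c)%N -> smooth_on setT b ->
 forall x, {for x, continuous (radial_pd l a c b m)}.
Proof.
move=> mac sb x.
have C a' c' b' m' (k : R) : (m'.*2 < a' + c')%N -> smooth_on setT b' ->
  {for x, continuous (fun y => k * radial a' c' b' m' y)}.
 by move=> H s; apply: continuousM; [exact: cst_continuous | exact: radial_cont].
have sl := smooth_partial l sb.
apply: (@continuousB _ _ _ (fun y => a%:R * (i == l)%:R * radial a.-1 c b m y +
 c%:R * (j == l)%:R * radial a c.-1 b m y + radial a c (pd l b) m y
 - m%:R * 2 * (i == l)%:R * radial a.+1 c b m.+1 y)); last by apply: C => //; lia.
apply: (@continuousB _ _ _ (fun y => a%:R * (i == l)%:R * radial a.-1 c b m y +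
 c%:R * (j == l)%:R * radial a c.-1 b m y + radial a c (pd l b) m y)); last by apply: C => //; lia.
apply: (@continuousD _ _ _ (fun y => a%:R * (i == l)%:R * radial a.-1 c b m y +
 c%:R * (j == l)%:R * radial a c.-1 b m y)); last by apply: radial_cont => //; lia.
by apply: continuousD; apply: C => //; lia.
Qed.

Lemma radial_pd_eq0 l a c b m x : (m.*2.+1 < a + c)%N -> rad2 x = 0 ->
 radial_pd l a c b m x = 0.
Proof.
move=> mac x0; rewrite /radial_pd !radial_eq0 ?mulr0 ?addr0 ?subr0 //; lia.
Qed.
(** On the axis the directions i and j are handled by [der_limit]; in every other direction the
    function is identically zero along the axis, and so is the formula. *)
Lemma radial_der l a c b m x : (m.*2.+1 < a + c)%N -> smooth_on setT b ->
 is_derive x (e_ l) (radial a c b m) (radial_pd l a c b m x).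
Proof.
move=> mac sb; have [x0|] := eqVneq (rad2 x) 0; last exact: radial_der_off.
have [lij|lij] := boolP ((l == i) || (l == j)).
 apply: der_limit; [|exact: radial_pd_cont|].
  by apply: radial_cont => //; lia.
 move=> t t0; apply: radial_der_off => //.
 move/eqP: x0; rewrite !rad2_eq0 !coordD => /andP[/eqP -> /eqP ->]; rewrite !add0r.
 rewrite !mulf_eq0 (negbTE t0) /=.
 case/orP: lij => /eqP ->; first by rewrite eqxx oner_eq0.
 by rewrite eqxx oner_eq0 andbF.
rewrite radial_pd_eq0 //.
have E : (fun h : R => h^-1 *: ((radial a c b m \o shift x) (h *: e_ l) - radial a c b m x)) =
  (fun h : R => h^-1 *: ((cst (0 : R) \o shift x) (h *: e_ l) - cst (0 : R) x)).
 fext => h /=; have ac : (0 < a + c)%N by lia.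
 rewrite !radial_eq0 //.
 move/eqP: x0; move/norP: lij => [li lj]; rewrite /shift /= addrC => x0.
 apply/eqP; rewrite rad2_eq0 !coordD; move: x0; rewrite rad2_eq0 => /andP[/eqP -> /eqP ->].
 by rewrite ![_ == l]eq_sym (negbTE li) (negbTE lj) mulr0 addr0 eqxx.
have [D1 D2] := is_derive_cst (0 : R) x (e_ l).
by split; [rewrite /derivable E | rewrite /derive E].
Qed.

Lemma radial_Ck k a c b m : (m.*2 + k < a + c)%N -> smooth_on setT b ->
 Ck k setT (radial a c b m).
Proof.
elim: k a c b m => [|k IH] a c b m mac sb.
 by split=> // x _; apply: radial_cont => //; lia.
have D l x : is_derive x (e_ l) (radial a c b m) (radial_pd l a c b m x).
 by apply: radial_der => //; lia.
split=> [x _|l]; first by apply: radial_cont => //; lia.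
split=> [x _|]; first by case: (D l x).
have -> : pd l (radial a c b m) = radial_pd l a c b m.
 by fext => x; case: (D l x).
have sl := smooth_partial l sb.
have C a' c' b' m' (r : R) : (m'.*2 + k < a' + c')%N -> smooth_on setT b' ->
  Ck k setT (cst r * radial a' c' b' m').
 by move=> H s; apply: CkM; [exact: openT | exact: Ck_cst | exact: IH].
have -> : radial_pd l a c b m =
 cst (a%:R * (i == l)%:R) * radial a.-1 c b m + cst (c%:R * (j == l)%:R) * radial a c.-1 b m
 + cst 1 * radial a c (pd l b) m
 + cst (- (m%:R * 2 * (i == l)%:R)) * radial a.+1 c b m.+1
 + cst (- (m%:R * 2 * (j == l)%:R)) * radial a c.+1 b m.+1.
 by fext => x; rewrite !fctE /radial_pd mul1r !mulNr.
do 4!(apply: CkD; [exact: openT| |by apply: C => //; lia]).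
by apply: C => //; lia.
Qed.
End RadialQuotient.

(** * Division by a complex coordinate *)

Section ComplexDivision.
Variables (R : realType) (n : nat) (i j : 'I_n).
Hypothesis ij : i != j.
Local Notation V := 'rV[R]_n.
Local Notation C := R[i].
Local Notation e_ i := (delta_mx ord0 i : V).
Local Notation Re := complex.Re.
Local Notation Im := complex.Im.
Implicit Types (F G : V -> C) (x y : V).

Definition csm F := smooth_on setT (fun x => Re (F x)) /\ smooth_on setT (fun x => Im (F x)).
Definition zc : V -> C := fun x => (x ord0 i +i* x ord0 j).
Definition zcb : V -> C := fun x => (x ord0 i -i* x ord0 j).
(** Twice the Wirtinger derivative in the conjugate of [zc]. *)
Definition dbar F : V -> C := fun x =>
 ((pd i (fun x => Re (F x)) x - pd j (fun x => Im (F x)) x) +i*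
  (pd i (fun x => Im (F x)) x + pd j (fun x => Re (F x)) x)).
Lemma smT_ext (f g : V -> R) : f =1 g -> smooth_on setT f -> smooth_on setT g.
Proof. by move=> /funext ->. Qed.
Lemma csmD F G : csm F -> csm G -> csm (F \+ G).
Proof.
move=> [F1 F2] [G1 G2]; split.
- apply: smT_ext (smooth_onD openT F1 G1) => x; rewrite !fctE /=.
 by case: (F x) (G x) => [? ?] [? ?].
- apply: smT_ext (smooth_onD openT F2 G2) => x; rewrite !fctE /=.
 by case: (F x) (G x) => [? ?] [? ?].
Qed.
Lemma sm_onB O (f g : V -> R) : open O -> smooth_on O f -> smooth_on O g ->
 smooth_on O (f - g).
Proof. by move=> oO sf sg k; apply: CkD => //; apply: CkN. Qed.
Lemma csmM F G : csm F -> csm G -> csm (F \* G).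
Proof.
move=> [F1 F2] [G1 G2]; have oT := @openT V; split.
- apply: smT_ext (sm_onB oT (smooth_onM oT F1 G1) (smooth_onM oT F2 G2)) => x.
 by rewrite !fctE /=; case: (F x) (G x) => [? ?] [? ?].
- apply: smT_ext (smooth_onD oT (smooth_onM oT F1 G2) (smooth_onM oT F2 G1)) => x.
 by rewrite !fctE /=; case: (F x) (G x) => [? ?] [? ?].
Qed.
Lemma csm_cst (a : C) : csm (cst a).
Proof. by split; exact: smooth_on_cst. Qed.
Lemma sm_coord O l : smooth_on O (fun x : V => x ord0 l).
Proof. by move=> k; apply: Ck_coord. Qed.
Lemma csm_zc : csm zc.
Proof. by split; exact: sm_coord. Qed.
Lemma csm_zcb : csm zcb.
Proof.
split; first exact: sm_coord.
have := smooth_onM openT (smooth_on_cst setT (-1)) (sm_coord setT j).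
by apply: smT_ext => x; rewrite !fctE mulN1r.
Qed.
Lemma csm_ext F G : F =1 G -> csm F -> csm G.
Proof. by move=> /funext ->. Qed.
Lemma csmX F N : csm F -> csm (fun x => F x ^+ N).
Proof.
move=> sF; elim: N => [|N IH].
 by apply: csm_ext (csm_cst 1) => x; rewrite expr0.
by apply: csm_ext (csmM sF IH) => x; rewrite exprS.
Qed.
Lemma dbarM F G x : csm F -> csm G ->
 dbar (F \* G) x = dbar F x * G x + F x * dbar G x.
Proof.
move=> [F1 F2] [G1 G2].
pose f1 x := Re (F x); pose f2 x := Im (F x); pose g1 x := Re (G x); pose g2 x := Im (G x).
have P l : pd l (fun x => Re ((F \* G) x)) x =
 f1 x * pd l g1 x + g1 x * pd l f1 x - (f2 x * pd l g2 x + g2 x * pd l f2 x).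
 have -> : (fun x => Re ((F \* G) x)) = f1 * g1 - f2 * g2.
  by fext => y; rewrite !fctE /f1 /f2 /g1 /g2 /=; case: (F y) (G y) => [? ?] [? ?].
 have D := is_deriveB (is_deriveM (sderive F1 x l) (sderive G1 x l))
  (is_deriveM (sderive F2 x l) (sderive G2 x l)).
 by rewrite {1}/pd (@derive_val _ _ _ _ _ _ _ D).
have Q l : pd l (fun x => Im ((F \* G) x)) x =
 f1 x * pd l g2 x + g2 x * pd l f1 x + (f2 x * pd l g1 x + g1 x * pd l f2 x).
 have -> : (fun x => Im ((F \* G) x)) = f1 * g2 + f2 * g1.
  by fext => y; rewrite !fctE /f1 /f2 /g1 /g2 /=; case: (F y) (G y) => [? ?] [? ?].
 have D := is_deriveD (is_deriveM (sderive F1 x l) (sderive G2 x l))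
  (is_deriveM (sderive F2 x l) (sderive G1 x l)).
 by rewrite {1}/pd (@derive_val _ _ _ _ _ _ _ D).
rewrite {1}/dbar !P !Q /dbar -/f1 -/f2 -/g1 -/g2.
have -> : F x = f1 x +i* f2 x by rewrite /f1 /f2; case: (F x).
have -> : G x = g1 x +i* g2 x by rewrite /g1 /g2; case: (G x).
move: (pd i f1 x) (pd i f2 x) (pd j f1 x) (pd j f2 x) => a b c d.
move: (pd i g1 x) (pd i g2 x) (pd j g1 x) (pd j g2 x) => a' b' c' d'.
move: (f1 x) (f2 x) (g1 x) (g2 x) => p q r s.
by ceq; ring.
Qed.

Lemma dbar_csm F : csm F -> csm (dbar F).
Proof.
move=> [F1 F2]; have oT := @openT V; split.
- exact: (sm_onB oT (smooth_partial i F1) (smooth_partial j F2)).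
- exact: (smooth_onD oT (smooth_partial i F2) (smooth_partial j F1)).
Qed.
Lemma dbarD F G x : csm F -> csm G -> dbar (F \+ G) x = dbar F x + dbar G x.
Proof.
move=> [F1 F2] [G1 G2].
have P l : pd l (fun x => Re ((F \+ G) x)) x =
  pd l (fun x => Re (F x)) x + pd l (fun x => Re (G x)) x.
 have -> : (fun x => Re ((F \+ G) x)) = (fun x => Re (F x)) + (fun x => Re (G x)).
  by fext => y; rewrite !fctE /=; case: (F y) (G y) => [? ?] [? ?].
 have D := is_deriveD (sderive F1 x l) (sderive G1 x l).
 by rewrite {1}/pd (@derive_val _ _ _ _ _ _ _ D).
have Q l : pd l (fun x => Im ((F \+ G) x)) x =
  pd l (fun x => Im (F x)) x + pd l (fun x => Im (G x)) x.
 have -> : (fun x => Im ((F \+ G) x)) = (fun x => Im (F x)) + (fun x => Im (G x)).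
  by fext => y; rewrite !fctE /=; case: (F y) (G y) => [? ?] [? ?].
 have D := is_deriveD (sderive F2 x l) (sderive G2 x l).
 by rewrite {1}/pd (@derive_val _ _ _ _ _ _ _ D).
rewrite {1}/dbar !P !Q /dbar.
move: (pd i _ x) (pd i _ x) (pd j _ x) (pd j _ x) => a b c d.
move: (pd i _ x) (pd i _ x) (pd j _ x) (pd j _ x) => a' b' c' d'.
by ceq; ring.
Qed.

Lemma dbar_zc x : dbar zc x = 0.
Proof.
rewrite /dbar /zc /= !pd_coord /= !eqxx (negbTE ij) eq_sym (negbTE ij).
by rewrite subrr addr0.
Qed.
Lemma dbar_zcb x : dbar zcb x = 2.
Proof.
have E l : pd l (fun x : V => - x ord0 j) x = - (l == j)%:R.
 have D := is_deriveN (sderive (sm_coord setT j) x l).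
 by rewrite /pd (@derive_val _ _ _ _ _ _ _ D) -/(pd l _ x) pd_coord.
rewrite /dbar /zcb /= !E !pd_coord /= !eqxx (negbTE ij) eq_sym (negbTE ij).
by apply/eqP; rewrite eq_complex /= ?mulr1n ?mulr0n oppr0 opprK !addr0 !eqxx.
Qed.
Lemma iter_dbar_csm k F : csm F -> csm (iter k dbar F).
Proof. by move=> sF; elim: k => //= k IH; apply: dbar_csm. Qed.
Lemma iter_dbarD k F G : csm F -> csm G ->
 iter k dbar (F \+ G) = iter k dbar F \+ iter k dbar G.
Proof.
move=> sF sG; elim: k => //= k ->; fext => x.
by rewrite dbarD //; exact: iter_dbar_csm.
Qed.
Lemma iter_dbar_zc k F : csm F -> iter k dbar (zc \* F) = zc \* iter k dbar F.
Proof.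
move=> sF; elim: k => //= k ->; fext => x.
by rewrite dbarM ?dbar_zc ?mul0r ?add0r //; [exact: csm_zc | exact: iter_dbar_csm].
Qed.
Lemma iter_dbar_zcb k F : csm F -> iter k.+1 dbar (zcb \* F) =
 (zcb \* iter k.+1 dbar F) \+ (cst (k.+1%:R *+ 2) \* iter k dbar F).
Proof.
move=> sF; elim: k => [|k IH].
 fext => x /=; rewrite dbarM ?dbar_zcb //; last exact: csm_zcb.
 by rewrite addrC.
rewrite iterS IH; fext => x.
have sk l : csm (iter l dbar F) by exact: iter_dbar_csm.
rewrite dbarD; [|exact: csmM csm_zcb (sk _) | exact: csmM (csm_cst _) (sk _)].
rewrite dbarM; [|exact: csm_zcb|exact: sk].
rewrite dbarM; [|exact: csm_cst|exact: sk].
have -> : dbar (cst (k.+1%:R *+ 2)) x = 0.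
 have E l (a : R) : pd l (fun x : V => a) x = 0 by exact: derive_cst.
 by rewrite /dbar /= !E subrr addr0.
rewrite dbar_zcb mul0r add0r [2 * _ + _]addrC -addrA; congr (_ + _) => /=.
by rewrite -mulrDl -natr1 mulrnDl addrC.
Qed.

Lemma proj_coord_smooth (h : V -> R) : smooth_on setT h ->
 smooth_on setT (fun x => h (x - x ord0 i *: e_ i)).
Proof.
move=> sh; apply: (@sm_comp R n setT setT h (fun x : V => x - x ord0 i *: e_ i)) => //.
- exact: openT.
- exact: openT.
move=> l; have [->|li] := eqVneq l i.
 apply: smT_ext (smooth_on_cst setT 0) => x.
 by rewrite !mxE !eqxx mulr1 subrr.
apply: smT_ext (sm_coord setT l) => x.
by rewrite !mxE eqxx (negbTE li) mulr0 subr0.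
Qed.

Lemma Hadamard_real (h : V -> R) : smooth_on setT h ->
 (forall x, x ord0 i = 0 -> x ord0 j = 0 -> h x = 0) ->
 exists k l : V -> R, [/\ smooth_on setT k, smooth_on setT l &
  forall x, h x = x ord0 i * k x + x ord0 j * l x].
Proof.
move=> sh h0; have sp := proj_coord_smooth sh; set hp := (fun x => _) in sp.
have pi x l : (x - x ord0 i *: e_ i) ord0 l = if l == i then 0 else x ord0 l.
 rewrite !mxE eqxx /=; case: eqVneq => [->|_]; first by rewrite mulr1 subrr.
 by rewrite mulr0 subr0.
have [k sk Ek] : exists2 k, smooth_on setT k & forall x, (h - hp) x = x ord0 i * k x.
 apply: Hadamard_coord; first exact: sm_onB openT sh sp.
 by move=> x x0; rewrite !fctE /hp x0 scale0r subr0 subrr.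
have [l sl El] : exists2 l, smooth_on setT l & forall x, hp x = x ord0 j * l x.
 apply: Hadamard_coord => // x x0; apply: h0; rewrite pi ?eqxx //.
 by rewrite eq_sym (negbTE ij).
exists k, l; split=> // x; rewrite -Ek -El !fctE; by rewrite subrK.
Qed.

(** Hadamard's lemma x_i K + x_j L, rewritten with x_i and x_j expressed through [zc] and its
    conjugate. *)
Lemma Hadamard_complex F : csm F ->
 (forall x, x ord0 i = 0 -> x ord0 j = 0 -> F x = 0) ->
 exists A B, [/\ csm A, csm B & forall x, F x = zc x * A x + zcb x * B x].
Proof.
move=> [F1 F2] F0.
have [k1 [l1 [sk1 sl1 E1]]] : exists k l : V -> R, [/\ smooth_on setT k, smooth_on setT l &
  forall x, Re (F x) = x ord0 i * k x + x ord0 j * l x].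
 by apply: Hadamard_real => // x xi xj; rewrite F0.
have [k2 [l2 [sk2 sl2 E2]]] : exists k l : V -> R, [/\ smooth_on setT k, smooth_on setT l &
  forall x, Im (F x) = x ord0 i * k x + x ord0 j * l x].
 by apply: Hadamard_real => // x xi xj; rewrite F0.
pose K x := (k1 x +i* k2 x); pose L x := (l1 x +i* l2 x).
have sK : csm K by []. have sL : csm L by [].
exists (fun x => (K x - 'i * L x) / 2), (fun x => (K x + 'i * L x) / 2); split.
- apply: csm_ext (csmM (csmD sK (csmM (csm_cst (- 'i)) sL)) (csm_cst 2^-1)) => x /=.
 by rewrite mulNr.
- exact: csmM (csmD sK (csmM (csm_cst 'i) sL)) (csm_cst 2^-1).
move=> x; have -> : F x = K x * (x ord0 i)%:C + L x * (x ord0 j)%:C.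
 apply/eqP; rewrite eq_complex /= E1 E2 !mulr0 !add0r subr0 subr0.
 by rewrite ![_ * x ord0 _]mulrC !eqxx.
have -> : zc x = (x ord0 i)%:C + 'i * (x ord0 j)%:C.
 by ceq; ring.
have -> : zcb x = (x ord0 i)%:C - 'i * (x ord0 j)%:C.
 by ceq; ring.
have i2 : 'i * 'i = -1 :> C by rewrite -expr2 sqr_i.
by field: i2.
Qed.

(** The obstruction to division by [zc]: since dbar commutes with multiplication by [zc], every
    multiple of [zc] satisfies this. *)
Definition flat_along F := forall k x, x ord0 i = 0 -> x ord0 j = 0 -> iter k dbar F x = 0.
Lemma zc0 x : x ord0 i = 0 -> x ord0 j = 0 -> zc x = 0.
Proof. by rewrite /zc => -> ->. Qed.
Lemma zcb0 x : x ord0 i = 0 -> x ord0 j = 0 -> zcb x = 0.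
Proof. by rewrite /zcb => -> ->; rewrite oppr0. Qed.
(** Hadamard's lemma is applied repeatedly to the remainder. Applying dbar k + 1 times to B = zc A'
    + zcb B' and restricting to the axis leaves 2 (k + 1) times the k-th dbar-derivative of B', so
    the new remainder is flat again. *)
Lemma flat_along_expand F N : csm F -> flat_along F ->
 exists A B, [/\ csm A, csm B, flat_along B & forall x, F x = zc x * A x + zcb x ^+ N * B x].
Proof.
move=> sF flF; elim: N => [|N [A [B [sA sB flB E]]]].
 exists (cst 0), F; split=> // [|x]; first exact: csm_cst.
 by rewrite mulr0 add0r expr0 mul1r.
have [A' [B' [sA' sB' E']]] := Hadamard_complex sB (flB 0%N).
exists (A \+ ((fun x => zcb x ^+ N) \* A')), B'; split=> //.
- by apply: csmD sA (csmM (csmX _ csm_zcb) sA').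
- move=> k x xi xj; have := flB k.+1 x xi xj.
 have -> : B = (zc \* A') \+ (zcb \* B') by fext.
 rewrite iter_dbarD; [|exact: csmM csm_zc sA'|exact: csmM csm_zcb sB'].
 rewrite iter_dbar_zc // iter_dbar_zcb //= zc0 // zcb0 // !mul0r !add0r.
 move/eqP; rewrite mulf_eq0 => /orP[|/eqP //].
 by rewrite -mulr_natl -natrM pnatr_eq0.
move=> x; rewrite E E' /= exprS; ring.
Qed.

(** Expanding one factor x_i - i x_j of the power at a time reduces to [radial_Ck]. *)
Lemma Ck_zcbX k N a c m (b1 b2 : V -> R) : (m.*2 + k < a + c + N)%N ->
 smooth_on setT b1 -> smooth_on setT b2 ->
 Ck k setT (fun x => x ord0 i ^+ a * x ord0 j ^+ c * Re (zcb x ^+ N * (b1 x +i* b2 x)) / rad2 i j x ^+ m) /\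
 Ck k setT (fun x => x ord0 i ^+ a * x ord0 j ^+ c * Im (zcb x ^+ N * (b1 x +i* b2 x)) / rad2 i j x ^+ m).
Proof.
elim: N a c => [|N IH] a c mac s1 s2.
 rewrite addn0 in mac.
 have E : (fun x => zcb x ^+ 0 * (b1 x +i* b2 x)) = (fun x => (b1 x +i* b2 x)).
  by fext => x; rewrite expr0 mul1r.
 split.
  have -> : (fun x => x ord0 i ^+ a * x ord0 j ^+ c * Re (zcb x ^+ 0 * (b1 x +i* b2 x)) / rad2 i j x ^+ m) = radial i j a c b1 m.
   by fext => x; rewrite expr0 mul1r.
  exact: radial_Ck.
 have -> : (fun x => x ord0 i ^+ a * x ord0 j ^+ c * Im (zcb x ^+ 0 * (b1 x +i* b2 x)) / rad2 i j x ^+ m) = radial i j a c b2 m.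
  by fext => x; rewrite expr0 mul1r.
 exact: radial_Ck.
have [I1 I2] := IH a.+1 c ltac:(lia) s1 s2; have [J1 J2] := IH a c.+1 ltac:(lia) s1 s2.
have oT := @openT V.
split.
 have := CkD oT I1 J2; congr Ck; fext => x; rewrite !fctE [zcb x ^+ N.+1]exprS -[zcb x * _ * _]mulrA.
 move: (zcb x ^+ N * _) => -[p q]; rewrite /zcb /= !exprS; ring.
have := CkD oT I2 (CkN oT J1); congr Ck; fext => x; rewrite !fctE [zcb x ^+ N.+1]exprS -[zcb x * _ * _]mulrA.
move: (zcb x ^+ N * _) => -[p q]; rewrite /zcb /= !exprS; ring.
Qed.

Lemma zc_zcb x : zc x * zcb x = (rad2 i j x)%:C.
Proof.
apply/eqP; rewrite eq_complex /= /rad2; apply/andP; split; apply/eqP; ring.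
Qed.
Lemma zc_eq0 x : (zc x == 0) = (rad2 i j x == 0).
Proof. by rewrite eq_complex /= rad2_eq0. Qed.
(** The quotient of zcb^N B by [zc], written with the real denominator |zc|^2. *)
Definition tail N (B : V -> C) : V -> C := fun x => zcb x ^+ N.+1 * B x * ((rad2 i j x)^-1)%:C.
Lemma zc_tail N B x : (0 < N)%N -> zc x * tail N B x = zcb x ^+ N * B x.
Proof.
move=> N0; have [z|z] := eqVneq (rad2 i j x) 0.
 move/eqP: (z); rewrite rad2_eq0 => /andP[/eqP xi /eqP xj].
 by rewrite zc0 // zcb0 // mul0r expr0n (gtn_eqF N0) mul0r.
have r1 : (rad2 i j x)%:C * ((rad2 i j x)^-1)%:C = 1 :> C.
 by rewrite -(rmorphM (real_complex R)) /= divff.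
transitivity (zc x * zcb x * ((rad2 i j x)^-1)%:C * (zcb x ^+ N * B x)).
 by rewrite /tail exprS; ring.
by rewrite zc_zcb r1 mul1r.
Qed.

Lemma tail_Ck k N B : (k.+1 < N)%N -> csm B ->
 Ck k setT (fun x => Re (tail N B x)) /\ Ck k setT (fun x => Im (tail N B x)).
Proof.
move=> kN [B1 B2]; have [H1 H2] := @Ck_zcbX k N.+1 0 0 1 _ _ ltac:(lia) B1 B2.
have EB x : B x = (Re (B x) +i* Im (B x)) by case: (B x).
split.
 apply: (@Ck_ext _ _ _ _ _ _ openT) H1 => x _.
 rewrite !expr0 !mul1r expr1 /tail -EB; move: (zcb x ^+ N.+1 * B x) => -[p q] /=.
 by rewrite mulr0 subr0.
apply: (@Ck_ext _ _ _ _ _ _ openT) H2 => x _.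
rewrite !expr0 !mul1r expr1 /tail -EB; move: (zcb x ^+ N.+1 * B x) => -[p q] /=.
by rewrite mulr0 add0r.
Qed.

Lemma eq_off_axis (f g : V -> R) : continuous f -> continuous g ->
 (forall x, rad2 i j x != 0 -> f x = g x) -> f = g.
Proof.
move=> cf cg fg; fext => x; have [x0|] := eqVneq (rad2 i j x) 0; last exact: fg.
apply/eqP; rewrite -subr_eq0 -normr_le0; apply/ler_addgt0Pl => e e0; rewrite addr0.
have e2 : 0 < e / 2 by rewrite divr_gt0.
have [d1 d10 H1] := cont_shrink (e_ i) (cf x) e2.
have [d2 d20 H2] := cont_shrink (e_ i) (cg x) e2.
pose t := Num.min d1 d2; have t0 : 0 < t by rewrite lt_min d10.
have td1 : `|t| <= d1 by rewrite gtr0_norm // ge_min lexx.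
have td2 : `|t| <= d2 by rewrite gtr0_norm // ge_min lexx orbT.
have E : f (x + t *: e_ i) = g (x + t *: e_ i).
 apply: fg; move/eqP: x0; rewrite !rad2_eq0 !coordD => /andP[/eqP -> _].
 by rewrite eqxx add0r mulr1 (gt_eqF t0).
by apply: (dist_half (b := f (x + t *: e_ i))); [exact: H1 | rewrite E; exact: H2].
Qed.

(** For each k, the expansion of order k + 2 has a remainder whose quotient by [zc] is C^k. All
    these quotients equal F / zc off the axis, hence everywhere by continuity, so one function is
    C^k for all k. *)
Lemma flat_along_divide F : csm F -> flat_along F ->
 exists2 G, csm G & forall x, F x = zc x * G x.
Proof.
move=> sF flF.
have [A [B [sA sB flB E]]] := flat_along_expand 2 sF flF.
pose G := A \+ tail 2 B.
have EG x : F x = zc x * G x by rewrite mulrDr zc_tail // E.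
have cT (f : V -> R) : Ck 0 setT f -> continuous f.
 by move=> cf x; exact: Ck_continuous cf Logic.I.
have oT := @openT V.
have Ck_part (A' B' : V -> C) k N : (k.+1 < N)%N -> csm A' -> csm B' ->
  Ck k setT (fun x => Re ((A' \+ tail N B') x)) /\ Ck k setT (fun x => Im ((A' \+ tail N B') x)).
 move=> kN [A1 A2] sB'; have [T1 T2] := tail_Ck kN sB'; split.
  have := CkD oT (A1 k) T1; congr Ck; fext => x; rewrite !fctE /=.
  by case: (A' x) (tail N B' x) => [? ?] [? ?].
 have := CkD oT (A2 k) T2; congr Ck; fext => x; rewrite !fctE /=.
 by case: (A' x) (tail N B' x) => [? ?] [? ?].
have [G1 G2] := Ck_part A B 0%N 2 isT sA sB.
have H k : Ck k setT (fun x => Re (G x)) /\ Ck k setT (fun x => Im (G x)).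
 have [A' [B' [sA' sB' _ E']]] := flat_along_expand k.+2 sF flF.
 have [H1 H2] := Ck_part A' B' k k.+2 (ltnSn _) sA' sB'.
 have [K1 K2] := Ck_part A' B' 0%N k.+2 isT sA' sB'.
 have EE x : rad2 i j x != 0 -> G x = (A' \+ tail k.+2 B') x.
  rewrite -zc_eq0 => z0; apply: (mulfI z0); rewrite -EG E' /= mulrDr.
  by rewrite zc_tail.
 split.
  have -> // : (fun x => Re (G x)) = (fun x => Re ((A' \+ tail k.+2 B') x)).
  by apply: eq_off_axis; [exact: cT|exact: cT|move=> x /EE ->].
 have -> // : (fun x => Im (G x)) = (fun x => Im ((A' \+ tail k.+2 B') x)).
 by apply: eq_off_axis; [exact: cT|exact: cT|move=> x /EE ->].
by exists G => //; split=> k; case: (H k).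
Qed.
End ComplexDivision.

(** * Charts and gluing *)

Section Straightening.
Variables (R : realType) (n : nat) (i : 'I_n).
Local Notation V := 'rV[R]_n.
Local Notation e_ i := (delta_mx ord0 i : V).
Implicit Types (u : V -> R) (x y w : V).

Definition setc x (a : R) : V := x + (a - x ord0 i) *: e_ i.
Lemma setcE x a l : setc x a ord0 l = if l == i then a else x ord0 l.
Proof.
rewrite /setc coordD; case: eqVneq => [->|_]; last by rewrite mulr0 addr0.
by rewrite mulr1 addrC subrK.
Qed.
Lemma set_coord_id x : setc x (x ord0 i) = x.
Proof. by apply/rowP => l; rewrite setcE; case: eqVneq => // ->. Qed.
Lemma set_coordK x a b : setc (setc x a) b = setc x b.
Proof. by apply/rowP => l; rewrite !setcE; case: eqVneq. Qed.
Lemma ballV x (d : R) y : 0 < d -> (forall l, `|x ord0 l - y ord0 l| < d) -> ball x d y.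
Proof.
move=> d0 H; rewrite -ball_normE /ball_ /= [ltLHS]mx_normrE; apply/bigmax_ltP; split=> //.
by move=> [a l] _ /=; rewrite (ord1 a) !mxE.
Qed.
Lemma ballVP x (d : R) y : ball x d y -> forall l, `|x ord0 l - y ord0 l| < d.
Proof.
rewrite -ball_normE /ball_ /= => H l; apply: le_lt_trans H.
by have := normrV_ge (x - y) l; rewrite !mxE.
Qed.

Variables (u : V -> R) (B : set V) (y0 : V) (r : R).
Hypothesis Bdef : B = ball y0 r.
Hypothesis r0 : 0 < r.
Hypothesis su : smooth_on B u.
Hypothesis du : forall y, B y -> 0 < pd i u y.

Let oB : open B. Proof. by rewrite Bdef; exact: ball_open. Qed.
(** The change of coordinates that replaces the i-th coordinate by u. Because only one coordinate
    moves, its inverse comes from monotonicity and the intermediate value theorem. *)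
Definition straight y : V := setc y (u y).
Definition unstr w : V := get [set y | B y /\ straight y = w].
Let B_between y a b c : B (setc y a) -> B (setc y b) -> a <= c <= b ->
 B (setc y c).
Proof.
rewrite Bdef => /ballVP Ba /ballVP Bb /andP[ac cb]; apply: ballV => // l.
move: (Ba l) (Bb l); rewrite !setcE; case: eqVneq => // _.
by rewrite !ltr_distlC => /andP[a1 a2] /andP[b1 b2]; apply/andP; split; lra.
Qed.
Let mono y a b : a < b -> B (setc y a) -> B (setc y b) ->
 u (setc y a) < u (setc y b).
Proof.
move=> ab Ba Bb; have h0 : b - a != 0 by rewrite subr_eq0 gt_eqF.
have Eb (t : R) : setc y a + t *: e_ i = setc y (a + t).
 by apply/rowP => l; rewrite coordD !setcE; case: eqVneq; rewrite ?mulr1 ?mulr0 ?addr0.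
rewrite -subr_gt0.
pose f (z : V) := u z.
have bt (t : R) : 0 <= t <= b - a -> B (setc y (a + t)).
 by move=> /andP[t0 tb]; apply: B_between Ba Bb _; lra.
have df (t : R) : 0 <= t <= b - a -> is_derive t 1 (fun t : R => u (setc y a + t *: e_ i))
  (pd i u (setc y (a + t))).
 move=> /bt Bt; have := @drv_line R n u (setc y a) (e_ i) t.
 by rewrite Eb; apply; exact: smooth_on_derivable su Bt.
have ba0 : 0 < b - a by rewrite subr_gt0.
have [t] : exists2 t, t \in `]0, b - a[ & u (setc y a + (b - a) *: e_ i) -
  u (setc y a + 0 *: e_ i) = pd i u (setc y (a + t)) * (b - a - 0).
 apply: (@MVT _ (fun t : R => u (setc y a + t *: e_ i))) => // [t|].
  by rewrite in_itv /= => /andP[t1 t2]; apply: df; lra.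
 apply: cont_subT => t; rewrite inE /= in_itv /= => tt.
 by apply: differentiable_continuous; apply/derivable1_diffP; case: (df _ tt).
have E1 : a + (b - a) = b by rewrite addrC subrK.
rewrite in_itv /= => /andP[t1 t2]; rewrite !Eb addr0 E1 subr0 => ->.
apply: mulr_gt0 => //; apply/du/bt; apply/andP; split; exact: ltW.
Qed.

Lemma straight_inj y y' : B y -> B y' -> straight y = straight y' -> y = y'.
Proof.
move=> By By' E.
have Eu : u y = u y'.
 by have /rowP/(_ i) := E; rewrite !setcE eqxx.
have Ey : y' = setc y (y' ord0 i).
 by apply/rowP => l; have /rowP/(_ l) := E; rewrite !setcE; case: eqVneq => [->|].
have Bs : B (setc y (y ord0 i)) by rewrite set_coord_id.
have Bs' : B (setc y (y' ord0 i)) by rewrite -Ey.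
case: (ltrgtP (y ord0 i) (y' ord0 i)) => [H|H|H].
- by have := mono H Bs Bs'; rewrite set_coord_id -Ey Eu ltxx.
- by have := mono H Bs' Bs; rewrite set_coord_id -Ey Eu ltxx.
- by rewrite Ey -H set_coord_id.
Qed.

Lemma straightK y : B y -> unstr (straight y) = y.
Proof.
move=> By; have [Bg Eg] : [set y' | B y' /\ straight y' = straight y] (unstr (straight y)).
 by apply: (@getI _ _ y); split.
exact: straight_inj.
Qed.
Lemma unstrK w : (straight @` B) w -> B (unstr w) /\ straight (unstr w) = w.
Proof. by move=> [y By <-]; rewrite straightK. Qed.
(** Along the segment of half-length d' in direction i, u is below w_i at one end and above it at
    the other, for all w close to the image of y. *)
Lemma straight_solve y (d : R) : B y -> 0 < d -> \forall w \near straight y,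
 exists t : R, [/\ `|t| <= d, B (setc w (y ord0 i + t)) & straight (setc w (y ord0 i + t)) = w].
Proof.
move=> By d0.
have /nbhs_ballP[e /= e0 eB] : nbhs y B by apply: open_nbhs_nbhs.
pose d' := Num.min d (e / 2); have d'0 : 0 < d' by rewrite lt_min d0 divr_gt0.
have d'd : d' <= d by rewrite ge_min lexx.
have d'e : d' <= e / 2 by rewrite ge_min lexx orbT.
pose a := y ord0 i - d'; pose b := y ord0 i + d'.
have Bab c : a <= c <= b -> B (setc y c).
 move=> /andP[ac cb]; apply: eB; apply: ballV => // l; rewrite setcE.
 case: eqVneq => [->|_]; last by rewrite subrr normr0.
 by rewrite ltr_distl; apply/andP; split; rewrite /a /b in ac cb; lra.
have ab : a < b by rewrite /a /b; lra.
have ay : a < y ord0 i by rewrite /a; lra.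
have yb : y ord0 i < b by rewrite /b; lra.
have aab : a <= a <= b by rewrite lexx ltW.
have bab : a <= b <= b by rewrite lexx ltW.
have Byi : B (setc y (y ord0 i)) by rewrite set_coord_id.
have ua : u (setc y a) < u y.
 by have := mono ay (Bab _ aab) Byi; rewrite set_coord_id.
have ub : u y < u (setc y b).
 by have := mono yb Byi (Bab _ bab); rewrite set_coord_id.
have cs c : a <= c <= b -> {for straight y, continuous (fun w => u (setc w c))}.
 move=> acb; apply: continuous_comp.
  apply: cont_coords => l; have [->|li] := eqVneq l i.
   have -> : (fun t : V => setc t c ord0 i) = cst c.
    by fext => t; rewrite setcE eqxx.
   exact: cst_continuous.
  have -> : (fun t : V => setc t c ord0 l) = (fun t : V => t ord0 l).
   by fext => t; rewrite setcE (negbTE li).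
  exact: coord_cont.
 by rewrite /= /straight set_coordK; apply: smooth_cont su _; exact: Bab.
have uiy : straight y ord0 i = u y by rewrite setcE eqxx.
have ci : {for straight y, continuous (fun w : V => w ord0 i)} by exact: coord_cont.
pose g1 := (u y - u (setc y a)) / 2; pose g2 := (u (setc y b) - u y) / 2.
have g10 : 0 < g1 by rewrite divr_gt0 // subr_gt0.
have g20 : 0 < g2 by rewrite divr_gt0 // subr_gt0.
have g3 : 0 < Num.min g1 g2 / 2 by rewrite divr_gt0 // lt_min g10.
have g31 : Num.min g1 g2 <= g1 by rewrite ge_min lexx.
have g32 : Num.min g1 g2 <= g2 by rewrite ge_min lexx orbT.
have N1 := near_close (cs _ aab) g10; have N2 := near_close (cs _ bab) g20.
have N3 := near_close ci g3.
have N4 : \forall w \near straight y, forall l, `|straight y ord0 l - (w : V) ord0 l| < e / 2.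
 have e2 : 0 < e / 2 by rewrite divr_gt0.
 by apply/nbhs_ballP; exists (e / 2) => // w /ballVP.
have SK c : setc (straight y) c = setc y c by rewrite /straight set_coordK.
rewrite !SK in N1 N2; rewrite uiy in N3.
apply: filterS (filterI (filterI N1 N2) (filterI N3 N4)) => w [[W1 W2] [W3 W4]].
have Bw c : a <= c <= b -> B (setc w c).
 move=> /andP[ac cb]; apply: eB; apply: ballV => // l; rewrite setcE.
 case: eqVneq => [->|li].
  by rewrite ltr_distl; apply/andP; split; rewrite /a /b in ac cb; lra.
 by have := W4 l; rewrite setcE (negbTE li) => H; lra.
have ineq : u (setc w a) <= w ord0 i <= u (setc w b).
 move: W1 W2 W3; rewrite !ler_distl => /andP[p1 p2] /andP[q1 q2] /andP[s1 s2].
 by rewrite /g1 /g2 in p1 p2 q1 q2 g31 g32 g3 *; apply/andP; split; lra.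
have [c] : exists2 c, c \in `[a, b] & u (setc w c) = w ord0 i.
 apply: (@IVT _ (fun c => u (setc w c))); first exact: ltW.
  apply: cont_subT => c; rewrite inE /= in_itv /= => acb.
  apply: (@continuous_comp _ _ _ (fun c => setc w c) u).
   by apply: continuousD; [exact: cst_continuous|];
     apply: (@continuous_comp _ _ _ (fun c : R => c - w ord0 i) (fun t => t *: e_ i));
     [apply: continuousB; [exact: cvg_id|exact: cst_continuous] | exact: scalel_continuous].
  exact: smooth_cont su (Bw _ acb).
 move/andP: ineq => [i1 i2]; have i3 := le_trans i1 i2.
 by rewrite (min_idPl i3) (max_idPr i3) i1 i2.
rewrite in_itv /= => acb Ec; exists (c - y ord0 i).
rewrite [y ord0 i + _]addrC subrK; split; last 2 first.
- exact: Bw.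
- by rewrite /straight Ec set_coordK set_coord_id.
by rewrite ler_distl; rewrite /a /b in acb; move/andP: acb => [? ?]; apply/andP; split; lra.
Qed.

Lemma straight_near y (d : R) : B y -> 0 < d -> \forall w \near straight y,
 [/\ (straight @` B) w, `|unstr w ord0 i - y ord0 i| <= d &
   forall l, l != i -> unstr w ord0 l = w ord0 l].
Proof.
move=> By d0; apply: filterS (straight_solve By d0) => w [t [td Bt Et]].
have E : unstr w = setc w (y ord0 i + t) by rewrite -{1}Et straightK.
split; first by exists (setc w (y ord0 i + t)).
 by rewrite E setcE eqxx addrC addKr.
by move=> l li; rewrite E setcE (negbTE li).
Qed.
Lemma straight_open : open (straight @` B).
Proof.
rewrite openE => _ [y By <-].
by apply: filterS (straight_near By ltr01) => w [].
Qed.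
Lemma unstr_other w l : (straight @` B) w -> l != i -> unstr w ord0 l = w ord0 l.
Proof. by move=> [y By <-] li; rewrite straightK // setcE (negbTE li). Qed.
Lemma unstr_cont w : (straight @` B) w -> {for w, continuous unstr}.
Proof.
move=> Ww; have [Bu Eu] := unstrK Ww; apply: cont_coords => l.
have [->|li] := eqVneq l i.
 apply: close_cont => e e0.
 have := straight_near Bu e0; rewrite Eu; apply: filterS => w' [_ H _].
 by rewrite distrC.
have E : \forall w' \near w, (w' : V) ord0 l = unstr w' ord0 l.
 by apply: filterS (open_nbhs_nbhs (conj straight_open Ww)) => w' W'; rewrite unstr_other.
rewrite /prop_for /continuous_at -(nbhs1 E).
apply: cvg_trans (near_eq_cvg E) _; exact: coord_cont.
Qed.

(** The derivative of the inverse, with the two partial derivatives of u taken at separate points: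
    the mean value theorem is used twice and produces two different points, and joint continuity
    then gives the limit. *)
Definition unstr_slope l (y z : V) : R :=
 ((l == i)%:R - (l != i)%:R * pd l u z) / pd i u y.
Lemma unstr_der w l : (straight @` B) w ->
 is_derive w (e_ l) (fun w => unstr w ord0 i) (unstr_slope l (unstr w) (unstr w)).
Proof.
move=> Ww; have [By Ey] := unstrK Ww; set y := unstr w in By Ey *.
set g := fun w => _; set S := unstr_slope l y y.
suff H : (fun h => h^-1 *: ((g \o shift w) (h *: e_ l) - g w)) @ 0^' --> (S : R).
 by split; [apply/cvg_ex; exists S | apply/cvg_lim].
apply/cvgrPdist_le => eps eps0.
have cl k : {for y, continuous (pd k u)}.
 exact: smooth_cont (smooth_partial k su) By.
have cQ : {for (y, y), continuous (fun z : V * V => unstr_slope l z.1 z.2)}.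
 apply: (@continuousM _ _ (fun z : V * V => (l == i)%:R - (l != i)%:R * pd l u z.2)
   (fun z : V * V => (pd i u z.1)^-1)).
  apply: continuousB; first exact: cst_continuous.
  apply: continuousM; first exact: cst_continuous.
  apply: (@continuous_comp _ _ _ snd (pd l u)); [exact: cvg_snd | exact: cl].
 apply: continuousV; first by rewrite lt0r_neq0 // du.
 apply: (@continuous_comp _ _ _ fst (pd i u)); [exact: cvg_fst | exact: cl].
have /nbhs_ballP[d1 /= d10 Hd] := near_close cQ eps0.
have /nbhs_ballP[d2 /= d20 d2B] : nbhs y B by apply: open_nbhs_nbhs.
pose d := Num.min d1 d2; have d0 : 0 < d by rewrite lt_min d10.
have dd1 : d <= d1 by rewrite ge_min lexx.
have dd2 : d <= d2 by rewrite ge_min lexx orbT.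
have d4 : 0 < d / 4 by rewrite divr_gt0.
have N0 : \forall h \near (0 : R)^', h != 0 /\ `|h| <= d / 4.
 by near=> h; split; [near: h; exact: nbhs_dnbhs_neq | near: h; exact: dnbhs0_le].
have N1 : \forall h \near (0 : R)^', (straight @` B) (w + h *: e_ l) /\ `|unstr (w + h *: e_ l) ord0 i - y ord0 i| <= d / 4.
 apply: nbhs_dnbhs.
 have c0 : {for 0, continuous (fun h : R => w + h *: e_ l)}.
  by apply: continuousD; [exact: cst_continuous | exact: scalel_continuous].
 have := straight_near By d4; rewrite Ey => /filterS N.
 have {}N : \forall w' \near w + 0 *: e_ l, (straight @` B) w' /\ `|unstr w' ord0 i - y ord0 i| <= d / 4.
  by rewrite scale0r addr0; apply: N => w' [].
 exact: c0 _ N.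
apply: filterS (filterI N0 N1) => h [[h0 hd] [Wh hD]].
set yh := unstr (w + h *: e_ l) in hD *.
pose D := yh ord0 i - y ord0 i.
pose y' := y + ((l != i)%:R * h) *: e_ l.
have [Byh Eyh] := unstrK Wh; rewrite -/yh in Byh Eyh.
have Eh : yh = y' + D *: e_ i.
 apply/rowP => k; rewrite !coordD; case: (eqVneq k i) => [->|ki].
  have -> : (l != i)%:R * h * (i == l)%:R = 0.
   by rewrite [i == l]eq_sym; case: (l == i); rewrite /= ?mulr0n ?mulr0 ?mul0r.
  by rewrite mulr1 addr0 addrC subrK.
 rewrite mulr0 addr0 unstr_other // coordD [y ord0 k]unstr_other //.
 congr (_ + _); case: (eqVneq k l) => [kl|_]; last by rewrite !mulr0.
 by rewrite -kl ki mul1r.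
have bd (s t : R) : `|s| <= d / 4 -> `|t| <= d / 4 -> ball y d (y + s *: e_ l + t *: e_ i).
 move=> sd td; apply: ballV => // k; rewrite !coordD.
 have H1 : `|s * (k == l)%:R| <= d / 4.
  by rewrite normrM; apply: le_trans sd; rewrite ler_piMr //; case: (k == l); rewrite ?normr1 ?normr0.
 have H2 : `|t * (k == i)%:R| <= d / 4.
  by rewrite normrM; apply: le_trans td; rewrite ler_piMr //; case: (k == i); rewrite ?normr1 ?normr0.
 rewrite -addrA opprD addrA subrr sub0r normrN; apply: le_lt_trans (ler_normD _ _) _.
 apply: le_lt_trans (lerD H1 H2) _; lra.
have hle : `|(l != i)%:R * h| <= d / 4.
 by rewrite normrM; apply: le_trans hd; rewrite ler_piMl //; case: (l != i); rewrite ?normr1 ?normr0.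
have d40 : `|0 : R| <= d / 4 by rewrite normr0 ltW.
have bB z : ball y d z -> B z by move=> H; apply: d2B; exact: le_ball H.
have b1 z : ball y d z -> ball y d1 z by move=> H; exact: le_ball H.
have [s sD Es] : exists2 s : R, `|s| <= `|D| & u (y' + D *: e_ i) - u y' = D * 'D_(e_ i) u (y' + s *: e_ i).
 apply: line_MVT => t tD; apply: smooth_on_derivable su _; apply/bB/bd => //.
 exact: le_trans tD hD.
have [t tH Et] : exists2 t : R, `|t| <= `|(l != i)%:R * h| &
  u (y + ((l != i)%:R * h) *: e_ l) - u y = (l != i)%:R * h * 'D_(e_ l) u (y + t *: e_ l).
 apply: line_MVT => t th; apply: smooth_on_derivable su _; apply: bB.
 by have := bd t 0 (le_trans th hle) d40; rewrite scale0r addr0.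
have uy : u y = w ord0 i by rewrite -Ey setcE eqxx.
have uyh : u yh = w ord0 i + h * (l == i)%:R.
 by have /rowP/(_ i) := Eyh; rewrite setcE eqxx coordD [i == l]eq_sym.
have bs : ball y d (y' + s *: e_ i) by apply: bd => //; exact: le_trans sD hD.
have bt : ball y d (y + t *: e_ l).
 by have := bd t 0 (le_trans tH hle) d40; rewrite scale0r addr0.
have pos : pd i u (y' + s *: e_ i) != 0 by rewrite lt0r_neq0 // du //; exact: bB.
have ED : D = h * unstr_slope l (y' + s *: e_ i) (y + t *: e_ l).
 have : u yh - u y = D * pd i u (y' + s *: e_ i) + (l != i)%:R * h * pd l u (y + t *: e_ l).
  by rewrite -Et -Es -Eh /y' addrA subrK.
 rewrite uyh uy addrC addKr /unstr_slope => E.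
 by rewrite mulrA mulrBr E mulrA [h * _%:R in X in _ - X]mulrC addrK mulfK.
have -> : h^-1 *: ((g \o shift w) (h *: e_ l) - g w) = unstr_slope l (y' + s *: e_ i) (y + t *: e_ l).
 rewrite /g /= [h *: e_ l + w]addrC -/yh -/y -/D ED /GRing.scale /= mulKf //.
by apply: (Hd (y' + s *: e_ i, y + t *: e_ l)); split; exact: b1.
Unshelve. all: end_near. Qed.

(** Bootstrapping: the derivative of the inverse is a smooth function composed with the inverse, so
    C^k of the inverse gives C^(k+1). *)
Lemma unstr_smooth l : smooth_on (straight @` B) (fun w => unstr w ord0 l).
Proof.
have oW := straight_open.
have step k : Ck k (straight @` B) (fun w => unstr w ord0 i) ->
  forall l, Ck k (straight @` B) (fun w => unstr w ord0 l).
 move=> H {}l; have [->//|li] := eqVneq l i.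
 apply: (@Ck_ext _ _ _ _ (fun w : V => w ord0 l)) (Ck_coord _ _ _) => // w Ww.
 by rewrite unstr_other.
move=> k; apply: (step k); elim: k => [|k IH].
 by split=> // w Ww; apply: continuous_comp (unstr_cont Ww) (@coord_cont _ _ _ _).
split=> [w Ww|m]; first by apply: continuous_comp (unstr_cont Ww) (@coord_cont _ _ _ _).
split=> [w Ww|]; first by case: (unstr_der m Ww).
apply: (@Ck_ext _ _ _ _ ((fun z => unstr_slope m z z) \o unstr)) => //.
 by move=> w Ww; case: (unstr_der m Ww).
apply: (@Ck_comp R n k _ B _ _ oW oB) => [w /unstrK[]//| |j]; last exact: step IH j.
have C1 := smooth_partial m su k; have C2 := smooth_partial i su k.
apply: (@CkM _ _ _ _ (fun z => (m == i)%:R - (m != i)%:R * pd m u z) (fun z => (pd i u z)^-1)) => //.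
 apply: CkD => //; first exact: Ck_cst.
 by apply: CkN => //; apply: CkM => //; exact: Ck_cst.
by apply: CkV => // z Bz; rewrite lt0r_neq0 // du.
Qed.

Lemma straight_smooth l : smooth_on B (fun y => straight y ord0 l).
Proof.
have [->|li] := eqVneq l i.
 by apply: sm_ext oB _ su => y _; rewrite setcE eqxx.
apply: sm_ext oB _ (@sm_coord _ _ B l) => y _.
by rewrite setcE (negbTE li).
Qed.
End Straightening.

(** * Smooth functions in charts, and charts with prescribed coordinates *)

Section Charts.
Variables (R : realType) (n : nat) (M : manifold R n).
Local Notation V := 'rV[R]_n.
Local Notation e_ i := (delta_mx ord0 i : V).
Implicit Types (c : chart R n M) (U W : set M) (p x : M) (F G : M -> R).

(** Membership in the maximal atlas: charts built below with prescribed functions as coordinates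
    need not belong to [atlas M]. *)
Definition compat c := forall c', atlas M c' -> forall i : 'I_n,
 smooth_on (cmap c @` (dom c `&` dom c')) (fun y => cmap c' (cinv c y) ord0 i) /\
 smooth_on (cmap c' @` (dom c' `&` dom c)) (fun y => cmap c (cinv c' y) ord0 i).
Lemma atlas_compatP c : atlas M c -> compat c.
Proof. by move=> ac c' ac' i; split; exact: atlas_compatible. Qed.
Lemma chart_im_open c U : open U -> open (cmap c @` (dom c `&` U)).
Proof.
move=> oU; rewrite openE => _ [x [cx Ux] <-].
have N1 : nbhs (cmap c x) (cmap c @` dom c).
 by apply: open_nbhs_nbhs; split; [exact: cmap_open | exists x].
have N2 : \forall y \near cmap c x, U (cinv c y).
 have := @cinv_cont _ _ _ c (cmap c x) (ex_intro2 _ _ x cx erefl).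
 by apply; rewrite /= cmapK //; apply: open_nbhs_nbhs.
apply: filterS (filterI N1 N2) => _ [[z cz <-]]; rewrite /= cmapK // => Uz.
by exists z.
Qed.

Lemma smoothR_sub U W F : W `<=` U -> smoothR U F -> smoothR W F.
Proof.
move=> WU sF c ac; apply: sm_sub (sF c ac).
by move=> _ [x [cx Wx] <-]; exists x => //; split=> //; exact: WU.
Qed.
Lemma smoothR_congr W F G : open W -> (forall x, W x -> F x = G x) ->
 smoothR W F -> smoothR W G.
Proof.
move=> oW FG sF c ac; apply: sm_ext (sF c ac); first exact: chart_im_open.
by move=> _ [x [cx Wx] <-]; rewrite /= cmapK // FG.
Qed.
Lemma smoothR_local U F : (forall x, U x -> exists W, [/\ open W, W x & smoothR W F]) ->
 smoothR U F.
Proof.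
move=> H c ac; apply: sm_local => _ [x [cx Ux] <-].
have [W [oW Wx sF]] := H x Ux.
exists (cmap c @` (dom c `&` W)); split; [exact: chart_im_open | by exists x | exact: sF].
Qed.
Lemma chart_smooth c W F : compat c -> open W -> W `<=` dom c ->
 smooth_on (cmap c @` W) (F \o cinv c) -> smoothR W F.
Proof.
move=> cc oW Wc sF c' ac'; have oI := @chart_im_open c' _ oW.
apply: sm_ext (oI) _ (@sm_comp R n _ (cmap c @` W) (F \o cinv c)
  (fun y => cmap c (cinv c' y)) oI _ _ sF _).
- by move=> _ [x [cx Wx] <-] /=; rewrite !cmapK //; exact: Wc.
- by have := @chart_im_open c _ oW; rewrite (setIidr Wc).
- by move=> _ [x [cx Wx] <-]; exists x => //; rewrite cmapK.
move=> j; have [_ s2] := cc c' ac' j; apply: sm_sub s2.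
by move=> _ [x [cx Wx] <-]; exists x => //; split=> //; exact: Wc.
Qed.

Lemma sm_chart c W F : compat c -> open W -> smoothR W F ->
 smooth_on (cmap c @` (dom c `&` W)) (F \o cinv c).
Proof.
move=> cc oW sF; apply: sm_local => _ [x [cx Wx] <-].
have [c' ac' c'x] := atlas_cover x.
pose W' := W `&` dom c'; have oW' : open W' by apply: openI => //; exact: dom_open.
have oI := @chart_im_open c _ oW'.
exists (cmap c @` (dom c `&` W')); split=> //; first by exists x.
apply: sm_ext (oI) _ (@sm_comp R n _ (cmap c' @` (dom c' `&` W)) (F \o cinv c')
  (fun y => cmap c' (cinv c y)) oI _ _ (sF c' ac') _).
- by move=> _ [z [cz [Wz c'z]] <-] /=; rewrite !cmapK.
- exact: chart_im_open.
- by move=> _ [z [cz [Wz c'z]] <-]; exists z => //; rewrite cmapK.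
move=> j; have [s1 _] := cc c' ac' j; apply: sm_sub s1.
by move=> _ [z [cz [Wz c'z]] <-]; exists z.
Qed.

Lemma rval_chart c (f : smooth_real M) : compat c ->
 smooth_on (cmap c @` dom c) (rval f \o cinv c).
Proof.
by move=> cc; have := sm_chart cc openT (smooth_realP f); rewrite setIT.
Qed.
Lemma nnopen p (P : M -> Prop) : (\forall x \near p, P x) ->
 exists W : set M, [/\ open W, W p & forall x, W x -> P x].
Proof.
rewrite /prop_near1 nbhsE => -[W [oW Wp] WP]; by exists W.
Qed.
Lemma glue_real F : (forall p, exists f : smooth_real M, \forall x \near p, F x = rval f x) ->
 exists f : smooth_real M, forall x, rval f x = F x.
Proof.
move=> H; have sF : smoothR setT F.
 apply: smoothR_local => p _; have [f /nnopen [W [oW Wp WF]]] := H p.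
 exists W; split=> //; apply: smoothR_congr oW (fun x Wx => esym (WF x Wx)) _.
 exact: smoothR_sub (@subsetT _ _) (smooth_realP f).
by exists (mk_real sF).
Qed.
Lemma glue_complex (F : M -> R[i]) :
 (forall p, exists f : smooth_complex M, \forall x \near p, F x = cval f x) ->
 exists f : smooth_complex M, forall x, cval f x = F x.
Proof.
move=> H; have [f1 E1] : exists f : smooth_real M, forall x, rval f x = complex.Re (F x).
 apply: glue_real => p; have [f Hf] := H p; exists (re f).
 by apply: filterS Hf => x ->.
have [f2 E2] : exists f : smooth_real M, forall x, rval f x = complex.Im (F x).
 apply: glue_real => p; have [f Hf] := H p; exists (im f).
 by apply: filterS Hf => x ->.
exists (toCx f1 + ccst M 'i * toCx f2) => x.
have -> : cval (toCx f1 + ccst M 'i * toCx f2) x =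
 (rval f1 x)%:C + 'i * (rval f2 x)%:C by [].
by rewrite E1 E2 -complexE.
Qed.

Lemma closed_ballV_cpt (y : V) (r : R) : compact [set z : V | `|z - y| <= r].
Proof.
apply: bounded_closed_compact.
 exists (`|y| + r); split; first exact: num_real.
 move=> k kr z /= zr; apply: ltW; apply: le_lt_trans kr.
 by rewrite -(subrK y z) addrC; apply: le_trans (ler_normD _ _) _; rewrite lerD2l.
have -> : [set z : V | `|z - y| <= r] = (fun z : V => `|z - y|) @^-1` [set t | t <= r] by [].
apply: closed_comp; last exact: closed_le.
move=> z _; apply: continuous_comp; last exact: norm_continuous.
by apply: continuousB; [exact: cvg_id | exact: cst_continuous].
Qed.

(* Extends by zero a function given near [p] in a chart, after cutting it off *)
(* outside a compact ball of that chart.                                      *)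
Lemma chart_extend c U p (O : set V) (phi : V -> R) :
 compat c -> open U -> U p -> dom c p -> open O -> O (cmap c p) -> smooth_on O phi ->
 exists f : smooth_real M, (\forall x \near p, rval f x = phi (cmap c x)) /\
  exists K : set M, [/\ closed K, compact K, K `<=` U `&` dom c &
    forall x, ~ K x -> rval f x = 0].
Proof.
move=> cc oU Up cp oO Op sphi; set y0 := cmap c p in Op *.
have oD := @chart_im_open c _ oU.
have /nbhs_ballP[e /= e0 eB] : nbhs y0 (O `&` (cmap c @` (dom c `&` U))).
 by apply: open_nbhs_nbhs; split; [exact: openI | split=> //; exists p].
pose r := e / 4; have r0 : 0 < r by rewrite divr_gt0.
have [chi [schi chi1 chi0]] := bump y0 r0.
pose B := [set z : V | `|z - y0| <= r *+ 2].
have BO : B `<=` O `&` (cmap c @` (dom c `&` U)).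
 move=> z Bz; apply: eB; rewrite -ball_normE /ball_ /= distrC; apply: le_lt_trans Bz _.
 by rewrite /r mulr2n; lra.
have cB : compact B by exact: closed_ballV_cpt.
have clB : closed B by apply: compact_closed cB; exact: norm_hausdorff.
have schiphi : smooth_on setT (chi * phi).
 move=> k; apply: (@Ck_cutoff _ _ _ O _ _ B oO clB) => //.
 - by move=> z /BO[].
 - by move=> z /negP; rewrite -ltNge => /ltW; exact: chi0.
pose K := cinv c @` B.
have KU : K `<=` U `&` dom c.
 by move=> _ [z /BO[_ [x [cx Ux] <-]] <-]; rewrite cmapK.
have cK : compact K.
 apply: continuous_compact => //; apply: cont_subT => z.
 by rewrite inE => /BO[_ [x [cx Ux] <-]]; apply: cinv_cont; exists x.
have clK : closed K by apply: compact_closed cK; exact: manifold_hausdorff.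
pose F x := if pselect (dom c x) then (chi * phi) (cmap c x) else 0.
have FK x : ~ K x -> F x = 0.
 rewrite /F; case: pselect => // cx nK; rewrite fctE chi0 ?mul0r // ltW // ltNge.
 by apply/negP => Bx; apply: nK; exists (cmap c x) => //; rewrite cmapK.
have FD x : dom c x -> F x = (chi * phi) (cmap c x) by rewrite /F; case: pselect.
have sF : smoothR setT F.
 apply: smoothR_local => x _; have [cx|ncx] := pselect (dom c x).
  exists (dom c); split=> //; first exact: dom_open.
  apply: (@chart_smooth c) => //; first exact: dom_open.
  apply: sm_ext (@cmap_open _ _ _ c) _ (sm_sub (@subsetT _ _) schiphi).
  by move=> _ [z cz <-]; rewrite /= cmapK // FD.
 exists (~` K); split; first exact: closed_openC.
  by move=> /KU[_ /ncx].
 apply: smoothR_congr (closed_openC clK) _ (@smoothR_sub setT _ _ (@subsetT _ _) (@smoothR_cst _ _ M 0)).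
 by move=> z /FK.
exists (mk_real sF); split; last by exists K.
have N1 : \forall x \near p, `|cmap c x - y0| <= r.
 apply: (@cmap_cont _ _ _ c p cp [set z | `|z - y0| <= r]).
 by apply/nbhs_ballP; exists r => //= z; rewrite -ball_normE /= distrC => /ltW.
have N2 : \forall x \near p, dom c x by apply: open_nbhs_nbhs; split=> //; exact: dom_open.
apply: filterS (filterI N1 N2) => x [xr cx].
by rewrite [LHS]FD // fctE chi1 // mul1r.
Qed.

Lemma bump_real U p : open U -> U p -> exists chi : smooth_real M,
 [/\ \forall x \near p, rval chi x = 1,
   exists K : set M, [/\ closed K, compact K, K `<=` U & forall x, ~ K x -> rval chi x = 0] &
   forall x, U x \/ \forall y \near x, rval chi y = 0].
Proof.
move=> oU Up; have [c /atlas_compatP cc cp] := atlas_cover p.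
have [f [f1 [K [clK cK KU fK]]]] := chart_extend cc oU Up cp openT Logic.I
  (smooth_on_cst setT (1 : R)).
have KU' : K `<=` U by move=> x /KU[].
exists f; split=> //; first by exists K.
move=> x; have [Kx|nKx] := pselect (K x); [by left; exact: KU' | right].
by apply: filterS (open_nbhs_nbhs (conj (closed_openC clK) nKx)) => y; exact: fK.
Qed.

Lemma rval_cont (f : smooth_real M) p : {for p, continuous (rval f)}.
Proof.
have [c ac cp] := atlas_cover p; have cc := atlas_compatP ac.
have E : \forall x \near p, (rval f \o cinv c \o cmap c) x = rval f x.
 apply: filterS (open_nbhs_nbhs (conj (@dom_open _ _ _ c) cp)) => x cx.
 by rewrite /= cmapK.
rewrite /prop_for /continuous_at -(nbhs1 E).
apply: cvg_trans (near_eq_cvg E) _.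
apply: continuous_comp; first exact: cmap_cont.
by apply: smooth_cont (rval_chart f cc) _; exists p.
Qed.

(** The straightening map is applied to u when its derivative is positive and to -u otherwise; the
    reflection [rf] then restores the sign. *)
Lemma straighten c p (u : smooth_real M) (i : 'I_n) : compat c -> dom c p ->
 pd i (rval u \o cinv c) (cmap c p) != 0 ->
 exists c', [/\ compat c', dom c' p, dom c' `<=` dom c &
  forall x, dom c' x -> forall l,
   cmap c' x ord0 l = if l == i then rval u x else cmap c x ord0 l].
Proof.
move=> cc cp du0; set y0 := cmap c p in du0.
pose s : R := if 0 < pd i (rval u \o cinv c) y0 then 1 else -1.
have ss : s * s = 1 by rewrite /s; case: ifP; rewrite ?mulr1 // mulrNN mulr1.
pose f := cst s * (rval u \o cinv c).
have oD := @cmap_open _ _ _ c; have Dp : (cmap c @` dom c) y0 by exists p.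
have sf : smooth_on (cmap c @` dom c) f.
 by apply: smooth_onM => //; [exact: smooth_on_cst | exact: rval_chart].
have Ef y : (cmap c @` dom c) y -> pd i f y = s * pd i (rval u \o cinv c) y.
 move=> Dy; have D := derivableP (smooth_on_derivable (rval_chart u cc) Dy).
 rewrite /pd (@derive_val _ _ _ _ _ _ _ (is_deriveM (is_derive_cst s y (e_ i)) (D i))).
 by rewrite scaler0 addr0.
have fp : 0 < pd i f y0.
 rewrite Ef // /s; case: ifPn => H; first by rewrite mul1r.
 by rewrite mulN1r oppr_gt0 lt_neqAle du0 leNgt.
have sdf := smooth_partial i sf.
have cdf : {for y0, continuous (pd i f)} by exact: smooth_cont sdf Dp.
have N1 : \forall y \near y0, 0 < pd i f y.
 by apply: (cdf [set t | 0 < t]); apply: open_nbhs_nbhs; split=> //; exact: open_gt.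
have N2 : nbhs y0 (cmap c @` dom c) by exact: open_nbhs_nbhs.
have N12 : nbhs y0 ([set y | 0 < pd i f y] `&` (cmap c @` dom c)) by exact: filterI.
have /nbhs_ballP[r /= r0 rB] := N12.
pose B := ball y0 r; have eB : B = ball y0 r by [].
have BD y : B y -> (cmap c @` dom c) y by move=> /rB[].
have sB : smooth_on B f by apply: sm_sub sf.
have dB y : B y -> 0 < pd i f y by move=> /rB[].
have oB : open B by exact: ball_open.
pose S := straight i f; pose T := unstr i f B.
have oS : open (S @` B) := straight_open eB r0 sB dB.
have TK y : B y -> T (S y) = y by exact: (straightK eB r0 sB dB).
have ST w : (S @` B) w -> B (T w) /\ S (T w) = w by exact: (unstrK eB r0 sB dB).
pose rf (w : V) := setc i w (s * w ord0 i).
have rfK w : rf (rf w) = w.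
 by rewrite /rf setcE eqxx mulrA ss mul1r set_coordK set_coord_id.
have srf O l : smooth_on O (fun w => rf w ord0 l).
 have [->|li] := eqVneq l i.
  have -> : (fun w => rf w ord0 i) = cst s * (fun w : V => w ord0 i).
   by fext => w; rewrite /rf setcE eqxx.
  apply: (@sm_sub _ _ setT) => //; apply: smooth_onM; first exact: openT.
   exact: smooth_on_cst.
  exact: sm_coord.
 have -> : (fun w => rf w ord0 l) = (fun w : V => w ord0 l).
  by fext => w; rewrite /rf setcE (negbTE li).
 exact: sm_coord.
have crf w : {for w, continuous rf}.
 apply: cont_coords => l; exact: smooth_cont (srf setT l) Logic.I.
have orf (O : set V) : open O -> open (rf @^-1` O).
 by move=> oO; apply: open_comp => // w _; exact: crf.
pose D := [set x | dom c x /\ B (cmap c x)].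
have oD' : open D.
 rewrite openE => x [cx Bx]; have N3 : \forall z \near x, B (cmap c z).
  by apply: (@cmap_cont _ _ _ c x cx B); apply: open_nbhs_nbhs.
 by apply: filterI N3; apply: open_nbhs_nbhs; split=> //; exact: dom_open.
pose cm x := rf (S (cmap c x)); pose ci w := cinv c (T (rf w)).
have cinvB y : B y -> dom c (cinv c y) /\ cmap c (cinv c y) = y.
 by move=> /BD[x cx <-]; rewrite cmapK.
have img : cm @` D = rf @^-1` (S @` B).
 apply/seteqP; split=> [_ [x [cx Bx] <-]|w /= Sw]; first by rewrite /= /cm rfK; exists (cmap c x).
 have [BT ET] := ST _ Sw; have [d1 d2] := cinvB _ BT.
 exists (ci w); first by split=> //; rewrite /ci d2.
 by rewrite /cm /ci d2 ET rfK.
have oimg : open (cm @` D) by rewrite img; exact: orf.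
have cK x : D x -> ci (cm x) = x by move=> [cx Bx]; rewrite /ci /cm rfK TK // cmapK.
have cSf y : B y -> {for y, continuous S}.
 move=> By; apply: cont_coords => l.
 have H : smooth_on B (fun y => S y ord0 l) by exact: (straight_smooth i eB sB l).
 exact: (smooth_cont H By).
have ccm x : D x -> {for x, continuous cm}.
 move=> [cx Bx]; apply: continuous_comp; last exact: crf.
 by apply: continuous_comp; [exact: cmap_cont | exact: cSf].
have cci w : (cm @` D) w -> {for w, continuous ci}.
 rewrite img => /= Sw; have [BT ET] := ST _ Sw.
 apply: (@continuous_comp _ _ _ (T \o rf)); last by apply: cinv_cont; exact: BD.
 apply: continuous_comp; first exact: crf.
 exact: (unstr_cont eB r0 sB dB Sw).
pose c' := Chart oD' oimg cK ccm cci.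
have Ec x : D x -> forall l, cm x ord0 l = if l == i then rval u x else cmap c x ord0 l.
 move=> [cx Bx] l; rewrite /cm /rf setcE /S setcE eqxx.
 case: eqVneq => [_|li]; last by rewrite setcE (negbTE li).
 by rewrite /f fctE /= cmapK // mulrA ss mul1r.
exists c'; split=> //; last by move=> x [].
 move=> c'' ac'' l; split.
  have oI := @chart_im_open c' _ (@dom_open _ _ _ c'').
  apply: sm_ext (oI) _ (@sm_comp R n _ (cmap c @` (dom c `&` dom c''))
    (fun y => cmap c'' (cinv c y) ord0 l) (T \o rf) oI _ _ (cc _ ac'' l).1 _) => //.
  - by apply: chart_im_open; exact: dom_open.
  - move=> _ [x [[cx Bx] c''x] <-]; exists x => //.
   by rewrite /= /cm rfK TK.
  move=> j; apply: (@sm_comp R n _ (S @` B) (fun w => T w ord0 j) rf) => //.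
  - by move=> _ [x [[cx Bx] c''x] <-]; rewrite /= /cm rfK; exists (cmap c x).
  - exact: (unstr_smooth eB r0 sB dB).
 have oI := @chart_im_open c'' _ oD'.
 have [li|li] := eqVneq l i.
  apply: sm_ext (oI) _ (sm_sub _ (rval_chart u (atlas_compatP ac''))).
   move=> _ [x [c''x Dx] <-]; rewrite /= cmapK // Ec // li eqxx //.
  by move=> _ [x [c''x Dx] <-]; exists x.
 apply: sm_ext (oI) _ (sm_sub _ (cc _ ac'' l).2).
  by move=> _ [x [c''x Dx] <-]; rewrite /= cmapK // Ec // (negbTE li).
 by move=> _ [x [c''x [cx Bx]] <-]; exists x.
by split=> //; exact: ballxx.
Qed.
End Charts.

(** * Algebras of smooth functions and frames *)

(** The local properties shared by the real and the complex function algebras, so that arguments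
    about derivations, ideals and gluing are made once for both. *)
Record nice (K : fieldType) (X : topologicalType) (A : falg K X) : Prop := Nice {
 nD : forall (f g : A) x, ev (f + g) x = ev f x + ev g x;
 nM : forall (f g : A) x, ev (f * g) x = ev f x * ev g x;
 n1 : forall x, ev (1 : A) x = 1;
 n_scalar : forall a x, ev (Defs.scalar A a) x = a;
 n_inj : forall f g : A, (forall x, ev f x = ev g x) -> f = g;
 n_open : forall (f : A) p, ev f p != 0 -> \forall x \near p, ev f x != 0;
 n_bump : forall (U : set X) p, open U -> U p -> exists chi : A,
  (\forall x \near p, ev chi x = 1) /\ forall x, U x \/ \forall y \near x, ev chi y = 0;
 n_inv : forall (f : A) p, ev f p != 0 -> exists g : A, \forall x \near p, ev f x * ev g x = 1;
 n_glue : forall F : X -> K, (forall p : X, exists f : A, \forall x \near p, F x = ev f x) ->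
  exists f : A, forall x, ev f x = F x;
 n_smooth : forall (U : set X) (F : X -> K), open U ->
  (locally_smooth A U F <-> forall x : X, U x -> exists f : A, \forall y \near x, F y = ev f y) }.

Section Nice.
Variables (K : fieldType) (X : topologicalType) (A : falg K X) (nA : nice A).
Implicit Types (f g : A) (p x : X) (I : ideal A).

Lemma n0 x : ev (0 : A) x = 0.
Proof. by apply: (addrI (ev (0 : A) x)); rewrite -(nD nA) !addr0. Qed.
Lemma nN f x : ev (- f) x = - ev f x.
Proof. by apply: (addrI (ev f x)); rewrite -(nD nA) !subrr n0. Qed.
Lemma nB f g x : ev (f - g) x = ev f x - ev g x.
Proof. by rewrite (nD nA) nN. Qed.
Lemma n_sum (J : Type) (r : seq J) (P : pred J) (F : J -> A) x :
 ev (\sum_(i <- r | P i) F i) x = \sum_(i <- r | P i) ev (F i) x.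
Proof.
by apply: (big_morph (fun f => ev f x)) => [f g|]; [exact: (nD nA) | exact: n0].
Qed.
Lemma n_prod (J : Type) (r : seq J) (P : pred J) (F : J -> A) x :
 ev (\prod_(i <- r | P i) F i) x = \prod_(i <- r | P i) ev (F i) x.
Proof.
by apply: (big_morph (fun f => ev f x)) => [f g|]; [exact: (nM nA) | exact: (n1 nA)].
Qed.
Lemma n_exp f k x : ev (f ^+ k) x = ev f x ^+ k.
Proof. by elim: k => [|k IH]; rewrite ?expr0 ?(n1 nA) // !exprS (nM nA) IH. Qed.
Lemma near_nbhsO p (P : X -> Prop) : (\forall x \near p, P x) ->
 exists W : set X, [/\ open W, W p & forall x, W x -> P x].
Proof.
rewrite /prop_near1 nbhsE => -[W [oW Wp] WP]; by exists W.
Qed.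
Definition nE := (nM nA, nB, nD nA, nN, n0, n1 nA, n_exp).
(** The Leibniz rule applied to chi f = 0, with chi a bump function equal to 1 near p. *)
Lemma vect_local0 I (V : vect I) f p : (\forall x \near p, ev f x = 0) ->
 \forall x \near p, ev (V f) x = 0.
Proof.
move=> /near_nbhsO [W [oW Wp WF]].
have [chi [chi1 chi0]] := n_bump nA oW Wp.
have E : chi * f = 0.
 apply: (n_inj nA) => x; rewrite !nE; case: (chi0 x) => [/WF ->|/nbhs1 ->].
  by rewrite mulr0.
 by rewrite mul0r.
have {}E x : ev (V chi) x * ev f x + ev chi x * ev (V f) x = 0.
 by rewrite -!(nM nA) -(nD nA) -vectM E (vect0 V) n0.
have oWp : \forall x \near p, W x by apply: open_nbhs_nbhs.
apply: filterS (filterI oWp chi1) => x [Wx chix]; move: (E x).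
by rewrite WF // chix mulr0 add0r mul1r.
Qed.

Lemma vect_local I (V : vect I) f g p : (\forall x \near p, ev f x = ev g x) ->
 \forall x \near p, ev (V f) x = ev (V g) x.
Proof.
move=> H; have : \forall x \near p, ev (V (f - g)) x = 0.
 by apply: vect_local0; apply: filterS H => x fg; rewrite !nE fg subrr.
by apply: filterS => x; rewrite vectD (vectN V) !nE => /eqP; rewrite subr_eq0 => /eqP.
Qed.
Lemma vect_sum (J : Type) (r : seq J) (P : pred J) I (F : J -> vect I) f :
 (\sum_(i <- r | P i) F i) f = \sum_(i <- r | P i) F i f.
Proof. by apply: (big_morph (fun V : vect I => V f)). Qed.
Lemma nopen (W : set X) p : open W -> W p -> \forall x \near p, W x.
Proof. by move=> oW Wp; apply: open_nbhs_nbhs. Qed.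
Definition dense_supp (J : Type) (a : J -> A) :=
 forall (x : X) (N : set X), nbhs x N -> exists2 y, N y & exists i, ev (a i) y != 0.
Lemma solve_uniq (J : Type) (a : J -> A) (W : set X) (h k : A) : dense_supp a -> open W ->
 (forall i y, W y -> ev (a i) y * ev h y = ev (a i) y * ev k y) ->
 forall y, W y -> ev h y = ev k y.
Proof.
move=> dense oW E y Wy; apply/eqP/negP => /negP; rewrite -subr_eq0 -nB => hk.
have [z [dz Wz] [i ai]] := dense y _ (filterI (n_open nA hk) (nopen oW Wy)).
by move/eqP: (E i z Wz); rewrite -subr_eq0 -mulrBr mulf_eq0 (negPf ai) -nB (negPf dz).
Qed.
(** On the dense set where some a_i is nonzero the solution is determined, so local solutions agree
    and glue. *)
Lemma solve_locally (J : Type) (a b : J -> A) : dense_supp a ->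
 (forall p : X, exists h : A, \forall y \near p, forall i, ev (a i * h) y = ev (b i) y) ->
 exists h : A, forall i, a i * h = b i.
Proof.
move=> dense /choice [h H].
have agree p : \forall x \near p, ev (h x) x = ev (h p) x.
 have [W [oW Wp WE]] := near_nbhsO (H p).
 apply: filterS (nopen oW Wp) => x Wx; have [W' [oW' W'x W'E]] := near_nbhsO (H x).
 apply: (@solve_uniq _ a (W `&` W') _ _ dense) => //; first exact: openI.
 by move=> i y [Wy W'y]; rewrite -!nE WE // W'E.
have [g gE] : exists g, forall x, ev g x = ev (h x) x.
 by apply: (n_glue nA) => p; exists (h p); apply: agree.
exists g => i; apply: (n_inj nA) => x; have := nbhs1 (H x) i.
by rewrite !nE gE.
Qed.
End Nice.

Section NiceFunctions.
Variables (R : realType) (n : nat) (M : manifold R n).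

Lemma nice_CR : nice (CR M).
Proof.
split=> //=.
- exact: rval_inj.
- move=> f p fp; have := @rval_cont _ _ _ f p; move/cvgr_neq0 => /(_ fp); exact.
- move=> U p oU Up; have [chi [c1 _ c3]] := bump_real oU Up.
 by exists chi.
- move=> f p fp; have [c ac cp] := atlas_cover p; have cc := atlas_compatP ac.
 have oN : open [set x | rval f x != 0].
  rewrite openE => x /= fx; have := @rval_cont _ _ _ f x; move/cvgr_neq0 => /(_ fx); exact.
 pose W := dom c `&` [set x | rval f x != 0].
 have oW : open W by apply: openI => //; exact: dom_open.
 have oI := @chart_im_open _ _ _ c _ oW.
 have := @sm_onV R n (cmap c @` (dom c `&` W)) (rval f \o cinv c) oI.
 move=> H; have {}H : smooth_on (cmap c @` (dom c `&` W)) (fun y => ((rval f \o cinv c) y)^-1).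
  apply: H; first by move=> _ [x [cx [_ fx]] <-] /=; rewrite cmapK.
  apply: sm_sub (rval_chart f cc) => _ [x [cx _] <-]; by exists x.
 have [] := @chart_extend R n M c W p _ _ cc oW _ cp oI _ H => //.
  by exists p.
 move=> g [gE _]; exists g.
 apply: filterS (filterI gE (nopen oW (conj cp fp))) => x [-> [cx fx]] /=.
 by rewrite cmapK // mulfV.
- move=> F H; apply: glue_real => p; have [f fE] := H p; by exists f.
- move=> U F oU; split=> [sF x Ux|H].
  have [c ac cx] := atlas_cover x; have cc := atlas_compatP ac.
  have oI := @chart_im_open _ _ _ c _ oU.
  have [] := @chart_extend R n M c U x _ _ cc oU Ux cx oI _ (sF c ac).
   by exists x.
  move=> g [gE _]; exists g; apply: filterS (filterI gE (nopen (@dom_open _ _ _ c) cx)).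
  by move=> y [-> cy] /=; rewrite cmapK.
 apply: smoothR_local => x Ux; have [f /nnopen [W [oW Wx WE]]] := H x Ux.
 exists W; split=> //; apply: (@smoothR_congr _ _ _ W (rval f)) => //.
  by move=> y Wy; rewrite WE.
 by apply: smoothR_sub (smooth_realP f).
Qed.

Lemma cval_conj (f : CC M) x : cval (conjA f) x = (cval f x)^*%C.
Proof.
have -> : cval (conjA f) x = (complex.Re (cval f x))%:C - 'i * (complex.Im (cval f x))%:C by [].
by case: (cval f x) => a b; apply/eqP; rewrite eq_complex /=;
  apply/andP; split; apply/eqP; ring.
Qed.
Lemma nice_CC : nice (CC M).
Proof.
have cD (f g : CC M) x : cval (f + g) x = cval f x + cval g x by [].
have cM (f g : CC M) x : cval (f * g) x = cval f x * cval g x by [].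
have neq0P (z : R[i]) : z != 0 -> 0 < complex.Re z ^+ 2 + complex.Im z ^+ 2.
 case: z => a b; rewrite eq_complex /= negb_and => /orP[] h.
  by rewrite ltr_wpDr ?sqr_ge0 // lt0r sqr_ge0 expf_neq0.
 by rewrite ltr_wpDl ?sqr_ge0 // lt0r sqr_ge0 expf_neq0.
have neq0E (z : R[i]) : complex.Re z ^+ 2 + complex.Im z ^+ 2 != 0 -> z != 0.
 by case: z => a b; apply: contraNneq => -[-> ->] /=; rewrite !expr0n addr0.
have sqE (f : CC M) x : rval (re f ^+ 2 + im f ^+ 2) x =
  complex.Re (cval f x) ^+ 2 + complex.Im (cval f x) ^+ 2 by [].
split=> //=.
- exact: cval_inj.
- move=> f p /neq0P; rewrite -sqE => fp.
 have := n_open nice_CR (lt0r_neq0 fp); apply: filterS => x; exact: neq0E.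
- move=> U p oU Up; have [chi [c1 c0]] := n_bump nice_CR oU Up.
 exists (toCx chi); split; first by apply: filterS c1 => x /= ->.
 by move=> x; case: (c0 x) => [|H]; [left|right; apply: filterS H => y /= ->].
- move=> f p /neq0P; rewrite -sqE => /lt0r_neq0 /(n_inv nice_CR) [g gE].
 exists (conjA f * toCx g); apply: filterS gE => x E.
 transitivity (cval f x * ((cval f x)^*%C * (rval g x)%:C)).
  by rewrite -cval_conj.
 rewrite mulrA; transitivity ((rval (re f ^+ 2 + im f ^+ 2) x * rval g x)%:C).
  rewrite rmorphM sqE; congr (_ * _); case: (cval f x) => a b /=.
  by ceq; ring.
 by move: E => /= ->.
- move=> F H; apply: glue_complex => p; have [f fE] := H p; by exists f.
- move=> U F oU; have nR := nice_CR; split=> [[s1 s2] x Ux|H].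
  have [f1 E1] := (n_smooth nR _ oU).1 s1 x Ux; have [f2 E2] := (n_smooth nR _ oU).1 s2 x Ux.
  exists (toCx f1 + ccst M 'i * toCx f2).
  apply: filterS (filterI E1 E2) => y [e1 e2]; rewrite cD cM.
  by rewrite [LHS]complexE e1 e2.
 split; apply: (n_smooth nR _ oU).2 => x Ux; have [f fE] := H x Ux.
  by exists (re f); apply: filterS fE => y ->.
 by exists (im f); apply: filterS fE => y ->.
Qed.
End NiceFunctions.

(** * Hadamard's lemma and coordinate frames *)

Section HadamardPoint.
Variables (R : realType) (n : nat).
Local Notation V := 'rV[R]_n.

Lemma sm_trunc (h : V -> R) k : smooth_on setT h ->
 smooth_on setT (fun x => h (trunc k x)).
Proof.
move=> sh; apply: (@sm_comp R n setT setT h (@trunc R n k)) => //; try exact: openT.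
move=> l; case lk : (l < k)%N.
 by apply: smT_ext (sm_coord setT l) => x; rewrite mxE lk.
by apply: smT_ext (smooth_on_cst setT 0) => x; rewrite mxE lk.
Qed.
Lemma sm_translate (h : V -> R) a : smooth_on setT h ->
 smooth_on setT (fun x => h (x + a)).
Proof.
move=> sh; apply: (@sm_comp R n setT setT h (fun x : V => x + a)) => //; try exact: openT.
move=> l; apply: smT_ext (smooth_onD openT (sm_coord setT l)
 (smooth_on_cst setT (a ord0 l))) => x.
by rewrite !fctE mxE.
Qed.
Lemma trunc_succ (i : 'I_n) (x : V) : x ord0 i = 0 -> trunc i.+1 x = trunc i x.
Proof. by move=> xi; rewrite truncS xi scale0r addr0. Qed.
(** The difference h x - h a telescopes along the truncations of x - a, and [Hadamard_coord] divides
    each increment by its coordinate. *)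
Lemma Hadamard_point (h : V -> R) a : smooth_on setT h ->
 exists2 k : 'I_n -> V -> R, (forall i, smooth_on setT (k i)) &
  forall x, h x = h a + \sum_i (x ord0 i - a ord0 i) * k i x.
Proof.
move=> sh; pose g x := h (x + a); have sg : smooth_on setT g by exact: sm_translate.
have H i : exists k : V -> R, smooth_on setT k /\
  forall x, g (trunc (i : 'I_n).+1 x) - g (trunc i x) = x ord0 i * k x.
 have [||k sk kE] := @Hadamard_coord R n i (fun x => g (trunc i.+1 x) - g (trunc i x)).
 - apply: sm_onB; [exact: openT|exact: sm_trunc|exact: sm_trunc].
 - by move=> x xi; rewrite trunc_succ // subrr.
 by exists k.
have [k kE] := choice H.
exists (fun i x => k i (x - a)) => [i|x].
 exact: sm_translate (kE i).1.
have -> : h x = g (trunc n (x - a)) by rewrite trunc_full /g subrK.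
have t0 : trunc 0 (x - a) = 0 by apply/rowP => l; rewrite !mxE.
have -> : h a = g (trunc 0 (x - a)) by rewrite t0 /g add0r.
apply/eqP; rewrite -subr_eq0 opprD addrA subr_eq0; apply/eqP.
rewrite -(telescope_sumr (fun k => g (trunc k (x - a)))) // big_mkord.
by apply: eq_bigr => i _; rewrite (kE i).2 !mxE.
Qed.
End HadamardPoint.

Section Values.
Variables (R : realType) (n : nat) (M : manifold R n).
Implicit Types (f g : CR M) (h k : CC M) (x : M).

Lemma evR f x : ev f x = rval f x. Proof. by []. Qed.
Lemma rvalD f g x : rval (f + g) x = rval f x + rval g x. Proof. by []. Qed.
Lemma rvalM f g x : rval (f * g) x = rval f x * rval g x. Proof. by []. Qed.
Lemma rvalN f x : rval (- f) x = - rval f x. Proof. exact: (nN (nice_CR M)). Qed.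
Lemma rvalB f g x : rval (f - g) x = rval f x - rval g x. Proof. by rewrite rvalD rvalN. Qed.
Lemma rval0 x : rval (0 : CR M) x = 0. Proof. exact: (n0 (nice_CR M)). Qed.
Lemma rval1 x : rval (1 : CR M) x = 1. Proof. by []. Qed.
Lemma rval_cst a x : rval (real_cst M a) x = a. Proof. by []. Qed.
Lemma rval_re h x : rval (re h) x = complex.Re (cval h x). Proof. by []. Qed.
Lemma rval_im h x : rval (im h) x = complex.Im (cval h x). Proof. by []. Qed.
Lemma rval_sum (J : Type) (r : seq J) (P : pred J) (F : J -> CR M) x :
 rval (\sum_(i <- r | P i) F i) x = \sum_(i <- r | P i) rval (F i) x.
Proof. exact: (n_sum (nice_CR M)). Qed.
Lemma evC h x : ev h x = cval h x. Proof. by []. Qed.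
Lemma cvalD h k x : cval (h + k) x = cval h x + cval k x. Proof. by []. Qed.
Lemma cvalM h k x : cval (h * k) x = cval h x * cval k x. Proof. by []. Qed.
Lemma cvalN h x : cval (- h) x = - cval h x. Proof. exact: (nN (nice_CC M)). Qed.
Lemma cvalB h k x : cval (h - k) x = cval h x - cval k x. Proof. by rewrite cvalD cvalN. Qed.
Lemma cval0 x : cval (0 : CC M) x = 0. Proof. exact: (n0 (nice_CC M)). Qed.
Lemma cval1 x : cval (1 : CC M) x = 1. Proof. by []. Qed.
Lemma cval_cst a x : cval (ccst M a) x = a. Proof. by []. Qed.
Lemma cval_tc f x : cval (toCx f) x = (rval f x)%:C. Proof. by []. Qed.
Lemma cval_sum (J : Type) (r : seq J) (P : pred J) (F : J -> CC M) x :
 cval (\sum_(i <- r | P i) F i) x = \sum_(i <- r | P i) cval (F i) x.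
Proof. exact: (n_sum (nice_CC M)). Qed.
Lemma cval_prod (J : Type) (r : seq J) (P : pred J) (F : J -> CC M) x :
 cval (\prod_(i <- r | P i) F i) x = \prod_(i <- r | P i) cval (F i) x.
Proof. exact: (n_prod (nice_CC M)). Qed.
Definition rvE := (evR, rvalB, rvalD, rvalM, rvalN, rval0, rval1, rval_cst, rval_sum).
Definition cvE := (evC, cvalB, cvalD, cvalM, cvalN, cval0, cval1, cval_cst, cval_tc, cval_conj,
 cval_sum, cval_prod).
End Values.

Section Frames.
Variables (R : realType) (n : nat) (M : manifold R n).
Local Notation V := 'rV[R]_n.
Local Notation TR := (vect (idealT (CR M))).
Local Notation TC := (vect (idealT (CC M))).
Implicit Types (c : chart R n M) (W : set M) (p x : M) (f g : CR M).

Definition push c (h : M -> R) : V -> R :=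
 fun y => if `[< (cmap c @` dom c) y >] then h (cinv c y) else 0.
Lemma pushE c h x : dom c x -> push c h (cmap c x) = h x.
Proof. by move=> cx; rewrite /push asboolT ?cmapK //; exists x. Qed.
Lemma push_smooth c f K : compat c -> compact K -> K `<=` dom c ->
 (forall x, ~ K x -> rval f x = 0) -> smooth_on setT (push c (rval f)).
Proof.
move=> cc cK Kc fK; apply: sm_local => y _.
have [Dy|nDy] := pselect ((cmap c @` dom c) y).
 exists (cmap c @` dom c); split=> //; first exact: cmap_open.
 apply: sm_ext (@cmap_open _ _ _ c) _ (rval_chart f cc).
 by move=> _ [z cz <-]; rewrite pushE //= cmapK.
have cI : compact (cmap c @` K).
 apply: continuous_compact => //; apply: cont_subT => z.
 by rewrite inE => /Kc; exact: cmap_cont.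
have clI : closed (cmap c @` K) by apply: compact_closed cI; exact: norm_hausdorff.
exists (~` (cmap c @` K)); split; first exact: closed_openC.
 by move=> [z /Kc cz zy]; apply: nDy; exists z.
apply: sm_ext (closed_openC clI) _ (smooth_on_cst _ 0) => z nKz.
rewrite /push; case: asboolP => // -[w cw wz].
by rewrite -wz cmapK // fK // => Kw; apply: nKz; exists w.
Qed.

Definition loc_pd c (i : 'I_n) (f : M -> R) : M -> R :=
 fun x => pd i (f \o cinv c) (cmap c x).
Lemma loc_pdD c i f g x : compat c -> dom c x ->
 loc_pd c i (rval (f + g)) x = loc_pd c i (rval f) x + loc_pd c i (rval g) x.
Proof.
move=> cc cx; have Dx : (cmap c @` dom c) (cmap c x) by exists x.
by rewrite /loc_pd /pd deriveD //; apply: (@smooth_on_derivable _ _ (cmap c @` dom c)) => //;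
 exact: rval_chart.
Qed.
Lemma loc_pdM c i f g x : compat c -> dom c x ->
 loc_pd c i (rval (f * g)) x =
 loc_pd c i (rval f) x * rval g x + rval f x * loc_pd c i (rval g) x.
Proof.
move=> cc cx; have Dx : (cmap c @` dom c) (cmap c x) by exists x.
rewrite /loc_pd /pd (@deriveM R V (rval f \o cinv c) (rval g \o cinv c)).
- by rewrite /= (cmapK cx) addrC; congr (_ + _); exact: mulrC.
- by apply: (@smooth_on_derivable _ _ (cmap c @` dom c)) => //; exact: rval_chart.
- by apply: (@smooth_on_derivable _ _ (cmap c @` dom c)) => //; exact: rval_chart.
Qed.
Lemma loc_pd_cst c i a x : loc_pd c i (rval (real_cst M a)) x = 0.
Proof. by rewrite /loc_pd /pd; exact: derive_cst. Qed.
Lemma loc_pd_coord c i l W f x : open W -> W x -> W `<=` dom c ->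
 (forall y, W y -> rval f y = cmap c y ord0 l) ->
 loc_pd c i (rval f) x = (i == l)%:R.
Proof.
move=> oW Wx Wc fE; transitivity (pd i (fun v : V => v ord0 l) (cmap c x)); last first.
 by rewrite pd_coord.
apply: near_eq_derive; have oI := @chart_im_open _ _ _ c _ oW.
apply: filterS (nopen oI _); last by exists x => //; split=> //; exact: Wc.
by move=> _ [z [cz Wz] <-]; rewrite /= cmapK // fE.
Qed.
(** The partial derivative is multiplied by a bump function supported in the chart, which makes it a
    derivation of the global algebra. *)
Lemma loc_field c i p : compat c -> dom c p -> exists (E : TR) (W : set M),
 [/\ open W, W p, W `<=` dom c &
   forall f x, W x -> rval (E f) x = loc_pd c i (rval f) x].
Proof.
move=> cc cp; have [chi [chi1 [K [clK cK Kc chi0]] chi00]] := bump_real (@dom_open _ _ _ c) cp.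
have H f : exists g : CR M, forall x, rval g x = rval chi x * loc_pd c i (rval f) x.
 apply: glue_real => q; case: (chi00 q) => [cq|H0]; last first.
  by exists 0; apply: filterS H0 => x ->; rewrite mul0r.
 have [] := @chart_extend R n M c setT q (cmap c @` dom c) (pd i (rval f \o cinv c)) cc openT I cq.
 - exact: cmap_open.
 - by exists q.
 - by apply: smooth_partial; exact: rval_chart.
 move=> g [gE _]; exists (chi * g : CR M); apply: filterS gE => x gx.
 by change (rval chi x * loc_pd c i (rval f) x = rval chi x * rval g x); rewrite gx.
have [E0 E0E] := choice H.
have chid x : dom c x \/ rval chi x = 0.
 by case: (chi00 x) => [|/nbhs1]; [left|right].
have ED f g : E0 (f + g) = E0 f + E0 g.
 apply: rval_inj => x; rewrite [RHS](nD (nice_CR M)) /= !E0E.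
 case: (chid x) => [cx|->]; last by rewrite !mul0r addr0.
 by rewrite loc_pdD // mulrDr.
have EM f g : E0 (f * g) = E0 f * g + f * E0 g.
 apply: rval_inj => x; rewrite [RHS](nD (nice_CR M)) !(nM (nice_CR M)) /= !E0E.
 case: (chid x) => [cx|->]; last by rewrite !mul0r mulr0 addr0.
 by rewrite loc_pdM // mulrDr mulrA [RHS]addrC [RHS]addrC; congr (_ + _); rewrite mulrCA.
have EZ a f : E0 (Defs.scalar (CR M) a * f) = Defs.scalar (CR M) a * E0 f.
 rewrite EM -[RHS]add0r; congr (_ + _); rewrite -[RHS](mul0r f); congr (_ * _).
 by apply: rval_inj => x; rewrite E0E loc_pd_cst mulr0.
pose E : TR := @Vect _ _ (CR M) (idealT _) E0 ED EM EZ (fun _ _ => Logic.I).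
have [W [oW Wp W1]] := nnopen chi1.
exists E, (W `&` dom c); split=> //.
- by apply: openI => //; exact: dom_open.
- by move=> f x [Wx cx]; rewrite [LHS]E0E W1 // mul1r.
Qed.

(** Global functions and derivations that agree near p with coordinates and coordinate fields.
    [fr_expand] is Hadamard's lemma in the form that evaluates an arbitrary derivation at q. *)
Record frame_at c p (x : 'I_n -> CR M) (E : 'I_n -> TR) (W : set M) : Prop := FrameAt {
 fr_open : open W;
 fr_mem : W p;
 fr_dom : W `<=` dom c;
 fr_coord : forall i y, W y -> rval (x i) y = cmap c y ord0 i;
 fr_partial : forall i f y, W y -> rval (E i f) y = loc_pd c i (rval f) y;
 fr_expand : forall f q, W q -> exists k : 'I_n -> CR M, \forall y \near q,
  rval f y = rval f q + \sum_i (rval (x i) y - rval (x i) q) * rval (k i) y }.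

Lemma frame_exists c p : compat c -> dom c p -> exists (x : 'I_n -> CR M) E W, frame_at c p x E W.
Proof.
move=> cc cp.
have Hx i : exists x : CR M, \forall y \near p, rval x y = cmap c y ord0 i.
 have [] := @chart_extend R n M c setT p setT (fun v => v ord0 i) cc openT I cp openT I.
  exact: sm_coord.
 by move=> x [xE _]; exists x.
have [x xE] := choice Hx.
have /choice [E /choice [W HW]] := fun i => @loc_field c i p cc cp.
have xW : \forall y \near p, forall i, rval (x i) y = cmap c y ord0 i.
 by apply: filter_forall.
have WW : \forall y \near p, forall i, W i y.
 by apply: filter_forall => i; have [oW Wp _ _] := HW i; exact: nopen.
have [N [oN Np NE]] := nnopen (filterI (filterI xW WW) (nopen (@dom_open _ _ _ c) cp)).
exists x, E, N; split=> //.
- by move=> y /NE[].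
- by move=> i y /NE[[]].
- by move=> i f y /NE[[_ Wy] _]; have [_ _ _ ->] := HW i.
move=> f q Nq; have [_ cq] := NE q Nq.
have [chi [chi1 [K [clK cK Kc chi0]] _]] := bump_real (@dom_open _ _ _ c) cq.
have sp : smooth_on setT (push c (rval (chi * f : CR M))).
 apply: (@push_smooth c (chi * f) K) => // y nKy.
 by rewrite rvalM chi0 // mul0r.
have [k0 sk0 k0E] := Hadamard_point (cmap c q) sp.
have Hk i : exists k : CR M, \forall y \near q, rval k y = k0 i (cmap c y).
 have [] := @chart_extend R n M c setT q setT (k0 i) cc openT I cq openT I (sk0 i).
 by move=> k [kE _]; exists k.
have [k kE] := choice Hk; exists k.
have kA : \forall y \near q, forall i, rval (k i) y = k0 i (cmap c y) by apply: filter_forall.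
have chiq := nbhs1 chi1.
apply: filterS (filterI (filterI kA chi1) (nopen oN Nq)) => y [[ky chiy] Ny].
have [[xy _] cy] := NE y Ny; have [[xq _] _] := NE q Nq.
have := k0E (cmap c y); rewrite !pushE // !rvalM.
rewrite chiy chiq !mul1r => ->; congr (_ + _); apply: eq_bigr => i _.
by rewrite xy xq ky.
Qed.

Lemma frame_delta c p (x : 'I_n -> CR M) E W i l q : frame_at c p x E W -> W q ->
 rval (E i (x l)) q = (i == l)%:R.
Proof.
move=> F Wq; rewrite (fr_partial F) //; apply: loc_pd_coord Wq _ _.
- exact: fr_open F.
- exact: fr_dom F.
- by move=> y Wy; exact: (fr_coord F).
Qed.
(** A derivation kills constants, and its value at q sees only the first-order terms of the
    expansion at q. *)
Lemma frame_vect c p (x : 'I_n -> CR M) E W (Y : TR) f q : frame_at c p x E W -> W q ->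
 rval (Y f) q = \sum_i rval (Y (x i)) q * rval (E i f) q.
Proof.
move=> F Wq; have [k kE] := fr_expand F f Wq; have nR := nice_CR M.
have {}kE : \forall y \near q, ev (f : CR M) y = ev (real_cst M (rval f q) +
  \sum_i (x i - real_cst M (rval (x i) q)) * k i : CR M) y.
 apply: filterS kE => y E0; rewrite !rvE E0; congr (_ + _).
have {}kE (Z : TR) : rval (Z f) q = \sum_i rval (Z (x i)) q * rval (k i) q.
 rewrite -[LHS]/(ev (Z f) q) (nbhs1 (vect_local nR Z kE)).
 rewrite vectD (@vect_scalar _ _ (CR M)) add0r.
 rewrite (big_morph Z (vectD Z) (vect0 Z)) !rvE; apply: eq_bigr => i _.
 rewrite vectM vectD (vectN Z) (@vect_scalar _ _ (CR M)) subr0 !rvE.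
 by rewrite subrr mul0r addr0.
rewrite kE; apply: eq_bigr => i _; congr (_ * _); rewrite kE (bigD1 i) //=.
rewrite (frame_delta _ _ F Wq) eqxx mul1r big1 ?addr0 // => l li.
by rewrite (frame_delta _ _ F Wq) eq_sym (negPf li) mul0r.
Qed.

Lemma ev_cvec (Y : TR) (h : CC M) q :
 cval (cvec Y h) q = (rval (Y (re h)) q)%:C + 'i * (rval (Y (im h)) q)%:C.
Proof. by []. Qed.
Lemma cvec_real (Y : TR) f : cvec Y (toCx f) = toCx (Y f).
Proof.
apply: cval_inj => q; rewrite ev_cvec.
have -> : re (toCx f) = f by exact: rval_inj.
have -> : im (toCx f) = 0 by exact: rval_inj.
by rewrite (vect0 Y) mulr0 addr0.
Qed.
Lemma frame_vectC c p (x : 'I_n -> CR M) E W (Y : TC) (h : CC M) q : frame_at c p x E W -> W q ->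
 cval (Y h) q = \sum_i cval (Y (toCx (x i))) q * cval (cvec (E i) h) q.
Proof.
move=> F Wq; have nC := nice_CC M; have nR := nice_CR M.
have H f : cval (Y (toCx f)) q = \sum_i cval (Y (toCx (x i))) q * (rval (E i f) q)%:C.
 have YE : Y (toCx f) = toCx (re_vect Y f) + ccst M 'i * toCx (im_vect Y f).
  exact: smooth_complexE.
 rewrite YE !cvE.
 rewrite !(frame_vect _ _ F Wq) !rmorph_sum /= mulr_sumr -big_split /=.
 apply: eq_bigr => i _; rewrite !rmorphM /= mulrA -mulrDl; congr (_ * _).
 exact/esym/complexE.
rewrite {1}[h]smooth_complexE vectD (vectZ Y) !cvE !H.
rewrite mulr_sumr -big_split; apply: eq_bigr => i _.
by rewrite ev_cvec mulrDr; congr (_ + _); rewrite mulrCA.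
Qed.
End Frames.

(** * Complex functions vanishing transversely *)

Global Arguments rval : simpl never.
Global Arguments cval : simpl never.

Lemma det_mx2 (S : comPzRingType) (A : 'M[S]_2) :
 \det A = A ord0 ord0 * A (lift ord0 ord0) (lift ord0 ord0) -
      A ord0 (lift ord0 ord0) * A (lift ord0 ord0) ord0.
Proof.
rewrite (expand_det_row _ ord0) !big_ord_recl big_ord0 addr0 /cofactor !det_mx11 !mxE /=.
rewrite expr0 expr1 mul1r mulN1r mulrN.
by congr (_ * A _ _ - A _ _ * A _ _); apply: val_inj.
Qed.

Section Adapted.
Variables (R : realType) (n : nat) (M : manifold R n).
Local Notation TR := (vect (idealT (CR M))).
Local Notation TC := (vect (idealT (CC M))).
Implicit Types (c : chart R n M) (W : set M) (p x q : M) (h z : CC M).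

Definition transv z p := wedge_neq0 p [:: z; conjA z : CC M].
Lemma transvP z p : transv z p <-> exists Y Z : TC,
 cval (Y z) p * cval (Z (conjA z)) p - cval (Z z) p * cval (Y (conjA z)) p != 0.
Proof.
rewrite /transv /wedge_neq0 /=; split=> [[Y]|[Y [Z YZ]]].
 by rewrite det_mx2 !mxE /= mulrC [X in _ - X]mulrC; exists (Y (lift ord0 ord0)), (Y ord0); rewrite -oppr_eq0 opprB mulrC [X in _ - X]mulrC.
exists (fun i => if i == ord0 then Y else Z).
by rewrite det_mx2 !mxE /=.
Qed.
Lemma cvec_conj (Y : TR) h q :
 cval (cvec Y (conjA h)) q = (cval (cvec Y h) q)^*%C.
Proof.
rewrite !ev_cvec.
have -> : re (conjA h) = re h.
 by apply: rval_inj => x; rewrite rval_re cval_conj rval_re; case: (cval h x).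
have -> : im (conjA h) = - im h.
 by apply: rval_inj => x; rewrite rval_im cval_conj rvalN rval_im; case: (cval h x).
rewrite (vectN Y) rvalN.
by ceq; ring.
Qed.

(** dz /\ dzbar is a combination of the real two-by-two minors of d(re z) and d(im z), so one of
    these is nonzero. *)
Lemma transv_minor z p c (x : 'I_n -> CR M) E W : transv z p -> frame_at c p x E W ->
 exists l m, rval (E l (re z)) p * rval (E m (im z)) p -
       rval (E m (re z)) p * rval (E l (im z)) p != 0.
Proof.
move=> /transvP[Y [Z YZ]] F; have Wp := fr_mem F.
apply: contrapT => H; move/eqP: YZ; apply.
pose e i := cval (cvec (E i) z) p.
rewrite !(@frame_vectC _ _ _ _ _ _ _ _ _ _ p F Wp).
under [X in _ * X - _]eq_bigr do rewrite cvec_conj.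
under [X in _ - _ * X]eq_bigr do rewrite cvec_conj.
rewrite !big_distrlr /= [X in _ - X]exchange_big -sumrB big1 // => i _.
rewrite -sumrB big1 // => k _; rewrite !ev_cvec.
have : rval (E i (re z)) p * rval (E k (im z)) p - rval (E k (re z)) p * rval (E i (im z)) p = 0.
 by apply/eqP/negPn/negP => ne; apply: H; exists i, k.
move: (rval (E i (re z)) p) (rval (E k (im z)) p) (rval (E k (re z)) p) (rval (E i (im z)) p).
move=> a b a' b' E0.
rewrite !mul0r !mul1r !add0r !oppr0 ?addr0.
transitivity (cval (Y (toCx (x i))) p * cval (Z (toCx (x k))) p *
 ((a%:C + 'i * b'%:C) * (a' -i* b) - (a'%:C + 'i * b%:C) * (a -i* b'))); first by ring.
set w := (X in _ * X); suff -> : w = 0 by rewrite mulr0.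
rewrite /w; ceq; first by ring.
by transitivity (-2 * (a * b - a' * b')); [ring | rewrite E0 mulr0].
Qed.

Definition adapted c z (i j : 'I_n) := [/\ compat c, i != j &
 forall x, dom c x -> cmap c x ord0 i = complex.Re (cval z x) /\
            cmap c x ord0 j = complex.Im (cval z x)].
(** Two straightenings, by re z and then by im z. After the first, the remaining partial derivative
    of im z is the nonzero minor divided by the pivot. *)
Lemma adapted_exists z p : transv z p -> exists c i j, adapted c z i j /\ dom c p.
Proof.
move=> tz; have [c ac cp] := atlas_cover p; have cc := atlas_compatP ac.
have [x [E [W F]]] := frame_exists cc cp.
have [l [m]] := transv_minor tz F.
wlog El : l m / rval (E l (re z)) p != 0.
 move=> H N; have [E0|?] := eqVneq (rval (E l (re z)) p) 0; last exact: (H l m).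
 apply: (H m l); last by rewrite -opprB oppr_eq0.
 by apply: contraNneq N => E1; rewrite E0 E1 !mul0r subrr.
move=> N; have lm : l != m by apply: contraNneq N => ->; rewrite subrr.
have := El; rewrite (fr_partial F) ?(fr_mem F) //; last exact: fr_mem F.
move=> /(straighten cc cp) [c1 [cc1 c1p c1c c1E]].
have [x1 [E1 [W1 F1]]] := frame_exists cc1 c1p.
have x1E k : rval (x1 k) p = if k == l then rval (re z) p else rval (x k) p.
 rewrite (fr_coord F1); last exact: fr_mem F1.
 by rewrite c1E // (fr_coord F) //; exact: fr_mem F.
have nx k : \forall y \near p, ev (x1 k) y = ev ((if k == l then re z else x k) : CR M) y.
 apply: filterS (filterI (nopen (fr_open F1) (fr_mem F1)) (nopen (fr_open F) (fr_mem F))).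
 move=> y [W1y Wy]; rewrite !evR (fr_coord F1) // c1E; last exact: fr_dom F1 _ W1y.
 by case: ifP => // _; rewrite (fr_coord F).
have Ex1 r k : rval (E r (x1 k)) p = if k == l then rval (E r (re z)) p else (r == k)%:R.
 have -> : rval (E r (x1 k)) p = rval (E r (if k == l then re z else x k)) p :=
  nbhs1 (vect_local (nice_CR M) (E r) (nx k)).
 by case: ifP => // _; rewrite (frame_delta _ _ F (fr_mem F)).
have ex r : rval (E r (im z)) p = rval (E r (re z)) p * rval (E1 l (im z)) p +
  \sum_(k | k != l) (r == k)%:R * rval (E1 k (im z)) p.
 rewrite (frame_vect _ _ F1 (fr_mem F1)) (bigD1 l) //= Ex1 eqxx; congr (_ + _).
 by apply: eq_bigr => k /negPf kl; rewrite Ex1 kl.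
have exl : rval (E l (im z)) p = rval (E l (re z)) p * rval (E1 l (im z)) p.
 by rewrite ex big1 ?addr0 // => k kl; rewrite eq_sym (negPf kl) mul0r.
have exm : rval (E m (im z)) p = rval (E m (re z)) p * rval (E1 l (im z)) p + rval (E1 m (im z)) p.
 rewrite ex (bigD1 m) 1?eq_sym //= eqxx mul1r big1 ?addr0 // => k /andP[_ km].
 by rewrite eq_sym (negPf km) mul0r.
have E1m : rval (E1 m (im z)) p != 0.
 by apply: contraNneq N => e0; rewrite exl exm e0 addr0; apply/eqP; ring.
move: E1m; rewrite (fr_partial F1); last exact: fr_mem F1.
move=> /(straighten cc1 c1p) [c2 [cc2 c2p c2c1 c2E]].
exists c2, l, m; split=> //; split=> // y c2y.
by rewrite !c2E // (negPf lm) eqxx c1E ?eqxx //; exact: c2c1.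
Qed.
End Adapted.

(** * The dbar operator of a transverse function *)

Section NormalForm.
Variables (R : realType) (n : nat) (M : manifold R n).
Local Notation V := 'rV[R]_n.
Local Notation TC := (vect (idealT (CC M))).
Implicit Types (c : chart R n M) (W : set M) (p x q : M) (f g : CR M) (h z : CC M).

Lemma itervD (D : TC) k (h g : CC M) : iter k D (h + g) = iter k D h + iter k D g.
Proof. by elim: k => // k IH; rewrite !iterS IH vectD. Qed.
Lemma itervM_flat (D : TC) (Z : set M) k (chi h : CC M) :
 (forall m x, Z x -> cval (iter m D h) x = 0) ->
 forall x, Z x -> cval (iter k D (chi * h)) x = 0.
Proof.
elim: k chi h => [|k IH] chi h H x Zx.
 by rewrite /= -[LHS]/(cval (chi * h) x) cvalM (H 0%N) // mulr0.
rewrite iterSr vectM itervD cvalD !IH ?addr0 // => m y Zy.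
by have := H m.+1 y Zy; rewrite iterSr.
Qed.
Lemma iterv_supp (D : TC) (W : set M) h : open W -> (forall x, W x -> cval h x = 0) ->
 forall k x, W x -> cval (iter k D h) x = 0.
Proof.
move=> oW h0; elim=> [|k IH] //= x Wx.
apply: (nbhs1 (vect_local0 (nice_CC M) D _)).
by apply: filterS (nopen oW Wx) => y /IH.
Qed.

(** Division by a complex coordinate without coordinates: D is dbar in a chart where z is a complex
    coordinate, and both division statements are phrased with z and D alone. *)
Record normal_form z (W : set M) (D : TC) : Prop := NormalForm {
 nf_open : open W;
 nf_D0 : forall x, W x -> cval (D z) x = 0;
 nf_D2 : forall x, W x -> cval (D (conjA z)) x = 2;
 nf_had : forall (W' : set M) h q, open W' -> W' `<=` W -> W' q ->
  (forall x, W' x -> cval z x = 0 -> cval h x = 0) ->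
  exists a b : CC M, \forall y \near q, cval h y = cval z y * cval a y + cval (conjA z) y * cval b y;
 nf_flat : forall (W' : set M) h q, open W' -> W' `<=` W -> W' q ->
  (forall k x, W' x -> cval z x = 0 -> cval (iter k D h) x = 0) ->
  exists a : CC M, \forall y \near q, cval h y = cval z y * cval a y }.

Definition pushC c h : V -> R[i] :=
 fun y => (push c (rval (re h)) y +i* push c (rval (im h)) y).
Lemma pushCE c h x : dom c x -> pushC c h (cmap c x) = cval h x.
Proof. by move=> cx; rewrite /pushC !pushE // rval_re rval_im; case: (cval h x). Qed.
Lemma pushC0 c h y : ~ (cmap c @` dom c) y -> pushC c h y = 0.
Proof. by move=> nc; rewrite /pushC /push asboolF. Qed.
Lemma pushC_csm c h K : compat c -> compact K -> K `<=` dom c ->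
 (forall x, ~ K x -> cval h x = 0) -> csm (pushC c h).
Proof.
move=> cc cK Kc h0; split.
- by apply: (@push_smooth _ _ _ c (re h) K) => // x nK; rewrite rval_re h0.
- by apply: (@push_smooth _ _ _ c (im h) K) => // x nK; rewrite rval_im h0.
Qed.
Lemma pullC c (G : V -> R[i]) q : compat c -> dom c q -> csm G ->
 exists g : CC M, \forall x \near q, cval g x = G (cmap c x).
Proof.
move=> cc cq [G1 G2].
have [f [fE _]] := @chart_extend R n M c setT q setT _ cc openT I cq openT I G1.
have [g [gE _]] := @chart_extend R n M c setT q setT _ cc openT I cq openT I G2.
exists (toCx f + ccst M 'i * toCx g).
by apply: filterS (filterI fE gE) => x [fx gx]; rewrite !cvE fx gx -complexE.
Qed.
Lemma pd_push c (i : 'I_n) f x : dom c x ->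
 pd i (push c (rval f)) (cmap c x) = loc_pd c i (rval f) x.
Proof.
move=> cx; apply: near_eq_derive.
apply: filterS (nopen (@cmap_open _ _ _ c) (ex_intro2 _ _ x cx erefl)) => _ [y cy <-].
by rewrite pushE //= cmapK.
Qed.
Lemma adapted_nform z c i j p : adapted c z i j -> dom c p ->
 exists W D, normal_form z W D /\ W p.
Proof.
move=> [cc ij zE] cp; have [x [E [W F]]] := frame_exists cc cp.
pose D : TC := vadd (cvec (E i)) (vscale (ccst M 'i : CC M) (cvec (E j))).
have DE h q : W q -> cval (D h) q = (rval (E i (re h)) q)%:C + 'i * (rval (E i (im h)) q)%:C +
  'i * ((rval (E j (re h)) q)%:C + 'i * (rval (E j (im h)) q)%:C) by [].
have zcE q : dom c q -> zc i j (cmap c q) = cval z q.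
 by move=> cq; rewrite /zc; have [-> ->] := zE q cq; case: (cval z q).
have zcbE q : dom c q -> zcb i j (cmap c q) = cval (conjA z) q.
 by move=> cq; rewrite /zcb; have [-> ->] := zE q cq; rewrite cval_conj; case: (cval z q).
have oW := fr_open F; have Wc := fr_dom F.
have dR q k : W q -> rval (E k (re z)) q = (k == i)%:R.
 move=> Wq; rewrite (fr_partial F) //; apply: loc_pd_coord Wq Wc _ => // y Wy.
 by rewrite (zE y (fr_dom F Wy)).1.
have dI q k : W q -> rval (E k (im z)) q = (k == j)%:R.
 move=> Wq; rewrite (fr_partial F) //; apply: loc_pd_coord Wq Wc _ => // y Wy.
 by rewrite (zE y (fr_dom F Wy)).2.
(* Functions with compact support in W are transported by zero extension to the model space, where D
   corresponds to dbar. *)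
have dbarE K h : compact K -> K `<=` W -> (forall q, ~ K q -> cval h q = 0) ->
  dbar i j (pushC c h) = pushC c (D h).
 move=> cK KW h0; fext => y.
 have clK : closed K by apply: compact_closed cK; exact: manifold_hausdorff.
 have [[q Wq <-]|nWy] := pselect ((cmap c @` W) y).
  have cq := Wc _ Wq; rewrite pushCE // DE // /dbar.
  have -> : (fun v => complex.Re (pushC c h v)) = push c (rval (re h)) by [].
  have -> : (fun v => complex.Im (pushC c h v)) = push c (rval (im h)) by [].
  rewrite !pd_push // !(fr_partial F) //.
  by do !move: (loc_pd _ _ _ _) => ?; ceq; ring.
 have cI : compact (cmap c @` K).
  apply: continuous_compact => //; apply: cont_subT => q.
  by rewrite inE => /KW /Wc; exact: cmap_cont.
 have clI : closed (cmap c @` K) by apply: compact_closed cI; exact: norm_hausdorff.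
 have N : \forall v \near y, ~ (cmap c @` K) v.
  apply: (nopen (closed_openC clI)) => -[q /KW Kq qy]; by apply: nWy; exists q.
 have pK v : ~ (cmap c @` K) v -> pushC c h v = 0.
  move=> nK; have [[q cq qv]|] := pselect ((cmap c @` dom c) v); last exact: pushC0.
  by rewrite -qv pushCE // h0 // => Kq; apply: nK; exists q.
 have P0 k (G : V -> R) : (\forall v \near y, G v = 0) -> pd k G y = 0.
  move=> G0; transitivity (pd k (cst 0) y); last exact: derive_cst.
  exact: near_eq_derive.
 have nR : \forall v \near y, complex.Re (pushC c h v) = 0 by apply: filterS N => v /pK ->.
 have nI : \forall v \near y, complex.Im (pushC c h v) = 0 by apply: filterS N => v /pK ->.
 rewrite /dbar !P0 // subrr addr0.
 have [[q cq qy]|] := pselect ((cmap c @` dom c) y); last by move=> /pushC0 ->.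
 rewrite -qy pushCE //; apply/esym.
 apply: (@iterv_supp D (~` K) h _ _ 1%N) => //; first exact: closed_openC.
 by move=> /KW Kq; apply: nWy; exists q.
have iterE K h k : compact K -> K `<=` W -> (forall q, ~ K q -> cval h q = 0) ->
  iter k (dbar i j) (pushC c h) = pushC c (iter k D h).
 move=> cK KW h0; elim: k => // k IH; rewrite !iterS IH; apply: (dbarE K) => //.
 have clK : closed K by apply: compact_closed cK; exact: manifold_hausdorff.
 by apply: iterv_supp => //; exact: closed_openC.
exists W, D; split; last exact: fr_mem F.
split=> //.
- move=> q Wq; rewrite DE // !dR // !dI // !eqxx (negPf ij) eq_sym (negPf ij).
 by ceq; ring.
- move=> q Wq; rewrite DE //.
 have -> : re (conjA z) = re z.
  by apply: rval_inj => y; rewrite rval_re cval_conj rval_re; case: (cval z y).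
 have -> : im (conjA z) = - im z.
  by apply: rval_inj => y; rewrite rval_im cval_conj rvalN rval_im; case: (cval z y).
 rewrite !vectN !rvalN !dR // !dI // !eqxx (negPf ij) eq_sym (negPf ij).
 by ceq; ring.
- move=> W' h q oW' W'W W'q H.
 have [chi [chi1 [K [clK cK KW' chi0]] _]] := bump_real oW' W'q.
 have KW : K `<=` W by move=> y /KW' /W'W.
 have h0 y : ~ K y -> cval (toCx chi * h) y = 0 by move=> nK; rewrite !cvE chi0 // mul0r.
 have cF : csm (pushC c (toCx chi * h)).
  by apply: (@pushC_csm _ _ K) => // y /KW /Wc.
 have [|A [B [sA sB AB]]] := Hadamard_complex ij cF.
  move=> y y1 y2; have [[r cr ry]|/pushC0 -> //] := pselect ((cmap c @` dom c) y).
  rewrite -ry pushCE //; have [Kr|/h0 //] := pselect (K r).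
  have zr : cval z r = 0 by rewrite -zcE // ry /zc y1 y2.
  by rewrite !cvE H ?mulr0 //; exact: KW'.
 have cq := Wc _ (W'W _ W'q).
 have [a aE] := pullC cc cq sA; have [b bE] := pullC cc cq sB.
 exists a, b; apply: filterS (filterI (filterI aE bE) (filterI chi1 (nopen (@dom_open _ _ _ c) cq))).
 move=> y [[ay by'] [chiy cy]]; rewrite ay by' -zcE // -zcbE // -AB pushCE // !cvE chiy.
 by rewrite mul1r.
- move=> W' h q oW' W'W W'q H.
 have [chi [chi1 [K [clK cK KW' chi0]] _]] := bump_real oW' W'q.
 have KW : K `<=` W by move=> y /KW' /W'W.
 have h0 y : ~ K y -> cval (toCx chi * h) y = 0 by move=> nK; rewrite !cvE chi0 // mul0r.
 have cF : csm (pushC c (toCx chi * h)).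
  by apply: (@pushC_csm _ _ K) => // y /KW /Wc.
 have [|A sA AE] := flat_along_divide ij cF.
  move=> k y y1 y2; rewrite (iterE K) //.
  have [[r cr ry]|/pushC0 -> //] := pselect ((cmap c @` dom c) y).
  rewrite -ry pushCE //; have [Kr|nKr] := pselect (K r); last first.
   by apply: (@iterv_supp D (~` K)) => //; exact: closed_openC.
  apply: (@itervM_flat D (W' `&` [set y | cval z y = 0])).
   by move=> m s [W's zs]; apply: H.
  by split; [exact: KW' | rewrite /= -zcE // ry /zc y1 y2].
 have cq := Wc _ (W'W _ W'q); have [a aE] := pullC cc cq sA.
 exists a; apply: filterS (filterI aE (filterI chi1 (nopen (@dom_open _ _ _ c) cq))).
 move=> y [ay [chiy cy]]; rewrite ay -zcE // -AE pushCE // !cvE chiy.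
 by rewrite mul1r.
Qed.

Lemma nform_exists z p : transv z p -> exists W D, normal_form z W D /\ W p.
Proof. by move=> /adapted_exists [c [i [j [H cp]]]]; exact: adapted_nform H cp. Qed.
End NormalForm.

(** * Divisibility of germs *)

Section Division.
Variables (R : realType) (n : nat) (M : manifold R n).
Local Notation TC := (vect (idealT (CC M))).
Local Notation CC := (CC M).
Implicit Types (W : set M) (p x : M) (f g h a b z : CC).

Let nC := nice_CC M.
Definition dvd p f h := exists g : CC, \forall x \near p, cval h x = cval f x * cval g x.
Lemma dvd_unit p f h : cval f p != 0 -> dvd p f h.
Proof.
move=> /(n_inv nC) [g gE]; exists (g * h); apply: filterS gE => x E.
by rewrite !cvE mulrA [_ * cval g x]E mul1r.
Qed.
Lemma dvd_congr p f f' h h' : (\forall x \near p, cval f x = cval f' x) ->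
 (\forall x \near p, cval h x = cval h' x) -> dvd p f h -> dvd p f' h'.
Proof.
by move=> E1 E2 [g E]; exists g; apply: filterS (filterI (filterI E1 E2) E) => x [[<- <-]].
Qed.
Lemma conjAK : involutive (@conjA R n M).
Proof. by move=> h; apply: cval_inj => x; rewrite !cval_conj conjcK. Qed.
Lemma conjA_eq0 h x : (cval (conjA h) x == 0) = (cval h x == 0).
Proof. by rewrite cval_conj conjc_eq0. Qed.
Lemma transv_conj z p : transv z p -> transv (conjA z) p.
Proof.
move=> /transvP[Y [Z YZ]]; apply/transvP; exists Z, Y.
by rewrite conjAK mulrC [X in _ - X]mulrC.
Qed.
Lemma transv_dense z p (N : set M) : transv z p -> nbhs p N ->
 exists2 y, N y & cval z y != 0.
Proof.
move=> /transvP[Y [Z YZ]] pN; apply: contrapT => H.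
have z0 : \forall y \near p, ev z y = 0.
 apply: filterS pN => y Ny; apply/eqP/negPn/negP => zy; by apply: H; exists y.
have V0 (V : TC) : cval (V z) p = 0 := nbhs1 (vect_local0 nC V z0).
by move/eqP: YZ; apply; rewrite !V0 !mul0r subrr.
Qed.
Lemma iterv_local (D : TC) k f g p : (\forall x \near p, cval f x = cval g x) ->
 \forall x \near p, cval (iter k D f) x = cval (iter k D g) x.
Proof. by move=> E; elim: k => //= k IH; exact: (vect_local nC D IH). Qed.
Lemma itervZ (D : TC) k (c : R[i]) f :
 iter k D (ccst M c * f) = ccst M c * iter k D f.
Proof. by elim: k => //= k ->; rewrite (vectZ D). Qed.
Lemma iterv_killed (D : TC) z W k b x : open W -> (forall y, W y -> cval (D z) y = 0) ->
 W x -> cval (iter k D (z * b)) x = cval z x * cval (iter k D b) x.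
Proof.
move=> oW Dz; elim: k b x => // k IH b x Wx; rewrite !iterSr -IH //.
apply: (nbhs1 (iterv_local D k _)); apply: filterS (nopen oW Wx) => y Wy.
by rewrite vectM !cvE Dz // mul0r add0r.
Qed.
Lemma iterv_conj (D : TC) z W k a x : open W -> (forall y, W y -> cval (D z) y = 2) ->
 W x -> cval (iter k.+1 D (z * a)) x =
  cval z x * cval (iter k.+1 D a) x + 2 * k.+1%:R * cval (iter k D a) x.
Proof.
move=> oW Dz; elim: k a x => [|k IH] a x Wx.
 by rewrite /= vectM !cvE Dz // mulr1 addrC.
rewrite iterSr (nbhs1 (@iterv_local D k.+1 _ (ccst M 2 * a + z * D a) x _)).
 rewrite itervD itervZ !cvE IH // -!iterSr !iterS.
 by rewrite -[k.+2%:R]natr1; ring.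
by apply: filterS (nopen oW Wx) => y Wy; rewrite vectM !cvE Dz.
Qed.

(** Unique factorisation for z and its conjugate. Applying D k + 1 times and restricting to z = 0
    gives 2 (k + 1) D^k a on the left and zero on the right, so a is flat along z = 0. *)
Lemma conj_divides z a b p : transv z p ->
 (\forall x \near p, cval (conjA z) x * cval a x = cval z x * cval b x) -> dvd p z a.
Proof.
move=> /nform_exists[W [D [nf Wp]]] /nnopen [N [oN Np E]].
have oW := nf_open nf.
apply: (@nf_flat _ _ _ _ _ _ nf (W `&` N)) => //; first exact: openI.
move=> k x [Wx Nx] zx.
have e1 := iterv_conj k a oW (nf_D2 nf) Wx.
have e2 := iterv_killed k.+1 b oW (nf_D0 nf) Wx.
have e3 : cval (iter k.+1 D (conjA z * a)) x = cval (iter k.+1 D (z * b)) x.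
 apply: (nbhs1 (iterv_local D k.+1 _)).
 by apply: filterS (nopen oN Nx) => y Ny; rewrite !cvE -E // cval_conj.
have zbx : cval (conjA z) x = 0 by apply/eqP; rewrite conjA_eq0 zx.
move: e3; rewrite e1 e2 zx zbx !mul0r add0r => /eqP; rewrite mulf_eq0 => /orP[|/eqP//].
by rewrite mulf_eq0 !pnatr_eq0.
Qed.

(** Divisibility by z is the vanishing of all D^k h on z = 0, a closed condition, so a dense subset
    of the zeros suffices. *)
Lemma divide_generic z W (S : set M) p h : open W -> W p ->
 (forall x, W x -> cval z x = 0 -> transv z x) ->
 (forall x (N : set M), W x -> cval z x = 0 -> nbhs x N -> exists y, [/\ N y, cval z y = 0 & S y]) ->
 (forall x, W x -> cval z x = 0 -> S x -> dvd x z h) -> dvd p z h.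
Proof.
move=> oW Wp tz dS H; have [zp|/dvd_unit //] := eqVneq (cval z p) 0.
have [W1 [D [nf W1p]]] := nform_exists (tz p Wp zp).
have oW1 := nf_open nf.
apply: (@nf_flat _ _ _ _ _ _ nf (W1 `&` W)) => //; first exact: openI.
move=> k x [W1x Wx] zx; apply/eqP/negPn/negP => nz.
have [y [[[W1y Wy] ny] zy Sy]] := dS x _ Wx zx (filterI (filterI (nopen oW1 W1x)
 (nopen oW Wx)) (n_open nC nz)).
have [g gE] := H y Wy zy Sy; move/eqP: ny; apply.
have gE' : \forall s \near y, cval h s = cval (z * g) s by apply: filterS gE => s ->; rewrite !cvE.
rewrite evC (nbhs1 (iterv_local D k gE')).
by rewrite (iterv_killed k g oW1 (nf_D0 nf) W1y) zy mul0r.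
Qed.

Definition dense_near p f := forall (N : set M), nbhs p N -> exists2 y, N y & cval f y != 0.
Lemma dcancel W f a b : open W -> (forall x, W x -> dense_near x f) ->
 (forall x, W x -> cval f x * cval a x = cval f x * cval b x) -> forall x, W x -> cval a x = cval b x.
Proof.
move=> oW df E x Wx; apply/eqP/negPn/negP; rewrite -subr_eq0 -cvalB => ab.
have [y [Wy aby] fy] := df x Wx _ (filterI (nopen oW Wx) (n_open nC ab)).
move/eqP: (E y Wy); rewrite -subr_eq0 -mulrBr mulf_eq0 (negPf fy) -cvalB => /eqP E0.
by rewrite evC E0 eqxx in aby.
Qed.
Lemma dense_unit p f : cval f p != 0 -> dense_near p f.
Proof. by move=> fp N pN; exists p => //; exact: nbhs1. Qed.
Lemma dense_zero p f : (cval f p = 0 -> transv f p) -> dense_near p f.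
Proof.
move=> H; have [/H tf|/dense_unit //] := eqVneq (cval f p) 0.
by move=> N pN; exact: transv_dense tf pN.
Qed.
Lemma dense_mul W f g x : open W -> W x -> (forall x, W x -> dense_near x f) ->
 (forall x, W x -> dense_near x g) -> dense_near x (f * g).
Proof.
move=> oW Wx df dg N xN; have [y [Wy] ny fy] := df x Wx _ (filterI (nopen oW Wx) (nbhs_interior xN)).
have [y' [Ny' fy'] gy'] := dg y Wy _ (filterI ny (n_open nC fy)).
by exists y' => //; rewrite !cvE mulf_neq0.
Qed.
End Division.

Section Wedge.
Variables (K : fieldType) (X : topologicalType) (A : falg K X).

Lemma wedge_dep x (s : seq A) (c : nat -> K) : wedge_neq0 x s ->
 (forall V : vect (idealT A), \sum_(i < size s) c i * ev (V s`_i) x = 0) ->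
 forall i, (i < size s)%N -> c i = 0.
Proof.
move=> [V dV] H i si; apply: contrapT => /eqP ci; move/negP: dV; apply.
apply/det0P; exists (\row_k c k).
 by apply/negP => /eqP /rowP /(_ (Ordinal si)); rewrite !mxE => /eqP; rewrite (negPf ci).
apply/rowP => j; rewrite !mxE -[RHS](H (V j)); apply: eq_bigr => k _.
by rewrite !mxE.
Qed.
End Wedge.

(** * Transverse families and their crossings *)

Section Families.
Variables (R : realType) (n : nat) (M : manifold R n).
Local Notation TC := (vect (idealT (CC M))).
Local Notation CC := (CC M).
Implicit Types (U W : set M) (p x : M) (f g h a b : CC).
Let nC := nice_CC M.
Definition transv_fam U j (f : 'I_j -> CC) := forall (S : {set 'I_j}) x, U x ->
 (forall i, i \in S -> ev (f i) x = 0) ->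
 wedge_neq0 x (flatten [seq [:: f i; conjA (f i) : CC] | i <- enum S]).

Variables (j : nat) (f : 'I_j -> CC).

Lemma fam_sub U W : W `<=` U -> transv_fam U f -> transv_fam W f.
Proof. by move=> WU tf S x Wx; apply: tf; exact: WU. Qed.
Lemma fam_transv U i x : transv_fam U f -> U x -> cval (f i) x = 0 ->
 transv (f i) x.
Proof.
move=> tf Ux fx; have := tf [set i]%SET x Ux; rewrite enum_set1; apply.
by move=> k; rewrite inE => /eqP ->.
Qed.
(** Otherwise f_k vanishes on the zeros of f_i near x and lies in the ideal of f_i and its
    conjugate; then df_k is at x a combination of the differentials of these two, against
    transversality. *)
Lemma fam_two U i k x (N : set M) : transv_fam U f -> open U -> U x -> i != k ->
 cval (f i) x = 0 -> cval (f k) x = 0 -> nbhs x N ->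
 exists y, [/\ N y, cval (f i) y = 0 & cval (f k) y != 0].
Proof.
move=> tf oU Ux ik fi fk xN; apply: contrapT => H.
have [W [D [nf Wx]]] := nform_exists (fam_transv tf Ux fi).
have [N' [oN' N'x N'N]] := nnopen xN.
have [a [b E]] : exists a b : CC, \forall y \near x,
  cval (f k) y = cval (f i) y * cval a y + cval (conjA (f i)) y * cval b y.
 apply: (@nf_had _ _ _ _ _ _ nf (W `&` N')) => //.
 - by apply: openI => //; exact: nf_open nf.
 - move=> y [_ N'y] fiy; apply/eqP/negPn/negP => fky; apply: H; exists y; split=> //.
  exact: N'N.
have fib : cval (conjA (f i)) x = 0 by apply/eqP; rewrite conjA_eq0 fi.
have VE (V : TC) : cval (V (f k)) x = cval a x * cval (V (f i)) x +
                   cval b x * cval (V (conjA (f i))) x.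
 have E' : \forall y \near x, ev (f k) y = ev (f i * a + conjA (f i) * b) y.
  by apply: filterS E => y Ey; rewrite !cvE Ey cval_conj.
 have -> : cval (V (f k)) x = cval (V (f i * a + conjA (f i) * b)) x :=
  nbhs1 (vect_local nC V E').
 rewrite vectD !vectM cvalD ![cval (_ + _) x]cvalD !cvalM fi fib !mul0r !addr0.
 by rewrite mulrC [X in _ + X]mulrC.
have ES : perm_eq (enum [set i; k]%SET) [:: i; k].
 apply: uniq_perm; rewrite ?enum_uniq //=; first by rewrite inE ik.
 by move=> l; rewrite mem_enum !inE.
have := tf [set i; k]%SET x Ux _; have {ES} : enum [set i; k]%SET = [:: i; k] \/ enum [set i; k]%SET = [:: k; i].
 move: (enum _) ES => [|a1 [|a2 [|a3 l]]] P; have := perm_size P => // _.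
 have := perm_mem P a1; have := perm_mem P a2; have := perm_uniq P; rewrite /= !inE ik !eqxx orbT /=.
 by move=> a12 /esym/orP[]/eqP E2 /esym/orP[]/eqP E1; move: a12; rewrite E1 E2 ?eqxx //; [right|left].
(* The enumeration may list the pair in either order: t1 and t1 + 1 are the positions of f_i and its
   conjugate, t2 that of f_k. *)
pose c (t1 t2 : nat) (l : nat) : R[i] := if l == t1 then cval a x else if l == t1.+1 then cval b x
 else if l == t2 then -1 else 0.
case=> -> H0.
- have /H0 W0 : forall l, l \in [set i; k]%SET -> ev (f l) x = 0.
  by move=> l; rewrite !inE => /orP[]/eqP ->.
 have := @wedge_dep _ _ _ _ _ (c 0 2) W0; move=> /(_ _ 2%N isT) E0.
 have /eqP : (-1 : R[i]) = 0.
  apply: E0 => V; rewrite /= !big_ord_recl big_ord0 /c /= ?evC VE; ring.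
 by rewrite oppr_eq0 oner_eq0.
- have /H0 W0 : forall l, l \in [set i; k]%SET -> ev (f l) x = 0.
  by move=> l; rewrite !inE => /orP[]/eqP ->.
 have := @wedge_dep _ _ _ _ _ (c 2 0) W0; move=> /(_ _ 0%N isT) E0.
 have /eqP : (-1 : R[i]) = 0.
  apply: E0 => V; rewrite /= !big_ord_recl big_ord0 /c /= ?evC VE; ring.
 by rewrite oppr_eq0 oner_eq0.
Qed.

Definition simple : set M :=
 [set x | forall i k, cval (f i) x = 0 -> cval (f k) x = 0 -> i = k].
(** The branches other than the i-th are left one at a time by [fam_two], inside the zeros of f_i;
    having left a branch is an open condition. *)
Lemma simple_dense U i x (N : set M) : transv_fam U f -> open U -> U x ->
 cval (f i) x = 0 -> nbhs x N -> exists y, [/\ N y, cval (f i) y = 0 & simple y].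
Proof.
move=> tf oU Ux fi /nnopen [N' [oN' N'x N'N]].
suff H (l : seq 'I_j) : i \notin l -> exists y, [/\ U y, N' y, cval (f i) y = 0 &
  forall k, k \in l -> cval (f k) y != 0].
 have [|y [Uy N'y fiy fl]] := H [seq k <- enum 'I_j | k != i].
  by rewrite mem_filter eqxx.
 exists y; split=> //; first exact: N'N.
 have only k : cval (f k) y = 0 -> k = i.
  move=> fk; apply/eqP/negPn/negP => ki; have := fl k; rewrite mem_filter ki mem_enum fk eqxx.
  by move/(_ isT).
 by move=> k k' /only -> /only ->.
elim: l => [|k l IH]; first by exists x.
rewrite inE negb_or => /andP[ik /IH [y [Uy N'y fiy fl]]].
have [fk|fk] := eqVneq (cval (f k) y) 0; last first.
 by exists y; split=> // k'; rewrite inE => /orP[/eqP ->|/fl].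
have nl : \forall s \near y, forall k', k' \in l -> cval (f k') s != 0.
 have : \forall s \near y, forall k', (k' \in l) ==> (cval (f k') s != 0).
  apply: filter_forall => k'; case kl : (k' \in l) => /=; last exact: nearW.
  have nk := n_open nC (fl k' kl); exact: nk.
 by apply: filterS => s H k' kl; have := H k'; rewrite kl.
have [s [[[Us N's] sl] fis fks]] := fam_two tf oU Uy ik fiy fk
 (filterI (filterI (nopen oU Uy) (nopen oN' N'y)) nl).
by exists s; split=> // k'; rewrite inE => /orP[/eqP ->|/sl].
Qed.

(** Factors and conjugate factors together, so that one induction covers powers of a local generator
    and of its conjugate. *)
Definition fac (t : 'I_j * bool) : CC := if t.2 then conjA (f t.1) else f t.1.
Lemma fac_eq0 t x : (cval (fac t) x == 0) = (cval (f t.1) x == 0).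
Proof. by rewrite /fac; case: t.2; rewrite ?conjA_eq0. Qed.
Lemma fac_transv U t x : transv_fam U f -> U x -> cval (fac t) x = 0 ->
 transv (fac t) x.
Proof.
case: t => i [] tf Ux; rewrite {1}/fac [LHS]/=; last exact: fam_transv tf Ux.
move=> /eqP; rewrite conjA_eq0 => /eqP f0; exact: transv_conj (fam_transv tf Ux f0).
Qed.

(* Hartogs-type principle: divisibility off the crossings extends over them. *)
Lemma divide_simple (s : seq ('I_j * bool)) U p h : transv_fam U f -> open U -> U p ->
 (forall x, U x -> simple x -> dvd x (\prod_(t <- s) fac t) h) -> dvd p (\prod_(t <- s) fac t) h.
Proof.
elim: s U h => [|t s IH] U h tf oU Up H.
 by exists h; apply: nearW => x; rewrite big_nil !cvE mul1r.
rewrite big_cons.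
have [||h1 h1E] := @divide_generic _ _ M (fac t) U simple p h oU Up (fun x Ux => fac_transv tf Ux).
- move=> x N Ux; move/eqP; rewrite fac_eq0 => /eqP fx xN.
 have [y [Ny fy sy]] := simple_dense tf oU Ux fx xN; exists y; split=> //.
 by apply/eqP; rewrite fac_eq0 fy.
- move=> x Ux _ sx; have := H x Ux sx; rewrite big_cons => -[g gE].
 by exists (\prod_(t <- s) fac t * g); apply: filterS gE => y ->; rewrite !cvalM mulrA.
have [W [oW Wp WE]] := nnopen (filterI h1E (nopen oU Up)).
have WU : W `<=` U by move=> x /WE[].
have [|g gE] := IH W h1 (fam_sub WU tf) oW Wp.
 move=> x Wx sx; have := H x (WU x Wx) sx; rewrite big_cons => -[g gE]; exists g.
 have [N [oN Nx NE]] := nnopen (filterI gE (nopen oW Wx)).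
 apply: filterS (nopen oN Nx) => y Ny; rewrite -cvalM.
 apply: (@dcancel _ _ M N (fac t)) => // {y Ny} y /NE [gy Wy].
  by apply: dense_zero => ft; exact: fac_transv tf (WU y Wy) ft.
 by rewrite -(WE y Wy).1 gy !cvalM mulrA.
exists g; apply: filterS (filterI gE (nopen oW Wp)) => y [gy Wy].
by rewrite (WE y Wy).1 gy !cvalM mulrA.
Qed.

Lemma fac_dense U (s : seq ('I_j * bool)) x : transv_fam U f -> open U -> U x ->
 dense_near x (\prod_(t <- s) fac t).
Proof.
move=> tf oU; elim: s x => [|t s IH] x Ux.
 by rewrite big_nil; apply: dense_unit; rewrite cvE oner_neq0.
rewrite big_cons; apply: (dense_mul oU Ux) => // y Uy.
by apply: dense_zero => ft; exact: fac_transv tf Uy ft.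
Qed.
End Families.

(** * Log ideals *)

Section PrincipalIdeals.
Variables (K : fieldType) (X : topologicalType) (A : falg K X) (nA : nice A).
Implicit Types (I : A -> Prop) (f g h a b : A) (p x : X) (U W : set X).

Definition near_in I f x := exists2 h, I h & \forall y \near x, ev f y = ev h y.
Definition loc_ideal I := forall f, (forall x, near_in I f x) -> I f.
Definition zeros_of I : set X := [set x | forall h, I h -> ev h x = 0].
Lemma nin_mem I f x : I f -> near_in I f x.
Proof. by move=> If; exists f => //; exact: nearW. Qed.
Lemma near_in_unit (J : ideal A) e f x : J e -> ev e x != 0 -> near_in J f x.
Proof.
move=> Je ex; have [v vE] := n_inv nA ex; exists (f * v * e); first exact: idealM.
by apply: filterS vE => y vy; rewrite -mulrA (nM nA) (nM nA v) [ev v y * _]mulrC vy mulr1.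
Qed.
Lemma nearby (P : X -> Prop) x : (\forall y \near x, P y) ->
 \forall y \near x, \forall z \near y, P z.
Proof.
move=> /near_nbhsO [N [oN Nx NP]]; apply: filterS (nopen oN Nx) => y Ny.
by apply: filterS (nopen oN Ny) => z /NP.
Qed.
Lemma gen_by_unit U W I g (u z : A) : open W -> W `<=` U -> gen_by U I g ->
 (forall y, W y -> ev u y != 0 /\ \forall s \near y, ev g s = ev u s * ev z s) ->
 gen_by W I z.
Proof.
move=> oW WU gg H x Wx f; have [uy gE] := H x Wx; have [v vE] := n_inv nA uy.
split=> [/(gg x (WU x Wx) f).1 [h hE]|[h hE]].
 exists (h * u); apply: filterS (filterI hE gE) => y [-> ->].
 by rewrite (nM nA) mulrA.
apply/(gg x (WU x Wx) f); exists (h * v); apply: filterS (filterI hE (filterI gE vE)).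
by move=> y [-> [-> uv]]; rewrite (nM nA) -mulrA; congr (_ * _); rewrite mulrA [ev v y * _]mulrC uv mul1r.
Qed.

Definition nz_dense g x := forall N : set X, nbhs x N -> exists2 y, N y & ev g y != 0.
Lemma nz_cancel W g a b : open W -> (forall x, W x -> nz_dense g x) ->
 (forall x, W x -> ev g x * ev a x = ev g x * ev b x) -> forall x, W x -> ev a x = ev b x.
Proof.
move=> oW dg E x Wx; apply/eqP/negPn/negP; rewrite -subr_eq0 -(nB nA) => ab.
have [y [Wy aby] gy] := dg x Wx _ (filterI (nopen oW Wx) (n_open nA ab)).
move/eqP: (E y Wy); rewrite -subr_eq0 -mulrBr mulf_eq0 (negPf gy) -(nB nA) => /eqP E0.
by rewrite E0 eqxx in aby.
Qed.
Lemma gen_near U I g x : gen_by U I g -> U x -> near_in I g x.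
Proof. by move=> gg Ux; apply/gg => //; exists 1; apply: nearW => y; rewrite (n1 nA) mul1r. Qed.
Lemma gen_dense U I g x : open U -> gen_by U I g -> U x ->
 (forall N : set X, nbhs x N -> exists2 y, N y & ~ zeros_of I y) -> nz_dense g x.
Proof.
move=> oU gg Ux H N xN; have [y [Ny Uy] nz] := H _ (filterI xN (nopen oU Ux)).
exists y => //; apply/negP => /eqP g0; apply: nz => h Ih.
have [k kE] := (gg y Uy h).1 (nin_mem y Ih).
by rewrite (nbhs1 kE) g0 mulr0.
Qed.
Lemma nowhere_denseP (Z : set X) : nowhere_dense Z ->
 forall x (N : set X), nbhs x N -> exists2 y, N y & ~ Z y.
Proof.
move=> nd x N xN; apply: contrapT => H.
have : interior (closure Z) x.
 apply: filterS xN => y Ny; apply: subset_closure; apply: contrapT => nZ; apply: H.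
 by exists y.
by rewrite nd.
Qed.
Lemma nowhere_dense_closed (Z : set X) : (forall x, ~ Z x -> \forall y \near x, ~ Z y) ->
 (forall x (N : set X), nbhs x N -> exists2 y, N y & ~ Z y) -> nowhere_dense Z.
Proof.
move=> oZ dZ; have cZ : closure Z = Z.
 apply/seteqP; split; last exact: subset_closure.
 by move=> x cx; apply: contrapT => /oZ /cx [y [Zy /(_ Zy)]].
rewrite /nowhere_dense cZ -subset0 => x iZ.
by have [y Zy /(_ Zy)] := dZ x _ iZ.
Qed.
(** Where the section s is nonzero, which is dense, the dual section giving f is f / s. The dual
    sections found near the various points therefore agree and glue. *)
Lemma div_ideal_local I : divisor_ideal I -> loc_ideal I.
Proof.
move=> [L [s [[sS sT] nd HI]]] f H; apply/HI.
have /choice [F FE] : forall x, exists t : lb_index L -> X -> K, is_dual_section t /\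
  \forall y \near x, forall i, lb_open i y -> ev f y = t i y * s i y.
 move=> x; have [h /HI [t dt tE] hE] := H x; exists t; split=> //.
 by apply: filterS hE => y -> i iy; exact: tE.
have dens x N : nbhs x N -> exists2 y, N y & forall i, lb_open i y -> s i y != 0.
 move=> xN; have [y Ny nz] := nowhere_denseP nd xN; exists y => // i iy.
 by apply/negP => /eqP s0; apply: nz; exists i.
have loc i x (t : lb_index L -> X -> K) : is_dual_section t -> lb_open i x ->
  exists a : A, \forall y \near x, t i y = ev a y.
 by move=> [st _] ix; apply: (n_smooth nA _ (lb_openP i)).1 (st i) x ix.
have agree i x y : lb_open i y -> (\forall z \near y, forall i, lb_open i z -> ev f z = F x i z * s i z) ->
  F x i y = F y i y.
 move=> iy Ex; have [dx _] := FE x; have [dy Ey] := FE y.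
 have [a aE] := loc i y _ dx iy; have [b bE] := loc i y _ dy iy.
 rewrite (nbhs1 aE) (nbhs1 bE).
 apply/eqP/negPn/negP; rewrite -subr_eq0 -(nB nA) => ab.
 have oi := nopen (lb_openP i) iy.
 have [z [[[abz iz] [e1 e2]] [e3 e4]] /(_ i iz) sz] := dens y _ (filterI (filterI (filterI (n_open nA ab) oi)
  (filterI aE bE)) (filterI Ex Ey)).
 move/eqP: abz; apply; rewrite (nB nA) -e1 -e2; apply/eqP; rewrite subr_eq0; apply/eqP.
 by apply: (mulIf sz); rewrite -e3 // -e4.
exists (fun i x => F x i x); last by move=> i x ix; have [_ /nbhs1] := FE x; apply.
split=> [i|i j x ix jx]; last by have [[_ dt] _] := FE x; exact: dt.
apply: (n_smooth nA _ (lb_openP i)).2 => x ix; have [dx Ex] := FE x.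
have [a aE] := loc i x _ dx ix; exists a.
apply: filterS (filterI (filterI aE (nopen (lb_openP i) ix)) (nearby Ex)) => y [[<- iy] Ey].
by rewrite -(agree i x y).
Qed.

(** The line bundle has one trivialisation per local generator, with the ratios of generators as
    transition functions. Generators are nonzero on dense sets, so these ratios are unique, and the
    cocycle identity follows. *)
Lemma div_ideal_intro I : loc_ideal I ->
 (forall p, exists (U : set X) g, [/\ open U, U p & gen_by U I g]) ->
 (forall x (N : set X), nbhs x N -> exists2 y, N y & ~ zeros_of I y) -> divisor_ideal I.
Proof.
move=> lI pI dI.
pose J := {Ug : set X * A | open Ug.1 /\ gen_by Ug.1 I Ug.2}.
pose O (i : J) := (projT1 i).1; pose G (i : J) := (projT1 i).2.
have oO i : open (O i) by have [] := projT2 i.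
have gG i : gen_by (O i) I (G i) by have [] := projT2 i.
have dG i x : O i x -> nz_dense (G i) x.
 by move=> Ox; apply: gen_dense (oO i) (gG i) Ox _; exact: dI.
have ratio i j x : exists k : A, O i x -> O j x ->
  \forall y \near x, ev (G i) y = ev k y * ev (G j) y.
 have [Ox|nO] := pselect (O i x /\ O j x).
  have [k kE] := (gG j x Ox.2 (G i)).1 (gen_near (gG i) Ox.1).
  by exists k.
 by exists 0 => h1 h2; case: nO.
pose k i j x := projT1 (cid (ratio i j x)).
have kE i j x : O i x -> O j x -> \forall y \near x, ev (G i) y = ev (k i j x) y * ev (G j) y.
 by rewrite /k; case: cid.
have uniq i x (a b : A) : O i x ->
  (\forall y \near x, ev a y * ev (G i) y = ev b y * ev (G i) y) ->
  \forall y \near x, ev a y = ev b y.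
 move=> Ox E; have [N [oN Nx NE]] := near_nbhsO (filterI E (nopen (oO i) Ox)).
 apply: filterS (nopen oN Nx) => y Ny; apply: (@nz_cancel N (G i)) => // z /NE[Ez Oz].
  exact: dG.
 by rewrite ![ev (G i) z * _]mulrC.
pose T i j x := ev (k i j x) x.
have TE i j x : O i x -> O j x -> \forall y \near x, T i j y = ev (k i j x) y.
 move=> Oi Oj; apply: filterS (filterI (filterI (nopen (oO i) Oi) (nopen (oO j) Oj))
  (nearby (kE i j x Oi Oj))) => y [[Oiy Ojy] Ey].
 apply: (nbhs1 (uniq j y _ _ Ojy _)).
 by apply: filterS (filterI Ey (kE i j y Oiy Ojy)) => z [<- <-].
have Tcoc i j l x : O i x -> O j x -> O l x -> T i j x * T j l x = T i l x.
 move=> Oi Oj Ol; rewrite /T -(nM nA); apply: (nbhs1 (uniq l x _ _ Ol _)).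
 apply: filterS (filterI (kE i j x Oi Oj) (filterI (kE j l x Oj Ol) (kE i l x Oi Ol))).
 by move=> y [e1 [e2 e3]]; rewrite -e3 (nM nA) e1 e2 mulrA.
have T1 i x : O i x -> T i i x = 1.
 move=> Oi; rewrite /T -(n1 nA x); apply: (nbhs1 (uniq i x _ _ Oi _)).
 by apply: filterS (kE i i x Oi Oi) => y <-; rewrite (n1 nA) mul1r.
have T0 i j x : O i x -> O j x -> T i j x != 0.
 move=> Oi Oj; apply/negP => /eqP t0; have := Tcoc i j i x Oi Oj Oi.
 by rewrite t0 mul0r T1 // => /eqP; rewrite eq_sym oner_eq0.
have cov x : exists i, O i x.
 have [U [g [oU Ux gg]]] := pI x.
 by exists (exist _ (U, g) (conj oU gg)).
have sT i j : locally_smooth A (O i `&` O j) (T i j).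
 apply: (n_smooth nA _ (openI (oO i) (oO j))).2 => x [Oi Oj].
 by exists (k i j x); exact: TE.
exists (@LineBundle _ _ A J O T oO cov sT T0 Tcoc), (fun i => ev (G i)); split.
- split=> /= [i|i j x Oi Oj].
  by apply: (n_smooth nA _ (oO i)).2 => x _; exists (G i); exact: nearW.
 exact: nbhs1 (kE i j x Oi Oj).
- apply: nowhere_dense_closed => [x nz|x N xN].
  have [i Oi] := cov x.
  have gx : ev (G i) x != 0 by apply/negP => /eqP g0; apply: nz; exists i.
  apply: filterS (filterI (n_open nA gx) (nopen (oO i) Oi)) => y [gy Oiy] [j /= Ojy gj].
  move/eqP: gy; apply; rewrite (nbhs1 (kE i j y Oiy Ojy)) gj mulr0 //.
 have [i Oi] := cov x; have [y [Ny Oy] gy] := dG i x Oi _ (filterI xN (nopen (oO i) Oi)).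
 exists y => // -[j /= Oj gj]; move/eqP: gy; apply.
 by rewrite (nbhs1 (kE i j y Oy Oj)) gj mulr0.
move=> f; split=> [If|[t [st dt] tE]].
 have /choice [h hE] : forall x, exists h : J -> A, forall i, O i x ->
   \forall y \near x, ev f y = ev (h i) y * ev (G i) y.
  move=> x; have H i : exists h : A, O i x -> \forall y \near x, ev f y = ev h y * ev (G i) y.
   have [Oi|nO] := pselect (O i x); last by exists 0.
   by have [h hE] := (gG i x Oi f).1 (nin_mem x If); exists h.
  by have [h hE] := choice H; exists h.
 have near_h i x : O i x -> \forall y \near x, ev (h y i) y = ev (h x i) y.
  move=> Oi; apply: filterS (filterI (nopen (oO i) Oi) (nearby (hE x i Oi))) => y [Oy Ey].
  apply: (nbhs1 (uniq i y _ _ Oy _)).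
  by apply: filterS (filterI Ey (hE y i Oy)) => z [<- <-].
 exists (fun i x => ev (h x i) x); last by move=> i x Oi; exact: nbhs1 (hE x i Oi).
 split=> [i|i j x Oi Oj].
  by apply: (n_smooth nA _ (oO i)).2 => x Oi; exists (h x i); exact: near_h.
 rewrite /= /T -(nM nA); apply: (nbhs1 (uniq j x _ _ Oj _)).
 apply: filterS (filterI (filterI (hE x i Oi) (hE x j Oj)) (kE i j x Oi Oj)) => y [[e1 e2] e3].
 by rewrite -e2 e1 e3 (nM nA) mulrA.
apply: lI => x; have [i Oi] := cov x; apply/(gG i x Oi).
have [a aE] := (n_smooth nA _ (oO i)).1 (st i) x Oi.
exists a; apply: filterS (filterI aE (nopen (oO i) Oi)) => y [<- Oy]; exact: tE.
Qed.
End PrincipalIdeals.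

(** * Log ideals and the extension principle *)

Section LogIdeals.
Variables (R : realType) (n : nat) (M : manifold R n).
Local Notation CC := (CC M).
Implicit Types (U W : set M) (p x : M) (f g h a b z : CC) (I : CC -> Prop).
Let nC := nice_CC M.
Definition simple_gen I W z := [/\ open W, gen_by W I z &
 forall x, W x -> cval z x = 0 -> transv z x].
Definition simple_at I p := exists W z, W p /\ simple_gen I W z.
Lemma log_fam U I j (f : 'I_j -> CC) : log_product U I f -> transv_fam U f.
Proof. by case. Qed.
(** All factors except at most one are units near such a point, so the remaining factor
    generates. *)
Lemma log_simple U I j (f : 'I_j -> CC) x : open U -> log_product U I f -> U x ->
 simple f x -> simple_at I x.
Proof.
move=> oU [gF _ tf] Ux sx.
have [[i fi]|nf] := pselect (exists i, cval (f i) x = 0).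
 pose u : CC := \prod_(k | k != i) f k.
 have ux : ev u x != 0.
  rewrite cvE cval_prod prodf_seq_neq0; apply/allP => k _; apply/implyP => ki.
  by apply: contraNneq ki => fk; apply/eqP; exact: sx.
 have [W [oW Wx WE]] := nnopen (filterI (n_open nC ux) (nopen oU Ux)).
 have WU : W `<=` U by move=> y /WE[].
 exists W, (f i); split=> //; split=> //.
  apply: (gen_by_unit nC oW WU gF (u := u)) => y Wy; split; first by have [] := WE y Wy.
  by apply: nearW => s; rewrite (bigD1 i) //= ?evC cvalM mulrC.
 by move=> y /WU Uy; exact: fam_transv tf Uy.
have ux : ev (\prod_k f k : CC) x != 0.
 rewrite evC cval_prod prodf_seq_neq0; apply/allP => k _; apply/implyP => _.
 by apply/negP => /eqP fk; apply: nf; exists k.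
have [W [oW Wx WE]] := nnopen (filterI (n_open nC ux) (nopen oU Ux)).
have WU : W `<=` U by move=> y /WE[].
exists W, 1; split=> //; split=> //.
 apply: (gen_by_unit nC oW WU gF (u := \prod_k f k)) => y Wy; split; first by have [] := WE y Wy.
 by apply: nearW => s; rewrite (n1 nC) mulr1.
by move=> y _ /eqP; rewrite cval1 oner_eq0.
Qed.

Lemma conjA1 : conjA (1 : CC) = 1.
Proof. by apply: cval_inj => x; rewrite !cvE conjc1. Qed.
Lemma conjAM f g : conjA (f * g) = conjA f * conjA g.
Proof. by apply: cval_inj => x; rewrite !cvE rmorphM. Qed.
Lemma conjAD f g : conjA (f + g) = conjA f + conjA g.
Proof. by apply: cval_inj => x; rewrite !cvE rmorphD. Qed.
Lemma conjA_prod (J : Type) (r : seq J) (P : pred J) (F : J -> CC) :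
 conjA (\prod_(i <- r | P i) F i) = \prod_(i <- r | P i) conjA (F i).
Proof. by apply: (big_morph (@conjA R n M)) => [f g|]; [exact: conjAM|exact: conjA1]. Qed.
Lemma prod_fac j (f : 'I_j -> CC) N N' : exists s : seq ('I_j * bool),
 (\prod_i f i) ^+ N * conjA (\prod_i f i) ^+ N' = \prod_(t <- s) fac f t.
Proof.
elim: N => [|N [s IH]]; last first.
 exists ([seq (i, false) | i <- enum 'I_j] ++ s).
 by rewrite big_cat big_map /= -IH exprS -!mulrA big_enum.
elim: N' => [|N' [s IH]]; first by exists [::]; rewrite big_nil mul1r.
exists ([seq (i, true) | i <- enum 'I_j] ++ s).
rewrite big_cat big_map /= -IH exprS expr0 !mul1r conjA_prod big_enum //.
Qed.
Lemma log_divide I U W j (f : 'I_j -> CC) p h N N' (F := \prod_i f i) : open U -> open W ->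
 W p -> W `<=` U -> log_product U I f ->
 (forall x, W x -> simple_at I x -> dvd x (F ^+ N * conjA F ^+ N') h) ->
 dvd p (F ^+ N * conjA F ^+ N') h.
Proof.
move=> oU oW Wp WU lp; have [s ->] := prod_fac f N N' => H.
apply: (divide_simple (fam_sub WU (log_fam lp)) oW Wp) => x Wx sx; apply: H => //.
exact: log_simple lp (WU x Wx) sx.
Qed.
Lemma log_power_dense I U j (f : 'I_j -> CC) x N N' (F := \prod_i f i) : open U -> U x ->
 log_product U I f -> dense_near x (F ^+ N * conjA F ^+ N').
Proof.
move=> oU Ux lp; have [s ->] := prod_fac f N N'; exact: fac_dense (log_fam lp) oU Ux.
Qed.
Lemma log_near_in I h : locally_log I -> (forall x, simple_at I x -> near_in I h x) ->
 forall p, near_in I h p.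
Proof.
move=> lI H p; have [U [oU Up [j [f lp]]]] := lI p; have [gF _ _] := lp.
have E : (\prod_i f i) = (\prod_i f i) ^+ 1 * conjA (\prod_i f i) ^+ 0 by rewrite expr1 expr0 mulr1.
have : dvd p ((\prod_i f i) ^+ 1 * conjA (\prod_i f i) ^+ 0) h.
 rewrite -E; rewrite E; have [s sE] := prod_fac f 1 0; rewrite sE.
 apply: (divide_simple (log_fam lp) oU Up) => x Ux sx; rewrite -sE -E.
 have [k kE] := (gF x Ux h).1 (H x (log_simple oU lp Ux sx)).
 by exists k; apply: filterS kE => y; rewrite mulrC.
rewrite -E => -[g gE]; apply/(gF p Up); exists g.
by apply: filterS gE => y; rewrite mulrC.
Qed.

Lemma log_zeros_dense I : locally_log I -> forall p (N : set M), nbhs p N ->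
 exists2 y, N y & ~ zeros_of I y.
Proof.
move=> lI p N pN; have [U [oU Up [j [f lp]]]] := lI p; have [gF _ _] := lp.
have [y [Ny Uy]] := log_power_dense 1 0 oU Up lp (filterI pN (nopen oU Up)).
rewrite expr1 expr0 mulr1 => Fy; exists y => // zy; have [h Ih hE] := gen_near nC gF Uy.
by move/eqP: Fy; apply; rewrite [LHS](nbhs1 hE); exact: zy.
Qed.
(** A compatible system a_i h = b_i need only be solved near simple points, provided that near each
    point some a_i is a power of the local generator times a power of its conjugate. For that index
    the Hartogs-type principle gives h, the compatibility relations give the other equations, and
    [solve_locally] glues. *)
Lemma log_extend (J : Type) (a b : J -> CC) I : locally_log I ->
 (forall i k, a i * b k = a k * b i) ->
 (forall x, simple_at I x -> exists h, forall i, \forall y \near x, cval (a i) y * cval h y = cval (b i) y) ->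
 (forall p U j (f : 'I_j -> CC), open U -> U p -> log_product U I f -> exists i N N',
   \forall x \near p, cval (a i) x = cval ((\prod_k f k) ^+ N * conjA (\prod_k f k) ^+ N') x) ->
 exists h, forall i, a i * h = b i.
Proof.
move=> lI ab solved powers.
have dens : dense_supp a.
 move=> x N xN; have [U [oU Ux [j [f lp]]]] := lI x.
 have [i [N1 [N2 E]]] := powers x U j f oU Ux lp.
 have [y [Ny Ey] Fy] := log_power_dense N1 N2 oU Ux lp (filterI xN E).
 by exists y => //; exists i; rewrite evC Ey.
apply: (solve_locally nC dens) => p.
have [U [oU Up [j [f lp]]]] := lI p; have [i [N1 [N2 E]]] := powers p U j f oU Up lp.
have [W [oW Wp WE]] := nnopen (filterI E (nopen oU Up)).
have WU : W `<=` U by move=> x /WE[].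
have [|h hE] := @log_divide I U W j f p (b i) N1 N2 oU oW Wp WU lp.
 move=> x Wx sx; have [k kE] := solved x sx; exists k.
 by apply: filterS (filterI (kE i) (nopen oW Wx)) => y [<- Wy]; rewrite -(WE y Wy).1.
have {}hE : \forall x \near p, cval (b i) x = cval (a i * h) x.
 by apply: filterS (filterI hE E) => x [e1 e]; rewrite e1 [RHS]cvalM e.
exists h; have [N [oN Np NE]] := nnopen (filterI hE (nopen oW Wp)).
apply: filterS (nopen oN Np) => y Ny k; rewrite !evC.
apply: (@dcancel _ _ M N (a i)) => // {y Ny} y /NE [hy Wy].
 move=> N' yN'; have [s [N's Ws] Fs] := log_power_dense N1 N2 oU (WU _ Wy) lp
  (filterI yN' (nopen oW Wy)).
 by exists s => //; rewrite (WE s Ws).1.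
by rewrite -[RHS]cvalM ab [RHS]cvalM hy !cvalM mulrCA.
Qed.
End LogIdeals.

(** * Exterior calculus *)

Local Notation ctr := Defs.contract.
Arguments clifford {R n M K A} u rho k _.

Section Exterior.
Variables (K : fieldType) (X : Type) (A : falg K X) (I : ideal A).
Local Notation T := (vect I).
Implicit Types (Y Z W : T) (f : A).

Lemma kaddE k (a b : kform I k) V : (a + b) V = a V + b V. Proof. by []. Qed.
Lemma koppE k (a : kform I k) V : (- a) V = - a V. Proof. by []. Qed.
Lemma kzeroE k V : (0 : kform I k) V = 0. Proof. by []. Qed.
Definition kE := (kaddE, koppE, kzeroE).
Lemma vconsE0 k Y (V : 'I_k -> T) : vcons Y V ord0 = Y.
Proof. by rewrite /vcons unlift_none. Qed.
Lemma vconsES k Y (V : 'I_k -> T) i : vcons Y V (lift ord0 i) = V i.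
Proof. by rewrite /vcons liftK. Qed.
Lemma vcons_eta k (V : 'I_k.+1 -> T) : vcons (V ord0) (V \o lift ord0) = V.
Proof.
by fext => i; case: (unliftP ord0 i) => [j ->|->]; rewrite ?vconsE0 ?vconsES.
Qed.
Lemma vcons_lift0 k Y (V : 'I_k -> T) : vcons Y V \o lift ord0 = V.
Proof. by fext => i /=; rewrite vconsES. Qed.
Lemma vcons_liftS k Y (V : 'I_k.+1 -> T) i :
 vcons Y V \o lift (lift ord0 i) = vcons Y (V \o lift i).
Proof.
fext => j /=; case: (unliftP ord0 j) => [j' ->|->].
 have -> : lift (lift ord0 i) (lift ord0 j') = lift ord0 (lift i j').
  by apply: val_inj; exact: bumpS.
 by rewrite !vconsES.
have -> : lift (lift ord0 i) ord0 = ord0 by apply: val_inj.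
by rewrite !vconsE0.
Qed.
Lemma upd_vcons0 k Y Z (V : 'I_k -> T) : upd (vcons Y V) ord0 Z = vcons Z V.
Proof.
by fext => i; rewrite /upd; case: (unliftP ord0 i) => [j ->|->]; rewrite ?vconsE0 ?vconsES.
Qed.
Lemma upd_vconsS k Y Z (V : 'I_k -> T) i :
 upd (vcons Y V) (lift ord0 i) Z = vcons Y (upd V i Z).
Proof.
fext => j; rewrite /upd; case: (unliftP ord0 j) => [j' ->|->]; last first.
 by rewrite (negPf (neq_lift _ _)) !vconsE0.
by rewrite (inj_eq (@lift_inj _ ord0)) !vconsES /upd.
Qed.
Definition v1 Y : 'I_1 -> T := fun=> Y.
Definition v2 Y Z := vcons Y (v1 Z).
Definition v3 Y Z W := vcons Y (v2 Z W).
Lemma v1_eta (V : 'I_1 -> T) : V = v1 (V ord0).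
Proof. by fext => i; rewrite ord1. Qed.
Lemma v1_vcons Y (V : 'I_0 -> T) : vcons Y V = v1 Y.
Proof. by fext => i; rewrite ord1 vconsE0. Qed.
Lemma v2_eta (V : 'I_2 -> T) : V = v2 (V ord0) (V (lift ord0 ord0)).
Proof. by rewrite /v2 -{1}[V]vcons_eta; congr vcons; exact: v1_eta. Qed.
Lemma v3_eta (V : 'I_3 -> T) :
 V = v3 (V ord0) (V (lift ord0 ord0)) (V (lift ord0 (lift ord0 ord0))).
Proof. by rewrite /v3 -{1}[V]vcons_eta; congr vcons; exact: v2_eta. Qed.
Lemma v0_eta (V V' : 'I_0 -> T) : V = V'.
Proof. by fext => -[]. Qed.
(** Identities between forms are proved by contracting both sides and inducting on the degree. *)
Lemma kform_ext k (a b : kform I k.+1) :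
 (forall Y : T, ctr Y a = ctr Y b) -> a = b.
Proof.
move=> H; fext => V; rewrite -[V]vcons_eta.
by have := H (V ord0) => /(congr1 (fun c : kform I k => c (V \o lift ord0))).
Qed.

Section FormTheory.
Variables (k : nat) (a : kform I k).
Hypothesis fa : is_form a.

Lemma formD V i Y Z : a (upd V i (Y + Z)) = a (upd V i Y) + a (upd V i Z).
Proof. by case: fa. Qed.
Lemma formZ V i f Y : a (upd V i (vscale f Y)) = f * a (upd V i Y).
Proof. by case: fa. Qed.
Lemma form_alt V i j : i != j -> V i = V j -> a V = 0.
Proof. by case: fa => _ _; apply. Qed.
Lemma form0 V i : a (upd V i 0) = 0.
Proof. by apply: (addrI (a (upd V i 0))); rewrite -formD !addr0. Qed.
Lemma formN V i Y : a (upd V i (- Y)) = - a (upd V i Y).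
Proof. by apply: (addrI (a (upd V i Y))); rewrite -formD !subrr form0. Qed.
Lemma upd_id V i : upd V i (V i) = V :> ('I_k -> T).
Proof. by fext => j; rewrite /upd; case: eqP => [->|]. Qed.
Lemma form_swap V i j Y Z : i != j ->
 a (upd (upd V i Y) j Z) = - a (upd (upd V i Z) j Y).
Proof.
move=> ij; apply/eqP; rewrite -addr_eq0; apply/eqP.
have H W : a (upd (upd V i W) j W) = 0.
 by apply: (form_alt ij); rewrite /upd (negPf ij) !eqxx.
have := H (Y + Z); rewrite formD.
have sw W W' : upd (upd V i W) j W' = upd (upd V j W') i W :> ('I_k -> T).
 fext => l; rewrite /upd; case: (eqVneq l j) => [->|//].
 by rewrite eq_sym (negPf ij).
by rewrite !sw !formD -!sw !H addr0 add0r => <-; rewrite addrC.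
Qed.
End FormTheory.

Lemma ctr_form k (a : kform I k.+1) Y : is_form a -> is_form (ctr Y a).
Proof.
move=> fa; split=> [V i Z Z'|V i f Z|V i j ij Vij]; rewrite /ctr -?upd_vconsS.
- exact: formD.
- exact: formZ.
- apply: (form_alt fa (i := lift ord0 i) (j := lift ord0 j)); rewrite ?(inj_eq (@lift_inj _ _)) //.
 by rewrite !vconsES.
Qed.
Lemma contractD k (a : kform I k.+1) Y Z : is_form a ->
 ctr (Y + Z) a = ctr Y a + ctr Z a.
Proof.
move=> fa; fext => V.
by have := formD fa (vcons 0 V) ord0 Y Z; rewrite !upd_vcons0.
Qed.
Lemma contractZ k (a : kform I k.+1) f Y : is_form a ->
 ctr (vscale f Y) a = fscale f (ctr Y a).
Proof.
move=> fa; fext => V.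
by have := formZ fa (vcons 0 V) ord0 f Y; rewrite !upd_vcons0.
Qed.
Lemma contractN k (a : kform I k.+1) Y : is_form a -> ctr (- Y) a = - ctr Y a.
Proof.
move=> fa; fext => V.
by have := formN fa (vcons 0 V) ord0 Y; rewrite !upd_vcons0.
Qed.
Lemma contract0 k (a : kform I k.+1) : is_form a -> ctr 0 a = 0.
Proof. by move=> fa; fext => V; have := form0 fa (vcons 0 V) ord0; rewrite upd_vcons0. Qed.
Lemma ctr_alt k (a : kform I k.+2) Y : is_form a -> ctr Y (ctr Y a) = 0.
Proof.
move=> fa; fext => V; apply: (form_alt fa (i := ord0) (j := lift ord0 ord0)) => //.
by rewrite vconsE0 vconsES vconsE0.
Qed.
Lemma ctr_sym k (a : kform I k.+2) Y Z : is_form a ->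
 ctr Y (ctr Z a) = - ctr Z (ctr Y a).
Proof.
move=> fa; have fY := ctr_form Y fa; have fZ := ctr_form Z fa.
have := ctr_alt (Y + Z) fa.
rewrite (contractD Y Z fa); set b := ctr Y a + _.
have -> : ctr (Y + Z) b = ctr (Y + Z) (ctr Y a) + ctr (Y + Z) (ctr Z a) by [].
rewrite !contractD // !ctr_alt // add0r addr0 => /eqP.
by rewrite addr_eq0 => /eqP ->; rewrite opprK.
Qed.
Lemma form0_is_form (a : kform I 0) : is_form a.
Proof. by split=> V []. Qed.
Lemma form_intro k (a : kform I k.+1) :
 (forall Y, is_form (ctr Y a)) ->
 (forall Y Z, ctr (Y + Z) a = ctr Y a + ctr Z a) ->
 (forall f Y, ctr (vscale f Y) a = fscale f (ctr Y a)) ->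
 (forall Y (V : 'I_k -> T) j, V j = Y -> a (vcons Y V) = 0) -> is_form a.
Proof.
move=> fa aD aZ a0; split=> [V i Y Z|V i f Y|V i j ij Vij]; rewrite -[V]vcons_eta.
- case: (unliftP ord0 i) => [i' ->|->]; last first.
  by rewrite !upd_vcons0; have := aD Y Z => /(congr1 (fun c : kform I k => c (V \o lift ord0))).
 by rewrite !upd_vconsS; have := formD (fa (V ord0)) (V \o lift ord0) i' Y Z.
- case: (unliftP ord0 i) => [i' ->|->]; last first.
  by rewrite !upd_vcons0; have := aZ f Y => /(congr1 (fun c : kform I k => c (V \o lift ord0))).
 by rewrite !upd_vconsS; have := formZ (fa (V ord0)) (V \o lift ord0) i' f Y.
- move: ij Vij; case: (unliftP ord0 i) => [i' ->|->]; case: (unliftP ord0 j) => [j' ->|->] ij Vij.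
 + by apply: (form_alt (fa (V ord0)) (i := i') (j := j')); rewrite ?(inj_eq (@lift_inj _ _)) // in ij *.
 + exact: (a0 _ _ i').
 + by apply: (a0 _ _ j'); rewrite /= Vij.
 + by rewrite eqxx in ij.
Qed.

Lemma form_introS k (a : kform I k.+2) :
 (forall Y, is_form (ctr Y a)) ->
 (forall Y Z, ctr (Y + Z) a = ctr Y a + ctr Z a) ->
 (forall f Y, ctr (vscale f Y) a = fscale f (ctr Y a)) ->
 (forall Y, ctr Y (ctr Y a) = 0) -> is_form a.
Proof.
move=> fa aD aZ a0; apply: form_intro => // Y V j Vj.
have {a0} a0 (V' : 'I_k -> T) : a (vcons Y (vcons Y V')) = 0.
 by have := a0 Y => /(congr1 (fun c : kform I k => c V')).
have [j0|j0] := eqVneq j ord0.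
 by rewrite -[V]vcons_eta -j0 Vj a0.
have := @form_swap _ _ (fa Y) V ord0 j Y (V ord0); rewrite eq_sym => /(_ j0).
have -> : upd (upd V ord0 (V ord0)) j Y = V by rewrite upd_id -Vj upd_id.
rewrite -[upd _ j _]vcons_eta {1}/upd eq_sym (negPf j0) {1}/upd eqxx.
by rewrite {1}/ctr a0 => /esym/eqP; rewrite oppr_eq0 => /eqP.
Qed.

Lemma form1_intro (a : kform I 1) :
 (forall Y Z, a (v1 (Y + Z)) = a (v1 Y) + a (v1 Z)) ->
 (forall f Y, a (v1 (vscale f Y)) = f * a (v1 Y)) -> is_form a.
Proof.
move=> aD aZ; apply: form_intro => [Y|Y Z|f Y|Y V []] //; first exact: form0_is_form.
- by fext => V; rewrite kE /ctr !v1_vcons aD.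
- by fext => V; rewrite /ctr /fscale !v1_vcons aZ.
Qed.
Lemma form1D (a : kform I 1) Y Z : is_form a -> a (v1 (Y + Z)) = a (v1 Y) + a (v1 Z).
Proof.
move=> fa; have := contractD Y Z fa => /(congr1 (fun c : kform I 0 => c (fun=> 0))).
by rewrite kE /ctr !v1_vcons.
Qed.
Lemma form1Z (a : kform I 1) f Y : is_form a -> a (v1 (vscale f Y)) = f * a (v1 Y).
Proof.
move=> fa; have := contractZ f Y fa => /(congr1 (fun c : kform I 0 => c (fun=> 0))).
by rewrite /ctr !v1_vcons => ->; rewrite /fscale v1_vcons.
Qed.
Lemma is_formD k (a b : kform I k) : is_form a -> is_form b -> is_form (a + b).
Proof.
move=> fa fb; split=> [V i Y Z|V i f Y|V i j ij Vij]; rewrite ?fctE.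
- by rewrite !formD //; ring.
- by rewrite !formZ // mulrDr.
- by rewrite !(form_alt _ ij) // addr0.
Qed.
Lemma is_formN k (a : kform I k) : is_form a -> is_form (- a).
Proof.
move=> fa; split=> [V i Y Z|V i f Y|V i j ij Vij]; rewrite ?fctE.
- by rewrite formD // opprD.
- by rewrite formZ // mulrN.
- by rewrite (form_alt _ ij) // oppr0.
Qed.
Lemma is_form0 k : is_form (0 : kform I k).
Proof. by split=> [V i Y Z|V i f Y|V i j ij Vij]; rewrite ?addr0 ?mulr0. Qed.
Lemma is_formZ k (a : kform I k) f : is_form a -> is_form (fscale f a).
Proof.
move=> fa; split=> [V i Y Z|V i g Y|V i j ij Vij]; rewrite /fscale.
- by rewrite formD // mulrDr.
- by rewrite formZ // mulrCA.
- by rewrite (form_alt _ ij) // mulr0.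
Qed.
(** Antisymmetrisation in one extra argument; wedge products are instances, so their form property
    and contraction rule are derived once. *)
Definition alt k (psi : T -> kform I k) : kform I k.+1 := fun V =>
 \sum_(i < k.+1) (-1) ^+ i * psi (V i) (V \o lift i).
Lemma wedge1_alt k (xi : kform I 1) (a : kform I k) :
 wedge1 xi a = alt (fun Y => fscale (xi (v1 Y)) a).
Proof. by []. Qed.
Lemma ctr_alt0 (psi : T -> kform I 0) Y : ctr Y (alt psi) = psi Y.
Proof.
fext => V; rewrite /ctr /alt big_ord_recl big_ord0 addr0 expr0 mul1r vconsE0.
by rewrite (v0_eta (_ \o _) V).
Qed.
Lemma ctr_altS k (psi : T -> kform I k.+1) Y :
 ctr Y (alt psi) = psi Y - alt (fun Z => ctr Y (psi Z)).
Proof.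
fext => V; rewrite /ctr /alt big_ord_recl expr0 mul1r vconsE0 vcons_lift0 !fctE.
congr (_ + _); rewrite -sumrN; apply: eq_bigr => i _.
by rewrite vconsES vcons_liftS lift0 exprS mulN1r mulNr.
Qed.
Lemma altD k (psi phi : T -> kform I k) : alt (fun Y => psi Y + phi Y) = alt psi + alt phi.
Proof.
fext => V; rewrite /alt !fctE -big_split; apply: eq_bigr => i _.
exact: mulrDr.
Qed.
Lemma altZ k f (psi : T -> kform I k) : alt (fun Y => fscale f (psi Y)) = fscale f (alt psi).
Proof.
fext => V; rewrite /alt /fscale mulr_sumr; apply: eq_bigr => i _.
by rewrite mulrCA.
Qed.
Lemma altN k (psi : T -> kform I k) : alt (fun Y => - psi Y) = - alt psi.
Proof.
fext => V; rewrite /alt !fctE -sumrN; apply: eq_bigr => i _.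
by rewrite mulrN.
Qed.
Lemma alt0 k : alt (fun=> 0 : kform I k) = 0.
Proof. by fext => V; rewrite /alt big1 // => i _; rewrite mulr0. Qed.
Lemma alt_form k (psi : T -> kform I k) : (forall Y, is_form (psi Y)) ->
 (forall Y Z, psi (Y + Z) = psi Y + psi Z) ->
 (forall f Y, psi (vscale f Y) = fscale f (psi Y)) -> is_form (alt psi).
Proof.
elim: k psi => [|k IH] psi fp pD pZ.
 by apply: form_intro => [Y|Y Z|f Y|Y V []] //; rewrite ?ctr_alt0 //; exact: form0_is_form.
have fq Y : is_form (alt (fun Z => ctr Y (psi Z))).
 apply: IH => [Z|Z Z'|f Z]; first exact: ctr_form.
  by rewrite pD.
 by rewrite pZ.
apply: form_introS => [Y|Y Z|f Y|Y]; rewrite ?ctr_altS.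
- by apply: is_formD => //; exact: is_formN.
- rewrite pD [RHS]addrACA -opprD -altD; congr (_ - alt _); fext => W.
 by rewrite contractD.
- rewrite pZ; have -> : fscale f (psi Y - alt (fun Z => ctr Y (psi Z))) =
   fscale f (psi Y) - fscale f (alt (fun Z => ctr Y (psi Z))).
  by fext => V; rewrite /fscale !kE mulrBr.
 by rewrite -altZ; congr (_ - alt _); fext => Z; rewrite contractZ.
- have -> (b c : kform I k.+1) : ctr Y (b - c) = ctr Y b - ctr Y c by [].
 case: k psi fp pD pZ {IH fq} => [|k] psi fp pD pZ.
  by rewrite ctr_alt0 subrr.
 rewrite ctr_altS opprB addrC subrK -[RHS](alt0 k); congr alt.
 by fext => Z; rewrite ctr_alt.
Qed.

Lemma wedge1_form k (xi : kform I 1) (a : kform I k) : is_form xi -> is_form a ->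
 is_form (wedge1 xi a).
Proof.
move=> fx fa; rewrite wedge1_alt; apply: alt_form => [Y|Y Z|f Y]; first exact: is_formZ.
 by fext => V; rewrite /fscale !kE form1D // mulrDl.
by fext => V; rewrite /fscale form1Z // mulrA.
Qed.
Lemma ctr_wedge0 (xi : kform I 1) (a : kform I 0) Y :
 ctr Y (wedge1 xi a) = fscale (xi (v1 Y)) a.
Proof. by rewrite wedge1_alt ctr_alt0. Qed.
Lemma ctr_wedgeS k (xi : kform I 1) (a : kform I k.+1) Y :
 ctr Y (wedge1 xi a) = fscale (xi (v1 Y)) a - wedge1 xi (ctr Y a).
Proof. by rewrite wedge1_alt ctr_altS. Qed.
Lemma wedge1Dl k (xi eta : kform I 1) (a : kform I k) :
 wedge1 (xi + eta) a = wedge1 xi a + wedge1 eta a.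
Proof.
rewrite !wedge1_alt -altD; congr alt; fext => Y; fext => V.
by rewrite /fscale !kE mulrDl.
Qed.
Lemma wedge1Zl k f (xi : kform I 1) (a : kform I k) :
 wedge1 (fscale f xi) a = fscale f (wedge1 xi a).
Proof.
rewrite !wedge1_alt -altZ; congr alt; fext => Y; fext => V.
by rewrite /fscale mulrA.
Qed.
Lemma wedge1Nl k (xi : kform I 1) (a : kform I k) : wedge1 (- xi) a = - wedge1 xi a.
Proof.
rewrite !wedge1_alt -altN; congr alt; fext => Y; fext => V.
by rewrite /fscale !kE mulNr.
Qed.
Lemma wedge1D k (xi : kform I 1) (a b : kform I k) :
 wedge1 xi (a + b) = wedge1 xi a + wedge1 xi b.
Proof.
rewrite !wedge1_alt -altD; congr alt; fext => Y; fext => V.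
by rewrite /fscale !kE mulrDr.
Qed.
Lemma wedge1N k (xi : kform I 1) (a : kform I k) : wedge1 xi (- a) = - wedge1 xi a.
Proof.
rewrite !wedge1_alt -altN; congr alt; fext => Y; fext => V.
by rewrite /fscale !kE mulrN.
Qed.
Lemma wedge1Z k f (xi : kform I 1) (a : kform I k) :
 wedge1 xi (fscale f a) = fscale f (wedge1 xi a).
Proof.
rewrite !wedge1_alt -altZ; congr alt; fext => Y; fext => V.
by rewrite /fscale mulrCA.
Qed.
Lemma wedge1_0 k (xi : kform I 1) : wedge1 xi (0 : kform I k) = 0.
Proof. by rewrite wedge1_alt -[RHS](alt0 k); congr alt; fext => Y; fext => V; rewrite /fscale mulr0. Qed.
Lemma wedge1_anti k (xi eta : kform I 1) (a : kform I k) :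
 wedge1 xi (wedge1 eta a) = - wedge1 eta (wedge1 xi a).
Proof.
have cN m (b : kform I m.+1) Y : ctr Y (- b) = - ctr Y b by [].
elim: k a => [|k IH] a; apply: kform_ext => Y; rewrite cN !ctr_wedgeS.
 by rewrite !ctr_wedge0 !wedge1Z opprB.
rewrite ?ctr_wedgeS !wedge1D !wedge1N !wedge1Z IH.
by fext => V; rewrite !kE /fscale; ring.
Qed.
Lemma wedge1_sqr k (xi : kform I 1) (a : kform I k) : wedge1 xi (wedge1 xi a) = 0.
Proof.
elim: k a => [|k IH] a; apply: kform_ext => Y; rewrite !ctr_wedgeS.
 by rewrite ctr_wedge0 wedge1Z subrr.
by rewrite ?ctr_wedgeS wedge1D wedge1N wedge1Z IH subr0 subrr.
Qed.
(** This is 2 b /\ a; keeping the factor two avoids a division. *)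
Definition wedge2 k (b : kform I 2) (a : kform I k) : kform I k.+2 :=
 alt (fun Y => wedge1 (ctr Y b) a).
Lemma ctr_wedge2_0 (b : kform I 2) (a : kform I 0) Y : is_form b ->
 ctr Y (wedge2 b a) = wedge1 (ctr Y b) a + wedge1 (ctr Y b) a.
Proof.
move=> fb; rewrite ctr_altS; congr (_ + _); rewrite -altN wedge1_alt; congr alt.
fext => Z; rewrite ctr_wedge0; fext => V; rewrite /fscale !kE -mulNr; congr (_ * _).
have /(congr1 (fun c : kform I 0 => c (fun=> 0))) := ctr_sym Y Z fb.
by rewrite kE /ctr !v1_vcons => ->; rewrite opprK.
Qed.
Lemma ctr_wedge2_S k (b : kform I 2) (a : kform I k.+1) Y : is_form b ->
 ctr Y (wedge2 b a) =
 wedge1 (ctr Y b) a + wedge1 (ctr Y b) a + wedge2 b (ctr Y a).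
Proof.
move=> fb; rewrite ctr_altS -addrA; congr (_ + _); rewrite -altN wedge1_alt -altD; congr alt.
fext => Z; rewrite ctr_wedgeS opprB addrC; congr (_ + _).
fext => V; rewrite /fscale !kE -mulNr; congr (_ * _).
have /(congr1 (fun c : kform I 0 => c (fun=> 0))) := ctr_sym Y Z fb.
by rewrite kE /ctr !v1_vcons => ->; rewrite opprK.
Qed.
Lemma wedge2_form k (b : kform I 2) (a : kform I k) : is_form b -> is_form a ->
 is_form (wedge2 b a).
Proof.
move=> fb fa; apply: alt_form => [Y|Y Z|f Y].
- by apply: wedge1_form => //; exact: ctr_form.
- by rewrite contractD // wedge1Dl.
- by rewrite contractZ // wedge1Zl.
Qed.
Lemma wedge2D k (b : kform I 2) (a c : kform I k) : wedge2 b (a + c) = wedge2 b a + wedge2 b c.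
Proof. by rewrite /wedge2 -altD; congr alt; fext => Y; rewrite wedge1D. Qed.
Lemma wedge2N k (b : kform I 2) (a : kform I k) : wedge2 b (- a) = - wedge2 b a.
Proof. by rewrite /wedge2 -altN; congr alt; fext => Y; rewrite wedge1N. Qed.
Lemma wedge2Z k f (b : kform I 2) (a : kform I k) : wedge2 b (fscale f a) = fscale f (wedge2 b a).
Proof. by rewrite /wedge2 -altZ; congr alt; fext => Y; rewrite wedge1Z. Qed.
Lemma wedge2_0 k (b : kform I 2) : wedge2 b (0 : kform I k) = 0.
Proof. by rewrite /wedge2 -[RHS](alt0 k.+1); congr alt; fext => Y; rewrite wedge1_0. Qed.
Lemma wedge1_wedge2 k (xi : kform I 1) (b : kform I 2) (a : kform I k) : is_form b ->
 wedge1 xi (wedge2 b a) = wedge2 b (wedge1 xi a).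
Proof.
move=> fb; elim: k a => [|k IH] a; apply: kform_ext => Y; rewrite ctr_wedgeS ctr_wedge2_S //.
 rewrite ctr_wedge2_0 // ctr_wedge0 !wedge1D wedge2Z.
 rewrite (wedge1_anti xi (ctr Y b)) opprD !opprK addrC //.
rewrite ctr_wedge2_S // !wedge1D IH ctr_wedgeS wedge2D wedge2N wedge2Z.
rewrite !(wedge1_anti xi (ctr Y b)).
by fext => V; rewrite !kE; ring.
Qed.
(** The direct formula, without the differential: Cartan's formula becomes a theorem, and the
    properties of d follow from it by induction on the degree. *)
Definition lie k Y (a : kform I k) : kform I k := fun V =>
 Y (a V) - \sum_(i < k) a (upd V i (bracket Y (V i))).
Lemma ctr_lie k Y Z (a : kform I k.+1) :
 ctr Z (lie Y a) = lie Y (ctr Z a) - ctr (bracket Y Z) a.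
Proof.
fext => V; rewrite /ctr /lie !fctE big_ord_recl upd_vcons0 vconsE0.
rewrite opprD addrA addrAC; congr (_ - _ - _); apply: eq_bigr => i _.
by rewrite upd_vconsS vconsES.
Qed.
Lemma lieD k Y (a b : kform I k) : lie Y (a + b) = lie Y a + lie Y b.
Proof.
by fext => V; rewrite /lie !fctE vectD big_split opprD addrACA.
Qed.
Lemma lieN k Y (a : kform I k) : lie Y (- a) = - lie Y a.
Proof.
fext => V; rewrite /lie !fctE (vectN Y) opprD; congr (_ + _).
by rewrite sumrN opprK.
Qed.
Lemma lie0 k Y : lie Y (0 : kform I k) = 0.
Proof. by fext => V; rewrite /lie (vect0 Y) big1 // subr0. Qed.
Lemma lieZ k Y f (a : kform I k) : lie Y (fscale f a) = fscale (Y f) a + fscale f (lie Y a).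
Proof.
fext => V; rewrite /lie /fscale !kE vectM -mulr_sumr; ring.
Qed.
Lemma bracketD Y Z W : bracket Y (Z + W) = bracket Y Z + bracket Y W.
Proof. by apply: vect_inj => f /=; rewrite vectD; ring. Qed.
Lemma bracketZ Y f Z : bracket Y (vscale f Z) = vscale (Y f) Z + vscale f (bracket Y Z).
Proof. by apply: vect_inj => g /=; rewrite vectM; ring. Qed.
Lemma bracketK Y : bracket Y Y = 0.
Proof. by apply: vect_inj => f /=; rewrite subrr. Qed.
Lemma lie_form k Y (a : kform I k) : is_form a -> is_form (lie Y a).
Proof.
elim: k a => [|k IH] a fa; first exact: form0_is_form.
have fl Z : is_form (lie Y (ctr Z a)) by apply: IH; exact: ctr_form.
apply: form_intro => [Z|Z W|f Z|Z V j Vj]; rewrite ?ctr_lie.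
- by apply: is_formD => //; apply: is_formN; exact: ctr_form.
- rewrite contractD // lieD bracketD contractD // opprD addrACA //.
- rewrite contractZ // bracketZ lieZ contractD // !contractZ //.
 by fext => V; rewrite !kE /fscale !kE; ring.
- have E0 : a (vcons Z V) = 0.
  by apply: (form_alt fa (i := ord0) (j := lift ord0 j)); rewrite ?vconsE0 ?vconsES.
 rewrite /lie E0 (vect0 Y) add0r big_ord_recl upd_vcons0 vconsE0 (bigD1 j) //= big1 => [|i ij].
  have Eu : upd V j Z = V by rewrite -Vj upd_id.
  rewrite addr0 upd_vconsS vconsES Vj.
  have := form_swap fa (vcons Z V) (bracket Y Z) Z (i := ord0) (j := lift ord0 j) isT.
  rewrite !upd_vcons0 !upd_vconsS Eu => ->.
  by rewrite addNr oppr0.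
 rewrite upd_vconsS; apply: (form_alt fa (i := ord0) (j := lift ord0 j)) => //.
 by rewrite vconsE0 vconsES /upd eq_sym (negPf ij).
Qed.

Lemma lie_wedge1 k Y (xi : kform I 1) (a : kform I k) : is_form xi ->
 lie Y (wedge1 xi a) = wedge1 (lie Y xi) a + wedge1 xi (lie Y a).
Proof.
move=> fx.
have lx Z : (lie Y xi) (v1 Z) = Y (xi (v1 Z)) - xi (v1 (bracket Y Z)).
 rewrite /lie big_ord_recl big_ord0 addr0; congr (_ - xi _).
 by fext => i; rewrite (ord1 i) /upd eqxx.
have cD m (b c : kform I m.+1) Z : ctr Z (b + c) = ctr Z b + ctr Z c by [].
elim: k a => [|k IH] a; apply: kform_ext => Z; rewrite ctr_lie cD.
 rewrite !ctr_wedge0 lieZ lx; fext => V; rewrite !kE /fscale; ring.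
rewrite !ctr_wedgeS lieD lieN lieZ IH ctr_lie wedge1D wedge1N lx.
by fext => V; rewrite !kE /fscale; ring.
Qed.
End Exterior.

(** * Cartan's formula, the exterior derivative and the exponential of a two-form *)

Section Cartan.
Variables (K : fieldType) (X : Type) (A : falg K X) (I : ideal A).
Local Notation T := (vect I).
Implicit Types (Y Z W : T) (f : A).

(** Compares a bracket placed in slot i, as in Koszul's formula, with one placed in the first
    slot. *)
Lemma form_front k (a : kform I k.+1) (V : 'I_k.+1 -> T) i Z : is_form a ->
 a (upd V i Z) = (-1) ^+ i * a (vcons Z (V \o lift i)).
Proof.
elim: k a V i => [|k IH] a V i fa; rewrite -[V]vcons_eta; case: (unliftP ord0 i) => [j ->|->].
- by case: j.
- by rewrite upd_vcons0 vcons_lift0 mul1r.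
- rewrite upd_vconsS vcons_liftS lift0 exprS mulN1r mulNr.
 have := IH (ctr (V ord0) a) (V \o lift ord0) j (ctr_form _ fa).
 rewrite {1}/ctr => ->; rewrite -mulrN; congr (_ * _).
 have := ctr_sym (V ord0) Z fa => /(congr1 (fun c : kform I k => c ((V \o lift ord0) \o lift j))).
 by rewrite kE /ctr => ->; rewrite opprK.
- by rewrite upd_vcons0 vcons_lift0 mul1r.
Qed.

Lemma cartan0 (a : kform I 0) Y : ctr Y (dif a) = lie Y a.
Proof.
fext => V; rewrite /ctr /dif /lie big_ord_recl big_ord0 addr0 expr0 mul1r.
rewrite big_ord0 addr0 big_pred0 ?addr0; last by case.
by rewrite vconsE0 (v0_eta (_ \o _) V) subr0.
Qed.
(** In Koszul's formula the summand j = 0 and the bracket terms with l = 0 make up the Lie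
    derivative; what remains is minus the differential of the contraction. *)
Lemma cartan k (a : kform I k.+1) Y : is_form a ->
 ctr Y (dif a) = lie Y a - dif (ctr Y a).
Proof.
move=> fa; fext => V; rewrite !kE /ctr /dif big_ord_recl expr0 mul1r.
rewrite vconsE0 vcons_lift0 big_pred0 ?addr0; last by move=> l.
rewrite /lie -addrA; congr (_ + _); rewrite -!sumrN -big_split; apply: eq_bigr => i _ /=.
rewrite vconsES vcons_liftS -![fintype.bump 0 i]/(i.+1) exprS mulN1r mulNr.
rewrite (form_front V i _ fa) -!opprD; congr (- _).
rewrite -mulrDr; congr (_ * _); rewrite [RHS]addrCA; congr (_ + _).
rewrite big_mkcond big_ord_recl [in RHS]big_mkcond /=; congr (_ + _); last first.
 apply: eq_bigr => l _; rewrite -[fintype.bump 0 l]/(l.+1) ltnS; case: ifP => // _.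
 rewrite upd_vconsS; congr (a (vcons _ (upd _ _ (bracket _ _)))).
 have -> : lift (lift ord0 i) (lift ord0 l) = lift ord0 (lift i l) by apply: val_inj; exact: bumpS.
 by rewrite vconsES.
rewrite upd_vcons0; congr (a (vcons (bracket _ _) _)).
have -> : lift (lift ord0 i) ord0 = ord0 :> 'I_k.+2 by apply: val_inj.
by rewrite vconsE0.
Qed.

Lemma lie_derivativeE k (a : kform I k) Y : is_form a -> lie_derivative Y a = lie Y a.
Proof.
case: k a => [|k] a fa /=; first exact: cartan0.
by rewrite cartan // subrK.
Qed.
Lemma lieDl k (a : kform I k) Y Z : is_form a -> lie (Y + Z) a = lie Y a + lie Z a.
Proof.
move=> fa; fext => V; rewrite kE /lie addrACA -opprD -big_split.
congr (_ - _); apply: eq_bigr => i _ /=; rewrite -formD //; congr (a (upd _ _ _)).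
by apply: vect_inj => f /=; rewrite vectD; ring.
Qed.
Lemma difD k (a b : kform I k) : dif (a + b) = dif a + dif b.
Proof.
fext => V; rewrite kE /dif -big_split; apply: eq_bigr => i _ /=.
rewrite !kE vectD -mulrDr; congr (_ * _); rewrite addrACA; congr (_ + _).
by rewrite -big_split; apply: eq_bigr.
Qed.
Lemma difN k (a : kform I k) : dif (- a) = - dif a.
Proof.
fext => V; rewrite kE /dif -sumrN; apply: eq_bigr => i _ /=.
rewrite !kE (vectN (V i)) -mulrN opprD; congr (_ * (_ + _)).
by rewrite -sumrN; apply: eq_bigr.
Qed.
Lemma dif0 k : dif (0 : kform I k) = 0.
Proof. by apply: (addrI (dif (0 : kform I k))); rewrite -difD !addr0. Qed.
Definition dfun f : kform I 1 := fun V => V ord0 f.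
Lemma dfun_form f : is_form (dfun f).
Proof. by apply: form1_intro. Qed.
Lemma lieZl k (a : kform I k.+1) f Y : is_form a ->
 lie (vscale f Y) a = fscale f (lie Y a) + wedge1 (dfun f) (ctr Y a).
Proof.
move=> fa; fext => V; rewrite kE /lie /fscale mulrBr -addrA; congr (_ + _).
rewrite mulr_sumr -!sumrN -big_split; apply: eq_bigr => i _ /=.
rewrite /dfun.
have -> : bracket (vscale f Y) (V i) = vscale f (bracket Y (V i)) - vscale (V i f) Y.
 apply: vect_inj => g; rewrite /= vectM; ring.
rewrite formD // formN // !formZ // opprD opprK; congr (_ + _).
by rewrite (form_front V i Y fa) mulrCA.
Qed.

Lemma difZ k (a : kform I k) f : is_form a ->
 dif (fscale f a) = wedge1 (dfun f) a + fscale f (dif a).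
Proof.
move=> fa; elim: k a fa => [|k IH] a fa; apply: kform_ext => Y.
 rewrite cartan0 lieZ -[RHS]/(ctr Y (wedge1 (dfun f) a) + ctr Y (fscale f (dif a))).
 by rewrite ctr_wedge0 -cartan0.
rewrite cartan; last exact: is_formZ.
rewrite -[RHS]/(ctr Y (wedge1 (dfun f) a) + fscale f (ctr Y (dif a))).
rewrite ctr_wedgeS cartan // lieZ -[ctr Y (fscale f a)]/(fscale f (ctr Y a)).
rewrite IH; last exact: ctr_form.
by fext => V; rewrite !kE /fscale !kE /dfun /v1; ring.
Qed.

(** By Cartan's formula the contractions of d a are L_Y a - d i_Y a, which are forms by
    induction. *)
Lemma dif_form k (a : kform I k) : is_form a -> is_form (dif a).
Proof.
elim: k a => [|k IH] a fa.
 apply: form_intro => [Y|Y Z|f Y|Y V []] //; rewrite ?cartan0; first exact: form0_is_form.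
  by rewrite lieDl.
 by fext => V; rewrite /lie /fscale !big_ord0 !subr0.
have fd Y : is_form (dif (ctr Y a)) by apply: IH; exact: ctr_form.
apply: form_introS => [Y|Y Z|f Y|Y]; rewrite ?cartan //.
- by apply: is_formD; [exact: lie_form|exact: is_formN].
- by rewrite lieDl // contractD // difD opprD addrACA.
- rewrite lieZl // contractZ // difZ; last exact: ctr_form.
 by fext => V; rewrite !kE /fscale !kE; ring.
- have -> (b c : kform I k.+1) : ctr Y (b - c) = ctr Y b - ctr Y c by [].
 rewrite ctr_lie bracketK contract0 // subr0.
 case: k a fa {IH fd} => [|k] a fa; first by rewrite cartan0 subrr.
 rewrite cartan ?ctr_alt // ?dif0 ?subr0 ?subrr //; exact: ctr_form.
Qed.

Lemma lie_bracket k (a : kform I k) Y Z : is_form a ->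
 lie Y (lie Z a) - lie Z (lie Y a) = lie (bracket Y Z) a.
Proof.
elim: k a => [|k IH] a fa.
 by fext => V; rewrite !kE /lie !big_ord0 !subr0.
apply: kform_ext => W.
have cB (b c : kform I k.+1) : ctr W (b - c) = ctr W b - ctr W c by [].
have fc U := ctr_form U fa.
rewrite cB !ctr_lie (lieD Y (lie Z (ctr W a))) (lieD Z (lie Y (ctr W a))) !lieN -IH //.
have -> : bracket (bracket Y Z) W = bracket Y (bracket Z W) - bracket Z (bracket Y W).
 by apply: vect_inj => f /=; rewrite !(vectD, vectN); ring.
rewrite contractD // contractN //.
by fext => V; rewrite !kE; ring.
Qed.

Lemma lie_dif k (a : kform I k) Y : is_form a ->
 lie Y (dif a) = dif (lie Y a).
Proof.
have cB Z m (b c : kform I m.+1) : ctr Z (b - c) = ctr Z b - ctr Z c by [].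
elim: k a => [|k IH] a fa; apply: kform_ext => Z.
 by rewrite ctr_lie !cartan0 -lie_bracket // opprB addrCA subrr addr0.
have fc U := ctr_form U fa.
rewrite ctr_lie !cartan //; last exact: lie_form.
rewrite ctr_lie (lieD Y (lie Z a)) lieN IH // difD difN -lie_bracket //.
by fext => V; rewrite !kE; ring.
Qed.

Lemma dif_sqr k (a : kform I k) : is_form a -> dif (dif a) = 0.
Proof.
elim: k a => [|k IH] a fa; apply: kform_ext => Y.
 rewrite cartan; last exact: dif_form.
 by rewrite cartan0 lie_dif // subrr.
have fc U := ctr_form U fa.
rewrite !cartan //; last exact: dif_form.
by rewrite difD difN IH // subr0 lie_dif // subrr.
Qed.

(** The degree k part of exp(s), built from the rule i_Y exp(s) = i_Y s /\ exp(s) so that no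
    factorial has to be inverted. *)
Fixpoint expform (s : kform I 2) k : kform I k :=
 match k return kform I k with
 | 0 => fun=> 1
 | 1 => 0
 | k'.+2 => fun V => wedge1 (ctr (V ord0) s) (@expform s k') (V \o lift ord0)
 end.

Arguments expform s k _ : clear implicits.

Lemma ctr_expform s k Y :
 ctr Y (expform s k.+2) = wedge1 (ctr Y s) (expform s k).
Proof. by fext => V; rewrite /ctr /= vconsE0 vcons_lift0. Qed.
Lemma expform_form s k : is_form s -> is_form (expform s k).
Proof.
move=> fs; have [m] := ubnP k; elim: m k => // m IH [|[|k]] /ltnSE km.
- exact: form0_is_form.
- exact: is_form0.
have fk : is_form (expform s k) by apply: IH; exact: ltnW.
have fcs Y := ctr_form Y fs.
have sYY Y : ctr Y s (v1 Y) = 0.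
 have := ctr_alt Y fs => /(congr1 (fun c : kform I 0 => c (fun=> 0))).
 by rewrite /ctr !v1_vcons kE.
apply: form_introS => [Y|Y Z|f Y|Y]; rewrite !ctr_expform.
- exact: wedge1_form.
- by rewrite contractD // wedge1Dl.
- by rewrite contractZ // wedge1Zl.
- case: k {IH km fk} => [|[|k]].
 + by rewrite ctr_wedge0 sYY; fext => V; rewrite /fscale mul0r.
 + by rewrite [expform s 1]/= wedge1_0.
 + rewrite ctr_wedgeS sYY ctr_expform wedge1_sqr subr0.
  by fext => V; rewrite /fscale mul0r.
Qed.

Lemma form2_v2 (s : kform I 2) Y Z : s (v2 Y Z) = ctr Y s (v1 Z).
Proof. by []. Qed.
Lemma form2_skew (s : kform I 2) Y Z : is_form s -> s (v2 Y Z) = - s (v2 Z Y).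
Proof.
move=> fs; have := ctr_sym Z Y fs => /(congr1 (fun c : kform I 0 => c (fun=> 0))).
by rewrite kE /ctr !v1_vcons.
Qed.
Lemma form2_alt (s : kform I 2) Y : is_form s -> s (v2 Y Y) = 0.
Proof.
move=> fs; have := ctr_alt Y fs => /(congr1 (fun c : kform I 0 => c (fun=> 0))).
by rewrite /ctr !v1_vcons.
Qed.
Lemma form2Dl (s : kform I 2) Y Z W : is_form s -> s (v2 (Y + Z) W) = s (v2 Y W) + s (v2 Z W).
Proof. by move=> fs; rewrite !form2_v2 contractD. Qed.
Lemma form2Dr (s : kform I 2) Y Z W : is_form s -> s (v2 W (Y + Z)) = s (v2 W Y) + s (v2 W Z).
Proof. by move=> fs; rewrite !form2_v2 form1D //; exact: ctr_form. Qed.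
Lemma form2Zl (s : kform I 2) f Y W : is_form s -> s (v2 (vscale f Y) W) = f * s (v2 Y W).
Proof. by move=> fs; rewrite !form2_v2 contractZ. Qed.
Lemma form2Zr (s : kform I 2) f Y W : is_form s -> s (v2 W (vscale f Y)) = f * s (v2 W Y).
Proof. by move=> fs; rewrite !form2_v2 form1Z //; exact: ctr_form. Qed.
Lemma form2Nl (s : kform I 2) Y W : is_form s -> s (v2 (- Y) W) = - s (v2 Y W).
Proof. by move=> fs; rewrite !form2_v2 contractN. Qed.
Lemma form1N (a : kform I 1) Y : is_form a -> a (v1 (- Y)) = - a (v1 Y).
Proof.
move=> fa; have := contractN Y fa => /(congr1 (fun c : kform I 0 => c (fun=> 0))).
by rewrite kE /ctr !v1_vcons.
Qed.
Lemma koszul1 (a : kform I 1) Y Z : is_form a ->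
 dif a (v2 Y Z) = Y (a (v1 Z)) - Z (a (v1 Y)) - a (v1 (bracket Y Z)).
Proof.
move=> fa; rewrite -[LHS]/(ctr Y (dif a) (v1 Z)) cartan // !kE.
rewrite -[X in _ - X](_ : ctr Z (dif (ctr Y a)) (fun=> 0) = _); last first.
 by rewrite /ctr v1_vcons.
rewrite cartan0 /lie big_ord0 subr0 big_ord_recl big_ord0 addr0.
have -> : upd (v1 Z) ord0 (bracket Y (v1 Z ord0)) = v1 (bracket Y Z).
 by fext => i; rewrite (ord1 i) /upd eqxx.
by rewrite /ctr v1_vcons addrAC.
Qed.

Lemma koszul2 (a : kform I 2) Y Z W : is_form a ->
 dif a (v3 Y Z W) = Y (a (v2 Z W)) - Z (a (v2 Y W)) + W (a (v2 Y Z))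
  - a (v2 (bracket Y Z) W) + a (v2 (bracket Y W) Z) - a (v2 (bracket Z W) Y).
Proof.
move=> fa; rewrite -[LHS]/(ctr Y (dif a) (v2 Z W)) cartan // !kE.
rewrite koszul1; last exact: ctr_form.
have -> : lie Y a (v2 Z W) = Y (a (v2 Z W)) - a (v2 (bracket Y Z) W) - a (v2 Z (bracket Y W)).
 rewrite /lie !big_ord_recl big_ord0 addr0 /v2 upd_vcons0 upd_vconsS vconsE0 vconsES opprD addrA.
 by congr (_ - a (vcons _ _)); fext => i; rewrite (ord1 i) /upd eqxx.
rewrite -!form2_v2 (form2_skew Z (bracket Y W)) // (form2_skew Y (bracket Z W)) //.
by rewrite -!/(v2 _ _); ring.
Qed.
End Cartan.

(** * Generalized sections acting on spinors *)

Section Spinors.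
Variables (R : realType) (n : nat) (M : manifold R n) (K : fieldType) (A : falg K M).
Implicit Types (u v : gsec A) (rho : forall k, kform (idealT A) k) (H : kform (idealT A) 3).

Definition nabla_form H u : kform (idealT A) 2 := dif u.2 + ctr u.1 H.
Lemma nabla_form_form H u : is_form H -> is_gsec u -> is_form (nabla_form H u).
Proof.
by move=> fH gu; apply: is_formD; [exact: dif_form|exact: ctr_form].
Qed.
Lemma courant_form H u v : is_form H -> is_gsec u -> is_gsec v ->
 (courant H u v).2 = lie u.1 v.2 - ctr v.1 (nabla_form H u).
Proof.
move=> fH gu gv.
rewrite -[LHS]/(lie_derivative u.1 v.2 - ctr v.1 (dif u.2) + ctr u.1 (ctr v.1 H)).
rewrite lie_derivativeE // -addrA; congr (_ + _).
by rewrite (ctr_sym u.1 v.1 fH) -opprD.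
Qed.
Lemma courant_is_gsec H u v : is_form H -> is_gsec u -> is_gsec v -> is_gsec (courant H u v).
Proof.
move=> fH gu gv; rewrite /is_gsec courant_form //; apply: is_formD; first exact: lie_form.
by apply/is_formN/ctr_form/nabla_form_form.
Qed.
(** Twice the operator L_X rho + (d xi + i_X H) /\ rho attached to u = X + xi; the factor two of the
    last term is inside [wedge2]. *)
Definition nabla H u rho k : kform (idealT A) k :=
 lie u.1 (rho k) + lie u.1 (rho k) +
 match k return kform (idealT A) k with
 | k'.+2 => wedge2 (nabla_form H u) (rho k')
 | _ => 0
 end.

Arguments nabla H u rho k _ : clear implicits.

Lemma nabla_is_form H u rho k : is_form H -> is_gsec u -> (forall k, is_form (rho k)) ->
 is_form (nabla H u rho k).
Proof.
move=> fH gu fr; rewrite /nabla; apply: is_formD.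
 by apply: is_formD; exact: lie_form.
case: k => [|[|k]]; [exact: is_form0|exact: is_form0|].
by apply: wedge2_form => //; exact: nabla_form_form.
Qed.
(** The operator generates the Courant bracket: v . nabla_u rho = nabla_u (v . rho) - 2 [u, v] .
    rho, and both terms on the right vanish. Low degrees are separate because the wedge term starts
    in degree two. *)
Lemma nabla_can H u v rho : is_form H -> is_gsec u -> is_gsec v ->
 (forall k, clifford v rho k = 0) -> (forall k, clifford (courant H u v) rho k = 0) ->
 forall k, clifford v (nabla H u rho) k = 0.
Proof.
move=> fH gu gv cv cc k.
have cD m (b c : kform (idealT A) m.+1) : ctr v.1 (b + c) = ctr v.1 b + ctr v.1 c by [].
have fb := nabla_form_form fH gu.
have Ec := courant_form fH gu gv.
have lc m : lie u.1 (clifford v rho m) = 0 by rewrite cv lie0.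
have ccE m : clifford (courant H u v) rho m = ctr (bracket u.1 v.1) (rho m.+1) +
  match m return kform (idealT A) m with 0 => 0 | m'.+1 => wedge1 (courant H u v).2 (rho m') end by [].
case: k => [|[|k]]; rewrite {1}/clifford /nabla.
- rewrite !addr0 cD !ctr_lie.
 have := lc 0%N; rewrite {1}/clifford addr0 => ->.
 by have := cc 0%N; rewrite ccE addr0 => ->; rewrite subrr addr0.
- rewrite cD cD !ctr_lie ctr_wedge2_0 // addr0 wedge1D.
 have := cc 1%N; rewrite ccE Ec wedge1Dl wedge1Nl => /eqP; rewrite addr_eq0 => /eqP E2.
 have {}E1 : lie u.1 (ctr v.1 (rho 2%N)) =
   - (wedge1 (lie u.1 v.2) (rho 0%N) + wedge1 v.2 (lie u.1 (rho 0%N))).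
  by apply/eqP; rewrite -addr_eq0 -lie_wedge1 // -lieD -[X in lie _ X]/(clifford v rho 1) lc.
 by rewrite E1 E2; fext => V; rewrite !kE; ring.
have {}E1 : lie u.1 (ctr v.1 (rho k.+3)) =
  - (wedge1 (lie u.1 v.2) (rho k.+1) + wedge1 v.2 (lie u.1 (rho k.+1))).
 by apply/eqP; rewrite -addr_eq0 -lie_wedge1 // -lieD -[X in lie _ X]/(clifford v rho k.+2) lc.
have E2 : ctr (bracket u.1 v.1) (rho k.+3) =
  - (wedge1 (lie u.1 v.2) (rho k.+1) - wedge1 (ctr v.1 (nabla_form H u)) (rho k.+1)).
 by have := cc k.+2; rewrite ccE Ec wedge1Dl wedge1Nl => /eqP; rewrite addr_eq0 => /eqP.
have E3 : wedge2 (nabla_form H u) (ctr v.1 (rho k.+1)) +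
  wedge1 v.2 (match k as m return kform (idealT A) m.+1 with
   | 0 => 0 | k'.+1 => wedge2 (nabla_form H u) (rho k') end) = 0.
 case: k {E1 E2} => [|k].
  rewrite wedge1_0 addr0; have := cv 0%N; rewrite {1}/clifford addr0 => ->.
  exact: wedge2_0.
 by rewrite wedge1_wedge2 // -wedge2D -[X in wedge2 _ X]/(clifford v rho k.+1) cv wedge2_0.
rewrite cD cD !ctr_lie ctr_wedge2_S // 2!wedge1D E1 E2.
fext => V; have := congr1 (fun c : kform (idealT A) k.+2 => c V) E3.
rewrite !kE => E4; rewrite -[RHS]E4; ring.
Qed.
End Spinors.

(** * Complexification of real fields and forms *)

Section ComplexForms.
Variables (R : realType) (n : nat) (M : manifold R n).
Local Notation CR := (CR M).
Local Notation CC := (CC M).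
Local Notation TR := (vect (idealT CR)).
Local Notation TC := (vect (idealT CC)).
Implicit Types (f : CR) (h g : CC) (Y Z : TC) (V W : TR).
Local Notation ii := (ccst M 'i : CC).
Local Notation tc := (@toCx R n M : CR -> CC).

Lemma cvect_inj Y Z : (forall f, Y (tc f) = Z (tc f)) -> Y = Z.
Proof.
move=> H; apply: vect_inj => h; rewrite [h]smooth_complexE !vectD.
by rewrite !(vectZ _ 'i) !H.
Qed.
Lemma cvecE Y : Y = cvec (re_vect Y) + vscale ii (cvec (im_vect Y)).
Proof.
apply: cvect_inj => f; rewrite -[RHS]/(cvec (re_vect Y) (tc f) + ii * cvec (im_vect Y) (tc f)).
by rewrite !cvec_real; exact: smooth_complexE.
Qed.
Lemma re_tc f : re (tc f) = f. Proof. exact: rval_inj. Qed.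
Lemma im_tc f : im (tc f) = 0. Proof. exact: rval_inj. Qed.
Lemma re_cvec V : re_vect (cvec V) = V.
Proof. by apply: vect_inj => f; rewrite -[LHS]/(re (cvec V (tc f))) cvec_real re_tc. Qed.
Lemma im_cvec V : im_vect (cvec V) = 0.
Proof. by apply: vect_inj => f; rewrite -[LHS]/(im (cvec V (tc f))) cvec_real im_tc. Qed.
Lemma reM_i h : re (ii * h) = - im h.
Proof. by apply: rval_inj => x; rewrite rvalN rval_re rval_im !cvE; case: (cval h x) => a b /=; ring. Qed.
Lemma imM_i h : im (ii * h) = re h.
Proof. by apply: rval_inj => x; rewrite rval_re rval_im !cvE; case: (cval h x) => a b /=; ring. Qed.
Lemma reN h : re (- h) = - re h.
Proof. by apply: rval_inj => x; rewrite rvalN !rval_re cvalN; case: (cval h x). Qed.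
Lemma imN h : im (- h) = - im h.
Proof. by apply: rval_inj => x; rewrite rvalN !rval_im cvalN; case: (cval h x). Qed.
Lemma re0 : re (0 : CC) = 0. Proof. by apply: rval_inj => x; rewrite rval_re rval0 cval0. Qed.
Lemma im0 : im (0 : CC) = 0. Proof. by apply: rval_inj => x; rewrite rval_im rval0 cval0. Qed.
Lemma re_im_inj h g : re h = re g -> im h = im g -> h = g.
Proof. by move=> E1 E2; rewrite [h]smooth_complexE [g]smooth_complexE E1 E2. Qed.
Lemma tc_inj f f' : tc f = tc f' -> f = f'.
Proof. by move=> /(congr1 (@re R n M)); rewrite !re_tc. Qed.
Lemma re_vectD Y Z : re_vect (Y + Z) = re_vect Y + re_vect Z.
Proof. by apply: vect_inj => f; exact: reD. Qed.
Lemma im_vectD Y Z : im_vect (Y + Z) = im_vect Y + im_vect Z.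
Proof. by apply: vect_inj => f; exact: imD. Qed.
Lemma re_vectZ h Y : re_vect (vscale h Y) = vscale (re h : CR) (re_vect Y) - vscale (im h : CR) (im_vect Y).
Proof. by apply: vect_inj => f; exact: reM. Qed.
Lemma im_vectZ h Y : im_vect (vscale h Y) = vscale (re h : CR) (im_vect Y) + vscale (im h : CR) (re_vect Y).
Proof. by apply: vect_inj => f; exact: imM. Qed.
Lemma cvecD V W : cvec (V + W) = cvec V + cvec W.
Proof.
apply: cvect_inj => f; rewrite -[RHS]/(cvec V (tc f) + cvec W (tc f)).
by rewrite !cvec_real -to_complexD.
Qed.
Lemma cvecZ f V : cvec (vscale f V) = vscale (tc f) (cvec V).
Proof.
apply: cvect_inj => g; rewrite -[RHS]/(tc f * cvec V (tc g)).
by rewrite !cvec_real -to_complexM.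
Qed.
Lemma cvec_bracket V W :
 cvec (bracket V W) = bracket (cvec V) (cvec W).
Proof.
apply: cvect_inj => g.
rewrite -[RHS]/(cvec V (cvec W (tc g)) - cvec W (cvec V (tc g))).
by rewrite !cvec_real -to_complexN -to_complexD.
Qed.
Definition cjvec Y : TC := cvec (re_vect Y) - vscale ii (cvec (im_vect Y)).
Lemma cjvecE Y h : cjvec Y h = conjA (Y (conjA h)).
Proof.
have conj_tc f : conjA (tc f) = tc f.
 by apply: cval_inj => x; rewrite !cvE conjc_real.
have H f : cjvec Y (tc f) = conjA (Y (tc f)).
 rewrite -[LHS]/(cvec (re_vect Y) (tc f) - ii * cvec (im_vect Y) (tc f)).
 by rewrite !cvec_real.
have conj_ii : conjA ii = - ii by apply: cval_inj => x; rewrite !cvE; apply/eqP; rewrite eq_complex /= oppr0 !eqxx.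
rewrite {1}[h]smooth_complexE vectD (vectZ _ 'i) !H.
have -> : conjA h = tc (re h) - ii * tc (im h) by [].
rewrite vectD (vectN Y) (vectZ Y 'i) conjAD.
have conjAN k : conjA (- k) = - conjA k by apply: cval_inj => x; rewrite !cvE rmorphN.
by rewrite conjAN conjAM conj_ii mulNr opprK.
Qed.

Lemma form_realC k (a b : kform (idealT CC) k) : is_form a -> is_form b ->
 (forall V : 'I_k -> TR, a (fun i => cvec (V i)) = b (fun i => cvec (V i))) -> a = b.
Proof.
elim: k a b => [|k IH] a b fa fb H.
 by fext => V; rewrite (v0_eta V (fun i => cvec (0 : TR))); exact: H.
apply: kform_ext => Y; rewrite [Y]cvecE !contractD // !contractZ //.
suff E V : ctr (cvec V) a = ctr (cvec V) b by rewrite !E.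
apply: IH => [||U]; try exact: ctr_form.
rewrite /ctr; have := H (vcons V U).
suff -> : (fun i => cvec (vcons V U i)) = vcons (cvec V) (fun i => cvec (U i)) by [].
by fext => i; case: (unliftP ord0 i) => [j ->|->]; rewrite ?vconsE0 ?vconsES.
Qed.

Lemma big_set_ord0 (A : nmodType) k (F : {set 'I_k.+1} -> A) :
 \sum_(S : {set 'I_k.+1}) F S =
 \sum_(S : {set 'I_k}) F [set lift ord0 i | i in S]%SET +
 \sum_(S : {set 'I_k}) F (ord0 |: [set lift ord0 i | i in S])%SET.
Proof.
have li := @lift_inj k.+1 ord0.
have n0 (S : {set 'I_k}) : ord0 \notin [set lift ord0 i | i in S]%SET.
 by apply/imsetP => -[i _ /eqP]; rewrite (negPf (neq_lift _ _)).
have pre (S : {set 'I_k}) : (lift ord0 @^-1: [set lift ord0 i | i in S])%SET = S.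
 by apply/setP => i; rewrite inE mem_imset.
rewrite (bigID (fun S : {set 'I_k.+1} => ord0 \notin S)) /=; congr (_ + _).
 rewrite (reindex_onto (fun S : {set 'I_k} => [set lift ord0 i | i in S]%SET)
  (fun S => (lift ord0 @^-1: S)%SET)) => [|S nS].
  by apply: eq_bigl => S; rewrite n0 pre eqxx.
 apply/setP => i; case: (unliftP ord0 i) => [j ->|->]; first by rewrite mem_imset // inE.
 by rewrite (negPf (n0 _)) (negPf nS).
rewrite (reindex_onto (fun S : {set 'I_k} => (ord0 |: [set lift ord0 i | i in S])%SET)
 (fun S => (lift ord0 @^-1: S)%SET)) => [|S nS].
 apply: eq_bigl => S; rewrite !inE eqxx /=; apply/eqP/setP => i.
 by rewrite !inE mem_imset // eq_sym (negPf (neq_lift _ _)).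
apply/setP => i; case: (unliftP ord0 i) => [j ->|->].
 by rewrite !inE mem_imset // inE eq_sym (negPf (neq_lift _ _)).
by rewrite !inE eqxx; move: nS; rewrite negbK.
Qed.

Lemma tc_sum (J : Type) (r : seq J) (P : pred J) (F : J -> CR) :
 tc (\sum_(i <- r | P i) F i) = \sum_(i <- r | P i) tc (F i).
Proof. by apply: (big_morph tc) => [f g|]; [exact: to_complexD|exact: to_complex0]. Qed.
(** The subsets indexing the complexification split according to whether they contain the first
    slot. This recursion yields the form property and the values on real fields. *)
Lemma ctr_cform k (a : kform (idealT CR) k.+1) Y :
 ctr Y (cform a) = cform (ctr (re_vect Y) a) +
  fscale ii (cform (ctr (im_vect Y) a)).
Proof.
fext => V; rewrite kE /fscale /cform {1}/ctr big_set_ord0 mulr_sumr.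
have li := @lift_inj k.+1 ord0.
have n0 (S : {set 'I_k}) : ord0 \in [set lift ord0 i | i in S]%SET = false.
 by apply/negP => /imsetP[i _ /eqP]; rewrite (negPf (neq_lift _ _)).
congr (_ + _); apply: eq_bigr => S _.
 rewrite card_imset //; congr (_ * tc (a _)); fext => j.
 by case: (unliftP ord0 j) => [i ->|->]; rewrite ?vconsE0 ?vconsES ?n0 // mem_imset.
rewrite cardsU1 n0 add1n card_imset // exprS mulrA.
have -> : ccst M ('i * 'i ^+ #|S|) = ii * ccst M ('i ^+ #|S|).
 by apply: cval_inj => x; rewrite !cvE.
congr (_ * _ * tc (a _)); fext => j; rewrite !inE.
case: (unliftP ord0 j) => [i ->|->]; rewrite ?vconsE0 ?vconsES ?eqxx //.
by rewrite mem_imset // eq_sym (negPf (neq_lift _ _)).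
Qed.

Lemma cform0E (a : kform (idealT CR) 0) (V : 'I_0 -> TC) : cform a V = tc (scal_of a).
Proof.
rewrite /cform (big_pred1 finset.set0) => [|S]; last first.
 by apply/esym/eqP/setP => -[].
rewrite cards0 expr0.
have -> : ccst M 1 = 1 :> CC by apply: cval_inj.
by rewrite mul1r /scal_of (v0_eta (fun j => _) (fun=> 0)).
Qed.
Lemma cformD k (a b : kform (idealT CR) k) :
 cform (a + b) = cform a + cform b.
Proof.
fext => V; rewrite kE /cform -big_split; apply: eq_bigr => S _.
by rewrite kE to_complexD mulrDr.
Qed.
Lemma cformZ k f (a : kform (idealT CR) k) :
 cform (fscale f a) = fscale (tc f) (cform a).
Proof.
fext => V; rewrite /cform /fscale mulr_sumr; apply: eq_bigr => S _.
by rewrite to_complexM mulrCA.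
Qed.
Lemma cformN k (a : kform (idealT CR) k) : cform (- a) = - cform a.
Proof.
fext => V; rewrite kE /cform -sumrN; apply: eq_bigr => S _.
by rewrite kE to_complexN mulrN.
Qed.
Lemma cform_0 k : cform (0 : kform (idealT CR) k) = 0.
Proof. by apply: (addrI (cform (0 : kform (idealT CR) k))); rewrite -cformD !addr0. Qed.
Lemma iiM : ii * ii = -1. Proof. exact: complex_iM. Qed.
Lemma fscaleDr k (g : CC) (a b : kform (idealT CC) k) : fscale g (a + b) = fscale g a + fscale g b.
Proof. by fext => V; rewrite /fscale !kE mulrDr. Qed.
Lemma cform_form k (a : kform (idealT CR) k) : is_form a -> is_form (cform a).
Proof.
elim: k a => [|k IH] a fa; first exact: form0_is_form.
have fc W : is_form (cform (ctr W a)) by apply: IH; exact: ctr_form.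
have cf Y : is_form (ctr Y (cform a)).
 by rewrite ctr_cform; apply: is_formD => //; exact: is_formZ.
have cD Y Z : ctr (Y + Z) (cform a) = ctr Y (cform a) + ctr Z (cform a).
 rewrite !ctr_cform re_vectD im_vectD !contractD // !cformD fscaleDr.
 by rewrite addrACA.
have cZ h Y : ctr (vscale h Y) (cform a) = fscale h (ctr Y (cform a)).
 rewrite !ctr_cform re_vectZ im_vectZ !(contractD, contractN, contractZ) //.
 rewrite !(cformD, cformN, cformZ).
 fext => V; rewrite /fscale !kE {5}[h]smooth_complexE.
 have i2 := iiM; ring: i2.
case: k a fa {IH} fc cf cD cZ => [|k] a fa fc cf cD cZ.
 apply: form_intro => // Y V [] //.
apply: form_introS => // Y; rewrite ctr_cform.
have -> (b c : kform (idealT CC) k.+1) : ctr Y (b + c) = ctr Y b + ctr Y c by [].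
have -> (b : kform (idealT CC) k.+1) : ctr Y (fscale ii b) = fscale ii (ctr Y b) by [].
rewrite !ctr_cform !ctr_alt // !cform_0 (ctr_sym (im_vect Y)) //.
rewrite cformN; fext => V; rewrite !kE /fscale !kE; ring.
Qed.

Lemma cform_real k (a : kform (idealT CR) k) (V : 'I_k -> TR) : is_form a ->
 cform a (fun i => cvec (V i)) = tc (a V).
Proof.
elim: k a V => [|k IH] a V fa; first by rewrite cform0E /scal_of (v0_eta V (fun=> 0)).
have -> : (fun i => cvec (V i)) =
  vcons (cvec (V ord0)) (fun i => cvec ((V \o lift ord0) i)).
 by rewrite -[LHS]vcons_eta.
rewrite -[LHS]/(ctr (cvec (V ord0)) (cform a) _) ctr_cform.
rewrite re_cvec im_cvec contract0 // cform_0 kE /fscale kE mulr0 addr0.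
by rewrite IH; [rewrite /ctr vcons_eta | exact: ctr_form].
Qed.

Lemma upd_complex k (V : 'I_k -> TR) i W :
 upd (fun i => cvec (V i)) i (cvec W) = fun j => cvec (upd V i W j).
Proof. by fext => j; rewrite /upd; case: ifP. Qed.
Lemma tc1 : tc 1 = 1. Proof. exact: cval_inj. Qed.
Lemma tc_sign i : tc ((-1) ^+ i) = (-1) ^+ i.
Proof. by elim: i => [|i IH]; rewrite ?expr0 ?tc1 // !exprS to_complexM IH to_complexN tc1. Qed.
Lemma cform_dif k (a : kform (idealT CR) k) : is_form a ->
 dif (cform a) = cform (dif a).
Proof.
move=> fa; apply: form_realC => [||V].
- exact/dif_form/cform_form.
- exact/cform_form/dif_form.
rewrite cform_real; last exact: dif_form.
rewrite /dif tc_sum; apply: eq_bigr => j _; rewrite to_complexM tc_sign; congr (_ * _).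
rewrite to_complexD tc_sum; congr (_ + _).
 rewrite -[(fun i => cvec (V i)) \o lift j]/(fun i => cvec ((V \o lift j) i)).
 by rewrite cform_real // cvec_real.
apply: eq_bigr => l _.
by rewrite -cvec_bracket (upd_complex (V \o lift j)) cform_real.
Qed.
End ComplexForms.

Section Anchors.
Variables (K : fieldType) (X : Type) (A : falg K X) (I : ideal A).

Definition pull k (a : kform (idealT A) k) : kform I k := fun V => a (fun i => anc (V i)).
Lemma pull_form k (a : kform (idealT A) k) : is_form a -> is_form (pull a).
Proof.
have U (V : 'I_k -> vect I) i Y : (fun j => anc (upd V i Y j)) = upd (fun j => anc (V j)) i (anc Y).
 by fext => j; rewrite /upd; case: ifP.
move=> fa; split=> [V i Y Z|V i f Y|V i j ij Vij]; rewrite /pull ?U.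
- rewrite -formD //; congr (a (upd _ _ _)); exact: vect_inj.
- rewrite -formZ //; congr (a (upd _ _ _)); exact: vect_inj.
- by apply: (form_alt fa ij); rewrite Vij.
Qed.
Lemma pull_dif k (a : kform (idealT A) k) : dif (pull a) = pull (dif a).
Proof.
fext => V; rewrite /pull /dif; apply: eq_bigr => j _; congr (_ * (_ + _)).
apply: eq_bigr => l _; congr (a _); fext => i; by rewrite /upd; case: ifP.
Qed.
End Anchors.

(** * Forms on the log algebroid *)

Section Scaling.
Variables (K : fieldType) (X : Type) (A : falg K X) (I : ideal A).

Lemma form_scale_all k (a : kform I k) f (V : 'I_k -> vect I) : is_form a ->
 a (fun i => vscale f (V i)) = f ^+ k * a V.
Proof.
elim: k a V => [|k IH] a V fa; first by rewrite mul1r; congr a; exact: v0_eta.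
have -> : (fun i => vscale f (V i)) = vcons (vscale f (V ord0)) (fun i => vscale f ((V \o lift ord0) i)).
 by rewrite -[LHS]vcons_eta.
rewrite -[LHS]/(ctr (vscale f (V ord0)) a _) contractZ // /fscale.
by rewrite IH; [rewrite /ctr vcons_eta exprS mulrA | exact: ctr_form].
Qed.
Lemma mk_vect (Y : vect (idealT A)) (H : forall f, I f -> I (Y f)) :
 exists Y' : vect I, anc Y' = Y.
Proof.
exists (@Vect _ _ A I Y (vectD Y) (vectM Y) (vectZ Y) H); exact: vect_inj.
Qed.
Lemma anchor_inj (Y Z : vect I) : anc Y = anc Z -> Y = Z.
Proof. by move=> E; apply: vect_inj => f; rewrite -[Y f]/(anc Y f) E. Qed.
End Scaling.

Section Divisibility.
Variables (R : realType) (n : nat) (M : manifold R n).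
Local Notation CC := (CC M).
Implicit Types (z h g : CC) (x : M).

Lemma cvalX h k x : cval (h ^+ k) x = cval h x ^+ k.
Proof. exact: (n_exp (nice_CC M)). Qed.
Lemma dvdD x z h g : dvd x z h -> dvd x z g -> dvd x z (h + g).
Proof.
move=> [h' E1] [g' E2]; exists (h' + g'); apply: filterS (filterI E1 E2) => y [e1 e2].
by rewrite !cvalD e1 e2 mulrDr.
Qed.
Lemma dvdMl x z h g : dvd x z h -> dvd x z (g * h).
Proof.
by move=> [h' E]; exists (g * h'); apply: filterS E => y e; rewrite !cvalM e mulrCA.
Qed.
Lemma dvdMM x z z' h h' : dvd x z h -> dvd x z' h' -> dvd x (z * z') (h * h').
Proof.
move=> [k E] [k' E']; exists (k * k'); apply: filterS (filterI E E') => y [e e'].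
by rewrite !cvalM e e' mulrACA.
Qed.
Lemma dvd_refl x z h : dvd x z (z * h).
Proof. by exists h; apply: nearW => y; rewrite cvalM. Qed.
Lemma dvd_near x z h h' : (\forall y \near x, cval h y = cval h' y) -> dvd x z h -> dvd x z h'.
Proof. by apply: dvd_congr; apply: nearW. Qed.
Lemma dvd_conjX x z m h : transv z x -> dvd x z (conjA z ^+ m * h) -> dvd x z h.
Proof.
move=> tz; elim: m h => [|m IH] h; first by rewrite mul1r.
rewrite exprSr -mulrA => /IH [g gE].
by apply: (conj_divides (b := g) tz); apply: filterS gE => y; rewrite cvalM.
Qed.
Lemma transv_local z z' x : (\forall y \near x, cval z y = cval z' y) ->
 transv z x -> transv z' x.
Proof.
move=> E /transvP[Y [Z YZ]]; apply/transvP; exists Y, Z.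
have Ec : \forall y \near x, cval (conjA z) y = cval (conjA z') y.
 by apply: filterS E => y e; rewrite !cval_conj e.
have L (V : vect (idealT CC)) : cval (V z') x = cval (V z) x /\
  cval (V (conjA z')) x = cval (V (conjA z)) x.
 by split; apply/esym; [exact: (nbhs1 (vect_local (nice_CC M) V E))
            |exact: (nbhs1 (vect_local (nice_CC M) V Ec))].
by rewrite !(L Y).1 !(L Z).1 !(L Y).2 !(L Z).2.
Qed.
End Divisibility.

(** * Log vector fields near smooth points, and residues *)

Section LogFields.
Variables (R : realType) (n : nat) (M : manifold R n).
Local Notation CR := (CR M).
Local Notation CC := (CC M).
Local Notation TC := (vect (idealT CC)).
Local Notation tc := (@toCx R n M : CR -> CC).
Variable ID : ideal CC.
Hypotheses (lI : locally_log ID) (loc : loc_ideal ID).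
Implicit Types (e f g h z : CC) (x : M) (Y U : TC).
Let nC := nice_CC M.
(** The common zeros of the ideal are nowhere dense, so an identity may be checked after
    multiplication by powers of its elements; smooth identities are thus tested with fields made log
    by such a factor. *)
Lemma ideal_cancel k f g : (forall e, ID e -> e ^+ k * f = e ^+ k * g) -> f = g.
Proof.
move=> H; apply: cval_inj => x; apply/eqP/negPn/negP; rewrite -subr_eq0 -cvalB => fg.
have [y fgy nz] := log_zeros_dense lI (n_open nC fg); apply: nz => e Ie.
apply/eqP/negPn/negP => ey; move/negP: fgy; apply.
have := congr1 (fun u : CC => cval u y) (H e Ie); rewrite !cvE cvalX => /eqP.
rewrite -subr_eq0 -mulrBr mulf_eq0 expf_eq0 (negPf ey) andbF /= => /eqP E0.
by rewrite E0.
Qed.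

Section Quotients.
Variables (N : set M) (z : CC) (chi : CR).
Hypotheses (oN : open N) (gz : gen_by N ID z).
Hypothesis chi0 : forall y, N y \/ \forall t \near y, rval chi t = 0.

Lemma gen_dense_near y : N y -> dense_near y z.
Proof.
move=> Ny N2 N2y; have [t [N2t Nt] et] := log_zeros_dense lI (filterI N2y (nopen oN Ny)).
exists t => //; apply/negP => /eqP zt; apply: et => k Ik.
have [k' k'E] := (gz Nt k).1 (nin_mem t Ik).
by rewrite (nbhs1 k'E) [ev z t]zt mulr0.
Qed.
Definition off_supp (r : CC) := forall y, (\forall t \near y, rval chi t = 0) -> cval r y = 0.
Lemma quot_uniq r r' : off_supp r -> off_supp r' -> r * z = r' * z -> r = r'.
Proof.
move=> r0 r0' E; apply: cval_inj => y; have [Ny|c0] := chi0 y; last by rewrite r0 ?r0'.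
apply: (@dcancel _ _ M N z r r' oN gen_dense_near) => // t _.
by rewrite -!cvalM ![z * _]mulrC E.
Qed.
(** The quotient of chi b by the local generator, unique because z is nonzero on a dense set,
    extended by zero where chi vanishes. *)
Lemma quot_exists b : ID b -> exists r, tc chi * b = r * z /\ off_supp r.
Proof.
move=> Ib.
have H y : exists g : CC, (N y -> \forall t \near y, cval (tc chi * b) t = cval (g * z) t) /\
  (~ N y -> g = 0).
 have [Ny|nN] := pselect (N y); last by exists 0.
 have [k kE] := (gz Ny b).1 (nin_mem y Ib).
 exists (tc chi * k); split=> // _; apply: filterS kE => t E.
 by rewrite -mulrA !(cvalM (tc chi)); congr (_ * _); rewrite cvalM.
have [g gE] := choice H.
have g0 y t : (N y -> N t -> \forall r \near t, cval (tc chi * b) r = cval (g y * z) r) ->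
  (\forall r \near t, rval chi r = 0) -> cval (g y) t = 0 \/ ~ N t.
 move=> E c0; have [Nt|] := pselect (N t); last by right.
 have [Ny|nN] := pselect (N y); last by left; have [_ ->] := gE y; rewrite ?cval0.
 left; have [N' [oN' N't N'E]] := nnopen (filterI (filterI (E Ny Nt) c0) (nopen oN Nt)).
 rewrite -(cval0 t); apply: (@dcancel _ _ M N' z _ _ oN') N't => r /N'E[[Er cr] Nr].
  exact: gen_dense_near.
 by rewrite -!cvalM mulrC -Er cvalM cval_tc cr mul0r mulr0 cval0.
have gs y : (\forall r \near y, rval chi r = 0) -> cval (g y) y = 0.
 move=> c0; have [+ gn] := gE y => gN; case: (g0 y y (fun Ny _ => gN Ny) c0) => // nN.
 by rewrite gn ?cval0.
have [r rE] : exists r : CC, forall y, cval r y = cval (g y) y.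
 apply: (glue_complex (F := fun y => cval (g y) y)) => y.
 have [Ny|c0] := chi0 y; last first.
  by exists 0; apply: filterS (nearby c0) => t ct; rewrite cval0 gs.
 exists (g y); have [/(_ Ny) E _] := gE y.
 have [N' [oN' N'y N'E]] := nnopen (filterI E (nopen oN Ny)).
 apply: filterS (nopen oN' N'y) => t N't; have [_ Nt] := N'E t N't.
 have [/(_ Nt) E' _] := gE t.
 have [N2 [oN2 N2t N2E]] := nnopen (filterI E' (nopen oN' N't)).
 apply: (@dcancel _ _ M N2 z _ _ oN2) N2t => [y' /N2E[_ /N'E[_]]|y' /N2E[E1 /N'E[E2 _]]].
  exact: gen_dense_near.
 by rewrite [LHS]mulrC [RHS]mulrC -(cvalM (g t)) -(cvalM (g y)) -E1 -E2.
exists r; split=> [|y c0]; last by rewrite rE gs.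
apply: cval_inj => y; have [Ny|c0] := chi0 y.
 by have [/(_ Ny) /nbhs1 E _] := gE y; rewrite E !cvalM rE.
by rewrite cvalM cval_tc (nbhs1 c0) mul0r cvalM rE gs ?mul0r.
Qed.
End Quotients.

(** The ideal times any vector field lies in the log algebroid. *)
Definition idealS e (Ie : ID e) Y : vect ID := projT1 (cid (@mk_vect _ _ CC ID (vscale e Y)
 (fun f _ => eq_ind _ (fun h => ID h) (idealM (Y f) Ie) _ (mulrC _ _)))).
Lemma idealSE e (Ie : ID e) Y : anc (idealS Ie Y) = vscale e Y.
Proof. by rewrite /idealS; case: cid. Qed.

(** Data at a smooth point of the divisor: an element z of the ideal generating it on N, a complex
    field U dual to dz and killing the conjugate of z, and a cutoff. *)
Record simple_frame x z (N : set M) U (chi : CR) : Prop := SimpleFrame {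
 sf_mem : ID z;
 sf_open : open N;
 sf_N : N x;
 sf_gen : gen_by N ID z;
 sf_z0 : cval z x = 0;
 sf_tr : transv z x;
 sf_U1 : forall y, N y -> cval (U z) y = 1;
 sf_U0 : forall y, N y -> cval (U (conjA z)) y = 0;
 sf_chi1 : \forall y \near x, rval chi y = 1;
 sf_chi0 : forall y, N y \/ \forall s \near y, rval chi s = 0 }.

Lemma simple_frameP x : simple_at ID x ->
 (exists2 e, ID e & cval e x != 0) \/ exists z N U chi, simple_frame x z N U chi.
Proof.
move=> [W [z0 [Wx [oW gW tW]]]]; have [z Iz zE] := gen_near nC gW Wx.
have [zx|zx] := eqVneq (cval z x) 0; last by left; exists z.
right; have z0x : cval z0 x = 0 by rewrite -[LHS]/(ev z0 x) (nbhs1 zE).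
have tz : transv z x by apply: transv_local zE _; exact: tW.
have [W1 [D [nf W1x]]] := nform_exists tz.
have [N [oN Nx NE]] := nnopen (filterI (filterI zE (nopen oW Wx))
 (nopen (nf_open nf) W1x)).
have [chi [c1 _ c0]] := bump_real oN Nx.
(* D sends the conjugate of z to 2 and kills z, so half its conjugate is dual to dz. *)
exists z, N, (vscale (ccst M 2^-1 : CC) (cjvec D)), chi; split=> //.
- apply: (gen_by_unit nC oN _ gW (u := 1)) => [y /NE[[]] //|y Ny]; split.
  by rewrite (n1 nC) oner_neq0.
 by apply: filterS (nopen oN Ny) => s /NE[[-> _] _]; rewrite (n1 nC) mul1r.
- move=> y /NE[_ W1y]; rewrite -[LHS]/(cval (ccst M 2^-1 * cjvec D z) y).
 rewrite cjvecE !cvE (nf_D2 nf W1y); apply/eqP; rewrite eq_complex /=.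
 by apply/andP; split; apply/eqP; field.
- move=> y /NE[_ W1y]; rewrite -[LHS]/(cval (ccst M 2^-1 * cjvec D (conjA z)) y).
 by rewrite cjvecE conjAK !cvE (nf_D0 nf W1y) conjc0 mulr0.
Qed.

Section Frame.
Variables (x : M) (z : CC) (N : set M) (U : TC) (chi : CR).
Hypothesis sf : simple_frame x z N U chi.

(** If Y z = 0 then Y (k z) = Y(k) z stays in the ideal; the cutoff removes the region where z is
    not a generator. *)
Lemma killer_vect Y : (forall y, N y -> cval (Y z) y = 0) ->
 exists Y' : vect ID, anc Y' = vscale (tc chi) Y.
Proof.
move=> Yz; apply: mk_vect => f If; apply: loc => y.
have [Ny|c0] := sf_chi0 sf y; last first.
 exists 0; first exact: ideal0.
 by apply: filterS c0 => s c; rewrite -[vscale _ _ f]/(tc chi * Y f) !evC !cvE c mul0r.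
have [k kE] := (sf_gen sf Ny f).1 (nin_mem y If).
have kE' : \forall s \near y, ev f s = ev (k * z) s by apply: filterS kE => s ->; rewrite (nM nC).
exists (tc chi * (Y k * z)); first by apply: idealM; apply: idealM; exact: sf_mem sf.
apply: filterS (filterI (vect_local nC Y kE') (nopen (sf_open sf) Ny)) => s [e Ns].
rewrite -[vscale _ _ f]/(tc chi * Y f) (nM nC) e vectM !(nM nC, nD nC) [ev (Y z) s]Yz //.
by rewrite mulr0 addr0.
Qed.

(** The projection of chi Y along U to the fields killing z. *)
Definition tangential Y : vect ID := projT1 (cid (killer_vect
 (Y := Y - vscale (Y z) U) (fun y Ny => ltac:(
  rewrite -[LHS]/(cval (Y z - Y z * U z) y) !cvE (sf_U1 sf Ny) mulr1 subrr; reflexivity)))).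
Lemma tangentialE Y : anc (tangential Y) = vscale (tc chi) (Y - vscale (Y z) U).
Proof. by rewrite /tangential; case: cid. Qed.

Local Notation zS := (idealS (sf_mem sf)).

(** Up to the cutoff, z Y is a multiple of z U modulo z times log fields: the pole of a log form
    sits in the direction z U alone. *)
Lemma scale_split Y : vscale (tc chi) (zS Y) =
 vscale z (tangential Y) + vscale (tc chi * Y z) (zS U).
Proof.
apply: anchor_inj; apply: vect_inj => f.
have E1 := congr1 (fun V : TC => V f) (idealSE (sf_mem sf) Y).
have E2 := congr1 (fun V : TC => V f) (idealSE (sf_mem sf) U).
have E3 := congr1 (fun V : TC => V f) (tangentialE Y).
rewrite -[LHS]/(tc chi * anc (zS Y) f).
rewrite -[RHS]/(z * anc (tangential Y) f + tc chi * Y z * anc (zS U) f).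
rewrite E1 E2 E3 -[vscale (tc chi) _ f]/(tc chi * (Y f - Y z * U f)) /=; ring.
Qed.

Definition kills m : kform ID m -> Prop :=
 match m return kform ID m -> Prop with
 | 0 => fun=> True
 | m'.+1 => fun c => ctr (zS U) c = 0
 end.
Lemma kills_scale m (c : kform ID m) (V : 'I_m -> TC) : is_form c -> kills c ->
 tc chi ^+ m * c (fun i => zS (V i)) = z ^+ m * c (fun i => tangential (V i)).
Proof.
elim: m c V => [|m IH] c V fc kc; first by rewrite !mul1r; congr c; exact: v0_eta.
have E (F : TC -> vect ID) : (fun i => F (V i)) = vcons (F (V ord0)) (fun i => F ((V \o lift ord0) i)).
 by rewrite -[LHS]vcons_eta.
rewrite (E zS) (E tangential) -!/(ctr _ c _) !exprSr -mulrA.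
have -> (W : 'I_m -> vect ID) : tc chi * ctr (zS (V ord0)) c W = z * ctr (tangential (V ord0)) c W.
 rewrite -/(fscale (tc chi) (ctr (zS (V ord0)) c) W) -contractZ // scale_split.
 by rewrite contractD // !contractZ // kc kE /fscale kE mulr0 addr0.
rewrite mulrCA -[RHS]mulrA [RHS]mulrCA; congr (_ * _).
apply: IH; first exact: ctr_form.
case: m c V fc kc {E} => //= m c V fc kc.
by rewrite ctr_sym // kc; fext => W; rewrite kE -[ctr _ 0 W]/(0 : CC) oppr0.
Qed.

(** Each z V_i is split by [scale_split]. Tangential parts carry a factor z; a part along z U gains
    its factor from the divisibility hypothesis, and by antisymmetry at most one such part occurs in
    a term. *)
Lemma residue_scale m (a : kform ID m.+1) (V : 'I_m.+1 -> TC) : is_form a ->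
 (forall W, dvd x z (a (vcons (zS U) W))) -> dvd x (z ^+ m.+1) (a (fun i => zS (V i))).
Proof.
suff H : is_form a -> (forall W, dvd x z (a (vcons (zS U) W))) ->
  dvd x (z ^+ m.+1) (tc chi ^+ m.+1 * a (fun i => zS (V i))).
 move=> fa ra; apply: dvd_near (H fa ra); apply: filterS (sf_chi1 sf) => y c1.
 by rewrite cvalM cvalX cval_tc c1 expr1n mul1r.
elim: m a V => [|m IH] a V fa ra.
all: have E (F : TC -> vect ID) : (fun i => F (V i)) =
    vcons (F (V ord0)) (fun i => F ((V \o lift ord0) i)) by rewrite -[LHS]vcons_eta.
all: rewrite (E zS) -!/(ctr _ a _) [tc chi ^+ _]exprSr -mulrA.
all: have -> W : tc chi * ctr (zS (V ord0)) a W =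
    z * ctr (tangential (V ord0)) a W + tc chi * V ord0 z * ctr (zS U) a W
 by rewrite -/(fscale (tc chi) (ctr (zS (V ord0)) a) W) -contractZ // scale_split
    contractD // !contractZ // kE.
all: rewrite mulrDr; apply: dvdD.
- by rewrite expr1 mul1r; exact: dvd_refl.
- by rewrite expr1 mul1r; apply: dvdMl; exact: ra.
- rewrite exprS mulrCA; apply: dvdMM; first by rewrite -[z in dvd _ _ z]mulr1; exact: dvd_refl.
 apply: IH; first exact: ctr_form.
 move=> W; have := ctr_sym (zS U) (tangential (V ord0)) fa.
 move=> /(congr1 (fun c : kform ID m => c W)); rewrite kE => E1.
 rewrite -[ctr _ a _]/(ctr (zS U) (ctr (tangential (V ord0)) a) W) E1.
 have [g gE] := ra (vcons (tangential (V ord0)) W).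
 by exists (- g); apply: filterS gE => y e; rewrite !cvalN mulrN -e.
- rewrite mulrCA; apply: dvdMl; rewrite kills_scale; first last.
 + by rewrite /= ctr_alt.
 + exact: ctr_form.
 rewrite exprSr; apply: dvdMM; last exact: ra.
 by rewrite -[X in dvd _ _ X]mulr1; exact: dvd_refl.
Qed.
End Frame.

(** In every frame at a smooth point, the coefficient of dz / z vanishes on the divisor. *)
Definition residue_free m (a : kform ID m.+1) := forall x z N U chi
 (sf : simple_frame x z N U chi) W, dvd x z (a (vcons (idealS (sf_mem sf) U) W)).
(** b(V) is the common quotient of a(e V_1, ..., e V_(m+1)) by e^(m+1), over all e in the ideal. It
    is supplied by [log_extend], whose condition at simple points is [residue_scale]; multilinearity
    is inherited after cancelling e^(m+1). *)
Lemma extend_form m (a : kform ID m.+1) : is_form a -> residue_free a ->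
 exists2 b : kform (idealT CC) m.+1, is_form b & pull b = a.
Proof.
move=> fa ra; pose J := {e | ID e}.
have scaleA (e e' : J) (V : 'I_m.+1 -> TC) :
  sval e ^+ m.+1 * a (fun i => idealS (svalP e') (V i)) =
  sval e' ^+ m.+1 * a (fun i => idealS (svalP e) (V i)).
 rewrite -(form_scale_all (sval e) _ fa) -(form_scale_all (sval e') _ fa); congr a; fext => i; apply: anchor_inj.
 apply: vect_inj => f.
 have E1 := congr1 (fun V : TC => V f) (idealSE (svalP e') (V i)).
 have E2 := congr1 (fun V : TC => V f) (idealSE (svalP e) (V i)).
 rewrite -[LHS]/(sval e * anc (idealS (svalP e') (V i)) f).
 rewrite -[RHS]/(sval e' * anc (idealS (svalP e) (V i)) f) E1 E2 /=; ring.
have [b bE] : exists b : kform (idealT CC) m.+1, forall V (e : J),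
  sval e ^+ m.+1 * b V = a (fun i => idealS (svalP e) (V i)).
 suff H V : exists h : CC, forall e : J, sval e ^+ m.+1 * h = a (fun i => idealS (svalP e) (V i)).
  by have [b bE] := choice H; exists b.
 have [|||h hE] := @log_extend R n M J (fun e : J => sval e ^+ m.+1)
  (fun e : J => a (fun i => idealS (svalP e) (V i))) ID lI; last by exists h.
 - by move=> e e'; exact: scaleA.
 - move=> x /simple_frameP[[e0 Ie0 e0x]|[z [N [U [chi sf]]]]].
   have [v vE] := n_inv nC e0x; pose e1 : J := exist _ e0 Ie0.
   exists (v ^+ m.+1 * a (fun i => idealS (svalP e1) (V i))) => e.
   apply: filterS vE => y vy; rewrite -cvalM mulrCA scaleA mulrA -exprMn cvalM.
   have {}vy : cval v y * cval e0 y = 1 by rewrite mulrC -vy.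
   by rewrite cvalX cvalM /= vy expr1n mul1r.
  have [h hE] := residue_scale V fa (ra _ _ _ _ _ sf); exists h => e.
  pose ez : J := exist _ z (sf_mem sf).
  have [N' [oN' N'x N'E]] := nnopen (filterI hE (nopen (sf_open sf) (sf_N sf))).
  apply: filterS (nopen oN' N'x) => y N'y; rewrite -cvalM.
  have tz s : N s -> dense_near s z.
   move=> Ns N2 N2s; have [w [N2w Nw] ew] := log_zeros_dense lI (filterI N2s (nopen (sf_open sf) Ns)).
   exists w => //; apply/negP => /eqP zw; apply: ew => k Ik.
   have [k' k'E] := (sf_gen sf Nw k).1 (nin_mem w Ik).
   by rewrite (nbhs1 k'E) [ev z w]zw mulr0.
  apply: (@dcancel _ _ M N' (z ^+ m.+1)) => // {y N'y} y /N'E [hy Ny].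
   by move=> N2 N2y; have [w N2w zw] := tz y Ny N2 N2y; exists w; rewrite // cvalX expf_neq0.
  have Ee : cval (z ^+ m.+1) y * cval (a (fun i => idealS (svalP e) (V i))) y =
    cval (sval e ^+ m.+1) y * cval (a (fun i => idealS (sf_mem sf) (V i))) y.
   have H := congr1 (fun u : CC => cval u y) (scaleA ez e V).
   have Ez : (fun i => idealS (svalP ez) (V i)) = (fun i => idealS (sf_mem sf) (V i)).
    by fext => i; apply: anchor_inj; rewrite !idealSE.
   by rewrite Ez in H; exact: H.
  by rewrite Ee hy [X in _ * X]cvalM mulrCA.
 - move=> p W j f oW Wp [gF _ _].
  have [e Ie eE] := gen_near nC gF Wp; exists (exist _ e Ie), m.+1, 0%N.
  apply: filterS eE => y E; rewrite expr0 mulr1 -!evC !(n_exp nC) E //.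
have bU u v : (forall e : J, sval e ^+ m.+1 * u = sval e ^+ m.+1 * v) -> u = v.
 by move=> H; apply: (@ideal_cancel m.+1) => e Ie; exact: (H (exist _ e Ie)).
have updS (e : J) V i Y : (fun j => idealS (svalP e) (upd V i Y j)) =
  upd (fun j => idealS (svalP e) (V j)) i (idealS (svalP e) Y).
 by fext => j; rewrite /upd; case: ifP.
have SD (e : J) Y Z : idealS (svalP e) (Y + Z) = idealS (svalP e) Y + idealS (svalP e) Z.
 apply: anchor_inj; rewrite idealSE; apply: vect_inj => f.
 have E1 := congr1 (fun V : TC => V f) (idealSE (svalP e) Y).
 have E2 := congr1 (fun V : TC => V f) (idealSE (svalP e) Z).
 rewrite -[RHS]/(anc (idealS (svalP e) Y) f + anc (idealS (svalP e) Z) f) E1 E2.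
 by rewrite -[LHS]/(sval e * (Y f + Z f)) mulrDr.
have SZ (e : J) f Y : idealS (svalP e) (vscale f Y) = vscale f (idealS (svalP e) Y).
 apply: anchor_inj; rewrite idealSE; apply: vect_inj => g.
 have E1 := congr1 (fun V : TC => V g) (idealSE (svalP e) Y).
 by rewrite -[RHS]/(f * anc (idealS (svalP e) Y) g) E1 /= mulrCA.
exists b.
 split=> [V i Y Z|V i f Y|V i j ij Vij]; apply: bU => e.
 - by rewrite mulrDr !bE !updS SD formD.
 - by rewrite mulrCA !bE !updS SZ formZ.
 - by rewrite bE mulr0 (form_alt fa ij) // Vij.
fext => V; apply: bU => e; rewrite bE -form_scale_all //; congr a.
by fext => i; apply: anchor_inj; rewrite idealSE; exact: vect_inj.
Qed.
End LogFields.

(** * Forms on the log algebroid that are real on the elliptic one *)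

Section RealParts.
Variables (R : realType) (n : nat) (M : manifold R n).
Local Notation CR := (CR M).
Local Notation CC := (CC M).
Local Notation TR := (vect (idealT CR)).
Local Notation TC := (vect (idealT CC)).
Local Notation tc := (@toCx R n M : CR -> CC).
Local Notation ii := (ccst M 'i : CC).
Implicit Types (e f g h z : CC) (x : M) (Y U : TC) (q c : CR).

Lemma conjA_re h : re (conjA h) = re h.
Proof. by apply: rval_inj => x; rewrite !rval_re cval_conj; case: (cval h x). Qed.
Lemma conjA_im h : im (conjA h) = - im h.
Proof. by apply: rval_inj => x; rewrite rvalN !rval_im cval_conj; case: (cval h x). Qed.
Lemma conjA_tc q : conjA (tc q) = tc q.
Proof. by apply: cval_inj => x; rewrite !cvE conjc_real. Qed.
Lemma conjAN h : conjA (- h) = - conjA h.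
Proof. by apply: cval_inj => x; rewrite !cvE rmorphN. Qed.
Lemma conjA_ii : conjA ii = - ii.
Proof. by apply: cval_inj => x; rewrite !cvE; apply/eqP; rewrite eq_complex /= oppr0 !eqxx. Qed.
Lemma cjvecZ h Y : cjvec (vscale h Y) = vscale (conjA h : CC) (cjvec Y).
Proof.
apply: vect_inj => f; rewrite cjvecE -[RHS]/(conjA h * cjvec Y f) cjvecE -conjAM //.
Qed.
Lemma conj_cvec (V : TR) : cjvec (cvec V) = cvec V.
Proof.
apply: cvect_inj => q; rewrite cjvecE conjA_tc cvec_real conjA_tc //.
Qed.
Lemma normE e : tc (re (e * conjA e)) = e * conjA e.
Proof.
apply: re_im_inj; first by rewrite re_tc.
by rewrite im_tc; apply: rval_inj => x; rewrite rval0 rval_im cvalM cval_conj; case: (cval e x) => a b /=; ring.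
Qed.

(** The interface between a log ideal and its elliptic ideal used in all algebroid arguments;
    induced divisors satisfy it by [ind_real_part]. *)
Record real_part (ID : ideal CC) (I : ideal CR) : Prop := RealPart {
 rp_lift : forall (V : vect I) f, ID f -> ID (cvec (anc V) f);
 rp_real : forall V : TR, (forall f, ID f -> ID (cvec V f)) -> forall q, I q -> I (V q);
 rp_norm : forall e, ID e -> I (re (e * conjA e)) }.

Variables (ID : ideal CC) (I : ideal CR).
Hypotheses (lI : locally_log ID) (loc : loc_ideal ID) (rp : real_part ID I).

Lemma liftP (V : vect I) : exists V' : vect ID, anc V' = cvec (anc V).
Proof. by apply: mk_vect => f; exact: rp_lift rp V f. Qed.
Definition liftv V := projT1 (cid (liftP V)).
Lemma liftE V : anc (liftv V) = cvec (anc V).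
Proof. by rewrite /liftv; case: cid. Qed.
Lemma lift_vectD V W : liftv (V + W) = liftv V + liftv W.
Proof.
apply: anchor_inj; rewrite liftE; have -> : anc (V + W) = anc V + anc W by exact: vect_inj.
by rewrite cvecD -!liftE; exact: vect_inj.
Qed.
Lemma lift_vectZ q V : liftv (vscale q V) = vscale (tc q) (liftv V).
Proof.
apply: anchor_inj; rewrite liftE; have -> : anc (vscale q V) = vscale q (anc V) by exact: vect_inj.
by rewrite cvecZ -!liftE; exact: vect_inj.
Qed.
Lemma lift_upd k (V : 'I_k -> vect I) i (Y : vect I) :
 (fun j => liftv (upd V i Y j)) = upd (fun j => liftv (V j)) i (liftv Y).
Proof. by fext => j; rewrite /upd; case: ifP. Qed.
Lemma unlift (Z : vect ID) (V : TR) : anc Z = cvec V ->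
 exists V' : vect I, anc V' = V /\ liftv V' = Z.
Proof.
move=> E; have [V' V'E] : exists V' : vect I, anc V' = V.
 by apply: mk_vect; apply: (rp_real rp) => f If; rewrite -E; exact: vect_ideal.
by exists V'; split=> //; apply: anchor_inj; rewrite liftE E V'E.
Qed.
Lemma realS_exists q : I q -> forall V : TR, exists V' : vect I, anc V' = vscale q V.
Proof. by move=> Iq V; apply: mk_vect => f If; rewrite /= mulrC; exact: idealM. Qed.
Lemma ideal_cancelR k (f g : CR) : (forall q, I q -> q ^+ k * f = q ^+ k * g) -> f = g.
Proof.
move=> H; apply: rval_inj => x; apply/eqP/negPn/negP; rewrite -subr_eq0 -rvalB => fg.
have [y fgy nz] := log_zeros_dense lI (n_open (nice_CR M) fg); apply: nz => e Ie.
apply/eqP/negPn/negP => ey; move/negP: fgy; apply.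
have qy : rval (re (e * conjA e)) y != 0.
 apply/negP => /eqP q0; have := congr1 (fun u : CC => cval u y) (normE e).
 rewrite cval_tc q0 cvalM => /esym/eqP; rewrite mulf_eq0 conjA_eq0 orbb.
 by apply/negP.
have := congr1 (fun u : CR => rval u y) (H _ (rp_norm rp Ie)).
rewrite !rvalM -[rval (_ ^+ _) y]/(ev (_ : CR) y) (n_exp (nice_CR M)) => /eqP.
by rewrite -subr_eq0 -mulrBr mulf_eq0 expf_eq0 (negPf qy) andbF.
Qed.

Definition real_on k (a : kform ID k) := forall W : 'I_k -> vect I, im (a (fun i => liftv (W i))) = 0.
Lemma real_on_ctr k (a : kform ID k.+1) V : real_on a -> real_on (ctr (liftv V) a).
Proof.
move=> ra W; have := ra (vcons V W); rewrite /ctr; congr (im (a _) = 0).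
by fext => i; case: (unliftP ord0 i) => [j ->|->]; rewrite ?vconsE0 ?vconsES.
Qed.
Lemma conj_split (V V' : vect ID) : anc V' = cjvec (anc V) ->
 exists A B : vect I, V = liftv A + vscale ii (liftv B) /\
            V' = liftv A - vscale ii (liftv B).
Proof.
move=> E; have E1 f : V f = cvec (re_vect (anc V)) f + ii * cvec (im_vect (anc V)) f.
 by have := congr1 (fun Y : TC => Y f) (cvecE (anc V)).
have E2 f : V' f = cvec (re_vect (anc V)) f - ii * cvec (im_vect (anc V)) f.
 by have := congr1 (fun Y : TC => Y f) E.
pose hf : CC := ccst M 2^-1.
have hf2 : hf + hf = 1.
 by apply: cval_inj => x; rewrite !cvE; ceq; field.
have i2 : ii * ii = -1 := iiM M.
have PA f : ID f -> ID (cvec (re_vect (anc V)) f).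
 move=> If; have -> : cvec (re_vect (anc V)) f = hf * (V f + V' f).
  by rewrite E1 E2 -[LHS]mul1r -hf2; ring.
 by apply: idealM; apply: idealD; exact: vect_ideal.
have PB f : ID f -> ID (cvec (im_vect (anc V)) f).
 move=> If; have -> : cvec (im_vect (anc V)) f = (- ii * hf) * (V f - V' f).
  rewrite E1 E2 -[LHS]mul1r -hf2; ring: i2.
 by apply: idealM; apply: idealD; [exact: vect_ideal|apply: idealN; exact: vect_ideal].
have [A AE] := mk_vect (rp_real rp PA); have [B BE] := mk_vect (rp_real rp PB).
have LA f : liftv A f = cvec (re_vect (anc V)) f.
 by have := congr1 (fun Y : TC => Y f) (liftE A); rewrite AE.
have LB f : liftv B f = cvec (im_vect (anc V)) f.
 by have := congr1 (fun Y : TC => Y f) (liftE B); rewrite BE.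
exists A, B; split; apply: vect_inj => f.
- by rewrite E1 -LA -LB.
- by rewrite E2 -LA -LB.
Qed.

(** Conjugate log fields are A + i B and A - i B with A and B lifted from elliptic fields, on which
    a is real. *)
Lemma real_conj k (a : kform ID k) (V V' : 'I_k -> vect ID) : is_form a -> real_on a ->
 (forall i, anc (V' i) = cjvec (anc (V i))) -> a V' = conjA (a V).
Proof.
elim: k a V V' => [|k IH] a V V' fa ra E.
 have := ra (fun=> 0); rewrite (v0_eta (fun i => liftv _) V) => im0'.
 rewrite (v0_eta V' V); apply: re_im_inj; first by rewrite conjA_re.
 by rewrite conjA_im im0' oppr0.
have [A [B [EV EV']]] := conj_split (E ord0).
rewrite -[V]vcons_eta -[V']vcons_eta -!/(ctr _ a _) EV EV'.
rewrite !contractD // contractN // !contractZ // !kE /fscale.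
have IHa W : ctr (liftv W) a (V' \o lift ord0) = conjA (ctr (liftv W) a (V \o lift ord0)).
 by apply: IH => [||i]; [exact: ctr_form|exact: real_on_ctr|exact: E].
by rewrite !IHa conjAD conjAM conjA_ii mulNr.
Qed.

(** The conjugate of the log field chi z U is zbar times the log field chi Ubar. Reality therefore
    equates chi zbar^m a(z U, W) with z times a smooth function; z divides this and hence a(z U, W),
    by unique factorisation. *)
Lemma real_residue_free m (a : kform ID m.+1) : is_form a -> real_on a -> residue_free a.
Proof.
move=> fa ra x z N U chi sf W; apply: (dvd_conjX (m := m) (sf_tr sf)).
have [Ub UbE] : exists Ub : vect ID, anc Ub = vscale (tc chi) (cjvec U).
 apply: (killer_vect loc sf) => y Ny.
 by rewrite cjvecE cval_conj (sf_U0 sf Ny) conjc0.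
pose V := vcons (vscale (tc chi) (idealS (sf_mem sf) U)) (fun i => vscale (conjA z : CC) (W i)).
pose V' := vcons (vscale (conjA z : CC) Ub) (fun i => idealS (sf_mem sf) (cjvec (anc (W i)))).
have aZ (J : ideal CC) f (Y : vect J) : anc (vscale f Y) = vscale f (anc Y) by exact: vect_inj.
have E : a V' = conjA (a V).
 apply: real_conj => // i; rewrite /V /V'; case: (unliftP ord0 i) => [j ->|->].
  by rewrite !vconsES idealSE aZ cjvecZ conjAK.
 rewrite !vconsE0 !aZ idealSE UbE !cjvecZ conjA_tc.
 by apply: vect_inj => f /=; rewrite mulrCA.
have E1 : a V = tc chi * (conjA z ^+ m * a (vcons (idealS (sf_mem sf) U) W)).
 rewrite /V -[LHS]/(ctr (vscale _ _) a _) contractZ // /fscale form_scale_all //.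
 exact: ctr_form.
have E2 : a V' = conjA z * a (vcons Ub (fun i => idealS (sf_mem sf) (cjvec (anc (W i))))).
 by rewrite /V' -[LHS]/(ctr (vscale _ _) a _) contractZ.
have E3 : a V = z * conjA (a (vcons Ub (fun i => idealS (sf_mem sf) (cjvec (anc (W i)))))).
 by rewrite -[a V]conjAK -E E2 conjAM conjAK.
exists (conjA (a (vcons Ub (fun i => idealS (sf_mem sf) (cjvec (anc (W i))))))).
apply: filterS (sf_chi1 sf) => y c1.
have := congr1 (fun u : CC => cval u y) E3; rewrite E1 [in RHS]cvalM [LHS]cvalM cval_tc c1 mul1r //.
Qed.

Lemma pull_inj k (a b : kform (idealT CC) k) : is_form a -> is_form b -> pull a = pull b :> kform ID k -> a = b.
Proof.
move=> fa fb E; fext => V; apply: (ideal_cancel lI (k := k)) => e Ie.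
have := congr1 (fun c : kform ID k => c (fun i => idealS Ie (V i))) E; rewrite /pull.
have -> : (fun i => anc (idealS Ie (V i))) = fun i => vscale e (V i).
 by fext => i; rewrite idealSE.
by rewrite !form_scale_all.
Qed.

(* A form on the log algebroid that is real on the real algebroid is a smooth *)
(* real form on the manifold.                                                 *)
Lemma real_ext m (a : kform ID m.+1) : is_form a -> real_on a ->
 exists2 h : kform (idealT CR) m.+1, is_form h & pull (cform h) = a.
Proof.
move=> fa ra; have [b fb ba] := extend_form lI loc fa (real_residue_free fa ra).
pose h : kform (idealT CR) m.+1 := fun V => re (b (fun i => cvec (V i))).
have U (V : 'I_m.+1 -> TR) i (Y : TR) : (fun j => cvec (upd V i Y j)) =
  upd (fun j : 'I_m.+1 => cvec (V j)) i (cvec Y) by rewrite upd_complex.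
(* A real field need not be elliptic, but q V is for q in the elliptic ideal; there the value is
   real, and q^(m+1) is cancelled. *)
have hE V : tc (h V) = b (fun i => cvec (V i)).
 apply: re_im_inj; first by rewrite re_tc.
 rewrite im_tc; apply/esym; apply: (ideal_cancelR (k := m.+1)) => q Iq; rewrite mulr0.
 have /choice [W WE] := fun i => realS_exists Iq (V i).
 have := ra W; rewrite -ba /pull.
 have -> : (fun i => anc (liftv (W i))) = fun i => vscale (tc q) (cvec (V i)).
  by fext => i; rewrite liftE WE cvecZ.
 rewrite form_scale_all //.
 have -> : tc q ^+ m.+1 = tc (q ^+ m.+1).
  by elim: (m.+1) => [|k IH]; rewrite ?expr0 ?tc1 // !exprS to_complexM IH.
 by rewrite im_to_complexM.
have fh : is_form h.
 split=> [V i Y Z|V i f Y|V i j ij Vij]; rewrite /h.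
 - by rewrite !U cvecD formD // reD.
 - by rewrite !U cvecZ formZ // re_to_complexM.
 - by rewrite (form_alt fb ij) ?Vij // re0.
exists h => //; rewrite -ba; congr pull; apply: form_realC => [||V] //.
 exact: cform_form.
by rewrite cform_real.
Qed.
End RealParts.

(** * From log symplectic forms to generalized complex structures *)

Section Gsec.
Variables (R : realType) (n : nat) (M : manifold R n).
Local Notation CR := (CR M).
Local Notation CC := (CC M).
Local Notation TR := (vect (idealT CR)).
Local Notation TC := (vect (idealT CC)).
Local Notation tc := (@toCx R n M : CR -> CC).
Local Notation ii := (ccst M 'i : CC).

Lemma form1_ext (K : fieldType) (X : Type) (A : falg K X) (I : ideal A) (a b : kform I 1) :
 (forall Y, a (v1 Y) = b (v1 Y)) -> a = b.
Proof. by move=> H; fext => V; rewrite [V]v1_eta. Qed.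
Lemma gsec_eq (K : fieldType) (A : falg K M) (u v : gsec A) : u.1 = v.1 ->
 (forall Y, u.2 (v1 Y) = v.2 (v1 Y)) -> u = v.
Proof. by case: u v => [u1 u2] [w1 w2] /= -> /form1_ext ->. Qed.
Lemma pairingE (K : fieldType) (A : falg K M) (u v : gsec A) :
 pairing u v = v.2 (v1 u.1) + u.2 (v1 v.1).
Proof. by rewrite /pairing /scal_of /ctr !v1_vcons. Qed.
Lemma cv1 (Y : TR) : (fun i => cvec (v1 Y i)) = v1 (cvec Y).
Proof. by []. Qed.
Lemma re_gsecE (u : gsec CC) Y : (re_gsec u).2 (v1 Y) = re (u.2 (v1 (cvec Y))).
Proof. by []. Qed.
Lemma im_gsecE (u : gsec CC) Y : (im_gsec u).2 (v1 Y) = im (u.2 (v1 (cvec Y))).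
Proof. by []. Qed.
Lemma form1_split (a : kform (idealT CC) 1) (Y : TC) : is_form a ->
 a (v1 Y) = a (v1 (cvec (re_vect Y))) + ii * a (v1 (cvec (im_vect Y))).
Proof. by move=> fa; rewrite {1}[Y]cvecE form1D // form1Z. Qed.
Lemma gsec_re_im (u v : gsec CC) : is_gsec u -> is_gsec v -> re_gsec u = re_gsec v ->
 im_gsec u = im_gsec v -> u = v.
Proof.
move=> gu gv Er Ei; apply: gsec_eq => [|Y].
 by rewrite [u.1]cvecE [v.1]cvecE (congr1 fst Er : re_vect u.1 = re_vect v.1)
   (congr1 fst Ei : im_vect u.1 = im_vect v.1).
have H Z : u.2 (v1 (cvec Z)) = v.2 (v1 (cvec Z)).
 apply: re_im_inj; first by rewrite -!re_gsecE Er.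
 by rewrite -!im_gsecE Ei.
by rewrite !(form1_split Y) // !H.
Qed.

Lemma re_gsec_form (u : gsec CC) : is_gsec u -> is_gsec (re_gsec u).
Proof.
move=> gu; apply: form1_intro => [Y Z|f Y]; rewrite !re_gsecE.
 by rewrite cvecD form1D // reD.
by rewrite cvecZ form1Z // re_to_complexM.
Qed.
Lemma im_gsec_form (u : gsec CC) : is_gsec u -> is_gsec (im_gsec u).
Proof.
move=> gu; apply: form1_intro => [Y Z|f Y]; rewrite !im_gsecE.
 by rewrite cvecD form1D // imD.
by rewrite cvecZ form1Z // im_to_complexM.
Qed.
Lemma re_gsecD (u v : gsec CC) : re_gsec (u + v) = re_gsec u + re_gsec v.
Proof. by apply: gsec_eq => [|Y]; [exact: re_vectD|exact: reD]. Qed.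
Lemma im_gsecD (u v : gsec CC) : im_gsec (u + v) = im_gsec u + im_gsec v.
Proof. by apply: gsec_eq => [|Y]; [exact: im_vectD|exact: imD]. Qed.
Lemma re_gsecN (u : gsec CC) : re_gsec (- u) = - re_gsec u.
Proof.
have z : re_gsec 0 = 0 :> gsec CR by apply: (addIr (re_gsec 0)); rewrite -re_gsecD add0r [RHS]add0r.
by apply: (addIr (re_gsec u)); rewrite -re_gsecD !addNr.
Qed.
Lemma re_gsec_tc f (u : gsec CC) : re_gsec (gscale (tc f) u) = gscale f (re_gsec u).
Proof.
by apply: gsec_eq => [|Y]; [apply: vect_inj => g; exact: re_to_complexM|exact: re_to_complexM].
Qed.
Lemma im_gsec_tc f (u : gsec CC) : im_gsec (gscale (tc f) u) = gscale f (im_gsec u).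
Proof.
by apply: gsec_eq => [|Y]; [apply: vect_inj => g; exact: im_to_complexM|exact: im_to_complexM].
Qed.
Lemma re_gsec_i (u : gsec CC) : re_gsec (gscale ii u) = - im_gsec u.
Proof. by apply: gsec_eq => [|Y]; [apply: vect_inj => g; exact: reM_i|exact: reM_i]. Qed.
Lemma im_gsec_i (u : gsec CC) : im_gsec (gscale ii u) = re_gsec u.
Proof. by apply: gsec_eq => [|Y]; [apply: vect_inj => g; exact: imM_i|exact: imM_i]. Qed.
Lemma is_gsecD (K : fieldType) (A : falg K M) (u v : gsec A) :
 is_gsec u -> is_gsec v -> is_gsec (u + v).
Proof. exact: is_formD. Qed.
Lemma is_gsecZ (K : fieldType) (A : falg K M) f (u : gsec A) :
 is_gsec u -> is_gsec (gscale f u).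
Proof. exact: is_formZ. Qed.
Lemma is_gsecN (K : fieldType) (A : falg K M) (u : gsec A) : is_gsec u -> is_gsec (- u).
Proof. exact: is_formN. Qed.
End Gsec.

(** * The graph of a log form *)

Section LogStructure.
Variables (R : realType) (n : nat) (M : manifold R n).
Local Notation CR := (CR M).
Local Notation CC := (CC M).
Local Notation TR := (vect (idealT CR)).
Local Notation TC := (vect (idealT CC)).
Local Notation tc := (@toCx R n M : CR -> CC).
Local Notation ii := (ccst M 'i : CC).
Implicit Types (e f g z : CC) (x : M) (Y U : TC) (q c : CR).
Let nC := nice_CC M.
Variables (ID : ideal CC) (I : ideal CR).
Hypotheses (lI : locally_log ID) (loc : loc_ideal ID) (rp : real_part ID I).
Variables (s : kform ID 2) (w : kform I 2).
Hypotheses (fs : is_form s) (fw : is_form w) (nw : Defs.nondegenerate w).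
Local Notation lift := (liftv rp).
Hypothesis ws : forall A B : vect I, w (v2 A B) = im (s (v2 (lift A) (lift B))).
(** The sections X - i_X s with X a log field, the one-form being tested on log fields; this is the
    model of the +i-eigenbundle. *)
Definition graph (u : gsec CC) := is_gsec u /\ exists Z : vect ID, anc Z = u.1 /\
 forall W : vect ID, u.2 (v1 (anc W)) = - s (v2 Z W).
Lemma graphD u v : graph u -> graph v -> graph (u + v).
Proof.
move=> [gu [Z [Zu Zs]]] [gv [Z' [Zv Zs']]]; split; first exact: is_gsecD.
exists (Z + Z'); split=> [|W]; first by rewrite -[RHS]/(u.1 + v.1) -Zu -Zv; exact: vect_inj.
by rewrite -[LHS]/(u.2 _ + v.2 _) Zs Zs' form2Dl // opprD.
Qed.
Lemma graphZ f u : graph u -> graph (gscale f u).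
Proof.
move=> [gu [Z [Zu Zs]]]; split; first exact: is_gsecZ.
exists (vscale f Z); split=> [|W]; first by rewrite -[RHS]/(vscale f u.1) -Zu; exact: vect_inj.
by rewrite -[LHS]/(f * u.2 _) Zs form2Zl // mulrN.
Qed.
Lemma graph_isotropic u v : graph u -> graph v -> pairing u v = 0.
Proof.
move=> [gu [Z [Zu Zs]]] [gv [Z' [Zv Zs']]].
by rewrite pairingE -Zu -Zv Zs Zs' (form2_skew Z' Z) // opprK subrr.
Qed.
Lemma ndeg_uniq (A : vect I) : (forall B, w (v2 A B) = 0) -> A = 0.
Proof.
move=> H; have [B [_ uB]] := nw (is_form0 I 1).
have <- : B = A by apply: uB; apply: form1_ext => Y; exact: H.
by apply: uB; rewrite contract0.
Qed.
Lemma imaginary_vect (Z : vect ID) : re_vect (anc Z) = 0 ->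
 exists A, Z = vscale ii (lift A).
Proof.
move=> Z0; have E : anc (vscale (- ii) Z) = cvec (im_vect (anc Z)).
 have -> : anc (vscale (- ii) Z) = vscale (- ii) (anc Z) by exact: vect_inj.
 rewrite {1}[anc Z]cvecE Z0; apply: vect_inj => f.
 have c0 : cvec (0 : TR) f = 0.
  by rewrite -[cvec 0 f]/(tc 0 + ii * tc 0) to_complex0 mulr0 addr0.
 rewrite -[LHS]/(- ii * (cvec 0 f + ii * cvec (im_vect (anc Z)) f)) c0.
 have i2 := iiM M; ring: i2.
have [A [_ AE]] := unlift rp E; exists A; rewrite AE.
by apply: vect_inj => f /=; have i2 := iiM M; ring: i2.
Qed.

(** Z is i times a lifted field A, and Re s(i A, W) = -Im s(A, W) = -w(A, W), so A = 0 by
    nondegeneracy. *)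
Lemma re_zero_uniq (Z : vect ID) : re_vect (anc Z) = 0 ->
 (forall W, re (s (v2 Z (lift W))) = 0) -> Z = 0.
Proof.
move=> /imaginary_vect [A ->] H; suff -> : A = 0.
 by apply: anchor_inj; apply: vect_inj => f /=;
   rewrite -[lift 0 f]/(anc (lift 0) f) liftE -[cvec _ f]/(tc 0 + ii * tc 0)
   to_complex0 mulr0 addr0 mulr0.
apply: ndeg_uniq => B; rewrite ws; have := H B.
by rewrite form2Zl // reM_i => /eqP; rewrite oppr_eq0 => /eqP.
Qed.
Lemma gsec_form_uniq (a b : kform (idealT CC) 1) : is_form a -> is_form b ->
 (forall W : vect ID, a (v1 (anc W)) = b (v1 (anc W))) -> a = b.
Proof.
move=> fa fb H; apply: (pull_inj lI fa fb); apply: form1_ext => W; exact: H.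
Qed.
Lemma graph_uniq u : graph u -> re_gsec u = 0 -> u = 0.
Proof.
move=> [gu [Z [Zu Zs]]] r0; have Z0 : Z = 0.
 apply: re_zero_uniq => [|W]; first by rewrite Zu; exact: (congr1 fst r0).
 have := congr1 (fun v : gsec CR => v.2 (v1 (anc W))) r0; rewrite re_gsecE -(liftE rp) Zs reN.
 by move=> /eqP; rewrite oppr_eq0 => /eqP.
apply: gsec_eq => [|Y]; first by rewrite -Zu Z0; exact: vect_inj.
rewrite (gsec_form_uniq (b := 0) gu (is_form0 _ _)) // => W.
by rewrite Zs Z0 form2_v2 contract0 // kE oppr0.
Qed.

Section Courant.
Variable h : kform (idealT CR) 3.
Hypotheses (fh : is_form h) (dsh : dif s = pull (cform h)).

(** By the Koszul formulas, the one-form part of the bracket tested on W differs from -s([Z, Z'], W)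
    by ds minus the pullback of h, which is zero. *)
Lemma graph_courant u v : graph u -> graph v -> graph (courant (cform (- h)) u v).
Proof.
move=> [gu [Z [Zu Zs]]] [gv [Z' [Zv Zs']]].
have fH : is_form (cform (- h)) by apply: cform_form; exact: is_formN.
split; first exact: courant_is_gsec.
exists (bracket Z Z'); split=> [|W]; first by rewrite -[RHS]/(bracket u.1 v.1) -Zu -Zv; exact: vect_inj.
rewrite courant_form //; have fc := ctr_form.
have lieE : lie u.1 v.2 (v1 (anc W)) = u.1 (v.2 (v1 (anc W))) - v.2 (v1 (bracket u.1 (anc W))).
 rewrite /lie big_ord_recl big_ord0 addr0; congr (_ - v.2 _).
 by fext => i; rewrite (ord1 i) /upd eqxx.
have HE : cform (- h) (v3 u.1 v.1 (anc W)) = - dif s (v3 Z Z' W).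
 rewrite dsh cformN kE -Zu -Zv /pull; congr (- cform h _).
 by rewrite [RHS]v3_eta /= /v3 /v2 !(vconsE0, vconsES).
have -> : (lie u.1 v.2 - ctr v.1 (nabla_form (cform (- h)) u)) (v1 (anc W)) =
  lie u.1 v.2 (v1 (anc W)) - (dif u.2 (v2 v.1 (anc W)) +
   cform (- h) (v3 u.1 v.1 (anc W))) by [].
rewrite lieE HE koszul1 // koszul2 //.
have bE (A B : vect ID) : bracket (anc A) (anc B) = anc (bracket A B) by exact: vect_inj.
rewrite -Zu -Zv !bE !Zs !Zs'.
have aN (A : vect ID) f : anc A (- f) = - A f by rewrite -(vectN A).
rewrite !aN.
rewrite (form2_skew (bracket Z W) Z') // (form2_skew (bracket Z' W) Z) //.
ring.
Qed.
End Courant.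

Variables (X : TR) (xi : kform (idealT CR) 1).
Hypothesis fxi : is_form xi.

(** Z is the log field of a prospective graph section with real part c (X + xi). Introducing c
    allows the problem to be solved first for c in the elliptic ideal or a cutoff, and divided by c
    afterwards. *)
Definition adm c (Z : vect ID) := re_vect (anc Z) = vscale c X /\
 forall W : vect I, re (s (v2 Z (lift W))) = - (c * xi (v1 (anc W))).
Lemma adm_uniq c c' Z Z' : adm c Z -> adm c' Z' -> vscale (tc c) Z' = vscale (tc c') Z.
Proof.
move=> [Zr Zs] [Zr' Zs']; apply/eqP; rewrite -subr_eq0; apply/eqP; apply: re_zero_uniq => [|W].
 have -> : anc (vscale (tc c) Z' - vscale (tc c') Z) = vscale (tc c) (anc Z') - vscale (tc c') (anc Z).
  exact: vect_inj.
 apply: vect_inj => f; have E1 := congr1 (fun V : TR => V f) Zr; have E2 := congr1 (fun V : TR => V f) Zr'.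
 rewrite -[LHS]/(re (tc c * Z' (tc f) - tc c' * Z (tc f))) reD reN !re_to_complexM.
 move: E1 E2; rewrite -[re_vect (anc Z) f]/(re (Z (tc f))) -[re_vect (anc Z') f]/(re (Z' (tc f))) => -> ->.
 by rewrite /= mulrCA subrr.
rewrite form2Dl // form2Nl // !form2Zl // reD reN !re_to_complexM Zs Zs'; ring.
Qed.

(** Adding i times a lifted field K leaves the real part of P unchanged and changes Re s(P, .) by
    -w(K, .), which can be prescribed. *)
Lemma adm_solve c (P : vect ID) : re_vect (anc P) = vscale c X -> exists Z, adm c Z.
Proof.
move=> Pr.
pose k : kform I 1 := fun W => re (s (v2 P (lift (W ord0)))) + c * xi (v1 (anc (W ord0))).
have fk : is_form k.
 apply: form1_intro => [A B|f A]; rewrite /k /v1.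
  have -> : anc (A + B) = anc A + anc B by exact: vect_inj.
  by rewrite lift_vectD form2Dr // reD form1D //; ring.
 have -> : anc (vscale f A) = vscale f (anc A) by exact: vect_inj.
 by rewrite lift_vectZ form2Zr // re_to_complexM form1Z //; ring.
have [K [Kk _]] := nw fk; exists (P + vscale ii (lift K)); split=> [|W].
 have -> : anc (P + vscale ii (lift K)) = anc P + vscale ii (cvec (anc K)).
  by rewrite -(liftE rp); exact: vect_inj.
 rewrite re_vectD Pr; apply: vect_inj => f.
 rewrite -[LHS]/(c * X f + re (ii * cvec (anc K) (tc f))) cvec_real reM_i im_tc.
 by rewrite oppr0 addr0.
rewrite form2Dl // form2Zl // reD reM_i -ws.
have := congr1 (fun a : kform I 1 => a (v1 W)) Kk; rewrite -[ctr K w _]/(w (v2 K W)) => ->.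
by rewrite /k /v1; ring.
Qed.

Lemma adm_ideal q : I q -> exists Z, adm q Z.
Proof.
move=> Iq; have [A AE] := realS_exists Iq X; apply: (@adm_solve q (lift A)).
by rewrite liftE AE re_cvec.
Qed.
Lemma adm_simple x : simple_at ID x -> exists c Z, adm c Z /\ rval c x != 0.
Proof.
move=> /simple_frameP[[e Ie ex]|[z [N [U [chi sf]]]]].
 have [Z aZ] := adm_ideal (rp_norm rp Ie); exists (re (e * conjA e)), Z; split=> //.
 apply/negP => /eqP q0; have := congr1 (fun u : CC => cval u x) (normE e).
 by rewrite cval_tc q0 cvalM => /esym/eqP; rewrite mulf_eq0 conjA_eq0 orbb (negPf ex).
have [Ub UbE] : exists Ub : vect ID, anc Ub = vscale (tc chi) (cjvec U).
 apply: (killer_vect loc sf) => y Ny.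
 by rewrite cjvecE cval_conj (sf_U0 sf Ny) conjc0.
(* Subtracting (X z) U from X and adding its conjugate changes only the imaginary part, and turns
   chi X into a log field. *)
pose P := tangential loc sf (cvec X) + vscale (conjA (cvec X z) : CC) Ub.
have [|Z aZ] := @adm_solve chi P.
 apply: vect_inj => f; rewrite -[LHS]/(re (tangential loc sf (cvec X) (tc f) +
  conjA (cvec X z) * Ub (tc f))).
 have -> : Ub (tc f) = tc chi * cjvec U (tc f) by rewrite -[LHS]/(anc Ub _) UbE.
 have -> : tangential loc sf (cvec X) (tc f) =
   tc chi * (cvec X (tc f) - cvec X z * U (tc f)).
  by rewrite -[LHS]/(anc (tangential loc sf _) _) tangentialE.
 rewrite cjvecE conjA_tc cvec_real.
 have -> : tc chi * (tc (X f) - cvec X z * U (tc f)) +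
   conjA (cvec X z) * (tc chi * conjA (U (tc f))) =
   tc chi * (tc (X f) - (cvec X z * U (tc f)) + conjA (cvec X z * U (tc f))).
  by rewrite conjAM; ring.
 by rewrite re_to_complexM reD conjA_re reD reN subrK re_tc.
exists chi, Z; split=> //; rewrite (nbhs1 (sf_chi1 sf)); exact: oner_neq0.
Qed.

(** The solutions for the various c are proportional by [adm_uniq], and some c is nonzero at each
    simple point, so [log_extend] divides them by c, applied to one function at a time. *)
Lemma adm_vect : exists Y : vect ID, adm 1 Y.
Proof.
pose J := {cZ : CR * vect ID | adm cZ.1 cZ.2}.
have H f : exists g : CC, forall k : J, tc (sval k).1 * g = (sval k).2 f.
 have [|||g gE] := @log_extend R n M J (fun k => tc (sval k).1) (fun k => (sval k).2 f) ID lI; last by exists g.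
 - move=> [[c Z] aZ] [[c' Z'] aZ'] /=.
  by have := adm_uniq aZ aZ' => /(congr1 (fun V : vect ID => V f)).
 - move=> x /adm_simple [c [Z [aZ cx]]].
  have cx' : ev (tc c : CC) x != 0 by rewrite evC cval_tc; apply: contraNneq cx => -[->].
  have [v vE] := n_inv nC cx'; exists (v * Z f) => -[[c' Z'] aZ'] /=.
  apply: filterS vE => y vy; have := adm_uniq aZ aZ' => /(congr1 (fun V : vect ID => cval (V f) y)).
  rewrite -[cval (vscale (tc c) Z' f) y]/(cval (tc c * Z' f) y) -[cval (vscale (tc c') Z f) y]/(cval (tc c' * Z f) y).
  rewrite !cvalM => E; rewrite mulrCA -E mulrA [cval v y * _]mulrC.
  by have -> : cval (tc c) y * cval v y = 1 by []; rewrite mul1r.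
 - move=> p W j F oW Wp [gF _ _]; have [e Ie eE] := gen_near nC gF Wp.
  have [Z aZ] := adm_ideal (rp_norm rp Ie).
  (* Here c = |e|^2 is a generator times its conjugate, whence the two exponents. *)
  exists (exist _ (re (e * conjA e), Z) aZ), 1%N, 1%N.
  apply: filterS eE => y; rewrite !evC => Ey; rewrite /= normE !expr1 !cvalM !cval_conj -Ey //.
have [Y0 Y0E] := choice H.
have uniq (a b : CC) : (forall k : J, tc (sval k).1 * a = tc (sval k).1 * b) -> a = b.
 move=> E; apply: (ideal_cancel lI (k := 1)) => e Ie; rewrite expr1.
 have [Z aZ] := adm_ideal (rp_norm rp Ie).
 have := E (exist _ (re (e * conjA e), Z) aZ); rewrite /= normE => E1.
 apply: cval_inj => y; have := congr1 (fun u : CC => cval u y) E1; rewrite !cvalM.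
 have [->|ey] := eqVneq (cval e y) 0; first by rewrite !mul0r.
 rewrite -!mulrA => /(mulfI ey); rewrite !(mulrC (cval (conjA e) y)) => /mulIf -> //.
 by rewrite conjA_eq0.
have YD f g : Y0 (f + g) = Y0 f + Y0 g.
 by apply: uniq => k; rewrite mulrDr !Y0E vectD.
have YM f g : Y0 (f * g) = Y0 f * g + f * Y0 g.
 apply: uniq => k; rewrite mulrDr [in RHS]mulrA Y0E [_ * (f * _)]mulrCA !Y0E vectM //.
have YZ a f : Y0 (Defs.scalar CC a * f) = Defs.scalar CC a * Y0 f.
 by apply: uniq => k; rewrite mulrCA !Y0E (vectZ (sval k).2).
have YI f : ID f -> ID (Y0 f).
 move=> If; apply: loc; apply: log_near_in => // x /adm_simple [c [Z [aZ cx]]].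
 have cx' : ev (tc c : CC) x != 0 by rewrite evC cval_tc; apply: contraNneq cx => -[->].
 have [v vE] := n_inv nC cx'; exists (v * Z f); first by apply: idealM; exact: vect_ideal.
 apply: filterS vE => y vy; have := congr1 (fun u : CC => cval u y) (Y0E f (exist _ (c, Z) aZ)).
 move=> E0; have E : cval (tc c) y * cval (Y0 f) y = cval (Z f) y := E0.
 rewrite !evC [RHS]cvalM -E mulrA [cval v y * _]mulrC.
 by have -> : cval (tc c) y * cval v y = 1 by []; rewrite mul1r.
pose Y : vect ID := @Vect _ _ CC ID Y0 YD YM YZ YI.
have YE c Z : adm c Z -> vscale (tc c) Y = Z.
 by move=> aZ; apply: vect_inj => f; exact: (Y0E f (exist _ (c, Z) aZ)).
exists Y; split=> [|W].
 apply: vect_inj => f; rewrite -[LHS]/(re (Y (tc f))) -[RHS]/(1 * X f) mul1r.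
 apply: (ideal_cancelR lI rp (k := 1)) => q Iq; rewrite expr1 -re_to_complexM.
 have [Z aZ] := adm_ideal Iq; have [Zr _] := aZ.
 have := congr1 (fun V : TR => V f) Zr; rewrite -(YE _ _ aZ) //.
apply: (ideal_cancelR lI rp (k := 1)) => q Iq; rewrite expr1.
have -> : q * re (s (v2 Y (lift W))) = re (s (v2 (vscale (tc q) Y) (lift W))).
 by rewrite form2Zl // re_to_complexM.
have [Z aZ] := adm_ideal Iq; rewrite (YE _ _ aZ); have [_ ->] := aZ.
by rewrite mul1r mulrN.
Qed.

(** With Y from [adm_vect], the one-form i (i_Y s + xi) is real on the elliptic algebroid, hence a
    smooth real form h by [real_ext]; then xi + i h equals -i_Y s and Y + xi + i h is the required
    section. *)
Lemma graph_exists : exists u, graph u /\ re_gsec u = (X, xi).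
Proof.
have [Y [Yr Ys]] := adm_vect.
pose a : kform ID 1 := fscale ii (ctr Y s + pull (cform xi)).
have fa : is_form a.
 apply: is_formZ; apply: is_formD; first exact: ctr_form.
 by apply: pull_form; exact: cform_form.
have ra : real_on rp a.
 move=> W; rewrite [W]v1_eta; set V := W ord0.
 rewrite -[a _]/(ii * (s (v2 Y (lift V)) + cform xi (v1 (anc (lift V))))).
 by rewrite imM_i reD Ys liftE -cv1 cform_real // re_tc mul1r addNr.
have [h fh hE] := real_ext lI loc fa ra.
pose zeta : kform (idealT CC) 1 := cform xi + fscale ii (cform h).
have fz : is_form zeta.
 by apply: is_formD; [exact: cform_form|apply: is_formZ; exact: cform_form].
exists (anc Y, zeta); split.
 split=> //; exists Y; split=> // W.
 have := congr1 (fun b : kform ID 1 => b (v1 W)) hE.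
 rewrite -[pull _ _]/(cform h (v1 (anc W))).
 rewrite -[a _]/(ii * (s (v2 Y W) + cform xi (v1 (anc W)))) => E.
 rewrite -[LHS]/(cform xi (v1 (anc W)) + ii * cform h (v1 (anc W))) E.
 have i2 := iiM M; ring: i2.
apply: gsec_eq => [|V]; first by rewrite -[LHS]/(re_vect (anc Y)) Yr; apply: vect_inj => f /=; rewrite mul1r.
rewrite re_gsecE -[X in re X]/(cform xi (v1 (cvec V)) + ii * cform h (v1 (cvec V))).
by rewrite -cv1 !cform_real // reD re_tc reM_i im_tc oppr0 addr0.
Qed.
End LogStructure.

Arguments expform {K X A I} s k _.

Section Spinor1.
Variables (R : realType) (n : nat) (M : manifold R n) (K : fieldType) (A : falg K M).

Lemma clifford1 (u : gsec A) (rho : forall k, kform (idealT A) k) Y :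
 clifford u rho 1 (v1 Y) = rho 2 (v2 u.1 Y) + u.2 (v1 Y) * scal_of (rho 0%N).
Proof.
rewrite /clifford kE; congr (_ + _).
rewrite /wedge1 big_ord_recl big_ord0 addr0 expr0 mul1r /scal_of; congr (_ * _).
by congr (rho 0%N); exact: v0_eta.
Qed.
Lemma pull_ctr (I : ideal A) k (a : kform (idealT A) k.+1) (Z : vect I) :
 pull (ctr (anc Z) a) = ctr Z (pull a).
Proof.
fext => V; rewrite /pull /ctr; congr (a _); fext => i.
by case: (unliftP ord0 i) => [j ->|->]; rewrite ?vconsE0 ?vconsES.
Qed.
End Spinor1.

(** * The anticanonical ideal of a graph structure *)

Section Anticanonical.
Variables (R : realType) (n : nat) (M : manifold R n).
Local Notation CR := (CR M).
Local Notation CC := (CC M).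
Local Notation TC := (vect (idealT CC)).
Local Notation tc := (@toCx R n M : CR -> CC).
Implicit Types (e f z : CC) (x : M) (Y U : TC) (q c : CR).
Let nC := nice_CC M.
Variables (ID : ideal CC) (I : ideal CR).
Hypotheses (lI : locally_log ID) (loc : loc_ideal ID) (rp : real_part ID I).
Variables (s : kform ID 2) (w : kform I 2).
Hypotheses (fs : is_form s) (fw : is_form w) (nw : Defs.nondegenerate w).
Local Notation lift := (liftv rp).
Hypothesis ws : forall A B : vect I, w (v2 A B) = im (s (v2 (lift A) (lift B))).

Section Residue.
Variables (x : M) (z : CC) (N : set M) (U : TC) (chi : CR).
Hypothesis sf : simple_frame ID x z N U chi.

Lemma frame_dense y : N y -> dense_near y z.
Proof. by move=> Ny; exact: (gen_dense_near lI (sf_open sf) (sf_gen sf) Ny). Qed.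
(** r is the residue V z / z of the log field V, cut off by chi. *)
Definition is_residue (V : vect ID) (r : CC) :=
 tc chi * V z = r * z /\ off_supp chi r.
Lemma residue_uniq V r r' : is_residue V r -> is_residue V r' -> r = r'.
Proof.
move=> [E r0] [E' r0']; apply: (quot_uniq lI (sf_open sf) (sf_gen sf) (sf_chi0 sf)) => //.
by rewrite -E -E'.
Qed.
Lemma residue_exists V : exists r, is_residue V r.
Proof.
exact: (quot_exists lI (sf_open sf) (sf_gen sf) (sf_chi0 sf) (vect_ideal V (sf_mem sf))).
Qed.
(** Nondegeneracy gives Y with w(Y, .) equal to the real part of the residue. On the real field chi
    z U plus its conjugate, whose residue at x is 1, this forces Im s(Y, z U) = 1 at x. *)
Lemma pole_pairing : exists W : vect ID, cval (s (v2 (idealS (sf_mem sf) U) W)) x != 0.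
Proof.
have [r rE] := choice residue_exists.
have rD V W : r (V + W) = r V + r W.
 apply: residue_uniq (rE _) _; have [E1 N1] := rE V; have [E2 N2] := rE W; split=> [|y nN].
  by rewrite -[(V + W) z]/(V z + W z) mulrDr E1 E2 mulrDl.
 by rewrite cvalD N1 ?N2 ?addr0.
have rZ f V : r (vscale f V) = f * r V.
 apply: residue_uniq (rE _) _; have [E1 N1] := rE V; split=> [|y nN].
  by rewrite -[vscale f V z]/(f * V z) mulrCA E1 mulrA.
 by rewrite cvalM N1 ?mulr0.
pose xi : kform I 1 := fun V => re (r (lift (V ord0))).
have fxi : is_form xi.
 apply: form1_intro => [A B|f A]; rewrite /xi /v1; first by rewrite lift_vectD rD reD.
 by rewrite lift_vectZ rZ re_to_complexM.
have [Y [Yw _]] := nw fxi.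
have [Ub UbE] : exists Ub : vect ID, anc Ub = vscale (tc chi) (cjvec U).
 apply: (killer_vect loc sf) => y Ny.
 by rewrite cjvecE cval_conj (sf_U0 sf Ny) conjc0.
pose zU := idealS (sf_mem sf) U.
pose P := vscale (tc chi) zU + vscale (conjA z : CC) Ub.
have zUE f : zU f = z * U f by rewrite -[LHS]/(anc zU f) idealSE.
have UbE' f : Ub f = tc chi * cjvec U f by rewrite -[LHS]/(anc Ub f) UbE.
have PE : anc P = cvec (re_vect (anc P)).
 apply: cvect_inj => q; rewrite cvec_real.
 suff E : conjA (P (tc q)) = P (tc q).
  apply: re_im_inj; first by rewrite re_tc.
  have := congr1 (@im R n M) E; rewrite conjA_im im_tc => E1; apply: rval_inj => y.
  have := congr1 (fun u : CR => rval u y) E1; rewrite rvalN rval0 => E2.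
  have -> : im (anc P (tc q)) = im (P (tc q)) by [].
  lra.
 rewrite -[P _]/(tc chi * zU (tc q) + conjA z * Ub (tc q)) zUE UbE' cjvecE conjA_tc.
 by rewrite conjAD !conjAM !conjAK !conjA_tc; ring.
have [A [_ AP]] := unlift rp PE.
have := congr1 (fun a : kform I 1 => rval (a (v1 A)) x) Yw.
rewrite -[ctr Y w _]/(w (v2 Y A)) ws AP /xi /v1 AP.
have -> : rval (re (r P)) x = 1.
 rewrite rval_re; suff -> : cval (r P) x = 1 by [].
 have [E _] := rE P.
 have [N' [oN' N'x N'E]] := nnopen (filterI (sf_chi1 sf) (nopen (sf_open sf) (sf_N sf))).
 rewrite -[RHS](@cval1 R n M x); apply: (@dcancel _ _ M N' z _ _ oN') N'x => [y /N'E[_]|y /N'E[c1 Ny]].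
  exact: frame_dense.
 rewrite -!cvalM mulr1 mulrC -E -[P z]/(tc chi * zU z + conjA z * Ub z) zUE UbE' cjvecE.
 rewrite !cvE c1 (sf_U1 sf Ny) (sf_U0 sf Ny) conjc0; ring.
rewrite form2Dr // !form2Zr // rval_im cvalD cvalM [cval (conjA z * _) x]cvalM.
rewrite cval_conj (sf_z0 sf) conjc0 mul0r addr0 cval_tc (nbhs1 (sf_chi1 sf)) mul1r => E.
exists (lift Y); rewrite (form2_skew _ _ fs) cvalN oppr_eq0.
by apply: contra_eqN E => /eqP ->; rewrite /= eq_sym oner_eq0.
Qed.
End Residue.

Variable g : gstructure M.
Hypothesis rep : forall u, eigsec g u <-> graph s u.

Lemma can_ratio rho : canonical_section g rho -> forall V W : vect ID,
 scal_of (rho 0%N) * s (v2 V W) = rho 2%N (v2 (anc V) (anc W)).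
Proof.
move=> [fr cr] V W; apply: (ideal_cancel lI (k := 2)) => e Ie.
(* A smooth one-form restricting to -e^2 i_V s on log fields: it exists because e times any field is
   log. *)
pose a : kform (idealT CC) 1 := fun Y : 'I_1 -> TC => - (e * s (v2 V (idealS Ie (Y ord0)))).
have SD Y Z : idealS Ie (Y + Z) = idealS Ie Y + idealS Ie Z.
 apply: anchor_inj; rewrite idealSE; apply: vect_inj => f.
 have E1 := congr1 (fun V : TC => V f) (idealSE Ie Y).
 have E2 := congr1 (fun V : TC => V f) (idealSE Ie Z).
 rewrite -[RHS]/(anc (idealS Ie Y) f + anc (idealS Ie Z) f) E1 E2.
 by rewrite -[LHS]/(e * (Y f + Z f)) mulrDr.
have SZ f Y : idealS Ie (vscale f Y) = vscale f (idealS Ie Y).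
 apply: anchor_inj; rewrite idealSE; apply: vect_inj => k.
 have E1 := congr1 (fun V : TC => V k) (idealSE Ie Y).
 by rewrite -[RHS]/(f * anc (idealS Ie Y) k) E1 /= mulrCA.
have SA (Y : vect ID) : idealS Ie (anc Y) = vscale e Y.
 by apply: anchor_inj; rewrite idealSE; exact: vect_inj.
have fa : is_form a.
 apply: form1_intro => [Y Z|f Y]; rewrite /a /v1; first by rewrite SD form2Dr // mulrDr opprD.
 by rewrite SZ form2Zr //; ring.
pose u : gsec CC := (anc (vscale (e ^+ 2) V), a).
have gu : graph s u.
 split=> //; exists (vscale (e ^+ 2) V); split=> // Z.
 rewrite -[LHS]/(- (e * s (v2 V (idealS Ie (anc Z))))) SA form2Zr // form2Zl //.
 by rewrite mulrA -expr2.
have /(congr1 (fun b : kform (idealT CC) 1 => b (v1 (anc W)))) := cr u ((rep u).2 gu) 1%N.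
rewrite clifford1 -[u.2 _]/(- (e * s (v2 V (idealS Ie (anc W))))) SA kE form2Zr //.
have -> : u.1 = vscale (e ^+ 2) (anc V) by exact: vect_inj.
rewrite form2Zl // => /eqP; rewrite addr_eq0 => /eqP ->; ring.
Qed.

(** Near a smooth point rho_0 s(z U, W) = z rho_2(U, W), and s(z U, W) is a unit for a suitable W by
    [pole_pairing], so z divides rho_0. *)
Lemma antican_sub f : anti_ideal g f -> ID f.
Proof.
move=> [rho cr ->]; have [fr _] := cr; set f0 := scal_of _.
apply: loc; apply: log_near_in => // x /simple_frameP[[e Ie ex]|[z [N [U [chi sf]]]]].
 exact (near_in_unit nC _ Ie ex).
have [W Wx] := pole_pairing sf; have [v vE] := n_inv nC Wx.
exists (v * rho 2%N (v2 U (anc W)) * z); first by apply: idealM; exact: sf_mem sf.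
have E := can_ratio cr (idealS (sf_mem sf) U) W.
rewrite idealSE form2Zl // in E.
apply: filterS vE => y vy; have := congr1 (fun k : CC => ev k y) E.
rewrite !(nM nC) -/f0 => E1.
by rewrite -[LHS]mulr1 -vy mulrA E1; ring.
Qed.

(** The spinor is f exp(s). Its components are smooth by [extend_form], since f supplies the factor
    z that kills residues, and the graph annihilates it because i_Z exp(s) = i_Z s /\ exp(s). *)
Lemma antican_sup f : ID f -> anti_ideal g f.
Proof.
move=> If.
have H k : exists b : kform (idealT CC) k, is_form b /\ pull b = fscale f (expform s k) :> kform ID k.
 case: k => [|[|k]].
 - by exists (fun=> f); split; [exact: form0_is_form|fext => V; rewrite /fscale mulr1].
 - exists 0; split; first exact: is_form0.
  by fext => V; rewrite /fscale [RHS]mulr0.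
 - have fe : is_form (expform s k.+2) by exact: expform_form.
  have [|b fb bE] := extend_form lI loc (is_formZ f fe); last by exists b.
  move=> x z N U chi sf W; have [k' k'E] := (sf_gen sf (sf_N sf) f).1 (nin_mem x If).
  exists (k' * expform s k.+2 (vcons (idealS (sf_mem sf) U) W)).
  apply: filterS k'E => y; rewrite !evC => E; rewrite /fscale !cvalM E; ring.
pose rho k := projT1 (cid (H k)).
have rhoP k : is_form (rho k) /\ pull (rho k) = fscale f (expform s k) by rewrite /rho; case: cid.
have rho0 : scal_of (rho 0%N) = f.
 have [_ /(congr1 (fun a : kform ID 0 => a (fun=> 0)))] := rhoP 0%N.
 rewrite /fscale /= mulr1 => <-; rewrite /scal_of /pull; congr (rho 0%N _); exact: v0_eta.
exists rho; rewrite ?rho0 //; split=> [k|u /rep [gu [Z [Zu Zs]]] k]; first by have [] := rhoP k.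
have fr k' : is_form (rho k') by have [] := rhoP k'.
have pr k' : pull (rho k') = fscale f (expform s k') by have [] := rhoP k'.
have pu : pull u.2 = - ctr Z s by apply: form1_ext => W; rewrite kE; exact: Zs.
have pw m (a : kform (idealT CC) 1) (b : kform (idealT CC) m) :
  pull (wedge1 a b) = wedge1 (pull a) (pull b) :> kform ID m.+1 by [].
have cZ m (a : kform ID m.+1) : ctr Z (fscale f a) = fscale f (ctr Z a) by [].
case: k => [|k].
 rewrite /clifford addr0; apply: (pull_inj lI) => //.
 - exact: ctr_form.
 - exact: is_form0.
 by rewrite -Zu pull_ctr pr; fext => V; exact: mulr0.
apply: (pull_inj lI).
- by apply: is_formD; [exact: ctr_form|exact: wedge1_form].
- exact: is_form0.
rewrite -[pull _]/(pull (ctr u.1 (rho k.+2)) + pull (wedge1 u.2 (rho k))) -Zu.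
rewrite pull_ctr pw !pr pu cZ ctr_expform wedge1Nl wedge1Z subrr.
by fext => V.
Qed.

Lemma graph_is_ratio : is_ratio g s.
Proof.
move=> W rho oW cr _ V x Wx; rewrite [V]v2_eta; set A := V _; set B := V _.
rewrite mulrC (can_ratio cr A B); congr (ev (rho 2%N _) x).
by rewrite [RHS]v2_eta; congr v2; rewrite /v2 ?vconsES ?vconsE0.
Qed.
End Anticanonical.

(** * From stable structures to log symplectic forms *)

Section GraphStructure.
Variables (R : realType) (n : nat) (M : manifold R n).
Local Notation CR := (CR M).
Local Notation CC := (CC M).
Local Notation tc := (@toCx R n M : CR -> CC).
Local Notation ii := (ccst M 'i : CC).
Variables (ID : ideal CC) (I : ideal CR).
Hypotheses (lI : locally_log ID) (loc : loc_ideal ID) (rp : real_part ID I).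
Variables (s : kform ID 2) (w : kform I 2).
Hypotheses (fs : is_form s) (fw : is_form w) (nw : Defs.nondegenerate w).
Local Notation lift := (liftv rp).
Hypothesis ws : forall A B : vect I, w (v2 A B) = im (s (v2 (lift A) (lift B))).
Variable h : kform (idealT CR) 3.
Hypotheses (fh : is_form h) (dsh : dif s = pull (cform h)).

Lemma gscaleN1 (K : fieldType) (A : falg K M) (u : gsec A) : gscale (-1) u = - u.
Proof.
by apply: gsec_eq => [|Y]; [apply: vect_inj => f; exact: mulN1r|exact: mulN1r].
Qed.
Lemma graph_eq u v : graph s u -> graph s v -> re_gsec u = re_gsec v -> u = v.
Proof.
move=> gu gv E; apply/eqP; rewrite -subr_eq0; apply/eqP.
apply: (graph_uniq lI fs fw nw ws); first by rewrite -gscaleN1; apply: graphD => //; exact: graphZ.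
by rewrite re_gsecD E re_gsecN subrr.
Qed.
Lemma form_closed : is_closed h.
Proof.
have E : cform (dif h) = 0.
 apply: (pull_inj lI).
 - exact/cform_form/dif_form.
 - exact: is_form0.
 - rewrite -cform_dif // -pull_dif -dsh dif_sqr //.
fext => V; apply: tc_inj; rewrite -cform_real; last exact: dif_form.
by rewrite E !kE to_complex0.
Qed.
(** J sends the real part of a graph section to minus its imaginary part. Linearity and J^2 = -1
    come from the uniqueness of the graph section with given real part, orthogonality from the
    isotropy of the graph. *)
Lemma graph_gstructure : exists g, generalized_complex g /\ forall u, eigsec g u <-> graph s u.
Proof.
have /choice [l lE] : forall a : gsec CR, exists u, is_gsec a -> graph s u /\ re_gsec u = a.
 move=> [X xi]; have [ga|na] := pselect (is_gsec ((X, xi) : gsec CR)); last by exists 0.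
 by have [u ue] := graph_exists lI loc fs fw nw ws X ga; exists u.
have lg a : is_gsec a -> graph s (l a) by move=> /lE[].
have lr a : is_gsec a -> re_gsec (l a) = a by move=> /lE[].
have gsg u : graph s u -> is_gsec u by case.
have lU u : graph s u -> l (re_gsec u) = u.
 move=> gu; have gr := re_gsec_form (gsg _ gu).
 by apply: graph_eq => //; [exact: lg|exact: lr].
have fN : is_form (- h) by exact: is_formN.
pose g := @GStructure R n M (fun a => - im_gsec (l a)) (- h).
have eig u : eigsec g u <-> graph s u.
 split=> [[gu E1 E2]|gu].
  have gr := re_gsec_form gu; suff -> : u = l (re_gsec u) by exact: lg.
  apply: gsec_re_im => //; first exact: gsg (lg _ gr).
   by rewrite lr.
  by apply: oppr_inj; rewrite -E1.
 split=> /=; first exact: gsg.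
  by rewrite lU.
 have -> : im_gsec u = re_gsec (gscale (- ii) u).
  have -> : gscale (- ii) u = - gscale ii u.
   by apply: gsec_eq => [|Y]; [apply: vect_inj => f; exact: mulNr|exact: mulNr].
  by rewrite re_gsecN re_gsec_i opprK.
 rewrite lU; last exact: graphZ.
 have -> : gscale (- ii) u = gscale ii (gscale (- 1) u).
  by apply: gsec_eq => [|Y]; [apply: vect_inj => f|]; rewrite /= /fscale; ring.
 by rewrite im_gsec_i gscaleN1 re_gsecN opprK.
have il a : is_gsec a -> l (- im_gsec (l a)) = gscale ii (l a).
 move=> ga; rewrite -re_gsec_i lU //; apply: graphZ => //; exact: lg.
exists g; split=> //; split=> /=.
- by split=> //; rewrite /is_closed difN (form_closed : dif h = 0) oppr0.
- split=> [a ga|a b ga gb|f a ga].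
 + by apply: is_gsecN; apply: im_gsec_form; exact: gsg (lg _ ga).
 + have -> : l (a + b) = l a + l b.
   apply: graph_eq; [exact/lg/is_gsecD|by apply: graphD => //; exact: lg|].
   by rewrite re_gsecD !lr //; exact: is_gsecD.
  by rewrite im_gsecD opprD.
 + have -> : l (gscale (f : CR) a) = gscale (tc f) (l a).
   apply: graph_eq; [exact/lg/is_gsecZ|by apply: graphZ => //; exact: lg|].
   by rewrite re_gsec_tc !lr //; exact: is_gsecZ.
  rewrite im_gsec_tc; apply: gsec_eq => [|Y].
   by apply: vect_inj => k; rewrite /= mulrN.
  by rewrite -[LHS]/(- (f * (im_gsec (l a)).2 (v1 Y))) -mulrN.
- move=> a b ga gb; have := graph_isotropic fs (lg _ ga) (lg _ gb).
 move=> /(congr1 (@re R n M)); rewrite re0 !pairingE.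
 have fa := gsg _ (lg _ ga); have fb := gsg _ (lg _ gb).
 rewrite !(form1_split _.1) // !reD !reM_i -!re_gsecE -!im_gsecE !lr //.
 have -> : re_vect (l a).1 = a.1 by rewrite -[LHS]/((re_gsec (l a)).1) lr.
 have -> : re_vect (l b).1 = b.1 by rewrite -[LHS]/((re_gsec (l b)).1) lr.
 move=> E; rewrite -[(- im_gsec (l a)).1]/(- im_vect (l a).1) -[(- im_gsec (l b)).1]/(- im_vect (l b).1).
 rewrite !form1N; try by apply: is_formN; exact: im_gsec_form.
 rewrite -[(- im_gsec (l a)).2 _]/(- (im_gsec (l a)).2 _) -[(- im_gsec (l b)).2 _]/(- (im_gsec (l b)).2 _).
 by rewrite !opprK; apply/eqP; rewrite -subr_eq0 -oppr_eq0 -E; apply/eqP; ring.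
- move=> a ga; rewrite il // im_gsec_i lr //.
- by move=> u v /eig gu /eig gv; apply/eig; exact: (graph_courant fs fh dsh).
Qed.
End GraphStructure.

(** * Eigensections and canonical sections *)

Section StableStructure.
Variables (R : realType) (n : nat) (M : manifold R n).
Local Notation CR := (CR M).
Local Notation CC := (CC M).
Local Notation TR := (vect (idealT CR)).
Local Notation TC := (vect (idealT CC)).
Local Notation ii := (ccst M 'i : CC).
Implicit Types (e f : CC) (x : M) (V W Y : TC) (u v : gsec CC) (a b : gsec CR).
Variable g : gstructure M.
Hypothesis gc : generalized_complex g.
Local Notation J := (gs_J g).
Local Notation H := (cform (gs_H g)).

Let fH : is_form (gs_H g). Proof. by case: gc => [[]]. Qed.
Let fHC : is_form H. Proof. exact: cform_form. Qed.
Let Jf a : is_gsec a -> is_gsec (J a). Proof. by case: gc => _ [+ _ _] _ _ _; apply. Qed.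
Let JZ (f : CR) (a : gsec CR) : is_gsec a -> J (gscale f a) = gscale f (J a).
Proof. by case: gc => _ [_ _ +] _ _ _; apply. Qed.
Let Jp a b : is_gsec a -> is_gsec b -> pairing (J a) (J b) = pairing a b.
Proof. by case: gc => _ _ + _ _; apply. Qed.
Let JJ a : is_gsec a -> J (J a) = - a. Proof. by case: gc => _ _ _ + _; apply. Qed.
Let Jc u v : eigsec g u -> eigsec g v -> eigsec g (courant H u v).
Proof. by case: gc => _ _ _ _; apply. Qed.
Definition toC a : gsec CC := (cvec a.1, cform a.2).
Lemma toC_form a : is_gsec a -> is_gsec (toC a). Proof. exact: cform_form. Qed.
Lemma re_toC a : is_gsec a -> re_gsec (toC a) = a.
Proof.
move=> ga; apply: gsec_eq => [|Y]; first exact: re_cvec.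
by rewrite re_gsecE -[X in re X]/(cform a.2 (fun i => cvec (v1 Y i))) cform_real // re_tc.
Qed.
Lemma im_toC a : is_gsec a -> im_gsec (toC a) = 0.
Proof.
move=> ga; apply: gsec_eq => [|Y]; first exact: im_cvec.
by rewrite im_gsecE -[X in im X]/(cform a.2 (fun i => cvec (v1 Y i))) cform_real // im_tc.
Qed.
(** a - i J a, the eigensection with real part a. *)
Definition lam a : gsec CC := toC a + gscale ii (toC (- J a)).
Lemma lam_re a : is_gsec a -> re_gsec (lam a) = a.
Proof.
move=> ga; have gJ := is_gsecN (Jf ga).
by rewrite re_gsecD re_toC // re_gsec_i im_toC // oppr0 addr0.
Qed.
Lemma lam_im a : is_gsec a -> im_gsec (lam a) = - J a.
Proof.
move=> ga; have gJ := is_gsecN (Jf ga).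
by rewrite im_gsecD im_toC // im_gsec_i re_toC // add0r.
Qed.
Lemma JN a : is_gsec a -> J (- a) = - J a.
Proof. by move=> ga; rewrite -!gscaleN1 JZ. Qed.
Lemma lam_eigen a : is_gsec a -> eigsec g (lam a).
Proof.
move=> ga; have gJ := is_gsecN (Jf ga); split.
- by apply: is_gsecD; [exact: toC_form|apply: is_gsecZ; exact: toC_form].
- by rewrite lam_re // lam_im // opprK.
- by rewrite lam_re // lam_im // JN ?JJ ?opprK //; exact: Jf.
Qed.
Lemma eigen_form u : eigsec g u -> is_gsec u. Proof. by case. Qed.
Lemma eigen_lam u : eigsec g u -> u = lam (re_gsec u).
Proof.
move=> [gu E1 E2]; have gr := re_gsec_form gu.
apply: gsec_re_im => //; first exact: eigen_form (lam_eigen gr).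
 by rewrite lam_re.
by rewrite lam_im // E1 opprK.
Qed.
Lemma re_pairing u v : is_gsec u -> is_gsec v ->
 re (pairing u v) = pairing (re_gsec u) (re_gsec v) - pairing (im_gsec u) (im_gsec v).
Proof.
move=> gu gv; rewrite !pairingE (form1_split u.1) // (form1_split v.1) // !reD !reM_i.
rewrite -!re_gsecE -!im_gsecE /=; ring.
Qed.
Lemma im_pairing u v : is_gsec u -> is_gsec v ->
 im (pairing u v) = pairing (re_gsec u) (im_gsec v) + pairing (im_gsec u) (re_gsec v).
Proof.
move=> gu gv; rewrite !pairingE (form1_split u.1) // (form1_split v.1) // !imD !imM_i.
rewrite -!re_gsecE -!im_gsecE /=; ring.
Qed.
Lemma pairingDl (K : fieldType) (A : falg K M) (u v t : gsec A) : is_gsec t ->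
 pairing (u + v) t = pairing u t + pairing v t.
Proof.
move=> gt; rewrite !pairingE form1D // -[(u + v).2 _]/(u.2 _ + v.2 _) addrACA //.
Qed.
Lemma pairingNl (K : fieldType) (A : falg K M) (u t : gsec A) : is_gsec t ->
 pairing (- u) t = - pairing u t.
Proof.
by move=> gt; rewrite !pairingE form1N // -[(- u).2 _]/(- u.2 _) opprD.
Qed.
Lemma pairingC (K : fieldType) (A : falg K M) (u v : gsec A) : pairing u v = pairing v u.
Proof. by rewrite !pairingE addrC. Qed.
Lemma pairingJ a b : is_gsec a -> is_gsec b -> pairing (J a) b = - pairing a (J b).
Proof.
move=> ga gb; rewrite -(Jp (Jf ga) gb) JJ // pairingNl //; exact: Jf.
Qed.
Lemma eigen_isotropic u v : eigsec g u -> eigsec g v -> pairing u v = 0.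
Proof.
move=> eu ev; rewrite (eigen_lam eu) (eigen_lam ev).
have ga := re_gsec_form (eigen_form eu); have gb := re_gsec_form (eigen_form ev).
set a := re_gsec u in ga *; set b := re_gsec v in gb *.
have fa := eigen_form (lam_eigen ga); have fb := eigen_form (lam_eigen gb).
move: (lam a) (lam b) fa fb (lam_re ga) (lam_im ga) (lam_re gb) (lam_im gb) => U V fU fV aR aI bR bI.
apply: re_im_inj; rewrite ?re_pairing ?im_pairing // aR aI bR bI.
 rewrite re0 (pairingNl _ (is_gsecN (Jf gb))) [pairing (J a) _]pairingC (pairingNl _ (Jf ga)).
 by rewrite [pairing (J b) _]pairingC opprK Jp ?subrr.
by rewrite im0 [pairing a _]pairingC !pairingNl // pairingJ // opprK [pairing b _]pairingC subrr.
Qed.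

Lemma pairing_ndeg (a : gsec CR) : is_gsec a ->
 (forall b, is_gsec b -> pairing a b = 0) -> a = 0.
Proof.
move=> ga E; apply: gsec_eq => [|Y].
 apply: vect_inj => f; have := E (0, @dfun _ _ _ (idealT CR) f) (@dfun_form _ _ _ _ f).
 rewrite pairingE /= -[X in _ + X]/(a.2 (v1 0)) -[dfun f _]/(a.1 f).
 have -> : a.2 (v1 0) = 0.
  have -> : v1 (0 : TR) = upd (v1 0) ord0 0 :> ('I_1 -> _).
   by fext => i; rewrite /upd; case: ifP.
  exact: form0.
 by rewrite addr0.
by have := E (Y, 0) (is_form0 _ _); rewrite pairingE /= kE add0r.
Qed.

(** For u = a + i b, the real part of the pairing with x - i J x is the pairing of a - J b with x;
    nondegeneracy of the pairing gives a = J b. *)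
Lemma maximal_isotropic u : is_gsec u ->
 (forall v, eigsec g v -> pairing u v = 0) -> eigsec g u.
Proof.
move=> gu E; have ga := re_gsec_form gu; have gb := im_gsec_form gu.
set a := re_gsec u in ga *; set b := im_gsec u in gb *.
have ab : a = J b.
 apply/eqP; rewrite -subr_eq0; apply/eqP; apply: pairing_ndeg => [|x gx].
  by apply: is_gsecD => //; apply: is_gsecN; exact: Jf.
 have := congr1 (@re R n M) (E _ (lam_eigen gx)).
 rewrite re0 re_pairing //; last exact: eigen_form (lam_eigen gx).
 rewrite lam_re // lam_im // -/a -/b pairingDl // pairingNl // pairingJ // opprK.
 rewrite [pairing b (- _)]pairingC pairingNl // [pairing (J x) b]pairingC opprK //.
by split; rewrite // -/a -/b ab ?JJ.
Qed.

Section Canonical.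
Variable rho : forall k, kform (idealT CC) k.
Arguments rho k _ : clear implicits.
Hypothesis cr : canonical_section g rho.
Local Notation f := (scal_of (rho 0%N)).

Let fr k : is_form (rho k). Proof. by case: cr => + _; apply. Qed.
Lemma can1 u W : eigsec g u -> f * u.2 (v1 W) = - rho 2 (v2 u.1 W).
Proof.
case: cr => _ cu eu; have := congr1 (fun c : kform (idealT CC) 1 => c (v1 W)) (cu u eu 1%N).
by rewrite clifford1 kE addrC => /eqP; rewrite addr_eq0 mulrC => /eqP.
Qed.
(** Its pairing with an eigensection v is the degree one part of v . rho = 0, so maximal isotropy
    applies. Where rho_0 is nonzero these sections describe the whole eigenbundle. *)
Lemma spinor_eigen V : eigsec g (vscale f V, - ctr V (rho 2%N)).
Proof.
have fc : is_form (- ctr V (rho 2%N)) by apply: is_formN; exact: ctr_form.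
apply: maximal_isotropic => // v ev; rewrite pairingE /= form1Z; last exact: eigen_form.
rewrite can1 // -[(- ctr V _) _]/(- rho 2%N (v2 V v.1)) (form2_skew V) // opprK.
by rewrite addNr.
Qed.
(** Integrability with denominators cleared: the identity f d rho_2 + f^2 H = df /\ rho_2, that is
    d(rho_2 / rho_0) = -H. It results from expanding the Courant bracket of two sections of
    [spinor_eigen]; the outer f^3 comes from replacing V_i by f V_i. *)
Lemma star V1 V2 V3 : f ^+ 3 * (f * dif (rho 2) (v3 V1 V2 V3) + f ^+ 2 * H (v3 V1 V2 V3) -
 (V1 f * rho 2 (v2 V2 V3) - V2 f * rho 2 (v2 V1 V3) + V3 f * rho 2 (v2 V1 V2))) = 0.
Proof.
pose X1 := vscale f V1; pose X2 := vscale f V2; pose X3 := vscale f V3.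
have e1 := spinor_eigen V1; have e2 := spinor_eigen V2; have e3 := spinor_eigen V3.
set u1 := (_, _) in e1; set u2 := (_, _) in e2.
have P1 W : f * u1.2 (v1 W) = - rho 2 (v2 X1 W) by exact: (can1 W e1).
have P2 W : f * u2.2 (v1 W) = - rho 2 (v2 X2 W) by exact: (can1 W e2).
have P12 := can1 X3 (Jc e1 e2).
have g1 := eigen_form e1; have g2 := eigen_form e2.
rewrite courant_form // in P12.
have lieE : lie u1.1 u2.2 (v1 X3) = X1 (u2.2 (v1 X3)) - u2.2 (v1 (bracket X1 X3)).
 rewrite /lie big_ord_recl big_ord0 addr0; congr (_ - u2.2 _).
 by fext => i; rewrite (ord1 i) /upd eqxx.
have E12 : (lie u1.1 u2.2 - ctr u2.1 (nabla_form H u1)) (v1 X3) =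
  lie u1.1 u2.2 (v1 X3) - (dif u1.2 (v2 X2 X3) + H (v3 X1 X2 X3)) by [].
rewrite E12 lieE koszul1 // -[(courant _ _ _).1]/(bracket X1 X2) in P12.
have kos := koszul2 X1 X2 X3 (fr 2).
rewrite (form2_skew (bracket X1 X3) X2) // (form2_skew (bracket X2 X3) X1) // in kos.
have D1 (W : CC) : X1 (f * W) = X1 f * W + f * X1 W by rewrite vectM.
have D2 (W : CC) : X2 (f * W) = X2 f * W + f * X2 W by rewrite vectM.
have D3 (W : CC) : X3 (f * W) = X3 f * W + f * X3 W by rewrite vectM.
have Q23 : rho 2 (v2 X2 X3) = - (f * u2.2 (v1 X3)) by rewrite P2 opprK.
have Q13 : rho 2 (v2 X1 X3) = - (f * u1.2 (v1 X3)) by rewrite P1 opprK.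
have Q12 : rho 2 (v2 X1 X2) = - (f * u1.2 (v1 X2)) by rewrite P1 opprK.
have Qb2 : rho 2 (v2 X2 (bracket X1 X3)) = - (f * u2.2 (v1 (bracket X1 X3))) by rewrite P2 opprK.
have Qb1 : rho 2 (v2 X1 (bracket X2 X3)) = - (f * u1.2 (v1 (bracket X2 X3))) by rewrite P1 opprK.
have Qb : rho 2 (v2 (bracket X1 X2) X3) = - (f * (X1 (u2.2 (v1 X3)) - u2.2 (v1 (bracket X1 X3)) -
  (X2 (u1.2 (v1 X3)) - X3 (u1.2 (v1 X2)) - u1.2 (v1 (bracket X2 X3)) + H (v3 X1 X2 X3)))).
 by rewrite P12 opprK.
rewrite Q23 Q13 Q12 Qb Qb1 Qb2 (vectN X1 (f * _)) (vectN X2 (f * _)) (vectN X3 (f * _)) D1 D2 D3 in kos.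
have S3 (c : kform (idealT CC) 3) : is_form c -> c (v3 X1 X2 X3) = f ^+ 3 * c (v3 V1 V2 V3).
 move=> fc; have := form_scale_all f (v3 V1 V2 V3) fc => <-; congr c.
 by rewrite [RHS]v3_eta /v3 /v2 !(vconsE0, vconsES).
have fd : is_form (dif (rho 2)) by exact: dif_form.
have S1 : f ^+ 3 * (V1 f * rho 2 (v2 V2 V3)) = X1 f * rho 2 (v2 X2 X3).
 by rewrite /X2 /X3 form2Zl // form2Zr // /X1 /=; ring.
have S2 : f ^+ 3 * (V2 f * rho 2 (v2 V1 V3)) = X2 f * rho 2 (v2 X1 X3).
 by rewrite /X1 /X3 form2Zl // form2Zr // /X2 /=; ring.
have S2' : f ^+ 3 * (V3 f * rho 2 (v2 V1 V2)) = X3 f * rho 2 (v2 X1 X2).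
 by rewrite /X1 /X2 form2Zl // form2Zr // /X3 /=; ring.
have -> (a b c d t : CC) : f ^+ 3 * (f * a + f ^+ 2 * b - (c - d + t)) =
  f * (f ^+ 3 * a) + f ^+ 2 * (f ^+ 3 * b) - (f ^+ 3 * c - f ^+ 3 * d + f ^+ 3 * t) by ring.
rewrite -!S3 // S1 S2 S2' kos Q23 Q13 Q12.
by ring.
Qed.
End Canonical.

Lemma clifford_add u (rho rho' : forall k, kform (idealT CC) k) k :
 clifford u (fun k => rho k + rho' k) k = clifford u rho k + clifford u rho' k.
Proof.
case: k => [|k]; first by rewrite /clifford !addr0.
by rewrite /clifford wedge1D addrACA.
Qed.
Lemma clifford_scale u f (rho : forall k, kform (idealT CC) k) k :
 clifford u (fun k => fscale f (rho k)) k = fscale f (clifford u rho k).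
Proof.
case: k => [|k]; first by rewrite /clifford !addr0.
by rewrite /clifford wedge1Z fscaleDr.
Qed.
Lemma anti0 : anti_ideal g 0.
Proof.
exists (fun k => 0) => //; split=> [k|u eu k]; first exact: is_form0.
by case: k => [|k]; rewrite /clifford ?wedge1_0 addr0.
Qed.
Lemma antiD f f' : anti_ideal g f -> anti_ideal g f' -> anti_ideal g (f + f').
Proof.
move=> [rho [fr cr] ->] [rho' [fr' cr'] ->]; exists (fun k => rho k + rho' k) => //.
split=> [k|u eu k]; first exact: is_formD.
by rewrite clifford_add cr // cr' // addr0.
Qed.
Lemma antiM f f' : anti_ideal g f' -> anti_ideal g (f * f').
Proof.
move=> [rho [fr cr] ->]; exists (fun k => fscale f (rho k)) => //.
split=> [k|u eu k]; first exact: is_formZ.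
by rewrite clifford_scale cr //; fext => V; rewrite /fscale kE mulr0.
Qed.
Definition anti : ideal CC := @Ideal _ _ CC (anti_ideal g) anti0 antiD antiM.
(** [nabla] maps canonical sections to canonical sections, and its degree zero part is twice the
    derivative of rho_0 along the vector part of u. *)
Lemma eigen_preserves u f : eigsec g u -> anti f -> anti (u.1 f).
Proof.
move=> eu [rho [fr cr] ->]; set f0 := scal_of _.
have -> : u.1 f0 = ccst M 2^-1 * (u.1 f0 + u.1 f0).
 apply: cval_inj => x; rewrite !cvE; case: (cval (u.1 f0) x) => p q; apply/eqP.
 by rewrite eq_complex /=; apply/andP; split; apply/eqP; field.
apply: antiM; exists (nabla H u rho); last first.
 by rewrite /nabla addr0 /scal_of kE /lie big_ord0 subr0.
split=> [k|v ev k]; first by apply: nabla_is_form => //; exact: eigen_form.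
apply: nabla_can => //; first exact: eigen_form.
- exact: eigen_form.
- by move=> k'; apply: cr.
- by move=> k'; apply: cr; exact: Jc.
Qed.
End StableStructure.

(** * The ratio of canonical components as a log form *)

Section StableData.
Variables (R : realType) (n : nat) (M : manifold R n).
Local Notation CC := (CC M).
Local Notation TC := (vect (idealT CC)).
Implicit Types (e f z : CC) (x : M) (u v : gsec CC).
Let nC := nice_CC M.
Variable g : gstructure M.
Hypotheses (gc : generalized_complex g) (ll : locally_log (anti_ideal g)).
Local Notation H := (cform (gs_H g)).
Local Notation ID := (anti g).
Lemma anti_log : locally_log ID. Proof. exact: ll. Qed.
Lemma anti_nz (W : set M) (a b : CC) : open W ->
 (forall e y, ID e -> W y -> cval e y * cval a y = cval e y * cval b y) ->
 forall y, W y -> cval a y = cval b y.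
Proof.
move=> oW E y Wy; pose J := {e : CC | ID e}.
rewrite -!evC; move: y Wy.
apply: (@solve_uniq _ _ _ nC J (fun k : J => sval k) W a b) => // [t N Nt|[e Ie] t Wt]; last exact: E.

have [t' Nt' zt] := log_zeros_dense anti_log Nt; exists t' => //.
apply: contrapT => nE; apply: zt => e Ie; apply: contrapT => /eqP et; apply: nE.
by exists (exist _ e Ie).
Qed.

(** Acting with f Y - i_Y rho_2 expresses f delta_(k+1) through delta_(k-1), so the vanishing of
    delta_0 propagates to all degrees once f is cancelled. *)
Lemma can_zero delta (N : set M) : canonical_section g delta -> open N ->
 (forall y, N y -> cval (scal_of (delta 0%N)) y = 0) ->
 forall k V y, N y -> cval (delta k V) y = 0.
Proof.
move=> cd oN d0; have [fd cd'] := cd.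
have step k : (forall xi V y, N y -> cval (match k return kform (idealT CC) k with
   0 => 0 | k'.+1 => wedge1 xi (delta k') end V) y = 0) ->
  forall V y, N y -> cval (delta k.+1 V) y = 0.
 move=> IH V; rewrite -(vcons_eta V); move: (V ord0) (V \o lift ord0) => Y W.
 move=> y Ny; rewrite -(cval0 y); move: y Ny; apply: (anti_nz oN) => e y [rho cr ->] Ny.
 have := congr1 (fun c : kform (idealT CC) k => cval (c W) y) (cd' _ (spinor_eigen gc cr Y) k).
 rewrite /clifford kE cvalD -[_.1]/(vscale _ Y) contractZ // /fscale cvalM.
 rewrite -[ctr Y _ W]/(delta k.+1 (vcons Y W)) cval0 mulr0.
 by rewrite (IH _ W y Ny) addr0.
suff: forall k, (forall V y, N y -> cval (delta k V) y = 0) /\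
  (forall V y, N y -> cval (delta k.+1 V) y = 0) by move=> S k; have [] := S k.
elim=> [|k [IH1 IH2]].
 have D0 (V : 'I_0 -> TC) y : N y -> cval (delta 0%N V) y = 0.
  by move=> Ny; rewrite -(d0 y Ny) /scal_of; congr (cval (delta 0%N _) y); exact: v0_eta.
 by split=> //; apply: step => xi V y Ny; rewrite kE cval0.
split=> //; apply: (step k.+1) => xi V y Ny.
by rewrite /wedge1 cval_sum big1 // => i _; rewrite !cvalM (IH1 (V \o lift i)) // !mulr0.
Qed.

(** Local canonical sections with scalar part f agree in every degree by [can_zero], so they glue to
    a global canonical section. *)
Lemma anti_local : loc_ideal ID.
Proof.
move=> f lf.
have H1 : forall p : M, exists rho : (forall k, kform (idealT CC) k), canonical_section g rho /\
  \forall y \near p, cval f y = cval (scal_of (rho 0%N)) y.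
 by move=> p; have [h [rho cr ->] E] := lf p; exists rho.
have [rho rhoE] := choice H1.
have cl p y : (\forall t \near y, cval f t = cval (scal_of (rho p 0%N)) t) ->
  forall k V, cval (rho p k V) y = cval (rho y k V) y.
 move=> E k V; have [cp _] := rhoE p; have [cy Ey] := rhoE y.
 have cd : canonical_section g (fun k => rho p k - rho y k).
  have [fp cp'] := cp; have [fy cy'] := cy.
  split=> [k'|u eu k']; first by apply: is_formD => //; exact: is_formN.
  have -> : clifford u (fun k => rho p k - rho y k) k' =
    clifford u (rho p) k' - clifford u (rho y) k'.
   case: k' => [|k']; first by rewrite /clifford !addr0.
   by rewrite /clifford wedge1D wedge1N opprD addrACA.
  by rewrite cp' // cy' // subrr.
 have [N [oN Ny NE]] := nnopen (filterI E Ey).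
 have d0 t : N t -> cval (scal_of ((rho p 0%N - rho y 0%N) : kform (idealT CC) 0)) t = 0.
  move=> /NE[E1 E2]; rewrite /scal_of 2!kE cvalD cvalN.
  by rewrite -[X in X - _]E1 -[X in _ - X]E2 subrr.
 have := can_zero cd oN d0 V Ny.
 by rewrite 2!kE cvalD cvalN => /eqP; rewrite subr_eq0 => /eqP.
have H2 : forall kV : {k & 'I_k -> TC}, exists r : CC,
  forall y, cval r y = cval (rho y (projT1 kV) (projT2 kV)) y.
 move=> [k V] /=; apply: (n_glue nC (F := fun y => cval (rho y k V) y)) => p.
 exists (rho p k V); have [_ /nearby Ep] := rhoE p.
 by apply: filterS Ep => y Ey; rewrite -(cl p y).
have [r rE] := choice H2.
pose sig k : kform (idealT CC) k := fun V => r (existT _ k V).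
have sE k V y : cval (sig k V) y = cval (rho y k V) y by rewrite rE.
have ry y k : is_form (rho y k) by have [[]] := rhoE y.
exists sig; last first.
 apply: cval_inj => y; rewrite /scal_of sE; have [_ /nbhs1 ->] := rhoE y.
 by rewrite /scal_of.
split=> [k|u eu k].
 split=> [V i Y Z|V i h Y|V i j ij Vij]; apply: cval_inj => y.
 - by rewrite cvalD !sE; have [-> _ _] := ry y k; rewrite cvalD.
 - by rewrite cvalM !sE; have [_ -> _] := ry y k; rewrite cvalM.
 - by rewrite sE; have [_ _ E] := ry y k; rewrite (E V i j).
fext => V; apply: cval_inj => y.
have [[_ cy] _] := rhoE y; rewrite -(cy u eu k) /clifford 2!kE 2!cvalD.
congr (_ + _); first exact: sE.
case: k V => [|k] V //; rewrite /wedge1 !cval_sum; apply: eq_bigr => i _.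
by rewrite !(cvalM ((-1) ^+ i)) ![cval (u.2 _ * _) y]cvalM sE.
Qed.

Lemma anti_div : log_divisor ID.
Proof.
split; last exact: ll.
apply: (div_ideal_intro nC anti_local) => [p|x N]; last exact: log_zeros_dense.
by have [U [oU Up [j [f [gF _ _]]]]] := ll p; exists U, (\prod_(i < j) f i).
Qed.
Lemma can2_compat rho rho' : canonical_section g rho -> canonical_section g rho' ->
 forall V W, scal_of (rho 0%N) * rho' 2%N (v2 V W) = scal_of (rho' 0%N) * rho 2%N (v2 V W).
Proof.
move=> cr cr' V W; have := can1 cr' W (spinor_eigen gc cr V).
rewrite -[_.2 _]/(- rho 2%N (v2 V W)) -[_.1]/(vscale _ V) form2Zl; last by case: cr'.
by rewrite mulrN => /oppr_inj.
Qed.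
(** The quotients rho_2(V, W) / rho_0 for different rho are compatible, so [log_extend] reduces the
    claim to simple points, where it follows from [star]. *)
Lemma ratio_exists (V W : TC) (PV : forall f, ID f -> ID (V f)) (PW : forall f, ID f -> ID (W f)) :
 exists h : CC, forall rho, canonical_section g rho -> scal_of (rho 0%N) * h = rho 2%N (v2 V W).
Proof.
pose J := {rho | canonical_section g rho}.
have [|||h hE] := @log_extend R n M J (fun k => scal_of (sval k 0%N))
  (fun k => sval k 2%N (v2 V W)) ID anti_log.
- by move=> [rho cr] [rho' cr'] /=; exact: can2_compat.
- move=> x /simple_frameP[[e [rho cr eE] ex]|[z [N [U [chi sf]]]]].
  rewrite eE in ex; have [v vE] := n_inv nC ex; exists (v * rho 2%N (v2 V W)) => -[rho' cr'] /=.
  apply: filterS vE => y vy; have := congr1 (fun f : CC => cval f y) (can2_compat cr cr' V W).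
  rewrite !cvalM; move: vy; rewrite !evC => vy E.
  by rewrite mulrCA -E mulrA [cval v y * _]mulrC vy mul1r.
 have [rho cr zE] := sf_mem sf.
 have [c cE] := (sf_gen sf (sf_N sf) (V z)).1 (nin_mem x (PV _ (sf_mem sf))).
 have [d dE] := (sf_gen sf (sf_N sf) (W z)).1 (nin_mem x (PW _ (sf_mem sf))).
 (* Since U z = 1, [star] at (U, V, W) can be solved for rho_2(V, W); as V z = c z and W z = d z,
    every other term is a multiple of z, and h is the quotient. *)
 pose h := dif (rho 2%N) (v3 U V W) + z * H (v3 U V W) + c * rho 2%N (v2 U W) - d * rho 2%N (v2 U V).
 have st := star gc cr U V W; rewrite -zE in st.
 have Nd y : N y -> dense_near y z by move=> Ny; exact: (frame_dense anti_log sf Ny).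
 have [N' [oN' N'x N'E]] := nnopen (filterI (filterI cE dE) (nopen (sf_open sf) (sf_N sf))).
 have E y : N' y -> cval (rho 2%N (v2 V W)) y = cval (z * h) y.
  move: y; apply: (@dcancel _ _ M N' (z ^+ 3) _ _ oN') => [y /N'E[_ Ny] N2 N2y|y /N'E[[Vz Wz] Ny]].
   have [t N2t zt] := Nd _ Ny _ N2y; exists t => //; rewrite cvalX expf_neq0 //.
  have := congr1 (fun f : CC => cval f y) st; rewrite !evC in Vz Wz.
  have Ev (t a b c1 c2 c3 : CC) : cval (t * (z * a + b - (c1 - c2 + c3))) y =
    cval t y * (cval z y * cval a y + cval b y - (cval c1 y - cval c2 y + cval c3 y)).
   by rewrite !cvE.
  rewrite Ev cval0 (cvalM (z ^+ 2)) !cvalX.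
  rewrite (cvalM (U z)) (cvalM (V z)) (cvalM (W z)) Vz Wz (sf_U1 sf Ny) (cvalM z h).
  set D := cval (dif (rho 2%N) (v3 U V W)) y; set HH := cval (H (v3 U V W)) y.
  rewrite /h !(cvalD, cvalB, cvalN) !cvalM -/D -/HH => E0; apply/eqP; rewrite -subr_eq0 -oppr_eq0 -E0.
  by apply/eqP; ring.
 exists h => -[rho' cr'] /=; apply: filterS (nopen oN' N'x) => y.
 rewrite -cvalM; apply: (@dcancel _ _ M N' z _ _ oN') => {}y N'y; have [_ Ny] := N'E _ N'y; first exact: Nd.
 have := congr1 (fun f : CC => cval f y) (can2_compat cr cr' V W).
 by rewrite -zE !cvalM => ->; rewrite E // !cvalM; ring.
- move=> p U j F oU Up [gF _ _]; have [e [rho cr eE] E] := gen_near nC gF Up.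
 exists (exist _ rho cr), 1%N, 0%N; apply: filterS E => y; rewrite !evC => Ey /=.
 by rewrite expr1 expr0 mulr1 Ey eE.
by exists h => rho cr; exact: (hE (exist _ rho cr)).
Qed.

Definition log_form : kform ID 2 := fun V => projT1 (cid (@ratio_exists
 (anc (V ord0)) (anc (V (lift ord0 ord0)))
 (@vect_ideal _ _ _ ID (V ord0)) (@vect_ideal _ _ _ ID (V (lift ord0 ord0))))).
Local Notation s := log_form.
Lemma log_formE rho V W : canonical_section g rho ->
 scal_of (rho 0%N) * s (v2 V W) = rho 2%N (v2 (anc V) (anc W)).
Proof. by move=> cr; rewrite /log_form; case: cid => h /= -> //; rewrite /v2 vconsE0 vconsES. Qed.
Lemma log_form_form : is_form s.
Proof.
have fr rho : canonical_section g rho -> is_form (rho 2%N) by case.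
have cc (a b : CC) : (forall rho, canonical_section g rho -> scal_of (rho 0%N) * a = scal_of (rho 0%N) * b) -> a = b.
 by move=> E; apply: (ideal_cancel anti_log (k := 1)) => e [rho cr ->]; rewrite expr1; exact: E.
have aD (Y Z : vect ID) : anc (Y + Z) = anc Y + anc Z by exact: vect_inj.
have aZ f (Y : vect ID) : anc (vscale f Y) = vscale f (anc Y) by exact: vect_inj.
apply: form_introS => [Y|Y Z|f Y|Y].
- apply: form1_intro => [Z W|f Z]; rewrite -!form2_v2; apply: cc => rho cr; have fo := fr _ cr.
  by rewrite mulrDr !log_formE // aD form2Dr.
 by rewrite mulrCA !log_formE // aZ form2Zr.
- apply: form1_ext => W; rewrite kE -!form2_v2; apply: cc => rho cr; have fo := fr _ cr.
 by rewrite mulrDr !log_formE // aD form2Dl.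
- apply: form1_ext => W; rewrite -[RHS]/(f * s (v2 Y W)) -!form2_v2; apply: cc => rho cr; have fo := fr _ cr.
 by rewrite mulrCA !log_formE // aZ form2Zl.
- fext => V; rewrite kE -[LHS]/(s (vcons Y (vcons Y V))) v1_vcons -/(v2 Y Y).
 apply: cc => rho cr; have fo := fr _ cr; by rewrite log_formE // form2_alt // mulr0.
Qed.

(** With rho_2 = f s on the log algebroid, [star] becomes f^5 (ds + H) = 0, which explains the
    exponent in the cancellation. *)
Lemma log_form_dif : dif s = pull (cform (- gs_H g)).
Proof.
fext => V; rewrite [V]v3_eta.
move: (V ord0) (V (lift ord0 ord0)) (V (lift ord0 (lift ord0 ord0))) => V1 V2 V3.
apply: (ideal_cancel anti_log (k := 5)) => e [rho cr ->]; have [fr _] := cr; set f := scal_of _.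
have st := star gc cr (anc V1) (anc V2) (anc V3); rewrite -/f in st.
have sE (A B : vect ID) : rho 2%N (v2 (anc A) (anc B)) = f * s (v2 A B) by rewrite log_formE.
have pE : pull (rho 2%N) = fscale f s.
 by fext => W; rewrite {2}[W]v2_eta /fscale -sE /pull; congr (rho 2%N _); exact: v2_eta.
have p3 (c : kform (idealT CC) 3) : c (v3 (anc V1) (anc V2) (anc V3)) = pull c (v3 V1 V2 V3).
 by rewrite /pull; congr c; rewrite [RHS]v3_eta /v3 /v2 !(vconsE0, vconsES).
rewrite cformN; rewrite !p3 -pull_dif pE difZ in st; last exact: log_form_form.
rewrite kE !sE in st.
have wE : wedge1 (@dfun _ _ _ ID f) s (v3 V1 V2 V3) =
  V1 f * s (v2 V2 V3) - V2 f * s (v2 V1 V3) + V3 f * s (v2 V1 V2).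
 rewrite -[LHS]/(ctr V1 (wedge1 (@dfun _ _ _ ID f) s) (v2 V2 V3)) ctr_wedgeS 2!kE.
 rewrite -[wedge1 _ (ctr V1 s) _]/(ctr V2 (wedge1 (@dfun _ _ _ ID f) (ctr V1 s)) (v1 V3)) ctr_wedgeS 2!kE.
 have -> : wedge1 (@dfun _ _ _ ID f) (ctr V2 (ctr V1 s)) (v1 V3) = V3 f * s (v2 V1 V2).
  rewrite -(v1_vcons V3 (fun=> 0)).
  rewrite -[LHS]/(ctr V3 (wedge1 (@dfun _ _ _ ID f) (ctr V2 (ctr V1 s))) (fun=> 0)).
  by rewrite ctr_wedge0 /fscale /dfun /ctr v1_vcons.
 by rewrite /fscale /dfun /ctr /v1 -/(v1 V3) -/(v2 V1 V3) -/(v2 V2 V3); ring.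
rewrite wE -[fscale f (dif s) _]/(f * dif s (v3 V1 V2 V3)) in st.
rewrite -[pull (- _) _]/(- pull H (v3 V1 V2 V3)) -[RHS]addr0 -st.
rewrite -[anc V1 f]/(V1 f) -[anc V2 f]/(V2 f) -[anc V3 f]/(V3 f); ring.
Qed.

(** An eigensection has a log vector part by [eigen_preserves] and lies in the graph by the degree
    one equation. Conversely the graph is isotropic, so maximal isotropy applies. *)
Lemma eigen_graph u : eigsec g u <-> graph s u.
Proof.
have fwd v : eigsec g v -> graph s v.
 move=> ev; have gv := eigen_form ev; split=> //.
 have [Z ZE] := @mk_vect _ _ _ ID v.1 (fun f If => eigen_preserves gc ev If).
 exists Z; split=> // W; apply: (ideal_cancel anti_log (k := 1)) => e [rho cr ->].
 by rewrite expr1 (can1 cr) // mulrN log_formE // ZE.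
split=> [|gu]; first exact: fwd.
have [fu _] := gu; apply: (maximal_isotropic gc) => // v ev.
by apply: (graph_isotropic log_form_form) => //; exact: fwd.
Qed.
End StableData.

Lemma ksumE (K : fieldType) (X : Type) (A : falg K X) (I : ideal A) k m
  (F : 'I_m -> kform I k) T : (\sum_i F i) T = \sum_i F i T.
Proof. by apply: (big_morph (fun a : kform I k => a T)). Qed.

(** * Nondegeneracy of the imaginary part *)

Section StableForm.
Variables (R : realType) (n : nat) (M : manifold R n).
Local Notation CR := (CR M).
Local Notation CC := (CC M).
Local Notation TR := (vect (idealT CR)).
Local Notation TC := (vect (idealT CC)).
Local Notation tc := (@toCx R n M : CR -> CC).
Local Notation ii := (ccst M 'i : CC).
Implicit Types (e f z : CC) (x : M) (u v : gsec CC) (p q : CR).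
Let nC := nice_CC M.
Let nR := nice_CR M.
Variable g : gstructure M.
Hypotheses (gc : generalized_complex g) (ll : locally_log (anti_ideal g)).
Local Notation ID := (anti g).
Local Notation s := (log_form gc ll).
Variable I : ideal CR.
Hypothesis rp : real_part ID I.
Local Notation lift := (liftv rp).
Local Notation J := (gs_J g).
Let fs : is_form s := log_form_form gc ll.
Let lI : locally_log ID := anti_log ll.
Lemma form_local (I0 : ideal CR) (a : kform I0 1) (V W : vect I0) x : is_form a ->
 (\forall y \near x, forall q, rval (V q) y = rval (W q) y) -> rval (a (v1 V)) x = rval (a (v1 W)) x.
Proof.
move=> fa E; have [N [oN Nx NE]] := nnopen E.
have [chi [c1 c0]] := n_bump nR oN Nx.
have VW : vscale chi V = vscale chi W.
 apply: vect_inj => q; apply: rval_inj => y; rewrite -[rval _ y]/(rval (chi * V q) y) -[RHS]/(rval (chi * W q) y).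
 rewrite !rvalM; case: (c0 y) => [Ny|/nbhs1]; first by rewrite NE.
 by rewrite evR => ->; rewrite !mul0r.
have := congr1 (fun T => rval (a (v1 T)) x) VW; rewrite !form1Z // !rvalM.
by have := nbhs1 c1; rewrite evR => ->; rewrite !mul1r.
Qed.

Lemma form1_sum (I0 : ideal CR) m (a : kform I0 1) (c : 'I_m -> CR) (V : 'I_m -> vect I0) :
 is_form a -> a (v1 (\sum_i vscale (c i) (V i))) = \sum_i c i * a (v1 (V i)).
Proof.
move=> fa; apply: (big_rec2 (fun (Y : vect I0) b => a (v1 Y) = b)) => [|i b Y _ <-].
 by have := form1Z 0 (0 : vect I0) fa; rewrite mul0r => <-; congr (a (v1 _)); apply: vect_inj => f /=; rewrite mul0r.
by rewrite form1D // form1Z.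
Qed.
Lemma form_frame c (x : M) (X : 'I_n -> CR) E W (eta : kform (idealT CR) 1) (Y : TR) t :
 frame_at c x X E W -> W t -> is_form eta ->
 rval (eta (v1 Y)) t = \sum_i rval (eta (v1 (E i))) t * rval (Y (X i)) t.
Proof.
move=> fr Wt fe.
have -> : rval (eta (v1 Y)) t = rval (eta (v1 (\sum_i vscale (Y (X i)) (E i)))) t.
 apply: (form_local fe); apply: filterS (nopen (fr_open fr) Wt) => y Wy q.
 rewrite (frame_vect Y q fr Wy) vect_sum rval_sum; apply: eq_bigr => i _.
 by rewrite -[RHS]/(rval (Y (X i) * E i q) y) rvalM.
by rewrite form1_sum // rval_sum; apply: eq_bigr => i _; rewrite rvalM mulrC.
Qed.

Definition real_form : kform I 2 := fun V => im (s (fun i => lift (V i))).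
Local Notation w := real_form.
Lemma real_formE A B : w (v2 A B) = im (s (v2 (lift A) (lift B))).
Proof. by rewrite /w [X in s X]v2_eta /v2 vconsE0 vconsES. Qed.
Lemma real_form_form : is_form w.
Proof.
have E V i Y : w (upd V i Y) = im (s (upd (fun j => lift (V j)) i (lift Y))).
 by rewrite /w lift_upd.
split=> [V i Y Z|V i f Y|V i j ij Vij].
- by rewrite !E lift_vectD (formD fs) imD.
- by rewrite !E lift_vectZ (formZ fs) im_to_complexM.
- by rewrite /w (form_alt fs ij) ?Vij // im0.
Qed.

(* The Poisson anchor of the structure: minus the inverse of w on smooth one-forms. *)
Lemma sharp_exists (eta : kform (idealT CR) 1) : is_form eta -> exists P : vect I,
 anc P = (J (0, eta)).1 /\ forall V : vect I, w (v2 P V) = - eta (v1 (anc V)).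
Proof.
move=> fe; have ga : is_gsec ((0, eta) : gsec CR) by exact: fe.
have [_ Jf _ _ _] := gc; have {Jf} [Jf _ _] := Jf; have gJ := Jf _ ga.
have eu := lam_eigen gc ga; set u := lam g _ in eu.
have u1 : u.1 = vscale (- ii) (cvec (J (0, eta)).1).
 apply: cvect_inj => f; rewrite /u /lam.
 have -> a b : (a + b : gsec CC).1 (tc f) = a.1 (tc f) + b.1 (tc f) by [].
 rewrite -[X in X + _]/(cvec (0 : TR) (tc f)) -[X in _ + X]/(ii * cvec (- J (0, eta)).1 (tc f)).
 rewrite -[RHS]/(- ii * cvec (J (0, eta)).1 (tc f)) !cvec_real to_complex0 add0r.
 by rewrite -[X in tc X]/(- (J (0, eta)).1 f) to_complexN mulrN mulNr.
have [_ [Z [Zu Zs]]] := (eigen_graph gc ll u).1 eu.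
have i2 := iiM M.
have ZE : anc (vscale ii Z) = cvec (J (0, eta)).1.
 by rewrite -[LHS]/(vscale ii (anc Z)) Zu u1; apply: vect_inj => f /=; ring: i2.
have [P [PE lP]] := unlift rp ZE; exists P; split=> // V.
rewrite real_formE lP form2Zl // imM_i.
have := Zs (lift V); rewrite liftE => E.
have -> : s (v2 Z (lift V)) = - u.2 (v1 (cvec (anc V))) by rewrite E opprK.
rewrite reN -re_gsecE; congr (- _).
by rewrite /u lam_re.
Qed.

Definition dR q : kform (idealT CR) 1 := @dfun _ _ _ (idealT CR) q.
(** Hamiltonian fields of real functions, all of them elliptic. *)
Lemma sharp_choice : exists P : CR -> vect I, forall q, anc (P q) = (J (0, dR q)).1 /\
 forall V : vect I, w (v2 (P q) V) = - anc V q.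
Proof.
have H q : exists P : vect I, anc P = (J (0, dR q)).1 /\
  forall V : vect I, w (v2 P V) = - anc V q.
 by have [P PE] := sharp_exists (@dfun_form _ _ _ (idealT CR) q); exists P.
by have [P PE] := choice H; exists P.
Qed.
Let P := projT1 (cid sharp_choice).
Let PJ q : anc (P q) = (J (0, dR q)).1. Proof. by rewrite /P; case: cid => Q /= /(_ q)[]. Qed.
Let Pw q V : w (v2 (P q) V) = - anc V q. Proof. by rewrite /P; case: cid => Q /= /(_ q)[_]. Qed.
Let Jadd (a b : gsec CR) : is_gsec a -> is_gsec b -> J (a + b) = J a + J b.
Proof. by case: gc => _ [_ + _] _ _ _; apply. Qed.
Let Jscale q (a : gsec CR) : is_gsec a -> J (gscale q a) = gscale q (J a).
Proof. by case: gc => _ [_ _ +] _ _ _; apply. Qed.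
Let fd q : is_gsec ((0, dR q) : gsec CR). Proof. exact: dfun_form. Qed.
Lemma sharpD p q : P (p + q) = P p + P q.
Proof.
apply: anchor_inj; rewrite -[RHS]/(anc (P p) + anc (P q)) !PJ -[RHS]/((J (0, dR p) + J (0, dR q)).1) -Jadd //.
congr (J _).1; apply: gsec_eq => [|Y]; first by rewrite /= addr0.
exact: vectD.
Qed.
Lemma sharpM p q : P (p * q) = vscale q (P p) + vscale p (P q).
Proof.
apply: anchor_inj; rewrite -[RHS]/(vscale q (anc (P p)) + vscale p (anc (P q))) !PJ.
rewrite -[RHS]/((gscale q (J (0, dR p)) + gscale p (J (0, dR q))).1) -!Jscale // -Jadd; try exact: is_gsecZ.
congr (J _).1; apply: gsec_eq => [|Y].
 by apply: vect_inj => f; rewrite /= !mulr0 addr0.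
by rewrite -[LHS]/(Y (p * q)) -[RHS]/(q * Y p + p * Y q) vectM [Y p * q]mulrC.
Qed.
Lemma sharp_cst a : P (real_cst M a) = 0.
Proof.
apply: anchor_inj; rewrite PJ.
have -> : (0, dR (real_cst M a)) = 0 :> gsec CR.
 by apply: gsec_eq => // Y; exact: (vect_scalar (A := CR) Y).
have -> : (0 : gsec CR) = gscale 0 0 by apply: gsec_eq => [|Y]; [apply: vect_inj => f|]; rewrite /= /fscale mul0r.
rewrite Jscale; last exact: is_form0.
by apply: vect_inj => f /=; rewrite mul0r.
Qed.
Lemma sharp_skew p q : P p q = - P q p.
Proof.
have := Pw p (P q); rewrite (form2_skew _ _ real_form_form) Pw => /oppr_inj.
by move=> E; rewrite -[P q p]/(anc (P q) p) -E opprK.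
Qed.

(* Off the divisor every vector field is of this form up to the factor f * conjA f. *)
Lemma scaled_sharp f (V : vect I) : ID f -> exists2 eta, is_form eta &
 anc (vscale (re (f * conjA f) : CR) V) = (J (0, eta)).1.
Proof.
move=> [rho cr ->]; set h := scal_of _; have [fr _] := cr.
have eu := spinor_eigen gc cr (cvec (anc V)); rewrite -/h in eu.
set u := (_, _) in eu; have gu := eigen_form eu.
pose u' := gscale (conjA h : CC) u.
have gu' : is_gsec u' by exact: is_gsecZ.
have eu' : eigsec g u'.
 apply: (maximal_isotropic gc) => // v ev; have := eigen_isotropic gc eu ev.
 rewrite !pairingE => E; have gv := eigen_form ev.
 rewrite -[u'.1]/(vscale (conjA h : CC) u.1) form1Z // -[u'.2 _]/(conjA h * u.2 _) -mulrDr E mulr0 //.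
have u1 : u'.1 = cvec (vscale (re (h * conjA h) : CR) (anc V)).
 rewrite cvecZ; apply: vect_inj => f'.
 rewrite -[RHS]/(tc (re (h * conjA h)) * cvec (anc V) f') normE.
 by rewrite -[LHS]/(conjA h * (h * cvec (anc V) f')); ring.
have [_ _ E] := eu'.
have i0 : im_gsec u' = (0, (im_gsec u').2).
 by apply: gsec_eq => // ; rewrite -[LHS]/(im_vect u'.1) u1 im_cvec.
exists (im_gsec u').2; first exact: (im_gsec_form gu').
rewrite -i0 E -[RHS]/(re_vect u'.1) u1 re_cvec; exact: vect_inj.
Qed.

Section Solve.
Variable xi : kform I 1.
Hypothesis fxi : is_form xi.

(** If w(Y, .) = xi, then Y q = w(Y, P q) = xi(P q), so this is the only candidate for Y. *)
Definition dual_fun q : CR := xi (v1 (P q)).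
Lemma dual_funM p q : dual_fun (p * q) = dual_fun p * q + p * dual_fun q.
Proof. by rewrite /dual_fun sharpM form1D // !form1Z // [q * _]mulrC. Qed.
Definition dual_vect : TR.
Proof.
refine (@Vect _ _ CR (idealT CR) dual_fun _ _ _ _) => [p q|p q|a q|//].
- by rewrite /dual_fun sharpD form1D.
- exact: dual_funM.
- rewrite -[Defs.scalar _ a]/(real_cst M a) dual_funM /dual_fun sharp_cst.
 have -> : xi (v1 0) = 0 by have := form1Z 0 (0 : vect I) fxi; rewrite mul0r => <-; congr (xi (v1 _)); apply: vect_inj => f /=; rewrite mul0r.
 by rewrite mul0r add0r.
Defined.
(** Let A and B be the Hamiltonian fields of re z and im z, so that the dual field sends z to xi(A)
    + i xi(B). The complex field A + i B maps all functions into the log ideal, so after cutting off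
    it is z W. Both W and its conjugate preserve the ideal, hence W = A' + i B' with A' and B'
    elliptic, and near x the value is (xi(A') + i xi(B')) z. *)
Lemma dual_preserves f : ID f -> ID (cvec dual_vect f).
Proof.
move=> If; apply: (anti_local gc ll) => p; move: p; apply: (log_near_in lI) => x.
move=> /simple_frameP[[e Ie ex]|[z [N [U [chi sf]]]]].
 exact (near_in_unit nC _ Ie ex).
suff [k kE] : exists k, \forall y \near x, cval (cvec dual_vect z) y = cval (k * z) y.
 have [c cE] := (sf_gen sf (sf_N sf) f).1 (nin_mem x If).
 exists ((cvec dual_vect c + c * k) * z); first by apply: idealM; exact: sf_mem sf.
 have cE' : \forall y \near x, ev f y = ev (c * z) y by apply: filterS cE => y ->; rewrite (nM nC).
 have := vect_local nC (cvec dual_vect) cE'; apply: filterS2 kE => y Ez ->.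
 by rewrite vectM !evC !cvalD !cvalM cvalD Ez !cvalM; ring.
pose A := P (re z); pose B := P (im z).
pose VA (q : CR) : CC := tc (A q) + ii * tc (B q).
have VE q : VA q = - cvec (anc (P q)) z.
 rewrite /VA (sharp_skew (re z)) (sharp_skew (im z)) !to_complexN.
 by rewrite mulrN -opprD.
have VID q : ID (VA q).
 by rewrite VE; apply: idealN; apply: (rp_lift rp); exact: sf_mem sf.
have Nd y : N y -> dense_near y z by move=> Ny; exact: (frame_dense lI sf Ny).
have quo := quot_exists lI (sf_open sf) (sf_gen sf) (sf_chi0 sf).
have quq := quot_uniq lI (sf_open sf) (sf_gen sf) (sf_chi0 sf).
pose VC : TC := cvec (anc (P (re z))) + vscale ii (cvec (anc (P (im z)))).
have VCtc q : VC (tc q) = VA q.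
 by rewrite -[LHS]/(cvec _ _ + ii * cvec _ _) !cvec_real.
have VCID h : ID (VC h).
 rewrite {1}[h]smooth_complexE vectD vectM.
 have -> : VC ii = 0 by exact: (vect_scalar (A := CC) VC).
 by rewrite mul0r add0r !VCtc; apply: idealD => //; exact: idealM.
have /choice [rr rE] : forall h : CC, exists r : CC, tc chi * VC h = r * z /\ off_supp chi r.
 by move=> h; exact: quo (VCID h).
have W0 y h : (\forall t \near y, rval chi t = 0) -> cval (rr h) y = 0 by have [_ +] := rE h; apply.
have Wz h : rr h * z = tc chi * VC h by have [-> _] := rE h.
have rD f1 f2 : rr (f1 + f2) = rr f1 + rr f2.
 apply: quq => [y|y nN|]; [exact: W0|by rewrite cvalD !W0 ?addr0|].
 by rewrite mulrDl !Wz vectD mulrDr.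
have rM f1 f2 : rr (f1 * f2) = rr f1 * f2 + f1 * rr f2.
 apply: quq => [y|y nN|]; [exact: W0|by rewrite cvalD !cvalM !W0 ?mulr0 ?mul0r ?addr0|].
 by rewrite mulrDl mulrAC -[f1 * _ * z]mulrA !Wz vectM; ring.
have rZ a f1 : rr (Defs.scalar CC a * f1) = Defs.scalar CC a * rr f1.
 apply: quq => [y|y nN|]; [exact: W0|by rewrite cvalM W0 ?mulr0|].
 by rewrite -mulrA !Wz vectZ mulrCA.
pose W : TC := @Vect _ _ CC (idealT CC) rr rD rM rZ (fun _ _ => Logic.I).
have Az : A (re z) = 0 /\ B (im z) = 0.
 have z0 (q : CR) : q = - q -> q = 0.
  move=> E; apply: rval_inj => y; have := congr1 (fun q => rval q y) E; rewrite rvalN rval0 => E1; lra.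
 by split; apply: z0; exact: sharp_skew.
(* Skew-symmetry of the Poisson bracket: the terms in re z alone and im z alone vanish, the mixed
   ones cancel. *)
have VCz : VC z = 0.
 rewrite -[LHS]/(cvec _ z + ii * cvec _ z).
 rewrite -[cvec _ z]/(tc (A (re z)) + ii * tc (A (im z))).
 rewrite -[cvec (anc (P (im z))) z]/(tc (B (re z)) + ii * tc (B (im z))).
 have [-> ->] := Az; rewrite (sharp_skew (re z) (im z) : A (im z) = - B (re z)) to_complexN to_complex0.
 by ring.
have Wz0 : W z = 0 by apply: quq => [y|y _|]; [exact: W0|exact: cval0|rewrite Wz VCz mulr0 mul0r].
(* A + i B sends zbar to a multiple of zbar, as A and B preserve the conjugate ideal, and also to a
   multiple of z; by unique factorisation zbar survives the division by z. *)
have Wzb y : N y -> dvd y z (conjA (W (conjA z))).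
 move=> Ny.
 have tz : transv z y.
  apply/transvP; exists U, (cjvec U).
  rewrite !cjvecE conjAK !cval_conj (sf_U1 sf Ny) (sf_U0 sf Ny) conjc0 conjc1 mul0r subr0 mul1r oner_neq0 //.
 have Iz V : ID (cvec (anc (P V)) z) by apply: (rp_lift rp); exact: sf_mem sf.
 have [a aE] := (sf_gen sf Ny _).1 (nin_mem y (Iz (re z))).
 have [b bE] := (sf_gen sf Ny _).1 (nin_mem y (Iz (im z))).
 have [c cE] := (sf_gen sf Ny _).1 (nin_mem y (VCID (conjA z))).
 have cc (V : TR) : cvec V (conjA z) = conjA (cvec V z).
  by rewrite -[in LHS](conj_cvec V) cjvecE conjAK.
 pose d := conjA a + ii * conjA b.
 have dE : \forall t \near y, cval (VC (conjA z)) t = cval (conjA z * d) t.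
  apply: filterS2 aE bE => t; rewrite !evC => Ea Eb.
  rewrite -[VC _]/(cvec _ _ + ii * cvec _ _) !cc /d cvalD [cval (ii * _) t]cvalM.
  by rewrite !cval_conj Ea Eb !cvE !rmorphM /=; ring.
 have [k kE] : dvd y z d.
  apply: (@conj_divides _ _ M z d c) tz _; apply: filterS2 dE cE => t; rewrite !evC => E1 E2.
  by rewrite -cvalM -E1 E2 mulrC.
 exists (conjA (tc chi * k) * 1).
 have [N' [oN' N'y N'E]] := nnopen (filterI (filterI dE kE) (nopen (sf_open sf) Ny)).
 apply: filterS (nopen oN' N'y) => t N't.
 have E : cval (W (conjA z)) t = cval (conjA z * (tc chi * k)) t.
  apply: (@dcancel _ _ M N' z _ _ oN') N't => t' /N'E[[E1 E2] Nt]; first exact: Nd.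
  by rewrite -[LHS]cvalM mulrC Wz cvalM E1 !cvalM E2; ring.
 transitivity (cval (conjA (conjA z * (tc chi * k))) t).
   by rewrite cval_conj [RHS]cval_conj E.
  by rewrite mulr1 (conjAM (conjA z)) conjAK cvalM.
have WID h : ID h -> ID (W h) /\ ID (cjvec W h).
 move=> Ih; have main y : near_in ID (W h) y /\ near_in ID (cjvec W h) y.
  case: (sf_chi0 sf y) => [Ny|c0]; last first.
   split; exists 0; try exact: ideal0.
    by apply: filterS (nearby c0) => t ct; rewrite !evC cval0; exact: W0.
   by apply: filterS (nearby c0) => t ct; rewrite !evC cval0 cjvecE cval_conj W0 // conjc0.
  have [c cE] := (sf_gen sf Ny h).1 (nin_mem y Ih).
  have cE' : \forall t \near y, ev h t = ev (c * z) t by apply: filterS cE => t ->; rewrite (nM nC).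
  split.
   exists (W c * z); first by apply: idealM; exact: sf_mem sf.
   have := vect_local nC W cE'; apply: filterS => t ->.
   by rewrite vectM Wz0 mulr0 addr0.
  have [k kE] := Wzb y Ny.
  exists ((cjvec W c + c * k) * z); first by apply: idealM; exact: sf_mem sf.
  have := vect_local nC (cjvec W) cE'; apply: filterS2 kE => t Ek ->.
  by rewrite vectM (cjvecE W z) !evC cvalD (cvalM _ z) (cvalM c) Ek (cvalM _ z) cvalD (cvalM c k); ring.
 by split; apply: (anti_local gc ll) => y; have [] := main y.
have WE h : W h = cvec (re_vect W) h + ii * cvec (im_vect W) h by rewrite {1}[W]cvecE.
have WcE h : cjvec W h = cvec (re_vect W) h - ii * cvec (im_vect W) h by [].
have i2 := iiM M.
have h2 : ccst M 2^-1 * (1 + 1) = 1 :> CC by apply: cval_inj => y; rewrite !cvE mulrC -mulr2n -[1 *+ 2]/2 divff // pnatr_eq0.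
have [A' AE] : exists A' : vect I, anc A' = re_vect W.
 apply: mk_vect; apply: (rp_real rp) => h /WID[I1 I2].
 have -> : cvec (re_vect W) h = ccst M 2^-1 * (W h + cjvec W h).
  rewrite WE WcE; transitivity (ccst M 2^-1 * (1 + 1) * cvec (re_vect W) h); last by ring.
  by rewrite h2 mul1r.
 by apply: idealM; exact: idealD.
have [B' BE] : exists B' : vect I, anc B' = im_vect W.
 apply: mk_vect; apply: (rp_real rp) => h /WID[I1 I2].
 have -> : cvec (im_vect W) h = ccst M 2^-1 * ii * (cjvec W h - W h).
  rewrite WE WcE; transitivity (ccst M 2^-1 * (1 + 1) * cvec (im_vect W) h); last by ring: i2.
  by rewrite h2 mul1r.
 by apply: idealM; apply: idealD => //; exact: idealN.
have EW q : tc chi * (tc (A q) + ii * tc (B q)) = (tc (A' q) + ii * tc (B' q)) * z.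
 rewrite -[tc (A q) + _]/(VA q) -VCtc -Wz; congr (_ * z).
 rewrite -[LHS]/(W (tc q)) WE !cvec_real.
 by rewrite -(congr1 (fun V : TR => V q) AE) -(congr1 (fun V : TR => V q) BE).
have rp1 (a b : CR) : re (tc a + ii * tc b) = a by rewrite reD re_tc reM_i im_tc oppr0 addr0.
have ip1 (a b : CR) : im (tc a + ii * tc b) = b by rewrite imD im_tc imM_i re_tc add0r.
have EA : vscale chi A = vscale (re z : CR) A' - vscale (im z : CR) B'.
 apply: vect_inj => q; have := congr1 (@re R n M) (EW q).
 rewrite re_to_complexM reM !rp1 !ip1 => E; rewrite -[LHS]/(chi * A q) E.
 by rewrite -[RHS]/(re z * A' q - im z * B' q); ring.
have EB : vscale chi B = vscale (re z : CR) B' + vscale (im z : CR) A'.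
 apply: vect_inj => q; have := congr1 (@im R n M) (EW q).
 rewrite im_to_complexM imM !rp1 !ip1 => E; rewrite -[LHS]/(chi * B q) E.
 by rewrite -[RHS]/(re z * B' q + im z * A' q); ring.
have xA : chi * xi (v1 A) = re z * xi (v1 A') - im z * xi (v1 B').
 by rewrite -form1Z // EA form1D // form1N // !form1Z.
have xB : chi * xi (v1 B) = re z * xi (v1 B') + im z * xi (v1 A').
 by rewrite -form1Z // EB form1D // !form1Z.
exists (tc (xi (v1 A')) + ii * tc (xi (v1 B'))).
have E : tc chi * cvec dual_vect z = (tc (xi (v1 A')) + ii * tc (xi (v1 B'))) * z.
 rewrite -[cvec _ z]/(tc (xi (v1 A)) + ii * tc (xi (v1 B))) [X in _ = _ * X]smooth_complexE.
 rewrite mulrDr mulrCA -!to_complexM xA xB !(to_complexD, to_complexN, to_complexM); ring: i2.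
apply: filterS (sf_chi1 sf) => y cy; rewrite -E cvalM cval_tc cy mul1r //.
Qed.

Lemma dual_exists : exists Y : vect I, anc Y = dual_vect.
Proof. by apply: mk_vect; apply: (rp_real rp); exact: dual_preserves. Qed.
(** After cutting off, eta is a finite combination of coordinate differentials, so V is locally a
    combination of Hamiltonian fields. *)
Lemma sharp_frame eta (V : vect I) (a : kform I 1) : is_form eta -> is_form a ->
 (forall q, a (v1 (P q)) = 0) -> anc V = (J (0, eta)).1 -> a (v1 V) = 0.
Proof.
move=> fe fa a0 VE; apply: rval_inj => y; rewrite rval0.
have [c Mc cy] := atlas_cover y.
have [X [E [W fr]]] := frame_exists (fun c' Mc' i => conj (atlas_compatible Mc Mc' i) (atlas_compatible Mc' Mc i)) cy.
have [chi [c1 c0]] := n_bump nR (fr_open fr) (fr_mem fr).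
pose b i := chi * eta (v1 (E i)).
have Ec : fscale chi eta = \sum_i fscale (b i) (dR (X i)).
 apply: form1_ext => Y; apply: rval_inj => t; rewrite ksumE rval_sum /fscale rvalM.
 case: (c0 t) => [Wt|/nbhs1]; last first.
  by rewrite evR => ct; rewrite ct mul0r big1 // => i _; rewrite /b !rvalM ct !mul0r.
 rewrite (form_frame Y fr Wt fe) mulr_sumr; apply: eq_bigr => i _.
 by rewrite /b !rvalM mulrA.
have JS : is_form (\sum_i fscale (b i) (dR (X i))) /\
  (J (0, \sum_i fscale (b i) (dR (X i)))).1 = anc (\sum_i vscale (b i) (P (X i))).
 apply: (big_rec2 (fun (k : kform (idealT CR) 1) (T : vect I) => is_form k /\ (J (0, k)).1 = anc T)).
  split; first exact: is_form0.
  have -> : ((0, 0) : gsec CR) = gscale 0 0.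
   by apply: gsec_eq => [|Y]; [apply: vect_inj => f|]; rewrite /= /fscale mul0r.
  by rewrite Jscale; [apply: vect_inj => f /=; rewrite mul0r|exact: is_form0].
 move=> i k T _ [fk IH]; have fb : is_form (fscale (b i) (dR (X i))) by apply: is_formZ; exact: fd.
 split; first exact: is_formD.
 have -> : ((0, fscale (b i) (dR (X i)) + k) : gsec CR) = gscale (b i) (0, dR (X i)) + (0, k).
  by apply: gsec_eq => // ; apply: vect_inj => f /=; rewrite mulr0 addr0.
 rewrite Jadd; [|exact: is_gsecZ (fd _)|exact: fk].
 rewrite Jscale; last exact: fd.
 rewrite -[LHS]/(vscale (b i) (J (0, dR (X i))).1 + (J (0, k)).1) IH -PJ.
 exact: vect_inj.
have EV : vscale chi V = \sum_i vscale (b i) (P (X i)).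
 apply: anchor_inj; rewrite -JS.2 -Ec -[LHS]/(vscale chi (anc V)) VE.
 have -> : ((0, fscale chi eta) : gsec CR) = gscale chi (0, eta).
  by apply: gsec_eq => // ; apply: vect_inj => f /=; rewrite mulr0.
 by rewrite Jscale.
have := congr1 (fun T => rval (a (v1 T)) y) EV; rewrite form1Z // form1_sum // rvalM.
have := nbhs1 c1; rewrite evR => ->; rewrite mul1r => ->.
by rewrite big1 ?rval0 // => i _; rewrite a0 mulr0.
Qed.
End Solve.

(** The one-form w(Y, .) - xi kills all Hamiltonian fields, hence every elliptic field of the form
    |e|^2 V with e in the log ideal by [scaled_sharp] and [sharp_frame]; the factors |e|^2 are
    cancelled. *)
Lemma real_form_ndeg : Defs.nondegenerate w.
Proof.
move=> xi fxi; have [Y YE] := dual_exists fxi.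
have wY q : w (v2 Y (P q)) = xi (v1 (P q)).
 by rewrite (form2_skew _ _ real_form_form) Pw opprK YE.
exists Y; split=> [|Y' Y'E]; last first.
 apply: anchor_inj; rewrite YE; apply: vect_inj => q.
 have := congr1 (fun a : kform I 1 => a (v1 (P q))) Y'E; rewrite -[ctr Y' w _]/(w (v2 Y' (P q))).
 by rewrite (form2_skew _ _ real_form_form) Pw opprK => ->.
pose a := ctr Y w - xi.
have fa : is_form a.
 by apply: is_formD; [exact: (ctr_form _ real_form_form)|exact: is_formN].
have a0 q : a (v1 (P q)) = 0 by rewrite /a 2!kE -[ctr Y w _]/(w (v2 Y (P q))) wY subrr.
apply/eqP; rewrite -subr_eq0; apply/eqP; apply: form1_ext => V; rewrite kE -/a.
apply: tc_inj; rewrite to_complex0; apply: cval_inj => y.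
apply: (anti_nz ll (W := setT)) => // [|e t Ie _]; first exact: openT.
have [->|et] := eqVneq (cval e t) 0; first by rewrite !mul0r.
have [eta fe VE] := scaled_sharp V Ie.
have := sharp_frame fe fa a0 VE; rewrite form1Z // => E0.
have : e * conjA e * tc (a (v1 V)) = 0 by rewrite -normE -to_complexM E0 to_complex0.
move=> /(congr1 (fun c : CC => cval c t)); rewrite !cvalM cval0 => /eqP.
by rewrite !mulf_eq0 conjA_eq0 orbb (negPf et) => /eqP ->; rewrite !mulr0.
Qed.
End StableForm.

(** * The induced elliptic divisor *)

Section Wedges.
Variables (R : realType) (n : nat) (M : manifold R n).
Local Notation CR := (CR M).
Local Notation CC := (CC M).
Local Notation TR := (vect (idealT CR)).
Local Notation tc := (@toCx R n M : CR -> CC).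
Local Notation ii := (ccst M 'i : CC).
Implicit Types (e f z : CC) (p x : M) (u v q : CR) (Y Z : TR).

Lemma wedge2P p u v : wedge_neq0 p [:: u; v] <-> exists Y Z, ndet u v p Y Z != 0.
Proof.
split=> [[V]|[Y [Z YZ]]].
 rewrite det_mx2 !mxE => H; exists (V ord0), (V (lift ord0 ord0)).
 by move: H; rewrite /ndet /=; congr (_ - _ != _); exact: mulrC.
exists (fun i => if i == ord0 then Y else Z); rewrite det_mx2 !mxE /=.
by move: YZ; rewrite /ndet; congr (_ - _ != _); exact: mulrC.
Qed.
Lemma transv_ndet z p : transv z p -> exists Y Z, ndet (re z) (im z) p Y Z != 0.
Proof.
move=> tz; have [c Mc cp] := atlas_cover p.
have [X [E [W fr]]] := frame_exists (atlas_compatP Mc) cp.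
have [l [m lm]] := transv_minor tz fr; exists (E l), (E m).
by move: lm; rewrite /ndet !evR [rval (E m (re z)) p * _]mulrC.
Qed.
Lemma im_ndet z p Y Z : complex.Im ((ev (cvec Y z) p)^*%C * ev (cvec Z z) p) =
 ndet (re z) (im z) p Y Z.
Proof. by rewrite !evC !ev_cvec /ndet !evR /=; ring. Qed.
(** The matrix of derivatives along a frame has independent rows, hence a right inverse, whose
    columns combine the frame into dual fields. *)
Lemma wedge_intro x (s : seq CR) : (forall c : nat -> R,
  (forall Y, \sum_(i < size s) c i * rval (Y s`_i) x = 0) -> forall i, (i < size s)%N -> c i = 0) ->
 wedge_neq0 x s.
Proof.
move=> H; have [c Mc cx] := atlas_cover x.
have [X [E [W fr]]] := frame_exists (atlas_compatP Mc) cx.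
pose A := \matrix_(i < size s, k < n) rval (E k s`_i) x.
have /row_freeP[B AB] : row_free A.
 apply: inj_row_free => v vA; apply/rowP => i; rewrite mxE.
 pose d (k : nat) := if insub k is Some k' then v ord0 k' else 0.
 have dE (k : 'I_(size s)) : d k = v ord0 k by rewrite /d valK.
 rewrite -dE; apply: H => // Y.
 under eq_bigr => k _ do rewrite dE (frame_vect Y _ fr (fr_mem fr)) mulr_sumr.
 rewrite exchange_big big1 // => k _.
 have := congr1 (fun B : 'rV_n => B ord0 k) vA; rewrite !mxE => E0.
 under eq_bigr => l _ do rewrite mulrCA.
 rewrite -mulr_sumr; under eq_bigr => l _ do rewrite -[rval (E k _) x](mxE (matrix_key) (fun l k => rval (E k s`_l) x) l k).
 by rewrite E0 mulr0.
exists (fun j => \sum_k vscale (real_cst M (B k j) : CR) (E k)).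
have -> : \matrix_(i, j) ev ((\sum_k vscale (real_cst M (B k j) : CR) (E k)) (nth 0 s i)) x = A *m B.
 apply/matrixP => i j; rewrite !mxE evR vect_sum rval_sum; apply: eq_bigr => k _.
 by rewrite -[vscale _ _ _]/(real_cst M (B k j) * E k s`_i) rvalM rval_cst mxE mulrC.
by rewrite AB det1 oner_neq0.
Qed.

Lemma flatten_sum (K : fieldType) (T T' : Type) (x0 : T') (a b : T -> T') (G : T' -> K) (e : seq T) (c : nat -> K) :
 \sum_(i < size (flatten [seq [:: a t; b t] | t <- e])) c i * G (nth x0 (flatten [seq [:: a t; b t] | t <- e]) i) =
 \sum_(k < size e) (c k.*2 * nth 0 [seq G (a t) | t <- e] k + c k.*2.+1 * nth 0 [seq G (b t) | t <- e] k).
Proof.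
elim: e c => [|t e IH] c; first by rewrite !big_ord0.
rewrite [LHS]/= !big_ord_recl addrA; congr (_ + _).
exact: (IH (fun i => c i.+2)).
Qed.
Lemma tcRe f : tc (re f) = ccst M 2^-1 * (f + conjA f).
Proof.
apply: cval_inj => y; rewrite !cvE; case: (cval f y) (rval_re f y) => p q /= ->.
by ceq; field.
Qed.
Lemma tcIm f : tc (im f) = ccst M 2^-1 * ii * (conjA f - f).
Proof.
apply: cval_inj => y; rewrite !cvE; case: (cval f y) (rval_im f y) => p q /= ->.
by ceq; field.
Qed.
(** A real relation among the d(re f_i) and d(im f_i), with coefficients c and c', is the complex
    relation with coefficients (c - i c') / 2 and (c + i c') / 2 among the df_i and their
    conjugates. *)
Lemma wedge_real_parts j (f : 'I_j -> CC) (s : seq 'I_j) x :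
 wedge_neq0 x (flatten [seq [:: f i; conjA (f i) : CC] | i <- s]) ->
 wedge_neq0 x (flatten [seq [:: re (f i) : CR; im (f i) : CR] | i <- s]).
Proof.
move=> Hw; apply: wedge_intro => c Hc.
have sz : size (flatten [seq [:: re (f i) : CR; im (f i) : CR] | i <- s]) =
 size (flatten [seq [:: f i; conjA (f i) : CC] | i <- s]).
 by elim: s {Hw Hc} => //= t s ->.
pose h : R[i] := 2^-1.
pose g (i : nat) : R[i] := if odd i then h * ((c i.-1)%:C + 'i * (c i)%:C) else h * ((c i)%:C - 'i * (c i.+1)%:C).
have g0 i : (i < size (flatten [seq [:: f i; conjA (f i) : CC] | i <- s]))%N -> g i = 0.
 apply: (@wedge_dep _ _ _ _ _ g Hw) => V.
 pose GV (k : CC) := cval (V k) x.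
 rewrite (flatten_sum 0 f (fun i => conjA (f i) : CC) GV).
 have GE k : rval (re_vect V k) x = complex.Re (cval (V (tc k)) x) by [].
 have GI k : rval (im_vect V k) x = complex.Im (cval (V (tc k)) x) by [].
 have H1 := Hc (re_vect V); have H2 := Hc (im_vect V).
 rewrite (flatten_sum 0 (fun i => re (f i) : CR) (fun i => im (f i) : CR) (fun k => rval (re_vect V k) x)) in H1.
 rewrite (flatten_sum 0 (fun i => re (f i) : CR) (fun i => im (f i) : CR) (fun k => rval (im_vect V k) x)) in H2.
 have cv (k : 'I_(size s)) (G : 'I_j -> R[i]) i0 : nth 0 [seq G i | i <- s] k = G (nth i0 s k) by rewrite (nth_map i0).
 have cvR (k : 'I_(size s)) (G : 'I_j -> R) i0 : nth 0 [seq G i | i <- s] k = G (nth i0 s k) by rewrite (nth_map i0).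
 transitivity ((\sum_(k < size s) (c k.*2 * nth 0 [seq rval (re_vect V (re (f t))) x | t <- s] k +
    c k.*2.+1 * nth 0 [seq rval (re_vect V (im (f t))) x | t <- s] k))%:C +
   'i * (\sum_(k < size s) (c k.*2 * nth 0 [seq rval (im_vect V (re (f t))) x | t <- s] k +
    c k.*2.+1 * nth 0 [seq rval (im_vect V (im (f t))) x | t <- s] k))%:C); last by rewrite H1 H2 mulr0 addr0.
 rewrite 2!(rmorph_sum (real_complex R)) mulr_sumr -big_split; apply: eq_bigr => k _ /=.
 have i0 : 'I_j by case: (s) k => [[]//|t s' _]; exact: t.
 rewrite !(cv _ _ i0) !(cvR _ _ i0) !GE !GI /g odd_double /= odd_double /=.
 set F := f _; rewrite /GV.
 have -> : cval (V F) x = cval (V (tc (re F))) x + 'i * cval (V (tc (im F))) x.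
  rewrite {1}[F]smooth_complexE vectD vectM (vect_scalar (A := CC) V 'i) mul0r add0r cvalD cvalM cval_cst //.
 have -> : cval (V (conjA F)) x = cval (V (tc (re F))) x - 'i * cval (V (tc (im F))) x.
  rewrite [conjA F]/(tc (re F) - ii * tc (im F)) vectD vectN vectM (vect_scalar (A := CC) V 'i) mul0r add0r cvalB cvalM cval_cst //.
 case: (cval (V (tc (re F))) x) (cval (V (tc (im F))) x) => [a1 a2] [b1 b2] /=.
 by apply/eqP; rewrite /h eq_complex /=; apply/andP; split; apply/eqP; field.
move=> i; rewrite sz => /g0 /eqP; rewrite /g; case: ifP => _.
all: rewrite mulf_eq0 invr_eq0 pnatr_eq0 /= eq_complex /= => /andP[/eqP E1 /eqP E2]; move: E1 E2; rewrite !mul0r !mul1r ?sub0r ?subr0 ?addr0 ?add0r ?oppr0 => E1 E2; lra.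
Qed.
End Wedges.

(** * The elliptic ideal, its strata and its co-orientation *)

Section InducedDivisor.
Variables (R : realType) (n : nat) (M : manifold R n).
Local Notation CR := (CR M).
Local Notation CC := (CC M).
Local Notation TR := (vect (idealT CR)).
Local Notation tc := (@toCx R n M : CR -> CC).
Implicit Types (e f z : CC) (p x : M) (u v q : CR) (Y Z : TR).
Let nC := nice_CC M.
Let nR := nice_CR M.
Variable ID : ideal CC.
Hypotheses (lI : locally_log ID) (loc : loc_ideal ID).
Definition hsum f := exists m (a b : 'I_m -> CC),
 (forall i, ID (a i) /\ ID (b i)) /\ f = \sum_(i < m) a i * conjA (b i).
Lemma hsum1 e f : ID e -> ID f -> hsum (e * conjA f).
Proof. by move=> Ie If; exists 1%N, (fun=> e), (fun=> f); split=> //; rewrite big_ord1. Qed.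
Lemma hsum0 : hsum 0.
Proof. by exists 0%N, (fun=> 0), (fun=> 0); split=> [[]|] //; rewrite big_ord0. Qed.
Lemma hsumD f f' : hsum f -> hsum f' -> hsum (f + f').
Proof.
move=> [m [a [b [ab ->]]]] [m' [a' [b' [ab' ->]]]].
exists (m + m')%N, (fun i => match fintype.split i with inl j => a j | inr j => a' j end),
 (fun i => match fintype.split i with inl j => b j | inr j => b' j end); split.
 by move=> i; case: fintype.split => j; [exact: ab|exact: ab'].
rewrite big_split_ord /=; congr (_ + _); apply: eq_bigr => i _.
 by rewrite (unsplitK (inl _ i)).
by rewrite (unsplitK (inr _ i)).
Qed.
Lemma hsum_big m (F : 'I_m -> CC) : (forall i, hsum (F i)) -> hsum (\sum_i F i).
Proof. by move=> H; apply: (big_ind hsum) => //; [exact: hsum0|exact: hsumD]. Qed.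
Lemma hsumM f h : hsum h -> hsum (f * h).
Proof.
move=> [m [a [b [ab ->]]]]; rewrite mulr_sumr; apply: hsum_big => i; rewrite mulrA.
by have [? ?] := ab i; apply: hsum1 => //; exact: idealM.
Qed.
Lemma conjA_sum m (F : 'I_m -> CC) : conjA (\sum_i F i) = \sum_i conjA (F i).
Proof.
apply: (big_morph (@conjA R n M)) => [a b|]; first exact: conjAD.
by apply: (addrI (conjA 0 : CC)); rewrite -conjAD !addr0.
Qed.
Lemma hsum_conj h : hsum h -> hsum (conjA h).
Proof.
move=> [m [a [b [ab ->]]]]; rewrite conjA_sum; apply: hsum_big => i; rewrite conjAM conjAK mulrC.
by have [? ?] := ab i; exact: hsum1.
Qed.
Lemma hsum_near h U F x : gen_by U ID F -> U x -> hsum h -> dvd x (F * conjA F) h.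
Proof.
move=> gF Ux [m [a [b [ab ->]]]].
apply: (big_ind (dvd x (F * conjA F))) => [|f f'|i _]; [|exact: dvdD|].
 by exists 0; apply: nearW => y; rewrite !cvE mulr0.
have [Ia Ib] := ab i; have [a' aE] := (gF _ Ux _).1 (nin_mem x Ia).
have [b' bE] := (gF _ Ux _).1 (nin_mem x Ib).
exists (a' * conjA b'); apply: filterS2 aE bE => y; rewrite !evC => Ea Eb.
by rewrite !cvalM !cval_conj Ea Eb rmorphM /=; ring.
Qed.
Lemma hsum_vect Y h : (forall f, ID f -> ID (cvec Y f)) -> hsum h -> hsum (cvec Y h).
Proof.
move=> HY [m [a [b [ab ->]]]].
have -> : cvec Y (\sum_i a i * conjA (b i)) = \sum_i cvec Y (a i * conjA (b i)).
 by apply: (big_morph (cvec Y)) => [f g|]; [exact: vectD|exact: vect0].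
apply: hsum_big => i; rewrite vectM; have [Ia Ib] := ab i.
have -> : cvec Y (conjA (b i)) = conjA (cvec Y (b i)).
 by rewrite -[in LHS](conj_cvec Y) cjvecE conjAK.
by apply: hsumD; apply: hsum1 => //; exact: HY.
Qed.
(** The squared modulus. *)
Definition nq z : CR := re (z * conjA z).
Lemma nqE z : tc (nq z) = z * conjA z. Proof. exact: normE. Qed.
Lemma nq_sq z : nq z = re z * re z + im z * im z.
Proof.
apply: tc_inj; rewrite nqE {1}[z]smooth_complexE /conjA to_complexD !to_complexM.
by have i2 := iiM M; ring: i2.
Qed.
Lemma nqM z f : nq (z * f) = nq z * nq f.
Proof. by apply: tc_inj; rewrite to_complexM !nqE conjAM mulrACA. Qed.
Lemma nq_prod j (f : 'I_j -> CC) : nq (\prod_i f i) = \prod_i nq (f i).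
Proof.
apply: (big_morph nq) => [a b|]; first exact: nqM.
by apply: tc_inj; rewrite nqE conjA1 mulr1 tc1.
Qed.
Lemma nq_eq0 z x : (rval (nq z) x == 0) = (cval z x == 0).
Proof.
have := congr1 (fun h : CC => cval h x) (nqE z); rewrite cval_tc cvalM => E.
apply/eqP/eqP => [q0|z0].
 by move: E; rewrite q0 => /esym/eqP; rewrite mulf_eq0 conjA_eq0 orbb => /eqP.
by move: E; rewrite z0 mul0r => -[].
Qed.
Lemma nq_zero_parts z x : rval (nq z) x = 0 <-> rval (re z) x = 0 /\ rval (im z) x = 0.
Proof.
rewrite rval_re rval_im; split=> [/eqP|[r0 i0]]; first by rewrite nq_eq0 => /eqP ->.
by apply/eqP; rewrite nq_eq0 eq_complex r0 i0 !eqxx.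
Qed.

Section Induced.
Variable I : ideal CR.
Hypothesis in1 : forall f, I (re f) /\ I (im f) <-> hsum f.

Lemma ind_mem q : I q <-> hsum (tc q).
Proof.
split=> [Iq|/in1[]]; last by rewrite re_tc.
by apply/in1; rewrite re_tc im_tc; split=> //; exact: ideal0.
Qed.
Lemma ind_norm e : ID e -> I (nq e).
Proof. by move=> Ie; apply/ind_mem; rewrite nqE; exact: hsum1. Qed.
(** If V preserves the elliptic ideal, it sends |z|^2 to a multiple of itself, so z divides zbar V z
    near a smooth point and hence V z; [log_near_in] covers the crossings. In the other direction
    the Leibniz rule applies to each product a conj(b). *)
Lemma ind_real_part : real_part ID I.
Proof.
split=> [V f If|V HV q /ind_mem Iq|e]; last exact: ind_norm.
 apply: loc => y; move: y; apply: (log_near_in lI) => x /simple_frameP[[e Ie ex]|[z [N [U [chi sf]]]]].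
  exact (near_in_unit nC _ Ie ex).
 have Iq := vect_ideal V (ind_norm (sf_mem sf)); move/ind_mem: Iq.
 have -> : tc (V (nq z)) = cvec (anc V) (z * conjA z) by rewrite -nqE cvec_real.
 move=> /(hsum_near (sf_gen sf) (sf_N sf)) [c cE]; rewrite vectM in cE.
 have VC : cvec (anc V) (conjA z) = conjA (cvec (anc V) z).
  by rewrite -[in LHS](conj_cvec (anc V)) cjvecE conjAK.
 have [k kE] : dvd x z (cvec (anc V) z).
  apply: (@conj_divides _ _ M z _ (conjA z * c - conjA (cvec (anc V) z))) (sf_tr sf) _.
  apply: filterS cE => y; rewrite VC !cvE => E; rewrite mulrBr mulrA -E; ring.
 have [c' c'E] := (sf_gen sf (sf_N sf) f).1 (nin_mem x If).
 have c'E' : \forall y \near x, ev f y = ev (c' * z) y by apply: filterS c'E => y ->; rewrite (nM nC).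
 exists ((cvec (anc V) c' + c' * k) * z); first by apply: idealM; exact: sf_mem sf.
 have := vect_local nC (cvec (anc V)) c'E'; apply: filterS2 kE => y Ek ->.
 by rewrite vectM !evC cvalD (cvalM _ z) (cvalM c') Ek (cvalM _ z) cvalD (cvalM c' k); ring.
by apply/ind_mem; rewrite -cvec_real; exact: hsum_vect.
Qed.

Lemma nq_gen U F : gen_by U ID F -> gen_by U I (nq F).
Proof.
move=> gF x Ux f; split=> [[q /ind_mem Iq fq]|[h hE]].
 have [c cE] := hsum_near gF Ux Iq; exists (re c); apply: filterS2 fq cE => y -> E.
 have := congr1 (@complex.Re R) E; rewrite cval_tc -nqE cval_tc /= => ->.
 by rewrite rval_re; case: (cval c y) => a b /=; ring.
have [e Ie eE] := gen_near nC gF Ux; exists (h * nq e).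
 by apply: idealM; exact: ind_norm.
apply: filterS2 hE eE => y -> E; rewrite [RHS]rvalM !evR; congr (_ * _).
by apply: (@complexI R); rewrite -!cval_tc !nqE !cvalM !cval_conj -!evC E.
Qed.

(** At a zero of z, Y (Y |z|^2) = 2 ((Y re z)^2 + (Y im z)^2). *)
Lemma nq_elliptic U z : (forall x, U x -> cval z x = 0 -> transv z x) -> smooth_elliptic U (nq z).
Proof.
move=> tz x Ux /eqP; rewrite evR nq_eq0 => /eqP zx; exists (re z), (im z); split.
 split; first by apply: nearW => y; exact: (nq_zero_parts z y).
 by apply/wedge2P/transv_ndet; exact: tz.
move=> Y; rewrite !evR => H.
have r0 : rval (re z) x = 0 by rewrite rval_re zx.
have i0 : rval (im z) x = 0 by rewrite rval_im zx.
rewrite nq_sq !vectD !vectM !vectD !vectM !rvE r0 i0 !mul0r !mulr0 !add0r !addr0.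
have -> (a b : R) : a * a + a * a + (b * b + b * b) = (a ^+ 2 + b ^+ 2) *+ 2 by ring.
rewrite pmulrn_lgt0 // lt_def addr_ge0 ?sqr_ge0 // andbT paddr_eq0 ?sqr_ge0 // !sqrf_eq0 negb_and.
by apply/orP.
Qed.

Lemma elliptic_of_log U j (f : 'I_j -> CC) : gen_by U ID (\prod_i f i) ->
 transv_fam U f -> elliptic_product U I (fun i => nq (f i)).
Proof.
move=> gF tf; split.
- by rewrite -nq_prod; exact: nq_gen.
- by move=> i; apply: nq_elliptic => x Ux fx; exact: (fam_transv tf Ux fx).
- move=> S x Ux H; have H' i : i \in S -> cval (f i) x = 0.
  by move=> /H/eqP; rewrite evR nq_eq0 => /eqP.
 exists (fun i => re (f i)), (fun i => im (f i)); split=> [i /H' fx|].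
  split; first by apply: nearW => y; exact: (nq_zero_parts (f i) y).
  by apply/wedge2P/transv_ndet; exact: (fam_transv tf Ux fx).
 apply: wedge_real_parts; exact: tf.
Qed.

Lemma factors_at0 p : factors_at I p 0 <-> exists2 q, I q & rval q p != 0.
Proof.
split=> [[U [oU Up [q [gq _ _]]]]|[q Iq qp]].
 rewrite big_ord0 in gq; have E1 : \forall y \near p, ev (1 : CR) y = ev (1 : CR) y * ev (1 : CR) y.
  by apply: nearW => y; rewrite (n1 nR) mulr1.
 have [h Ih hE] := (gq _ Up 1).2 (ex_intro _ 1 E1).
 exists h => //; rewrite -evR -(nbhs1 hE) (n1 nR) oner_neq0 //.
have [N [oN Np NE]] := nnopen (n_open nR qp).
exists N; split=> //; exists (fun=> 0); split=> [x Nx f|[]//|S x _ _].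
 rewrite big_ord0; split=> [_|_]; first by exists f; apply: nearW => y; rewrite (n1 nR) mulr1.
 have [v vE] := n_inv nR (NE _ Nx); exists (f * v * q); first exact: idealM.
 by apply: filterS vE => y vy; rewrite !(nM nR) -mulrA [ev v y * _]mulrC vy mulr1.
exists (fun=> 0), (fun=> 0); split=> [[]//|].
have -> : enum S = [::] by case: (enum S) => [|[]].
by exists (fun=> 0); rewrite det_mx00 oner_neq0.
Qed.

Lemma C1E p : C1 I p <-> factors_at I p 1 /\ ~ factors_at I p 0.
Proof.
split=> [[[j [Fj mj] j1] n2]|[F1 nF0]].
 have j1' : j = 1%N.
  case: j j1 Fj mj => [|[|j]] // _ Fj mj; case: n2; exists j.+2 => //; by split.
 by subst j; split=> // /mj.
split; first by exists 1%N => //; split=> // -[|j'] // /nF0.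
by move=> [j [Fj mj] j2]; have := leq_trans j2 (mj _ F1).
Qed.
Lemma log_nonzero p U j (f : 'I_j -> CC) : gen_by U ID (\prod_i f i) -> U p ->
 ~ factors_at I p 0 -> exists i, cval (f i) p = 0.
Proof.
move=> gF Up nF; apply: contrapT => H; apply: nF; apply/factors_at0.
have [e Ie eE] := gen_near nC gF Up; exists (nq e); first exact: ind_norm.
rewrite nq_eq0 -evC -(nbhs1 eE) evC cval_prod; apply/prodf_neq0 => i _.
by apply/negP => /eqP f0; apply: H; exists i.
Qed.
(** If two factors of the log ideal vanished at a point with a single elliptic factor q0, then q0
    would be |f_1|^2 times a function vanishing there, so all Y (Y q0) would be zero at p, against
    the positive Hessian. *)
Lemma C1_simple p : C1 I p <-> simple_at ID p /\ zeros_of ID p.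
Proof.
rewrite C1E; split=> [[[U' [oU' U'p [q [gq eq _]]]] nF]|[[W [z [Wp [oW gz tz]]]] zp]].
 have [U [oU Up [j [f lp]]]] := lI p; have [gF _ _] := lp.
 have [i fi] := log_nonzero gF Up nF.
 have zF : cval (\prod_i f i) p = 0 by rewrite cval_prod (bigD1 i) //= fi mul0r.
 split; last first.
  move=> e Ie; have [k kE] := (gF _ Up e).1 (nin_mem p Ie).
  by rewrite (nbhs1 kE) [ev (\prod_i f i) p]zF mulr0.
 apply: (log_simple oU lp Up) => i1 i2 f1 f2; apply/eqP/negPn/negP => ne.
 rewrite big_ord1 in gq; set q0 := q _ in gq.
 have [h hE] := ((nq_gen gF) _ Up q0).1 (gen_near nR gq U'p).
 have F0 : rval (nq (\prod_(i < j) f i)) p = 0 by apply/eqP; rewrite nq_eq0 zF.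
 have q0p : ev q0 p = 0 by rewrite (nbhs1 hE) [ev (nq _) p]F0 mulr0.
 have [u [v [[_ /wedge2P[Y [Z YZ]]] Hs]]] := eq ord0 p U'p q0p.
 have [Y' /Hs] : exists Y', ev (Y' u) p != 0 \/ ev (Y' v) p != 0.
  exists Y; apply: contrapT => /not_orP[/negP/negPn/eqP E1 /negP/negPn/eqP E2].
  by move: YZ; rewrite /ndet E1 E2 !mul0r subrr eqxx.
 pose b := h * nq (f i2) * nq (\prod_(i | (i != i1) && (i != i2)) f i).
 have E : \forall y \near p, ev q0 y = ev (nq (f i1) * b) y.
  apply: filterS hE => y ->; rewrite (bigD1 i1) //= (bigD1 i2) 1?eq_sym //= !nqM /b !rvalM; ring.
 rewrite (nbhs1 (vect_local nR Y' (vect_local nR Y' E))).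
 have a0 : rval (nq (f i1)) p = 0 by apply/eqP; rewrite nq_eq0 f1.
 have b0 : rval b p = 0.
  have b2 : rval (nq (f i2)) p = 0 by apply/eqP; rewrite nq_eq0 f2.
  by rewrite !rvalM b2 mulr0 mul0r.
 have Ya0 : rval (Y' (nq (f i1))) p = 0.
  by rewrite nq_sq vectD !vectM !rvE rval_re rval_im f1 !(mul0r, mulr0) !addr0.
 have G (a c : CR) : rval a p = 0 -> rval c p = 0 -> rval (Y' a) p = 0 -> rval (Y' (Y' (a * c))) p = 0.
  by move=> E1 E2 E3; rewrite vectM vectD !vectM !rvalD !rvalM E1 E2 E3 !(mul0r, mulr0) !addr0.
 by rewrite evR G // ltxx.
have [e Ie eE] := gen_near nC gz Wp.
have z0 : cval z p = 0 by rewrite -evC (nbhs1 eE) zp.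
split; last first.
 by move=> /factors_at0[q /ind_mem Iq]; have [c cE] := hsum_near gz Wp Iq;
   rewrite -(inj_eq (@complexI R)) -cval_tc (nbhs1 cE) cvalM z0 !mul0r eqxx.
exists W; split=> //; exists (fun=> nq z); apply: (@elliptic_of_log W 1 (fun=> z)).
 by rewrite big_ord1.
move=> S x Wx Sx.
have [S0|S1] : enum S = [::] \/ enum S = [:: ord0].
 have := enum_uniq S; case: (enum S) => [|a [|b s]] /=; [by left|by rewrite (ord1 a); right|].
 by rewrite (ord1 a) (ord1 b) inE eqxx.
 by rewrite S0; exists (fun=> 0); rewrite det_mx00 oner_neq0.
rewrite S1 /=; apply: tz => //; apply: (Sx ord0); by rewrite -mem_enum S1 inE.
Qed.

Lemma C1_near p W z : simple_gen ID W z -> forall y, W y -> C1 I y <-> cval z y = 0.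
Proof.
move=> [oW gz tz] y Wy; rewrite C1_simple; split=> [[_ zy]|zy].
 by have [e Ie eE] := gen_near nC gz Wy; rewrite -evC (nbhs1 eE) zy.
split; first by exists W, z.
by move=> e Ie; have [k kE] := (gz _ Wy e).1 (nin_mem y Ie); rewrite (nbhs1 kE) [ev z y]zy mulr0.
Qed.

Variable o : M -> TR -> TR -> Prop.
Hypothesis in2 : forall p Y Z, o p Y Z <-> C1 I p /\
 exists (U : set M) f, [/\ open U, U p, gen_by U ID f &
  0 < complex.Im ((ev (cvec Y f) p)^*%C * ev (cvec Z f) p)].

(** Two local generators differ by a unit c, which multiplies the oriented area by |c|^2 > 0 on the
    divisor. *)
Lemma orientedP p W z Y Z : simple_gen ID W z -> W p -> C1 I p ->
 o p Y Z <-> 0 < ndet (re z) (im z) p Y Z.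
Proof.
move=> sg Wp Cp; have z0 := (C1_near p sg Wp).1 Cp; have [oW gz tz] := sg.
rewrite in2; split=> [[_ [U [f [oU Up gf]]]]|H]; last first.
 by split=> //; exists W, z; split=> //; rewrite im_ndet.
have [c cE] := (gf _ Up z).1 (gen_near nC gz Wp).
have [d dE] := (gz _ Wp f).1 (gen_near nC gf Up).
have cd : cval (c * d) p = 1.
 have [N [oN Np NE]] := nnopen (filterI (filterI cE dE) (nopen oW Wp)).
 rewrite -(cval1 (M := M) p); apply: (@dcancel _ _ M N z _ _ oN) Np => y /NE[[E1 E2] Wy].
  by apply: dense_zero => zy; exact: tz.
 by move: E1 E2; rewrite !evC => E1 E2; rewrite cval1 mulr1 {2}E1 E2 cvalM; ring.
have f0 : cval f p = 0 by rewrite -evC (nbhs1 dE) [ev z p]z0 mulr0.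
have Vf (V : TR) : ev (cvec V z) p = cval c p * ev (cvec V f) p.
 have E : \forall y \near p, ev z y = ev (c * f) y by apply: filterS cE => y ->; rewrite (nM nC).
 by rewrite (nbhs1 (vect_local nC _ E)) vectM (nD nC) !(nM nC) [ev f p]f0 mulr0 add0r.
rewrite -im_ndet !Vf; have c0 : cval c p != 0.
 by apply: contra_eqN cd => /eqP c0; rewrite cvalM c0 mul0r eq_sym oner_eq0.
case: (cval c p) c0 (ev (cvec Y f) p) (ev (cvec Z f) p) => [c1 c2] cn0 [a1 a2] [b1 b2] /=.
move=> H; suff : 0 < (c1 ^+ 2 + c2 ^+ 2) * (a1 * b2 + - a2 * b1) by congr (_ < _); ring.
apply: mulr_gt0 => //; move: cn0; rewrite eq_complex /= negb_and => cn0.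
by rewrite lt_def addr_ge0 ?sqr_ge0 // andbT paddr_eq0 ?sqr_ge0 // !sqrf_eq0 negb_and.
Qed.

(** u and v vanish on the zeros of z, so their differentials at p are combinations of d(re z) and
    d(im z); k is the determinant of this change. *)
Lemma cut_out_ndet p W z u v : simple_gen ID W z -> W p -> C1 I p -> cut_out p (C1 I) u v ->
 exists2 k : R, k != 0 & forall Y Z, ndet u v p Y Z = k * ndet (re z) (im z) p Y Z.
Proof.
move=> sg Wp Cp [cu /wedge2P[Y0 [Z0 YZ0]]]; have z0 := (C1_near p sg Wp).1 Cp; have [oW gz tz] := sg.
have [N [oN Np NE]] := nnopen (filterI cu (nopen oW Wp)).
have [D [X [nf Dp]]] := nform_exists (tz _ Wp z0).
have exp (t : CR) : (forall y, N y -> cval z y = 0 -> rval t y = 0) -> exists k1 k2 : R, forall Y,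
  rval (Y t) p = k1 * rval (Y (re z)) p + k2 * rval (Y (im z)) p.
 move=> tz0; have [a [b E]] : exists a b : CC, \forall y \near p,
   cval (tc t) y = cval z y * cval a y + cval (conjA z) y * cval b y.
  apply: (@nf_had _ _ _ _ _ _ nf (D `&` N)) => //.
  - by apply: openI => //; exact: nf_open nf.
  - by move=> y [_ Ny] /tz0 ty; rewrite cval_tc ty.
 exists (complex.Re (cval a p + cval b p)), (complex.Re ('i * (cval a p - cval b p))) => Y.
 have E' : \forall y \near p, ev (tc t) y = ev (z * a + conjA z * b) y.
  by apply: filterS E => y Ey; rewrite evC Ey !cvE.
 have := nbhs1 (vect_local nC (cvec Y) E').
 have Yc : cvec Y (conjA z) = conjA (cvec Y z).
  by rewrite -[in LHS](conj_cvec Y) cjvecE conjAK.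
 have zc0 : cval (conjA z) p = 0 by rewrite cval_conj z0 conjc0.
 rewrite cvec_real vectD !vectM Yc !evC !cvalD !cvalM z0 zc0 !mul0r !addr0 cval_tc cval_conj.
 move=> /(congr1 (@complex.Re R)) /= ->.
 rewrite ev_cvec; case: (cval a p) (cval b p) => [a1 a2] [b1 b2] /=; ring.
have [k1 [k2 uE]] : exists k1 k2 : R, forall Y, rval (Y u) p = k1 * rval (Y (re z)) p + k2 * rval (Y (im z)) p.
 by apply: exp => y /NE[cy Wy] zy; have [+ _] := cy.1 ((C1_near p sg Wy).2 zy).
have [l1 [l2 vE]] : exists k1 k2 : R, forall Y, rval (Y v) p = k1 * rval (Y (re z)) p + k2 * rval (Y (im z)) p.
 by apply: exp => y /NE[cy Wy] zy; have [_ +] := cy.1 ((C1_near p sg Wy).2 zy).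
have E Y Z : ndet u v p Y Z = (k1 * l2 - k2 * l1) * ndet (re z) (im z) p Y Z.
 by rewrite /ndet !evR !uE !vE; ring.
exists (k1 * l2 - k2 * l1) => //; apply: contraNneq YZ0 => k0; by rewrite E k0 mul0r.
Qed.

Lemma ind_co_orientation : co_orientation I o.
Proof.
split=> [p Y Z /in2[]//|p u v Cp cu|p Y Z oYZ].
- have [[W [z [Wp sg]]] _] := (C1_simple p).1 Cp.
 have [k k0 kE] := cut_out_ndet sg Wp Cp cu; have oP := orientedP _ _ sg Wp Cp.
 split=> [Y Z /oP H|Y Z Y' Z']; first by rewrite kE mulf_neq0 // gt_eqF.
 rewrite !kE !oP; have -> (a b c : R) : a * b * (a * c) = a ^+ 2 * (b * c) by ring.
 have k2 : 0 < k ^+ 2 by rewrite lt_def sqrf_eq0 k0 sqr_ge0.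
 split.
  by rewrite pmulr_rgt0 // => H; split=> H'; [rewrite -(pmulr_rgt0 _ H')|rewrite -(pmulr_lgt0 _ H')].
 rewrite pmulr_rlt0 // => H; split=> [H'|/negP].
  by apply/negP; rewrite -leNgt ltW // -(pmulr_rlt0 _ H').
 rewrite -leNgt le_eqVlt => /orP[/eqP E|H']; first by rewrite E mulr0 ltxx in H.
 by rewrite -(nmulr_llt0 _ H').
- have Cp : C1 I p by have [] := (in2 p Y Z).1 oYZ.
 have [[W [z [Wp sg]]] _] := (C1_simple p).1 Cp.
 have H := (orientedP Y Z sg Wp Cp).1 oYZ; have [oW _ _] := sg.
 pose d : CR := Y (re z) * Z (im z) - Y (im z) * Z (re z).
 have dE y : rval d y = ndet (re z) (im z) y Y Z by rewrite /ndet !rvE.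
 have cd := @rval_cont R n M d p.
 have : \forall y \near p, 0 < rval d y.
  by apply: (cvgr_gt _ cd); rewrite dE.
 apply: filterS2 (nopen oW Wp) => y Wy dy Cy.
 by apply/(orientedP Y Z sg Wy Cy); rewrite -dE.
Qed.
End Induced.
End InducedDivisor.

(** * Finitely many generators *)

Section Lipschitz.
Variables (R : realType) (n : nat).
Local Notation V := 'rV[R]_n.
Local Notation e_ i := (delta_mx ord0 i : V).
Implicit Types (x y : V).

Lemma cpt_norm_bound (W : normedModType R) (A : set W) : compact A ->
 exists2 B : R, 0 <= B & forall w, A w -> `|w| <= B.
Proof.
move=> /compact_bounded[B [_ HB]]; exists (`|B| + 1); first by rewrite addr_ge0.
by apply: HB; rewrite (le_lt_trans (ler_norm B)) // ltrDl.
Qed.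
Lemma lipschitz_box (h : V -> R) (B : R) : smooth_on setT h ->
 exists2 L : R, 0 <= L & forall x y, `|x| <= B -> `|y| <= B -> `|h y - h x| <= L * `|y - x|.
Proof.
(* The intermediate points x + [trunc k d] + t e_i have norm at most B + 2 B + 2 B. *)
move=> sh; have cK : compact [set z : V | `|z - 0| <= B *+ 5] by exact: closed_ballV_cpt.
have bd i : exists2 L : R, 0 <= L & forall z, `|z| <= B *+ 5 -> `|pd i h z| <= L.
 have [L L0 HL] := @cpt_norm_bound R _ (continuous_compact (f := pd i h)
  (cont_subT (fun z _ => smooth_cont (smooth_partial i sh) (I : setT z))) cK).
 by exists L => // z zB; apply: HL; exists z => //=; rewrite subr0.
have bd' i : exists L : R, 0 <= L /\ forall z, `|z| <= B *+ 5 -> `|pd i h z| <= L.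
 by have [L L0 HL] := bd i; exists L.
have [L HL] := choice bd'.
exists (\sum_i L i); first by apply: sumr_ge0 => i _; have [] := HL i.
move=> x y xB yB; have B0 : 0 <= B by exact: le_trans xB.
pose d := y - x; have dB : `|d| <= B *+ 2 by rewrite (le_trans (ler_normB _ _)) // mulr2n lerD.
have tB k (z : V) : `|trunc k z| <= `|z|.
 by apply: normrV_mono => i; rewrite mxE; case: ifP => // _; rewrite normr0.
suff H k : (k <= n)%N -> `|h (x + trunc k d) - h x| <= (\sum_(i < n | (i < k)%N) L i) * `|d|.
 have xd : x + d = y by rewrite /d addrC subrK.
 have := H n (leqnn n); rewrite trunc_full xd => /le_trans; apply.
 rewrite ler_wpM2r // le_eqVlt; apply/orP; left; apply/eqP; apply: eq_bigl => i; exact: ltn_ord.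
elim: k => [_|k IH kn].
 have -> : trunc 0 d = 0 by apply/rowP => l; rewrite !mxE.
 by rewrite addr0 subrr normr0 mulr_ge0 // sumr_ge0 // => i _; have [] := HL i.
pose i := Ordinal kn; have -> : trunc k.+1 d = trunc k d + d ord0 i *: e_ i by exact: (truncS i).
have dv (t : R) : derivable h (x + trunc k d + t *: e_ i) (e_ i) by exact: smooth_on_derivable.
have [t td E] := line_MVT (fun (t : R) (_ : `|t| <= `|d ord0 i|) => dv t).
have nd : `|d ord0 i| <= `|d| by exact: normrV_ge.
have ti : `|h (x + trunc k d + d ord0 i *: e_ i) - h (x + trunc k d)| <= L i * `|d|.
 rewrite E normrM mulrC ler_pM //; have [_] := HL i; apply.
 rewrite (le_trans (ler_normD _ _)) // (_ : B *+ 5 = (B + B *+ 2) + B *+ 2); last by ring.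
 rewrite lerD //; first by rewrite (le_trans (ler_normD _ _)) // lerD // (le_trans (tB _ _)).
 rewrite normrZ (le_trans (y := `|t| * 1)) ?ler_wpM2l ?delta_norm // mulr1.
 by rewrite (le_trans td) // (le_trans nd).
rewrite (bigD1 i) //= mulrDl addrA.
have -> : h (x + trunc k d + d ord0 i *: e_ i) - h x =
 (h (x + trunc k d + d ord0 i *: e_ i) - h (x + trunc k d)) + (h (x + trunc k d) - h x) by ring.
rewrite (le_trans (ler_normD _ _)) // lerD //.
rewrite (le_trans (IH (ltnW kn))) // ler_wpM2r // le_eqVlt; apply/orP; left; apply/eqP.
apply: eq_bigl => l; rewrite ltnS [in RHS]leq_eqVlt -val_eqE /=.
by case: (ltngtP l k).
Qed.

Lemma natr_dist_lt1 (a b : nat) : `|a%:R - b%:R| < 1 :> R -> a = b.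
Proof.
rewrite ltr_norml => /andP[h1 h2]; case: (ltngtP a b) => [lt|lt|//].
 have : a.+1%:R <= b%:R :> R by rewrite ler_nat.
 by rewrite -natr1 => h3; exfalso; lra.
have : b.+1%:R <= a%:R :> R by rewrite ler_nat.
by rewrite -natr1 => h3; exfalso; lra.
Qed.

(* A Lipschitz map from a bounded subset of an n-dimensional space misses a point *)
(* of the cube of dimension n + 1: it cannot separate the points of a fine grid.  *)
Lemma lipschitz_misses (T : Type) (A : set T) (X : T -> V) (G : T -> 'I_n.+1 -> R) (B L : R) :
 (forall t, A t -> `|X t| <= B) ->
 (forall t t' i, A t -> A t' -> `|G t i - G t' i| <= L * `|X t - X t'|) ->
 exists c : 'I_n.+1 -> R, (forall i, 0 <= c i <= 1) /\ forall t, A t -> exists i, G t i != c i.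
Proof.
move=> AB GL; apply: contrapT => H.
have hit (c : 'I_n.+1 -> R) : (forall i, 0 <= c i <= 1) -> exists t, A t /\ forall i, G t i = c i.
 move=> c01; apply: contrapT => H'; apply: H; exists c; split=> // t At.
 apply: contrapT => H2; apply: H'; exists t; split=> // i.
 by apply/eqP/negPn/negP => Gi; apply: H2; exists i.
pose N (r : R) := (Num.trunc `|r|).+1.
have NE (r : R) : r < (N r)%:R by rewrite (le_lt_trans (ler_norm r)) //; have /andP[] := truncn_itv (normr_ge0 r).
(* There are m^(n+1) grid points with step 1/m and at most (C m)^n cells of side 1 / (k m); m > C^n
   makes the cells too few, while two grid points in one cell would coincide by the Lipschitz
   bound. *)
pose b := N B; pose k := N L; pose C := (2 * b * k).+1; pose m := (C ^ n).+1.
have m0 : 0 < m%:R :> R by rewrite ltr0n.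
have km0 : 0 < (k * m)%:R :> R by rewrite ltr0n.
pose gr (f : {ffun 'I_n.+1 -> 'I_m}) i : R := (f i)%:R / m%:R.
have gr01 f i : 0 <= gr f i <= 1.
 by rewrite /gr divr_ge0 ?ler0n // ler_pdivrMr // mul1r ler_nat ltnW.
have [P PE] := choice (fun f => hit (gr f) (gr01 f)).
pose Q := (2 * b * (k * m))%N.
pose cell (f : {ffun 'I_n.+1 -> 'I_m}) : {ffun 'I_n -> 'I_Q.+1} :=
 [ffun i => inord (Num.trunc ((X (P f) ord0 i + b%:R) * (k * m)%:R))].
have XB f i : 0 <= X (P f) ord0 i + b%:R <= (2 * b)%:R.
 have [AP _] := PE f; have := le_trans (normrV_ge (X (P f)) i) (AB _ AP).
 rewrite ler_norml => /andP[l u]; have bB := ltW (NE B); rewrite natrM.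
 by apply/andP; split; rewrite -/b in bB; lra.
have cellE f i : (cell f i : nat) = Num.trunc ((X (P f) ord0 i + b%:R) * (k * m)%:R).
 rewrite ffunE inordK // ltnS; have /andP[X0 X1] := XB f i.
 rewrite -(ler_nat R); have -> : Q%:R = (2 * b)%:R * (k * m)%:R :> R by rewrite -natrM.
 apply: le_trans (_ : (X (P f) ord0 i + b%:R) * (k * m)%:R <= _).
  by rewrite truncn_le mulr_ge0 // ltW.
 by rewrite ler_wpM2r // ltW.
have inj : injective cell.
 move=> f f' ff'; apply/ffunP => i; apply/val_inj.
 have [AP GP] := PE f; have [AP' GP'] := PE f'.
 have Xd : `|X (P f) - X (P f')| * (k * m)%:R <= 1.
  rewrite -ler_pdivlMr // div1r; apply: normrV_le => [|l]; first by rewrite invr_ge0 ltW.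
  rewrite !mxE -div1r ler_pdivlMr // -[(k * m)%:R in leLHS]ger0_norm ?ltW // -normrM.
  have := cellE f l; rewrite ff' cellE => E.
  have /andP[X0 _] := XB f l; have /andP[X0' _] := XB f' l.
  have /andP[a1 a2] := truncn_itv (mulr_ge0 X0 (ltW km0)).
  have /andP[b1 b2] := truncn_itv (mulr_ge0 X0' (ltW km0)).
  rewrite -E in a1 a2; rewrite -natr1 in a2; rewrite -natr1 in b2.
  by rewrite ltr_norml mulrBl; rewrite !mulrDl in a1 a2 b1 b2; apply/andP; split; lra.
 have := GL _ _ i AP AP'; rewrite GP GP' /gr -mulrBl normrM normfV [X in _ / X]ger0_norm ?ler0n //.
 rewrite ler_pdivrMr // => H1; apply: natr_dist_lt1; apply: le_lt_trans H1 _; have kL := NE L; rewrite -/k in kL.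
  have [X0|Xn0] := eqVneq (`|X (P f) - X (P f')|) 0; first by rewrite X0 mulr0 mul0r.
  apply: lt_le_trans (_ : k%:R * `|X (P f) - X (P f')| * m%:R <= _).
   by rewrite ltr_pM2r // ltr_pM2r // lt_def Xn0 normr_ge0.
  by move: Xd; rewrite natrM; lra.
have := leq_card cell inj; rewrite !card_ffun !card_ord leqNgt => /negP; apply.
have QC : (Q.+1 <= C * m)%N.
 have gen (c d : nat) : (0 < d)%N -> ((c * d).+1 <= c.+1 * d)%N.
  by move=> d0; rewrite mulSn -add1n leq_add2r.
 by rewrite /Q mulnA; exact: gen.
apply: leq_ltn_trans (_ : (C * m) ^ n < _)%N; first by case: (n) => [|n'] //; rewrite leq_exp2r.
by rewrite expnMn expnS ltn_pmul2r // expn_gt0.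
Qed.
End Lipschitz.

(** * Global generators of a log ideal, and locality of the induced ideal *)

Section Generators.
Variables (R : realType) (n : nat) (M : manifold R n).
Local Notation CR := (CR M).
Local Notation CC := (CC M).
Local Notation tc := (@toCx R n M : CR -> CC).
Implicit Types (e f a : CC) (p x y : M) (U N K : set M).
Let nC := nice_CC M.
Let nR := nice_CR M.
Variable ID : ideal CC.
Hypotheses (lI : locally_log ID) (loc : loc_ideal ID).
Definition gen_at a x := exists N, [/\ open N, N x & gen_by N ID a].
Lemma gen_dense_at a x : gen_at a x -> dense_near x a.
Proof. by move=> [N [oN Nx ga]]; exact (gen_dense_near lI oN ga Nx). Qed.
Lemma gen_scale a b u x : gen_at a x ->
 (\forall y \near x, cval b y = cval (u * a) y) -> cval u x != 0 -> gen_at b x.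
Proof.
move=> [N [oN Nx ga]] E ux; have [v vE] := n_inv nC ux.
have [W [oW Wx WE]] := nnopen (filterI (filterI (nearby E) (nearby vE)) (nopen oN Nx)).
exists W; split=> //; apply: (gen_by_unit nC oW (u := v)) ga _ => [y /WE[]//|y /WE[[Ey vy] _]].
split; first by apply: contra_eqN (nbhs1 vy) => /eqP ->; rewrite mulr0 eq_sym oner_eq0.
by apply: filterS2 Ey vy => t; rewrite !evC => -> vt; rewrite cvalM mulrA [cval v t * _]mulrC vt mul1r.
Qed.
Lemma gen_unit a b u x : ID b -> gen_at a x -> gen_at b x ->
 (\forall y \near x, cval b y = cval (u * a) y) -> cval u x != 0.
Proof.
move=> Ib ga [N [oN Nx gb]] E; have [Na [oNa Nax ga']] := ga.
have [h Ih ah] := gen_near nC ga' Nax.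
have [v vE] := (gb x Nx a).1 (ex_intro2 _ _ h Ih ah).
have [W [oW Wx WE]] := nnopen (filterI (filterI E vE) (nopen oNa Nax)).
have : cval (v * u) x = cval (1 : CC) x.
 apply: (@dcancel _ _ M W a _ _ oW) Wx => [y /WE[_ Ny]|y /WE[[E1 E2] _]].
  by apply: gen_dense_at; exists Na.
 by move: E1 E2; rewrite !evC => E1 E2; rewrite cval1 mulr1 [RHS]E2 E1 !cvalM; ring.
by rewrite cvalM cval1 => vu; apply: contra_eqN vu => /eqP ->; rewrite mulr0 eq_sym oner_eq0.
Qed.

(** A cutoff supported in a compact part of one chart, with an element of the ideal generating
    there. The condition is void for the zero cutoff, which pads the countable list. *)
Definition loc_piece (ca : CR * CC) := ID ca.2 /\ forall x0, rval ca.1 x0 != 0 -> exists N K c,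
 [/\ open N, gen_by N ID ca.2, compact K, K `<=` N & [/\ compat c, K `<=` dom c &
   forall x, ~ K x -> rval ca.1 x = 0]].
(** Countability: one cutoff is chosen for each basic open set on which some cutoff is identically
    1. *)
Lemma pieces_exist : exists ca : nat -> CR * CC, (forall k, loc_piece (ca k)) /\
 forall x, exists k, \forall y \near x, rval (ca k).1 y = 1.
Proof.
have H x : exists ca, loc_piece ca /\ \forall y \near x, rval ca.1 y = 1.
 have [U [oU Ux [j [f [gF _ _]]]]] := lI x; have [c Mc cx] := atlas_cover x.
 have [a Ia aE] := gen_near nC gF Ux.
 have [N [oN Nx ga]] : gen_at a x.
  apply: (@gen_scale (\prod_i f i) _ 1); first by exists U.
   by apply: filterS aE => y; rewrite !evC mul1r => ->.
  by rewrite cval1 oner_neq0.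
 have [chi [c1 [K [cK kK KN K0]] _]] := @bump_real R n M (N `&` dom c) x (openI oN (@dom_open _ _ _ c)) (conj Nx cx).
 exists (chi, a); split=> //; split=> // x0 _; exists N, K, c; split=> //.
  by move=> y /KN[].
 by split=> // [|y /KN[]//]; exact: atlas_compatP Mc.
have [ca0 caP] := choice H.
have [B /countable_injP[nu nuI] [Bo Bb]] := manifold_countable M.
have nb x : exists2 b, B b /\ b x & b `<=` [set y | rval (ca0 x).1 y = 1].
 have [_ c1] := caP x; have [b [Bb' bx] bs] := Bb x _ c1; by exists b.
have H2 k : exists ca, loc_piece ca /\ forall b, B b -> nu b = k ->
  (exists x, b `<=` [set y | rval (ca0 x).1 y = 1]) -> b `<=` [set y | rval ca.1 y = 1].
 have [[b [Bb' bk [x bx]]]|nE] := pselect (exists b, [/\ B b, nu b = k &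
   exists x, b `<=` [set y | rval (ca0 x).1 y = 1]]).
  exists (ca0 x); split; first by have [] := caP x.
  by move=> b' Bb2 b'k _; have -> : b' = b by apply: nuI; rewrite ?inE ?b'k ?bk.
 exists (0, 0); split; last by move=> b Bb' bk bx; case: nE; exists b.
 by split=> [|x0]; [exact: ideal0|rewrite rval0 eqxx].
have [ca caE] := choice H2; exists ca; split=> [k|x]; first by have [] := caE k.
have [b [Bb' bx] bs] := nb x; exists (nu b); have [_ /(_ b Bb' erefl) bs'] := caE (nu b).
apply: filterS (nopen (Bo _ Bb') bx) => y; apply: bs'; by exists x.
Qed.

(** It vanishes wherever an earlier cutoff equals 1, so adding multiples of it does not alter what
    has been achieved there. *)
Definition lead k (ca : nat -> CR * CC) : CR := (ca k).1 * \prod_(j < k) (1 - (ca j).1).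
Definition covered k (ca : nat -> CR * CC) : set M := [set x | exists2 j, (j < k)%N & rval (ca j).1 x = 1].
Definition generates (S : 'I_n.+1 -> CC) x := exists i, gen_at (S i) x.
Lemma rval_prod k (F : 'I_k -> CR) x : rval (\prod_j F j) x = \prod_j rval (F j) x.
Proof. exact: (n_prod nR). Qed.
Lemma lead_covered k ca x : covered k ca x -> rval (lead k ca) x = 0.
Proof.
move=> [j jk c1]; rewrite /lead rvalM rval_prod (bigD1 (Ordinal jk)) //= rvalB rval1 c1 subrr.
by rewrite mul0r mulr0.
Qed.
Lemma lead_uncovered k ca x : rval (ca k).1 x = 1 -> rval (lead k ca) x = 0 -> covered k ca x.
Proof.
rewrite /lead rvalM => ->; rewrite mul1r rval_prod => /eqP/prodf_eq0[j _].
by rewrite rvalB rval1 subr_eq0 => /eqP E; exists j; rewrite ?ltn_ord.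
Qed.
Lemma chart_lipschitz c K (f : CR) : compat c -> compact K -> K `<=` dom c ->
 (forall x, ~ K x -> rval f x = 0) -> exists2 L : R, 0 <= L & forall x y, K x -> K y ->
 `|rval f x - rval f y| <= L * `|cmap c x - cmap c y|.
Proof.
move=> cc cK Kc f0; have cI : compact (cmap c @` K).
 apply: continuous_compact => //; apply: cont_subT => x /set_mem Kx.
 by apply: cmap_cont; exact: Kc.
have [B B0 HB] := cpt_norm_bound cI.
have [L L0 HL] := lipschitz_box B (push_smooth cc cK Kc f0).
exists L => // x y Kx Ky; have := HL (cmap c y) (cmap c x).
by rewrite !pushE; [apply; apply: HB; [exists y|exists x]|exact: Kc|exact: Kc].
Qed.

Section Step.
Variables (ca : nat -> CR * CC) (k : nat) (S : 'I_n.+1 -> CC).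
Hypotheses (pc : loc_piece (ca k)) (SI : forall i, ID (S i)).
Hypothesis Sg : forall x, covered k ca x -> generates S x.
Local Notation psi := (lead k ca).
Local Notation a := (ca k).2.
Let next (b : 'I_n.+1 -> R) i : CC := S i + tc (real_cst M (b i) * psi) * a.
Lemma step_covered b x : covered k ca x -> generates (next b) x.
Proof.
move=> cx; have [i gi] := Sg cx; exists i; have [N [oN Nx gN]] := gi.
have [al alE] := (gN x Nx a).1 (nin_mem x pc.1).
apply: (@gen_scale (S i) _ (1 + tc (real_cst M (b i) * psi) * al)) => //.
 by apply: filterS alE => y; rewrite !evC => Ey; rewrite cvalD cvalM Ey !cvalM cvalD cvalM cval1; ring.
by rewrite cvalD cvalM cval_tc rvalM lead_covered // mulr0 mul0r addr0 cval1 oner_neq0.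
Qed.
Lemma quotients N K : open N -> gen_by N ID a -> compact K -> K `<=` N ->
 (forall x, ~ K x -> rval (ca k).1 x = 0) -> exists v : 'I_n.+1 -> CC,
 forall i, (forall x, ~ K x -> cval (v i) x = 0) /\
 forall x, N x -> \forall y \near x, cval (v i * a) y = cval (tc (ca k).1 * S i) y.
Proof.
move=> oN ga cK KN K0; have clK : closed K by apply: compact_closed => //; exact: manifold_hausdorff.
have oK : open (~` K) by exact: closed_openC.
have c0 y : N y \/ \forall t \near y, rval (ca k).1 t = 0.
 have [Ky|nK] := pselect (K y); first by left; exact: KN.
 by right; apply: filterS (nopen oK nK) => t; exact: K0.
have [v vE] := choice (fun i => quot_exists lI oN ga c0 (SI i)).
exists v => i; have [E v0] := vE i; split=> [x nK|x _]; last by apply: nearW => y; rewrite E.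
by apply: v0; apply: filterS (nopen oK nK) => t; exact: K0.
Qed.

(** Where the new cutoff is 1, S_i = v_i a, so the modified family is (v_i + b_i psi) a and b must
    prevent a common zero of these coefficients. Zeros can only occur on a compact set T, on which
    psi is nonzero because S already generates where the cutoff is 1 and psi = 0. There the map with
    components -re(v_i) / psi is Lipschitz from an n-dimensional chart, so it misses some b in the
    unit cube of dimension n + 1. *)
Lemma gen_next : exists b, forall x, covered k.+1 ca x -> generates (next b) x.
Proof.
have [[x0 x0n]|n0] := pselect (exists x, rval (ca k).1 x != 0); last first.
 exists (fun=> 0) => x [j]; rewrite ltnS leq_eqVlt => /orP[/eqP ->|jk] c1; last by apply: step_covered; exists j.
 by case: n0; exists x; rewrite c1 oner_neq0.
have [_ /(_ x0 x0n)[N [K [c [oN ga cK KN [cc Kc K0]]]]]] := pc.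
have [v vE] := quotients oN ga cK KN K0.
have gax x : N x -> gen_at a x by move=> Nx; exists N.
have val x i : rval (ca k).1 x = 1 -> N x -> exists2 w : CC,
  (\forall y \near x, cval (S i) y = cval (w * a) y) & cval w x = cval (v i) x.
 move=> c1 Nx; have [w wE] := (ga x Nx (S i)).1 (nin_mem x (SI i)).
 have wE' : \forall y \near x, cval (S i) y = cval (w * a) y by apply: filterS wE => y; rewrite !evC cvalM.
 exists w => //; have [_ /(_ x Nx) E] := vE i.
 have [W [oW Wx WE]] := nnopen (filterI (filterI E wE') (nopen oN Nx)).
 have : cval (tc (ca k).1 * w) x = cval (v i) x.
  apply: (@dcancel _ _ M W a _ _ oW) Wx => y /WE[[E1 E2] Ny].
   by apply: gen_dense_at; exact: gax.
  by rewrite -!cvalM [a * v i]mulrC E1 cvalM [RHS]cvalM E2 !cvalM cval_tc; ring.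
 by rewrite cvalM cval_tc c1 mul1r.
(* A common zero of the v_i + b_i psi with all b_i in [0, 1] lies in T; the bound by |psi| also
   keeps the quotients Lipschitz. *)
pose T : set M := [set x | rval (ca k).1 x = 1 /\ forall i, rval (im (v i)) x = 0 /\ `|rval (re (v i)) x| <= `|rval psi x|].
have TK x : T x -> K x.
 by move=> [c1 _]; apply: contrapT => /K0; rewrite c1 => /eqP; rewrite oner_eq0.
have psi0 x : T x -> rval psi x != 0.
 move=> Tx; apply/negP => /eqP p0; have [c1 Ti] := Tx; have cx := lead_uncovered c1 p0.
 have [i gi] := Sg cx; have [w wE wv] := val x i c1 (KN _ (TK _ Tx)).
 have := gen_unit (SI i) (gax _ (KN _ (TK _ Tx))) gi wE; rewrite wv eq_complex -rval_re -rval_im.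
 by have [-> ] := Ti i; rewrite p0 normr0 normr_le0 => ->; rewrite /= eqxx.
have cT : compact T.
 apply: subclosed_compact cK TK.
 have -> : T = [set x | rval (ca k).1 x = 1] `&` \bigcap_(i in [set: 'I_n.+1])
   ([set x | rval (im (v i)) x = 0] `&` [set x | rval (re (v i)) x ^+ 2 <= rval psi x ^+ 2]).
  have sq (r t : R) : (`|r| <= `|t|) = (r ^+ 2 <= t ^+ 2).
   by rewrite -(real_normK (num_real r)) -(real_normK (num_real t)) ler_sqr // nnegrE.
  apply/seteqP; split=> x /=.
   by move=> [-> H]; split=> // i _; have [h1 h2] := H i; split=> //=; rewrite -sq.
  by move=> [c1 H]; split=> // i; have [h1 /= h2] := H i Logic.I; rewrite sq.
 have ce (f : CR) (r : R) : closed [set x | rval f x = r].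
  have -> : [set x | rval f x = r] = rval f @^-1` [set r] by [].
  by apply: closed_comp; [move=> x _; exact: rval_cont|exact: closed_eq].
 apply: closedI; first exact: ce.
 apply: closed_bigI => i _; apply: closedI; first exact: ce.
 have -> : [set x | rval (re (v i)) x ^+ 2 <= rval psi x ^+ 2] =
   rval ((re (v i) : CR) * re (v i) - psi * psi) @^-1` [set r | r <= 0].
  by apply/seteqP; split=> x /=; rewrite rvalB !rvalM subr_le0 !expr2.
 by apply: closed_comp; [move=> x _; exact: rval_cont|exact: closed_le].
have [D D0 HD] : exists2 D : R, 0 <= D & forall x, T x -> `|rval psi x|^-1 <= D.
 have cI : compact ((fun x => (rval psi x)^-1) @` T).
  apply: continuous_compact => //; apply: cont_subT => x /set_mem Tx.
  by apply: continuousV; [exact: psi0|exact: rval_cont].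
 have [D D0 HD] := cpt_norm_bound cI; exists D => // x Tx.
 by rewrite -normfV; apply: HD; exists x.
have psiK x : ~ K x -> rval psi x = 0 by move=> /K0 c0; rewrite /lead rvalM c0 mul0r.
have vK i x : ~ K x -> rval (re (v i)) x = 0 by move=> nK; have [v0 _] := vE i; rewrite rval_re v0.
have [L1 L10 HL1] := chart_lipschitz cc cK Kc psiK.
have H2 i : exists L : R, 0 <= L /\ forall x y, K x -> K y ->
  `|rval (re (v i)) x - rval (re (v i)) y| <= L * `|cmap c x - cmap c y|.
 by have [L L0 HL] := chart_lipschitz cc cK Kc (vK i); exists L.
have [L2 HL2] := choice H2.
have cIK : compact (cmap c @` K).
 apply: continuous_compact => //; apply: cont_subT => x /set_mem Kx.
 by apply: cmap_cont; exact: Kc.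
have [B B0 HB] := cpt_norm_bound cIK.
pose G x (i : 'I_n.+1) : R := - rval (re (v i)) x / rval psi x.
have [||b [b01 bG]] := @lipschitz_misses R n M T (cmap c) G B (D * (L1 + \sum_i L2 i)).
- by move=> x /TK Kx; apply: HB; exists x.
- move=> x y i Tx Ty; have px := psi0 _ Tx; have py := psi0 _ Ty.
 set Q := `|cmap c x - cmap c y|; have Q0 : 0 <= Q by exact: normr_ge0.
 have E : G x i - G y i = (rval psi y)^-1 * ((rval (re (v i)) y - rval (re (v i)) x) +
   rval (re (v i)) x / rval psi x * (rval psi x - rval psi y)).
  by rewrite /G; field; rewrite px py.
 rewrite E normrM normfV -[leRHS]mulrA; apply: ler_pM; [by rewrite invr_ge0|exact: normr_ge0|exact: HD|].
 rewrite (le_trans (ler_normD _ _)) // mulrDl addrC lerD //.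
  have q1 : `|rval (re (v i)) x / rval psi x| <= 1.
   by rewrite normrM normfV ler_pdivrMr ?normr_gt0 // mul1r; have [_ /(_ i)[]] := Tx.
  rewrite normrM (le_trans (y := 1 * `|rval psi x - rval psi y|)) ?ler_wpM2r // mul1r.
  by apply: HL1; exact: TK.
 rewrite distrC (le_trans (y := L2 i * Q)) //; first by have [_] := HL2 i; apply; exact: TK.
 rewrite ler_wpM2r // (bigD1 i) //= lerDl sumr_ge0 // => l _; by have [] := HL2 l.
exists b => x [j]; rewrite ltnS leq_eqVlt => /orP[/eqP ->|jk] c1; last by apply: step_covered; exists j.
have [cx|ncx] := pselect (covered k ca x); first exact: step_covered.
have Kx : K x by apply: contrapT => /K0; rewrite c1 => /eqP; rewrite oner_eq0.
have Nx := KN _ Kx.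
have [i ne] : exists i, cval (v i) x + (b i * rval psi x)%:C != 0.
 apply: contrapT => H.
 have all i : rval (re (v i)) x = - (b i * rval psi x) /\ rval (im (v i)) x = 0.
  have : cval (v i) x + (b i * rval psi x)%:C == 0.
   by apply/negPn/negP => h; apply: H; exists i.
  rewrite rval_re rval_im; case: (cval (v i) x) => p q; rewrite eq_complex /= addr0 => /andP[/eqP E1 /eqP ->].
  by split=> //; apply/eqP; rewrite -addr_eq0 E1.
 have Tx : T x.
  split=> // i; have [E1 E2] := all i; rewrite E1 E2; split=> //.
  have /andP[b0 b1] := b01 i; rewrite normrN normrM -[leRHS]mul1r ler_wpM2r // ger0_norm //.
 have [i /eqP] := bG x Tx; apply; have [E1 _] := all i.
 by rewrite /G E1 opprK mulfK // psi0.
exists i; have [w wE wv] := val x i c1 Nx.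
apply: (@gen_scale a _ (w + tc (real_cst M (b i) * psi))); first exact: gax.
 by apply: filterS wE => y Ey; rewrite cvalD Ey !cvalM cvalD; ring.
by rewrite cvalD wv cval_tc rvalM rval_cst.
Qed.
End Step.

(** The successive modifications stabilise near every point, because all later leads vanish where a
    cutoff equals 1; the limit is smooth and generates everywhere. *)
Lemma finite_gens : exists S : 'I_n.+1 -> CC, (forall i, ID (S i)) /\ forall x, generates S x.
Proof.
have [ca [pc cov]] := pieces_exist.
pose next k (S : 'I_n.+1 -> CC) (b : 'I_n.+1 -> R) i : CC := S i + tc (real_cst M (b i) * lead k ca) * (ca k).2.
have H (kS : nat * ('I_n.+1 -> CC)) : exists b, (forall i, ID (kS.2 i)) ->
  (forall x, covered kS.1 ca x -> generates kS.2 x) ->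
  forall x, covered kS.1.+1 ca x -> generates (next kS.1 kS.2 b) x.
 case: kS => k S /=; have [SI|nS] := pselect (forall i, ID (S i)); last by exists (fun=> 0).
 have [Sg|nS] := pselect (forall x, covered k ca x -> generates S x); last by exists (fun=> 0).
 by have [b bE] := gen_next (pc k) SI Sg; exists b.
have [bb bbE] := choice H.
pose SS := fix SS k := if k is k'.+1 then next k' (SS k') (bb (k', SS k')) else fun=> 0.
have SID k i : ID (SS k i).
 elim: k i => [|k IH] i /=; first exact: ideal0.
 by apply: idealD => //; apply: idealM; have [] := pc k.
have Sg k x : covered k ca x -> generates (SS k) x.
 elim: k x => [|k IH] x; first by case.
 exact: (bbE (k, SS k) (fun i => SID k i) IH).
have stab k m i x : rval (ca k).1 x = 1 -> (k < m)%N -> cval (SS m i) x = cval (SS k.+1 i) x.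
 move=> c1; elim: m => // m IH; rewrite ltnS leq_eqVlt => /orP[/eqP ->//|km].
 rewrite [SS m.+1]/= /next cvalD cvalM cval_tc rvalM lead_covered; last by exists k.
 by rewrite mulr0 mul0r addr0 IH.
have [kk kE] := choice cov.
have Sloc i p : \forall y \near p, cval (SS (kk y).+1 i) y = cval (SS (kk p).+1 i) y.
 apply: filterS (kE p) => y c1; have c2 := nbhs1 (kE y).
 pose m := (maxn (kk y) (kk p)).+1.
 by rewrite -(stab _ m i _ c1) ?ltnS ?leq_maxr // -(stab _ m i _ c2) ?ltnS ?leq_maxl.
have H3 i : exists s : CC, forall y, cval s y = cval (SS (kk y).+1 i) y.
 by apply: (glue_complex (F := fun y => cval (SS (kk y).+1 i) y)) => p; exists (SS (kk p).+1 i); exact: Sloc.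
have [S SE] := choice H3.
have SE' i p : \forall y \near p, cval (S i) y = cval (SS (kk p).+1 i) y.
 by apply: filterS (Sloc i p) => y <-; exact: SE.
exists S; split=> [i|x].
 apply: loc => x; exists (SS (kk x).+1 i); first exact: SID.
 by apply: filterS (SE' i x) => y; rewrite !evC.
have [|i gi] := Sg (kk x).+1 x; first by exists (kk x); rewrite ?ltnSn //; exact: nbhs1 (kE x).
exists i; apply: (@gen_scale _ _ 1 _ gi); last by rewrite cval1 oner_neq0.
by apply: filterS (SE' i x) => y ->; rewrite cvalM cval1 mul1r.
Qed.

(** The sum Q of the |S_i|^2 generates the induced ideal near every point. So q is locally a
    multiple of Q, the multiplier is unique and global, and q is an honest finite sum. *)
Lemma hsum_local q : (forall x, exists2 q', hsum ID (tc q') & \forall y \near x, rval q y = rval q' y) ->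
 hsum ID (tc q).
Proof.
move=> lq; have [S [SI Sg]] := finite_gens.
pose Q : CR := \sum_i nq (S i).
have QE : tc Q = \sum_i S i * conjA (S i) by rewrite /Q tc_sum; apply: eq_bigr => i _; rewrite nqE.
have IQ : hsum ID (tc Q) by rewrite QE; apply: hsum_big => i; exact: hsum1.
have div x : exists h : CR, \forall y \near x, rval (Q * h) y = rval q y.
 have [i [N [oN Nx gN]]] := Sg x.
 have [u uE] := choice (fun l => (gN x Nx (S l)).1 (nin_mem x (SI l))).
 have [q' Iq' qE] := lq x; have [c cE] := hsum_near gN Nx Iq'.
 pose P : CR := \sum_l nq (u l).
 have QP : \forall y \near x, rval Q y = rval (P * nq (S i)) y.
  have : \forall y \near x, forall l, cval (S l) y = cval (u l * S i) y.
   apply: filter_forall => l; apply: filterS (uE l) => y; rewrite !evC cvalM //.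
  apply: filterS => y H; rewrite /Q /P mulr_suml !rval_sum; apply: eq_bigr => l _.
  rewrite -nqM; apply: (@complexI R); rewrite -!cval_tc !nqE cvalM cval_conj H.
  by rewrite [RHS]cvalM [X in _ = _ * X]cval_conj.
 have P0 : ev P x != 0.
  have ui : cval (u i) x != 0.
   apply: (@gen_unit (S i) (S i) (u i) x (SI i)); try by exists N.
   by apply: filterS (uE i) => y; rewrite !evC cvalM.
  rewrite evR /P rval_sum psumr_neq0; last first.
   by move=> l _; rewrite nq_sq rvalD !rvalM -!expr2 addr_ge0 ?sqr_ge0.
  apply/hasP; exists i; first by rewrite mem_index_enum.
  rewrite /= lt_def nq_eq0 ui nq_sq rvalD !rvalM -!expr2 addr_ge0 ?sqr_ge0 //.
 have [v vE] := n_inv nR P0; exists (v * re c).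
 apply: filterS (filterI (filterI QP qE) (filterI vE cE)) => y [[E1 E2] [E3 E4]].
 rewrite rvalM E1 E2 !rvalM; move: E4; rewrite -nqE !cval_tc => /(congr1 (@complex.Re R)).
 move: E3; rewrite !evR rval_re; case: (cval c y) => c1 c2 /= E3; rewrite mul0r subr0 => ->.
 by rewrite mulrACA E3 mul1r.
have [h hE] : exists h : CR, forall k : unit, Q * h = q.
 apply: (@solve_locally _ _ _ nR unit (fun=> Q) (fun=> q)) => [x N Nx|x]; last first.
  by have [h hE] := div x; exists h; apply: filterS hE => y E _.
 have [y Ny ey] := log_zeros_dense lI Nx; exists y => //; exists tt; apply/negP => /eqP Q0.
 apply: ey => e Ie; have [i [U [oU Uy gU]]] := Sg y.
 have [k kE] := (gU y Uy e).1 (nin_mem y Ie).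
 suff S0 : cval (S i) y = 0 by rewrite (nbhs1 kE) [ev (S i) y]S0 mulr0.
 apply/eqP; rewrite -nq_eq0.
 have := Q0; rewrite evR /Q rval_sum => /eqP; rewrite psumr_eq0; last first.
  by move=> l _; rewrite nq_sq rvalD !rvalM -!expr2 addr_ge0 ?sqr_ge0.
 by move=> /allP/(_ i); rewrite mem_index_enum => /(_ isT).
by rewrite -(hE tt) mulrC to_complexM; exact: hsumM.
Qed.
End Generators.

(** * The correspondence *)

Lemma ideal_ext (K : fieldType) (X : Type) (A : falg K X) (I I' : ideal A) :
 (forall f, I f <-> I' f) -> I = I'.
Proof.
case: I I' => [I I0 ID IM] [I' I0' ID' IM'] /= H.
have E : I = I' by fext => f; exact/propext.
by subst I'; congr Ideal; exact: Prop_irrelevance.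
Qed.

Section Correspondence.
Variables (R : realType) (n : nat) (M : manifold R n).
Local Notation CR := (CR M).
Local Notation CC := (CC M).
Local Notation TR := (vect (idealT CR)).
Local Notation tc := (@toCx R n M : CR -> CC).
Local Notation ii := (ccst M 'i : CC).
Implicit Types (ID : ideal CC) (I : ideal CR) (p x : M) (Y Z : TR) (g : gstructure M)
 (t : elliptic_triple M).
Let nC := nice_CC M.
Let nR := nice_CR M.

Section Existence.
Variable ID : ideal CC.

Fact induced0 : hsum ID (tc 0). Proof. by rewrite to_complex0; exact: hsum0. Qed.
Fact inducedD (f g : CR) : hsum ID (tc f) -> hsum ID (tc g) -> hsum ID (tc (f + g)).
Proof. by rewrite to_complexD; exact: hsumD. Qed.
Fact inducedM (f g : CR) : hsum ID (tc g) -> hsum ID (tc (f * g)).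
Proof. by rewrite to_complexM; exact: hsumM. Qed.

Definition induced : ideal CR := @Ideal _ _ CR (fun q => hsum ID (tc q)) induced0 inducedD inducedM.
Definition ind_coor p Y Z := C1 induced p /\ exists (U : set M) (f : CC),
 [/\ open U, U p, gen_by U ID f &
   0 < complex.Im ((ev (cvec Y f) p)^*%C * ev (cvec Z f) p)].
Lemma ind_induces : induces ID induced ind_coor.
Proof.
split=> // f; split=> [[fr fi]|hf].
 have : hsum ID f; last by [].
 by rewrite [f]smooth_complexE; apply: hsumD => //; exact: hsumM.
have hf' : hsum ID f by exact: hf.
have hc := hsum_conj hf'; split; rewrite /= ?tcRe ?tcIm; apply: hsumM; apply: hsumD => //.
by rewrite -mulN1r; exact: hsumM.
Qed.

Variable I : ideal CR.
Hypotheses (ld : log_divisor ID) (in1 : forall f, I (re f) /\ I (im f) <-> hsum ID f).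
Let lI : locally_log ID := ld.2.
Let loc : loc_ideal ID := div_ideal_local nC ld.1.
Lemma ind_elliptic : elliptic_divisor I.
Proof.
split.
 apply: (div_ideal_intro nR) => [q lq|p|x N Nx].
 - apply/(ind_mem in1); apply: (hsum_local lI loc) => x; have [q' Iq' E] := lq x.
  by exists q' => //; apply/(ind_mem in1).
 - have [U [oU Up [j [f [gF _ _]]]]] := lI p; exists U, (nq (\prod_i f i)); split=> //.
  exact: (nq_gen in1).
 - have [y Ny ey] := log_zeros_dense lI Nx; exists y => // H; apply: ey => e Ie.
  by apply/eqP; rewrite evC -nq_eq0 -evR H //; exact: (ind_norm in1).
move=> p; have [U [oU Up [j [f lp]]]] := lI p; have [gF _ _] := lp; exists j, U; split=> //.
by exists (fun i => nq (f i)); apply: (elliptic_of_log in1) => //; exact: log_fam lp.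
Qed.
End Existence.

(** Near a smooth point z = z' a + zbar' b for generators z and z' of the two ideals, which have the
    same zeros. Equal orientations make a a unit. Since |z'|^2 divides |z|^2, z' divides b abar
    zbar', hence b, so z is a multiple of z'. *)
Lemma div_determined ID ID' I o : locally_log ID -> loc_ideal ID' -> locally_log ID' ->
 induces ID I o -> induces ID' I o -> forall f, ID f -> ID' f.
Proof.
move=> lI loc' lI' [in1 in2] [in1' in2'] f If; apply: loc' => x0; move: x0.
apply: (log_near_in lI') => x [W' [z' [Wx' sg']]]; have [oW' gz' tz'] := sg'.
have [e' Ie' e'E] := gen_near nC gz' Wx'.
have [z0|zn0] := eqVneq (cval z' x) 0; last first.
 have en : ev e' x != 0 by rewrite -(nbhs1 e'E).
 exact (near_in_unit nC _ Ie' en).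
have Cx : C1 I x by exact/(C1_near lI' in1' x sg' Wx').
have [[W [z [Wx sg]]] _] := (C1_simple lI in1 x).1 Cx; have [oW gz tz] := sg.
have [D [X [nf Dx]]] := nform_exists (tz' _ Wx' z0).
have [a [b abE]] : exists a b : CC, \forall y \near x,
  cval z y = cval z' y * cval a y + cval (conjA z') y * cval b y.
 apply: (@nf_had _ _ _ _ _ _ nf (D `&` (W `&` W'))) => //.
 - by apply: openI; [exact: nf_open nf|exact: openI].
 - by move=> y [_ [Wy Wy']] zy; apply/(C1_near lI in1 x sg Wy)/(C1_near lI' in1' x sg' Wy').
have zc0 : cval (conjA z') x = 0 by rewrite cval_conj z0 conjc0.
have VE Y : cval (cvec Y z) x = cval a x * cval (cvec Y z') x +
  cval b x * (cval (cvec Y z') x)^*%C.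
 have E : \forall y \near x, ev z y = ev (z' * a + conjA z' * b) y.
  by apply: filterS abE => y Ey; rewrite evC Ey !cvE.
 have Yc : cvec Y (conjA z') = conjA (cvec Y z').
  by rewrite -[in LHS](conj_cvec Y) cjvecE conjAK.
 rewrite -[LHS]evC (nbhs1 (vect_local nC _ E)) vectD !vectM Yc evC !cvalD !cvalM z0 zc0.
 by rewrite !mul0r !addr0 cval_conj mulrC [X in _ + X]mulrC.
have nE Y Z : ndet (re z) (im z) x Y Z = (complex.Re (cval a x) ^+ 2 + complex.Im (cval a x) ^+ 2 -
  (complex.Re (cval b x) ^+ 2 + complex.Im (cval b x) ^+ 2)) * ndet (re z') (im z') x Y Z.
 rewrite -!im_ndet !evC !VE; case: (cval a x) (cval b x) => [a1 a2] [b1 b2].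
 by case: (cval (cvec Y z') x) (cval (cvec Z z') x) => [c1 c2] [d1 d2] /=; ring.
(* The oriented areas differ by the factor |a|^2 - |b|^2, which must be positive. *)
have an : ev a x != 0.
 have [Y [Z YZ]] : exists Y Z, 0 < ndet (re z') (im z') x Y Z.
  have [Y [Z YZ]] := transv_ndet (tz' _ Wx' z0).
  case: (ltrgt0P (ndet (re z') (im z') x Y Z)) YZ => // H _; first by exists Y, Z.
  by exists Z, Y; move: H; rewrite /ndet; lra.
 have := (orientedP lI in1 in2 Y Z sg Wx Cx).1 ((orientedP lI' in1' in2' Y Z sg' Wx' Cx).2 YZ).
 rewrite nE pmulr_lgt0 // evC; case: (cval a x) => a1 a2 /=; apply: contraTneq => -[-> ->].
 rewrite -leNgt !expr0n /= addr0 sub0r oppr_le0; exact: addr_ge0 (sqr_ge0 _) (sqr_ge0 _).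
have [e Ie eE] := gen_near nC gz Wx.
have /(hsum_near gz' Wx') [c cE] : hsum ID' (e * conjA e).
 by rewrite -nqE; apply/(ind_mem in1'); exact: (ind_norm in1).
have E0 : \forall y \near x, cval (conjA z') y * cval (b * conjA a * conjA z') y =
  cval z' y * cval ((c - a * conjA a - b * conjA b) * conjA z' - a * conjA b * z') y.
 apply: filterS (filterI (filterI abE eE) cE) => y [[Ea Ee] Ec].
 have Ee' : cval e y = cval z' y * cval a y + (cval z' y)^*%C * cval b y.
  by rewrite -evC -Ee evC Ea cval_conj.
 move: Ec; rewrite !cvalM !cval_conj Ee' !(rmorphD, rmorphM) /= conjcK => Ec.
 rewrite !cvE.
 set zz := (cval z' y)^*%C in Ec *; set aa := (cval a y)^*%C in Ec *; set bb := (cval b y)^*%C in Ec *.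
 transitivity ((cval z' y * cval a y + zz * cval b y) * (zz * aa + cval z' y * bb) -
  cval z' y * cval a y * zz * aa - zz * cval b y * cval z' y * bb - cval z' y * cval a y * cval z' y * bb).
  by ring.
 by rewrite Ec; ring.
have [k kE] := conj_divides (tz' _ Wx' z0) E0.
have [k2 k2E] : dvd x z' (b * conjA a).
 apply: (@conj_divides _ _ M z' _ k) (tz' _ Wx' z0) _; apply: filterS kE => y.
 by rewrite cvalM mulrC.
have acn : ev (conjA a : CC) x != 0 by rewrite evC conjA_eq0.
have [v vE] := n_inv nC acn.
have [m mE] := (gz _ Wx f).1 (nin_mem x If).
exists (m * (a + k2 * v * conjA z') * e'); first exact: idealM.
apply: filterS (filterI (filterI (filterI abE e'E) (filterI k2E vE)) mE) => y [[[Ea Ee] [Ek Ev]] ->].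
move: Ea Ee Ek Ev; rewrite !evC => Ea Ee Ek Ev; rewrite Ea !cvalM cvalD !cvalM -Ee.
have -> : cval b y = cval z' y * cval k2 y * cval v y.
 by rewrite -Ek cvalM -mulrA Ev mulr1.
by ring.
Qed.

Section RealForms.
Variables (ID : ideal CC) (I : ideal CR) (rp : real_part ID I).
Local Notation lift := (liftv rp).

Lemma lift_uniq k (V : 'I_k -> vect I) (V' : 'I_k -> vect ID) :
 (forall i, anc (V' i) = cvec (anc (V i))) -> V' = fun i => lift (V i).
Proof. by move=> H; fext => i; apply: anchor_inj; rewrite H liftE. Qed.
Lemma lift_bracket (A B : vect I) : lift (bracket A B) = bracket (lift A) (lift B).
Proof.
apply: anchor_inj; rewrite liftE.
have -> : anc (bracket A B) = bracket (anc A) (anc B) by exact: vect_inj.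
rewrite cvec_bracket -!(liftE rp); exact: vect_inj.
Qed.
Lemma im_sum m (P : pred 'I_m) (F : 'I_m -> CC) : im (\sum_(i < m | P i) F i) = \sum_(i < m | P i) (im (F i) : CR).
Proof. by apply: (big_morph (@im R n M : CC -> CR)) => [f g|]; [exact: imD|exact: im0]. Qed.
Lemma im_dif k (s : kform ID k) (w : kform I k) :
 (forall V, w V = im (s (fun i => lift (V i)))) ->
 forall V, dif w V = im (dif s (fun i => lift (V i))).
Proof.
move=> wE V; rewrite /dif im_sum; apply: eq_bigr => j _.
rewrite -tc_sign im_to_complexM imD im_sum; congr (_ * (_ + _)).
 rewrite wE -[lift (V j) _]/(anc (lift (V j)) _) liftE.
 by rewrite -[cvec _ _]/(tc _ + ii * tc _) imD im_tc imM_i re_tc add0r.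
apply: eq_bigr => l _; rewrite wE; congr (im (s _)).
by rewrite lift_upd lift_bracket.
Qed.
End RealForms.

(** Ideals and co-orientations are extensional and a section of the algebroid is determined by its
    anchor, so isomorphism of triples is equality. *)
Lemma isomorphic_eq (t t' : elliptic_triple M) : isomorphic_triples t t' <-> t = t'.
Proof.
split=> [[EI Eo Ef]|->]; last by split=> // V V' H; congr (@et_form _ _ _ _ _); fext => i; exact: anchor_inj.
case: t t' EI Eo Ef => [I o w] [I' o' w'] /= EI; have E := @ideal_ext _ _ CR _ _ EI; subst I' => Eo Ef.
have E : o = o' by fext => p; fext => Y; fext => Z; exact/propext.
by subst o'; congr EllipticTriple; fext => V; exact: Ef.
Qed.
(** Common to the construction of structures and to gauge transformations: once the eigensections
    are the graph of s, both the anticanonical ideal and the ratio rho_2 / rho_0 can be read off. *)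
Lemma assigned_intro g (t : elliptic_triple M) ID (s : kform ID 2) (h : kform (idealT CR) 3) :
 locally_log ID -> loc_ideal ID -> forall rp : real_part ID (et_ideal t),
 induces ID (et_ideal t) (et_coor t) -> is_form s -> is_form h ->
 dif s = pull (cform h) -> Defs.nondegenerate (@et_form _ _ _ t) ->
 (forall V, @et_form _ _ _ t V = im (s (fun i => liftv rp (V i)))) ->
 (forall u, eigsec g u <-> graph s u) ->
 assigned g t /\ forall f, ID f <-> anti_ideal g f.
Proof.
move=> lI loc rp ind fs fh dsh nw wE rep.
have ws A B : @et_form _ _ _ t (v2 A B) = im (s (v2 (liftv rp A) (liftv rp B))).
 by rewrite wE [X in s X]v2_eta /v2 vconsE0 vconsES.
have IE f : ID f <-> anti_ideal g f.
 split; first exact: (antican_sup lI loc fs rep).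
 exact: (antican_sub lI loc fs nw ws rep).
have ip : Im_pullback s (@et_form _ _ _ t).
 by move=> V; exists (fun i => liftv rp (V i)); split=> // i; exact: liftE.
split=> //; exists ID; split=> //; exists s; split=> //; first exact: (graph_is_ratio lI fs rep).
by split=> //; [exists h|exists (@et_form _ _ _ t)].
Qed.

Lemma stable_assigned g : stable g -> exists2 t, symplectic_triple t & assigned g t.
Proof.
move=> [gc _ ll]; have lI := anti_log ll; have loc := anti_local gc ll.
have ind := ind_induces (anti g); have [in1 in2] := ind.
have rp : real_part (anti g) (induced (anti g)) by exact: (ind_real_part lI loc in1).
pose s := log_form gc ll; pose w := real_form gc ll rp.
pose t := @EllipticTriple R n M (induced (anti g)) (ind_coor (anti g)) w.
have fs : is_form s by exact: log_form_form.
have [fH _] : is_form (gs_H g) /\ is_closed (gs_H g) by have [] := gc.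
have fN : is_form (- gs_H g) by exact: is_formN.
have ds := log_form_dif gc ll; rewrite -/s in ds.
have ld := anti_div gc ll.
exists t; last first.
 by have [] := @assigned_intro g t _ s _ lI loc rp ind fs fN ds
  (real_form_ndeg gc ll rp) (fun=> erefl) (eigen_graph gc ll).
split=> /=.
- exact: (ind_elliptic ld in1).
- exact: (ind_co_orientation lI in1 in2).
- split; [exact: real_form_form| |exact: real_form_ndeg].
 fext => V; rewrite (im_dif (s := s) (rp := rp) (fun=> erefl)) ds /pull.
 have -> : (fun i => anc (liftv rp (V i))) = fun i => cvec (anc (V i)).
  by fext => i; exact: liftE.
 by rewrite cform_real // im_tc.
- exists (anti g); split=> //; exists s => // V.
 by exists (fun i => liftv rp (V i)); split=> // i; exact: liftE.
Qed.

(** The form in [assigned] can only be [log_form]: both equal rho_2 / rho_0 wherever some rho_0 is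
    nonzero, a dense set. *)
Lemma assigned_form g (gc : generalized_complex g) (ll : locally_log (anti_ideal g)) t :
 assigned g t -> induces (anti g) (et_ideal t) (et_coor t) /\
 forall V V', (forall i, anc (V' i) = cvec (anc (V i))) ->
  @et_form _ _ _ t V = im (log_form gc ll V').
Proof.
move=> [ID [IE ind [s [sr [fs _ _] ip]]]].
have E : ID = anti g by exact: (@ideal_ext _ _ CC ID (anti g) IE).
subst ID; split=> // V V' VV'; have [V2 [V2E ->]] := ip V.
have <- : V2 = V' by fext => i; apply: anchor_inj; rewrite V2E VV'.
congr im; apply: cval_inj => y; apply: (anti_nz ll (W := setT)) => // [|e x Ie _]; first exact: openT.
have [rho cr eE] := Ie; have [->|ex] := eqVneq (cval e x) 0; first by rewrite !mul0r.
have [W [oW Wx We]] := nnopen (n_open nC ex).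
have nv : nonvanishing_on W rho.
 by move=> q /We; rewrite eE => H; exists 0%N, (fun=> 0).
have := sr W rho oW cr nv V2 x Wx; rewrite -eE evC cvalM mulrC => ->.
rewrite -cvalM eE; have := @log_formE _ _ _ _ gc ll rho (V2 ord0) (V2 (lift ord0 ord0)) cr.
by rewrite -(v2_eta V2) => ->; rewrite evC; congr (cval (rho 2%N _) x); exact: v2_eta.
Qed.

Lemma assigned_unique g t t' : stable g -> assigned g t -> assigned g t' -> t = t'.
Proof.
move=> [gc _ ll] /(assigned_form gc ll)[[in1 in2] Ew] /(assigned_form gc ll)[[in1' in2'] Ew'].
apply/isomorphic_eq; case: t t' in1 in2 Ew in1' in2' Ew' => [I o w] [I' o' w'] in1 in2 Ew in1' in2' Ew'.
have {}in1 : forall f, I (re f) /\ I (im f) <-> hsum (anti g) f := in1.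
have {}in1' : forall f, I' (re f) /\ I' (im f) <-> hsum (anti g) f := in1'.
have EI : I = I' by apply: ideal_ext => q; rewrite (ind_mem in1) (ind_mem in1').
subst I'; have rp := ind_real_part (anti_log ll) (anti_local gc ll) in1.
split=> [//|p Y Z|V V' VV']; first exact: iff_trans (in2 p Y Z) (iff_sym (in2' p Y Z)).
have E : V = V' by fext => i; exact: anchor_inj.
subst V'; transitivity (im (log_form gc ll (fun i => liftv rp (V i)))).
 by apply: Ew => i; exact: liftE.
by symmetry; apply: Ew' => i; exact: liftE.
Qed.

(** * Gauge transformations *)

Section Gauge.
Variables (g g' : gstructure M) (B : kform (idealT CR) 2).
Hypothesis fB : is_form B.
Local Notation BC := (cform B).

Lemma shearK (K : fieldType) (A : falg K M) (C : kform (idealT A) 2) (a : gsec A) :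
 shear C (shear (- C) a) = a.
Proof. by apply: gsec_eq => // Y; rewrite -[LHS]/(a.2 (v1 Y) - ctr a.1 C (v1 Y) + ctr a.1 C (v1 Y)) subrK. Qed.
Lemma shearKV (K : fieldType) (A : falg K M) (C : kform (idealT A) 2) (a : gsec A) :
 shear (- C) (shear C a) = a.
Proof. by apply: gsec_eq => // Y; rewrite -[LHS]/(a.2 (v1 Y) + ctr a.1 C (v1 Y) - ctr a.1 C (v1 Y)) addrK. Qed.
Lemma shear_gsec (K : fieldType) (A : falg K M) (C : kform (idealT A) 2) (a : gsec A) :
 is_form C -> is_gsec a -> is_gsec (shear C a).
Proof. by move=> fC ga; apply: is_formD => //; exact: ctr_form. Qed.
Lemma shearN (K : fieldType) (A : falg K M) (C : kform (idealT A) 2) (a : gsec A) :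
 is_form C -> shear C (- a) = - shear C a.
Proof.
move=> fC; apply: gsec_eq => // Y.
rewrite -[LHS]/(- a.2 (v1 Y) + ctr (- a.1) C (v1 Y)) contractN // koppE.
by rewrite -[RHS]/(- (a.2 (v1 Y) + ctr a.1 C (v1 Y))) opprD.
Qed.
Let parts (u : gsec CC) Y : ctr u.1 BC (v1 (cvec Y)) =
 tc (B (v2 (re_vect u.1) Y)) + ii * tc (B (v2 (im_vect u.1) Y)).
Proof.
have r (C : kform (idealT CR) 1) : is_form C -> cform C (v1 (cvec Y)) = tc (C (v1 Y)).
 by move=> fC; rewrite -[v1 (cvec Y)]/(fun i => cvec (v1 Y i)) cform_real.
rewrite ctr_cform kE -[fscale ii _ _]/(ii * cform (ctr (im_vect u.1) B) (v1 (cvec Y))).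
by rewrite !r //; exact: ctr_form.
Qed.
Lemma re_shear (u : gsec CC) : re_gsec (shear (- BC) u) = shear (- B) (re_gsec u).
Proof.
apply: gsec_eq => // Y; rewrite re_gsecE -[X in re X]/(u.2 (v1 (cvec Y)) - ctr u.1 BC (v1 (cvec Y))).
by rewrite parts reD reN reD re_tc reM_i im_tc oppr0 addr0.
Qed.
Lemma im_shear (u : gsec CC) : im_gsec (shear (- BC) u) = shear (- B) (im_gsec u).
Proof.
apply: gsec_eq => // Y; rewrite im_gsecE -[X in im X]/(u.2 (v1 (cvec Y)) - ctr u.1 BC (v1 (cvec Y))).
by rewrite parts imD imN imD im_tc imM_i re_tc add0r.
Qed.
Let fBC : is_form BC. Proof. exact: cform_form. Qed.
Let fBN : is_form (- B). Proof. exact: is_formN. Qed.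
Let fBCN : is_form (- BC). Proof. exact: is_formN. Qed.
Lemma shear_eigen u : (forall a, is_gsec a -> gs_J g' a = shear B (gs_J g (shear (- B) a))) ->
 eigsec g' u <-> eigsec g (shear (- BC) u).
Proof.
move=> JE; split=> [[gu E1 E2]|[gu E1 E2]].
 split; first exact: shear_gsec.
  rewrite re_shear im_shear -shearN // -E1 JE ?shearKV //; exact: re_gsec_form.
 rewrite re_shear im_shear -E2 JE ?shearKV //; exact: im_gsec_form.
have gu' : is_gsec u by have := shear_gsec fBC gu; rewrite shearK.
move: E1 E2; rewrite re_shear im_shear => E1 E2; split=> //.
 by rewrite JE ?E1 -?shearN ?shearK //; exact: re_gsec_form.
by rewrite JE ?E2 ?shearK //; exact: im_gsec_form.
Qed.

Lemma shear_graph ID (s : kform ID 2) u : graph (s - pull BC) u <-> graph s (shear (- BC) u).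
Proof.
have bE (Z W : vect ID) : pull BC (v2 Z W) = ctr (anc Z) BC (v1 (anc W)).
 rewrite /pull -form2_v2; congr (cform B _).
 by rewrite [LHS]v2_eta /v2 vconsE0 vconsES.
split=> [[gu [Z [Zu Zs]]]|[gu [Z [Zu Zs]]]].
 split; first exact: shear_gsec.
 exists Z; split=> // W.
 by rewrite -[LHS]/(u.2 (v1 (anc W)) - ctr u.1 BC (v1 (anc W))) Zs 2!kE bE Zu; ring.
split; first by have := shear_gsec fBC gu; rewrite shearK.
have Zu' : anc Z = u.1 by exact: Zu.
exists Z; split=> // W; have := Zs W.
rewrite -[LHS]/(u.2 (v1 (anc W)) - ctr u.1 BC (v1 (anc W))) -Zu' -bE 2!kE => /eqP.
by rewrite subr_eq => /eqP ->; ring.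
Qed.

(** J is recovered from its eigensections a - i J a. *)
Lemma eigen_shear : generalized_complex g -> generalized_complex g' ->
 (forall u, eigsec g' u <-> eigsec g (shear (- BC) u)) ->
 forall a, is_gsec a -> gs_J g' a = shear B (gs_J g (shear (- B) a)).
Proof.
move=> gc gc' H a ga; have eu := lam_eigen gc' ga.
have [_ E1 _] := (H _).1 eu; move: E1; rewrite re_shear im_shear (lam_re gc' ga) (lam_im gc' ga) => ->.
by rewrite -shearN // opprK shearK.
Qed.
End Gauge.

Lemma cform_inj k (a b : kform (idealT CR) k) : is_form a -> is_form b ->
 cform a = cform b -> a = b.
Proof.
move=> fa fb E; fext => V; apply: tc_inj.
by rewrite -!cform_real // E.
Qed.
(** A B-field replaces s by s - B. As B is real and smooth, the imaginary part and the log ideal are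
    unchanged, and ds - dB corresponds to H + dB. *)
Lemma gauge_assigned g g' t : stable g -> stable g' -> gauge_equivalent g g' ->
 symplectic_triple t -> assigned g t -> assigned g' t.
Proof.
move=> [gc _ ll] _ [B [fB HE JE]] [_ _ [_ _ nw] _] /(assigned_form gc ll)[ind Ew]; have [in1 _] := ind.
have lI := anti_log ll; have loc := anti_local gc ll.
have rp := ind_real_part lI loc in1.
have fs := log_form_form gc ll; have ds := log_form_dif gc ll.
set s := log_form gc ll in Ew fs ds.
have fBC : is_form (cform B) by exact: cform_form.
have [fH _] : is_form (gs_H g) /\ is_closed (gs_H g) by have [] := gc.
have fs' : is_form (s - pull (cform B)) by apply: is_formD => //; apply: is_formN; exact: pull_form.
have fh : is_form (- gs_H g - dif B).
 by apply: is_formD; [exact: is_formN|apply: is_formN; exact: dif_form].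
have dsh : dif (s - pull (cform B)) = pull (cform (- gs_H g - dif B)).
 rewrite difD difN ds pull_dif cform_dif //.
 by rewrite cformD (cformN (dif B)).
have wE V : @et_form _ _ _ t V = im ((s - pull (cform B)) (fun i => liftv rp (V i))).
 rewrite (Ew V _ (fun i => liftE rp (V i))) 2!kE imD imN /pull.
 have -> : (fun i => anc (liftv rp (V i))) = fun i => cvec (anc (V i)).
  by fext => i; exact: liftE.
 by rewrite cform_real // im_tc subr0.
have rep u : eigsec g' u <-> graph (s - pull (cform B)) u.
 by rewrite (shear_eigen fB u JE) (eigen_graph gc ll) -(shear_graph fB s u).
by have [] := assigned_intro lI loc ind fs' fh dsh nw wE rep.
Qed.

(** The log ideals agree by [div_determined]. The difference of the two log forms is real on the
    elliptic algebroid, hence a smooth real two-form B by [real_ext]; comparing differentials gives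
    H' = H + dB. *)
Lemma assigned_gauge g g' t : stable g -> stable g' -> assigned g t -> assigned g' t ->
 gauge_equivalent g g'.
Proof.
move=> [gc _ ll] [gc' _ ll'] /(assigned_form gc ll)[ind Ew] /(assigned_form gc' ll')[ind' Ew'].
have lI := anti_log ll; have loc := anti_local gc ll.
have lI' := anti_log ll'; have loc' := anti_local gc' ll'.
have E : anti g' = anti g.
 apply: ideal_ext => f; split.
  exact: (div_determined lI' loc lI ind' ind).
 exact: (div_determined lI loc' lI' ind ind').
have [s' [fs' rep' ds' Ews']] : exists s' : kform (anti g) 2, [/\ is_form s',
  forall u, eigsec g' u <-> graph s' u,
  dif s' = pull (cform (- gs_H g')) &
  forall V V', (forall i, anc (V' i) = cvec (anc (V i))) -> @et_form _ _ _ t V = im (s' V')].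
 have : exists s' : kform (anti g') 2, [/\ is_form s',
  forall u, eigsec g' u <-> graph s' u,
  dif s' = pull (cform (- gs_H g')) &
  forall V V', (forall i, anc (V' i) = cvec (anc (V i))) -> @et_form _ _ _ t V = im (s' V')].
  exists (log_form gc' ll'); split=> //; [exact: log_form_form|exact: eigen_graph|exact: log_form_dif].
 by rewrite E.
have [in1 _] := ind; have rp := ind_real_part lI loc in1.
have fs := log_form_form gc ll; have ds := log_form_dif gc ll.
set s := log_form gc ll in Ew fs ds.
have fd : is_form (s - s') by apply: is_formD => //; exact: is_formN.
have rd : real_on rp (s - s').
 move=> V; rewrite 2!kE imD imN -(Ew V _ (fun i => liftE rp (V i))).
 by rewrite -(Ews' V _ (fun i => liftE rp (V i))) subrr.
have [B fB BE] := real_ext lI loc fd rd.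
have sE : s' = s - pull (cform B) by rewrite BE opprB addrC subrK.
have [fH _] : is_form (gs_H g) /\ is_closed (gs_H g) by have [] := gc.
have [fH' _] : is_form (gs_H g') /\ is_closed (gs_H g') by have [] := gc'.
have fdB : is_form (dif B) by exact: dif_form.
exists B; split=> //; last first.
 apply: (eigen_shear fB gc gc') => u.
 by rewrite rep' sE (shear_graph fB s u) (eigen_graph gc ll).
apply: oppr_inj; apply: cform_inj; [exact: is_formN|by apply: is_formN; exact: is_formD|].
apply: (pull_inj lI); [exact/cform_form/is_formN|by apply/cform_form/is_formN/is_formD|].
rewrite -ds' sE difD difN ds pull_dif cform_dif //.
by rewrite opprD cformD (cformN (dif B)).
Qed.

(** The imaginary part of ds is dw = 0, so ds is a smooth real three-form h by [real_ext], and the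
    graph of s defines a structure with H = -h. *)
Lemma symplectic_assigned t : symplectic_triple t -> exists2 g, stable g & assigned g t.
Proof.
move=> [_ _ [fw cw nw] [ID [ld ind [s fs ip]]]].
have lI : locally_log ID := ld.2; have loc : loc_ideal ID := div_ideal_local nC ld.1.
have [in1 _] := ind; have rp := ind_real_part lI loc in1.
have wE V : @et_form _ _ _ t V = im (s (fun i => liftv rp (V i))).
 by have [V' [VE ->]] := ip V; rewrite (lift_uniq rp VE).
have ws A B : @et_form _ _ _ t (v2 A B) = im (s (v2 (liftv rp A) (liftv rp B))).
 by rewrite wE [X in s X]v2_eta /v2 vconsE0 vconsES.
have fds : is_form (dif s) by exact: dif_form.
have rds : real_on rp (dif s).
 by move=> V; rewrite -(im_dif wE) (cw : dif _ = 0).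
have [h fh /esym dsh] := real_ext lI loc fds rds.
have [g [gc rep]] := graph_gstructure lI loc fs fw nw ws fh dsh.
have [ag IE] := assigned_intro lI loc ind fs fh dsh nw wE rep.
exists g => //; split=> //.
 apply: nowhere_dense_closed => [x nx|x N Nx].
  have [rho cr rx] : exists2 rho, canonical_section g rho & ev (scal_of (rho 0%N) : CC) x != 0.
   apply: contrapT => H; apply: nx => rho cr; apply/eqP/negPn/negP => rx; apply: H; by exists rho.
  by apply: filterS (n_open nC rx) => y ry /(_ rho cr) /eqP; rewrite (negPf ry).
 have [y Ny ey] := log_zeros_dense lI Nx; exists y => // H; apply: ey => e /IE[rho cr ->].
 exact: H.
have -> : anti_ideal g = ID; last by [].
by fext => f; apply/propext; rewrite IE.
Qed.
End Correspondence.

Theorem theorem4p15 (R : realType) (n : nat) (M : manifold R n) :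
  exists Phi : {g : gstructure M | stable g} ->
               {t : elliptic_triple M | symplectic_triple t},
    [/\ forall (g : {g : gstructure M | stable g})
               (t : {t : elliptic_triple M | symplectic_triple t}),
          assigned (proj1_sig g) (proj1_sig t) <->
          isomorphic_triples (proj1_sig (Phi g)) (proj1_sig t),
        forall g g' : {g : gstructure M | stable g},
          gauge_equivalent (proj1_sig g) (proj1_sig g') <->
          isomorphic_triples (proj1_sig (Phi g)) (proj1_sig (Phi g')) &
        forall t : {t : elliptic_triple M | symplectic_triple t},
          exists g : {g : gstructure M | stable g},
            isomorphic_triples (proj1_sig (Phi g)) (proj1_sig t)].
Proof.
have H (g : {g : gstructure M | stable g}) :
  exists t : {t : elliptic_triple M | symplectic_triple t}, assigned (proj1_sig g) (proj1_sig t).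
 by case: g => g sg /=; have [t st ag] := stable_assigned sg; exists (exist _ t st).
have [Phi PhiE] := choice H; exists Phi.
have Phi1 g t : assigned (proj1_sig g) (proj1_sig t) <-> isomorphic_triples (proj1_sig (Phi g)) (proj1_sig t).
 rewrite isomorphic_eq; split=> [|<-]; last exact: PhiE.
 exact: assigned_unique (proj2_sig g) (PhiE g).
split=> // [g g'|t].
 rewrite isomorphic_eq; split=> [gg|E].
  apply: assigned_unique (proj2_sig g') _ (PhiE g').
  exact: gauge_assigned (proj2_sig g) (proj2_sig g') gg (proj2_sig (Phi g)) (PhiE g).
 apply: assigned_gauge (proj2_sig g) (proj2_sig g') (PhiE g) _; rewrite E; exact: PhiE.
have [g sg ag] := symplectic_assigned (proj2_sig t).
by exists (exist _ g sg); apply/Phi1.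
Qed.
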